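(* For every $T\in(\exp(481958),\exp(6.7\cdot10^{12})]$ and every $\sigma\in[0.985,1]$, $$N(\sigma,T)\le 1.62\cdot10^{11}\; T^{1.448(1-\sigma)}.$$
   Context: $\zeta$ is the Riemann zeta function and $N(\sigma,T)=\#\{\rho=\beta+i\gamma:\ \zeta(\rho)=0,\ 0<\gamma<T,\ \sigma<\beta<1\}$ (so $N(1,T)=0$). *)

(* Defs.v *)
From mathcomp Require Import all_boot all_order all_algebra.
From mathcomp Require Import complex.
From mathcomp Require Import all_classical all_reals all_analysis.

Set Implicit Arguments.
Unset Strict Implicit.
Unset Printing Implicit Defensive.

Import Order.TTheory GRing.Theory Num.Theory.
Import numFieldNormedType.Exports.

Local Open Scope classical_set_scope.
Local Open Scope ring_scope.

(* The complex numbers R[i], seen as a normed module over themselves, so that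
   limits are complex limits and [derivable] is complex differentiability. *)
Notation Cplx R := (R[i]^o).

Definition cexp (R : realType) (z : Cplx R) : Cplx R :=
  Complex (expR (complex.Re z) * cos (complex.Im z))
          (expR (complex.Re z) * sin (complex.Im z)).

(* n ^ (- s) = exp (- s log n); only used for n > 0. *)
Definition dirichlet_term (R : realType) (s : Cplx R) (n : nat) : Cplx R :=
  cexp (- (s * real_complex R (ln n%:R))).

(* [zeta] is the Riemann zeta function: the Dirichlet series
   \sum_(n >= 1) n ^ (- s) on the half-plane Re s > 1, continued
   holomorphically to the complex plane minus the point 1. By the identity
   theorem this determines zeta everywhere except at the pole s = 1, where the
   value of a total function is irrelevant. *)
Definition is_riemann_zeta (R : realType) (zeta : Cplx R -> Cplx R) : Prop :=
  (forall s : Cplx R, 1 < complex.Re s ->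
     series (fun n => dirichlet_term s n.+1) @ \oo --> zeta s) /\
  (forall s : Cplx R, s != 1 -> derivable zeta s 1).

(* [counting] is the cardinality of a finite set and +oo on infinite sets, so a
   finite upper bound on N includes the finiteness of the set of zeros. *)
Definition N (R : realType) (zeta : Cplx R -> Cplx R) (sigma T : R) : \bar R :=
  counting [set rho : Cplx R | [/\ zeta rho = 0,
                                   0 < complex.Im rho < T &
                                   sigma < complex.Re rho < 1]].

(* Main.v *)
Require Import Defs.
From mathcomp Require Import all_boot all_order all_algebra.
From mathcomp Require Import complex ring lra zify.
From mathcomp Require Import all_classical all_reals all_analysis.

(* Write [T = exp L], [delta = 1 - sigma]; only zeros with real part in
   [(1 - delta, 1)] and ordinate in [(0, T)] matter, and a finite list of them is
   bounded.

   Zeros of ordinate at least [exp (10 + 0.71 delta L)] are detected by a Dirichlet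
   polynomial with coefficients [a n * b n], where [a] is a (smoothed) Selberg-type
   detector, [a 1 = 1] and [a n] negligible for [1 < n <= T ^ 0.345], and [b] is a Selberg
   mollifier of length [T ^ 0.003]. Comparing the sum with [zeta rho = 0] shows that
   its part above [T ^ 0.345] has modulus at least 9/10 at each such zero. The
   Halasz-Montgomery duality argument bounds the number of zeros by a mean square of
   [a], which Selberg's diagonalisation makes bounded independently of [L], times a
   sum over pairs of zeros of a smoothed kernel. That kernel decays quadratically in
   the distance of the ordinates measured in units of [1 / L], and Jensen's inequality
   bounds the number of zeros per unit by a multiple of [1 + delta L].

   The analytic input is van der Corput's derivative tests (Weyl differencing and the
   Kusmin-Landau inequality), with the saving [N ^ (-1/15)] for [t <= N ^ 3]; it makes every error term a negative power
   of [T], which absorbs all constants since [L >= 481000]. The zeros of small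
   ordinate are counted by Jensen's inequality on intervals of bounded length.

   Cauchy's theorem is needed only for means over circles, and is obtained from
   Goursat's bisection argument in logarithmic coordinates. *)


Set Implicit Arguments.
Unset Strict Implicit.
Unset Printing Implicit Defensive.

Import Order.TTheory GRing.Theory Num.Theory.
Import numFieldNormedType.Exports.

Local Open Scope ring_scope.
Import Normc.

(** * Elementary bounds for the real exponential, sine, cosine and powers *)

Section RealBounds.
Variable R : realType.
Implicit Types (x y a b t : R).

(** The bound carries no power of [ln T], so every logarithm has to cancel. The detector is a
    difference of two Selberg sieves of lengths [T ^ 0.3545] and [T ^ 0.3645]; the mollifier puts a
    factor of order [1 / ln T] into the kernel, which pays for the logarithmic length of the window.

    The exponents come from the range [t <= N ^ 3]. Separating zeros at distance up to [T] needs
    windows starting above [T ^ (1/3)], hence a detector negligible that far; detecting a zero of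
    height [T] needs a sum longer than the detector by another factor [T ^ (1/3)]. The total length
    is [T ^ 0.7015]; twice this exponent plus [0.0286], the price of absorbing [1 + delta L], is
    [1.4316 < 1.448]. The upper limit for [T] keeps [ln (ln T)] below 32 in the local zero count.

    Of [zeta] only the series on [Re s > 1] and holomorphy are given. The strip is reached by
    propagating to the left, through a maximum principle on annuli, the convergence of
    [dsum s 1 n + n ^ (1 - s) / (s - 1)]. *)

Lemma mvt_segment (f df : R -> R) a b : a <= b ->
  (forall x, a <= x <= b -> is_derive x 1 f (df x)) ->
  exists2 c, a <= c <= b & f b - f a = df c * (b - a).
Proof.
move=> ab fd; have [|c|c /[!in_itv]/= cab ->] := @MVT_segment R f df a b ab.
- by move=> x /[!in_itv]/= /andP[ax xb]; apply: fd; rewrite !ltW.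
- apply: derivable_within_continuous => x /[!in_itv]/= xab.
  by have := fd x xab; case.
- by exists c.
Qed.

Lemma derive_ge0_le (f df : R -> R) a b : a <= b ->
  (forall x, a <= x <= b -> is_derive x 1 f (df x)) ->
  (forall x, a <= x <= b -> 0 <= df x) -> f a <= f b.
Proof.
move=> ab fd df0; have [c cab e] := mvt_segment ab fd.
by rewrite -subr_ge0 e mulr_ge0 ?subr_ge0 ?df0.
Qed.

Lemma sin_le_id x : 0 <= x -> sin x <= x.
Proof.
move=> x0.
have := @derive_ge0_le (fun t => t - sin t) (fun t => 1 - cos t) 0 x x0.
rewrite sin0 subrr subr_ge0; apply => t _; by rewrite subr_ge0 cos_le1.
Qed.

Lemma cos_ge_quad x : 1 - x ^+ 2 / 2 <= cos x.
Proof.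
wlog x0 : x / 0 <= x.
  move=> H; case: (lerP 0 x) => [/H//|/ltW]; rewrite -oppr_ge0 => /H.
  by rewrite cosN sqrrN.
have := @derive_ge0_le (fun t => cos t - (1 - t ^+ 2 / 2)) (fun t => t - sin t) 0 x x0.
rewrite cos0 expr0n/= mul0r subr0 subrr subr_ge0; apply => t.
  move=> _; apply: is_derive_eq.
  rewrite /GRing.scale/= /GRing.scale/=; lra.
by case/andP=> t0 _; rewrite subr_ge0 sin_le_id.
Qed.

Lemma sin_ge_half x : 0 <= x <= 1 -> x / 2 <= sin x.
Proof.
case/andP=> x0 x1.
have [c /andP[c0 cx]] := @mvt_segment sin cos 0 x x0 _.
rewrite sin0 !subr0 => ->; rewrite mulrC; apply: ler_wpM2r => //.
apply: le_trans (cos_ge_quad c); nra.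
Qed.

Lemma cos_le_quad x : -1 <= x <= 1 -> cos x <= 1 - x ^+ 2 / 8.
Proof.
wlog x0 : x / 0 <= x.
  move=> H; case: (lerP 0 x) => [/H//|/ltW]; rewrite -oppr_ge0 => /H.
  rewrite cosN sqrrN => h /andP[a b]; apply: h; apply/andP; split; lra.
case/andP=> _ x1.
have := @derive_ge0_le (fun t => (1 - t ^+ 2 / 8) - cos t) (fun t => sin t - t / 4) 0 x x0.
rewrite cos0 expr0n/= mul0r subr0 subrr subr_ge0; apply => t.
  move=> _; apply: is_derive_eq.
  rewrite /GRing.scale/= /GRing.scale/=; lra.
case/andP=> t0 tx; have := @sin_ge_half t; rewrite t0 (le_trans tx x1) => /(_ isT); lra.
Qed.

(** The upper bound comes from [expR x * (1 - x) <= 1], the tangent inequality at [- x]; the factor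
    2 is what [x <= 1 / 2] allows. *)
Lemma expR_taylor1 x : `|x| <= 1 / 2 -> `|expR x - 1 - x| <= 2 * x ^+ 2.
Proof.
rewrite ler_norml => /andP[x1 x2].
have h := expR_ge1Dx x; have h' := expR_ge1Dx (- x); have e0 := expR_gt0 x.
have e2 : expR x * expR (- x) = 1 by rewrite -expRD subrr expR0.
have e3 : expR x * (1 - x) <= 1 by rewrite -[leRHS]e2 ler_pM2l.
have e4 : expR x <= 1 + x + 2 * x ^+ 2.
  have p : 0 < 1 - x by lra.
  rewrite -(ler_pM2r p) (le_trans e3) //; nra.
rewrite ler_norml; apply/andP; split; nra.
Qed.

Lemma cos_taylor1 x : `|cos x - 1| <= x ^+ 2 / 2.
Proof.
have := cos_ge_quad x; have := cos_le1 x => a b.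
by rewrite ler_norml; apply/andP; split; nra.
Qed.

Lemma sin_taylor1 x : `|x| <= 1 -> `|sin x - x| <= x ^+ 2.
Proof.
wlog x0 : x / 0 <= x.
  move=> H; case: (lerP 0 x) => [/H//|/ltW]; rewrite -oppr_ge0 => /H.
  by rewrite sinN !normrN sqrrN -opprD normrN.
rewrite (ger0_norm x0) => x1.
have [c /andP[c0 cx]] := @mvt_segment sin cos 0 x x0 _.
rewrite sin0 !subr0 => ->.
have := cos_ge_quad c; have := cos_le1 c => a b.
by rewrite ler_norml; apply/andP; split; nra.
Qed.

Lemma bernoulli_ineq x (n : nat) : 0 <= x -> 1 + n%:R * x <= (1 + x) ^+ n.
Proof.
move=> x0; elim: n => [|n ih]; first by rewrite mul0r addr0 expr0.
rewrite exprS -natr1; have : 0 <= n%:R * x by rewrite mulr_ge0.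
nra.
Qed.

Lemma exprn_small x y : 0 <= x < 1 -> 0 < y -> exists n : nat, x ^+ n <= y.
Proof.
case/andP; rewrite le_eqVlt => /orP[/eqP <- _ y0|x0 x1 y0].
  by exists 1%N; rewrite expr1 ltW.
pose d := x^-1 - 1; have d0 : 0 < d by rewrite subr_gt0 invf_gt1.
exists (Num.trunc ((d * y)^-1)).+1; set n := _.+1.
have dy : 0 < d * y by rewrite mulr_gt0.
have h1 : (d * y)^-1 <= n%:R by exact/ltW/truncnS_gt.
have h2 := @bernoulli_ineq d n (ltW d0).
rewrite -[x]invrK exprVn invf_ple ?posrE ?exprn_gt0 ?invr_gt0 //.
have -> : x^-1 = 1 + d by rewrite /d; ring.
apply: le_trans h2.
have : y^-1 <= n%:R * d.
  move: h1; rewrite invfM => h1.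
  by rewrite -ler_pdivrMr // mulrC.
lra.
Qed.

End RealBounds.

(** * The complex modulus, the unit circle and polar form *)

Section ComplexBasics.
Variable R : realType.
Local Notation C := R[i].
Implicit Types (z w s : C) (x y t : R) (n : nat).

Lemma cabsD z w : normc (z + w) <= normc z + normc w.
Proof. exact: le_normcD. Qed.

Lemma cabsN z : normc (- z) = normc z.
Proof. exact: normcN. Qed.

Lemma cabsB z w : normc (z - w) <= normc z + normc w.
Proof. by rewrite -(cabsN w) cabsD. Qed.

Lemma cabsBC z w : normc (z - w) = normc (w - z).
Proof. by rewrite -cabsN opprB. Qed.

Lemma cabs_ge0 z : 0 <= normc z.
Proof. by case: z => a b /=; exact: sqrtr_ge0. Qed.
Hint Resolve cabs_ge0 : core.

Lemma cabs_sum (I : Type) (r : seq I) (P : pred I) (F : I -> C) :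
  normc (\sum_(i <- r | P i) F i) <= \sum_(i <- r | P i) normc (F i).
Proof.
elim/big_rec2: _ => [|i y x _ h]; first by rewrite normc0.
by apply: le_trans (cabsD _ _) _; rewrite lerD2l.
Qed.

Lemma cabs_tri z w u : normc (z - u) <= normc (z - w) + normc (w - u).
Proof. by apply: le_trans (cabsD _ _); rewrite addrA subrK. Qed.

Lemma cabs_lb z w : normc z - normc w <= normc (z + w).
Proof. by rewrite lerBlDr -{1}(addrK w z) cabsB. Qed.

Lemma cabs_real x : normc (x%:C)%C = `|x|.
Proof. by rewrite /= expr0n/= addr0 sqrtr_sqr. Qed.

Lemma cabsX z n : normc (z ^+ n) = normc z ^+ n.
Proof. by elim: n => [|n ih]; rewrite ?expr0 ?normc1 // !exprS normcM ih. Qed.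

Lemma cabs_sqr z : normc z ^+ 2 = complex.Re z ^+ 2 + complex.Im z ^+ 2.
Proof. by case: z => a b /=; rewrite sqr_sqrtr // addr_ge0 ?sqr_ge0. Qed.

Lemma cabs_Re z : `|complex.Re z| <= normc z.
Proof.
rewrite -ler_sqr ?nnegrE// real_normK ?num_real// cabs_sqr lerDl sqr_ge0 //.
Qed.

Lemma cabs_Im z : `|complex.Im z| <= normc z.
Proof.
rewrite -ler_sqr ?nnegrE// real_normK ?num_real// cabs_sqr lerDr sqr_ge0 //.
Qed.

Lemma cabs_ReIm z : normc z <= `|complex.Re z| + `|complex.Im z|.
Proof.
rewrite -ler_sqr ?nnegrE ?addr_ge0// cabs_sqr sqrrD !real_normK ?num_real//.
by rewrite addrAC lerDl mulrn_wge0 // mulr_ge0.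
Qed.

Lemma cabs_eq0 z : (normc z == 0) = (z == 0).
Proof. by apply/eqP/eqP => [/eq0_normc|->] //; rewrite normc0. Qed.

Lemma cabs_gt0 z : (0 < normc z) = (z != 0).
Proof. by rewrite lt_def cabs_ge0 andbT cabs_eq0. Qed.

Lemma ReD z w : complex.Re (z + w) = complex.Re z + complex.Re w.
Proof. by case: z w => [a b] [c d]. Qed.

Lemma ImD z w : complex.Im (z + w) = complex.Im z + complex.Im w.
Proof. by case: z w => [a b] [c d]. Qed.

Lemma ReN z : complex.Re (- z) = - complex.Re z.
Proof. by case: z. Qed.

Lemma ImN z : complex.Im (- z) = - complex.Im z.
Proof. by case: z. Qed.

Lemma ReM z w : complex.Re (z * w) =
  complex.Re z * complex.Re w - complex.Im z * complex.Im w.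
Proof. by case: z w => [a b] [c d]. Qed.

Lemma ImM z w : complex.Im (z * w) =
  complex.Re z * complex.Im w + complex.Im z * complex.Re w.
Proof. by case: z w => [a b] [c d]. Qed.

Lemma complex_ext z w : complex.Re z = complex.Re w ->
  complex.Im z = complex.Im w -> z = w.
Proof. by case: z w => [a b] [c d] /= -> ->. Qed.

Lemma cabs_abs_sub z w : `|normc z - normc w| <= normc (z - w).
Proof.
have := cabs_tri z w 0; have := cabs_tri w z 0; rewrite !subr0 (cabsBC w).
by move=> h1 h2; rewrite ler_norml; apply/andP; split; lra.
Qed.

Definition cis t : C := (cos t +i* sin t)%C.

Lemma cis0 : cis 0 = 1.
Proof. by rewrite /cis cos0 sin0. Qed.

Lemma cisD x y : cis (x + y) = cis x * cis y.
Proof. by apply: complex_ext; rewrite /cis ?ReM ?ImM /= ?cosD ?sinD // addrC. Qed.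

Lemma cabs_cis t : normc (cis t) = 1.
Proof. by rewrite /cis /= cos2Dsin2 sqrtr1. Qed.

Lemma cisN t : cis (- t) = ((cis t)^*)%C.
Proof. by rewrite /cis /= cosN sinN. Qed.

Lemma cis_sub1_sqr t : normc (cis t - 1) ^+ 2 = 2 - 2 * cos t.
Proof.
rewrite cabs_sqr ReD ImD ReN ImN /= subr0 sqrrB1.
have := cos2Dsin2 t => h; lra.
Qed.

Lemma cis_sub1_le t : normc (cis t - 1) <= `|t|.
Proof.
rewrite -ler_sqr ?nnegrE// cis_sub1_sqr real_normK ?num_real//.
have := cos_ge_quad t; lra.
Qed.

Lemma cis_sub_le x y : normc (cis x - cis y) <= `|x - y|.
Proof.
have -> : cis x - cis y = cis y * (cis (x - y) - 1).
  by rewrite mulrBr mulr1 -cisD (addrC y) subrK.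
by rewrite normcM cabs_cis mul1r cis_sub1_le.
Qed.

Lemma cis_sub1_ge t : 0 <= t <= 1 -> t / 2 <= normc (cis t - 1).
Proof.
case/andP=> t0 t1; rewrite -ler_sqr ?nnegrE ?divr_ge0// cis_sub1_sqr.
have h : -1 <= t <= 1 by rewrite t1 andbT; lra.
have := cos_le_quad h; lra.
Qed.

Lemma cabs_conj z : normc (z^*)%C = normc z.
Proof. by case: z => a b /=; rewrite sqrrN. Qed.

Lemma conjc_sum (I : Type) (r : seq I) (P : pred I) (F : I -> C) :
  ((\sum_(i <- r | P i) F i)^*)%C = \sum_(i <- r | P i) ((F i)^*)%C.
Proof. exact: (rmorph_sum (@conjc R)). Qed.

Lemma mulcJ z : z * (z^*)%C = ((normc z ^+ 2)%:C)%C.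
Proof.
by rewrite cabs_sqr; apply: complex_ext; case: z => a b /=; rewrite -?expr2; ring.
Qed.

Lemma polarE z : exists2 t, `|t| <= pi & z = (normc z)%:C%C * cis t.
Proof.
have [->|z0] := eqVneq z 0.
  by exists 0; rewrite ?normr0 ?pi_ge0 // normc0 mul0r.
have n0 : 0 < normc z by rewrite cabs_gt0.
have e := cabs_sqr z.
pose c := complex.Re z / normc z; pose s := complex.Im z / normc z.
have cs : c ^+ 2 + s ^+ 2 = 1.
  rewrite /c /s !expr_div_n -mulrDl -e divff //; by rewrite expf_neq0 // gt_eqF.
have c1 : -1 <= c <= 1.
  by rewrite -ler_norml -(@expr_le1 _ 2) // real_normK ?num_real // -cs lerDl sqr_ge0.
have h : sin (acos c) = `|s|.
  have c1' : sin (acos c) ^+ 2 = s ^+ 2.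
    have := cos2Dsin2 (acos c); rewrite acosK ?in_itv//= => k.
    by apply/eqP; rewrite -(inj_eq (addrI (c ^+ 2))) k cs.
  have p : 0 <= sin (acos c) by rewrite sin_ge0_pi // acos_ge0 ?acos_lepi.
  by apply/eqP; rewrite -(@eqrXn2 _ 2) ?nnegrE // real_normK ?num_real // c1'.
have zc : z = (normc z)%:C%C * (c +i* s)%C.
  apply: complex_ext; rewrite ?ReM ?ImM /= mul0r ?subr0 ?addr0.
    by rewrite /c mulrC divfK // gt_eqF.
  by rewrite /s mulrC divfK // gt_eqF.
case: (lerP 0 s) => s0.
  exists (acos c); first by rewrite ger0_norm ?acos_ge0 ?acos_lepi.
  rewrite {1}zc; congr (_ * _); rewrite /cis acosK ?in_itv//.
  by rewrite h ger0_norm.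
exists (- acos c); first by rewrite normrN ger0_norm ?acos_ge0 ?acos_lepi.
rewrite {1}zc; congr (_ * _); rewrite /cis cosN sinN acosK ?in_itv//.
by rewrite h ltr0_norm // opprK.
Qed.

(** Rotating a value onto the positive axis makes its modulus linear: this bounds path integrals by
    a real mean value theorem, and turns a sum of moduli into a complex sum in the duality
    argument. *)
Lemma unimodular_factor z : exists2 w, normc w = 1 & w * z = (normc z)%:C%C.
Proof.
have [t _ e] := polarE z; exists (cis (- t)); first exact: cabs_cis.
by rewrite {1}e mulrCA -cisD addNr cis0 mulr1.
Qed.

End ComplexBasics.
#[global] Hint Resolve cabs_ge0 : core.

(** * Goursat's theorem and Jensen's inequality *)

Section ComplexDerivative.
Variable R : realType.
Local Notation C := R[i].
Implicit Types (z w s l m : C) (x y t e d : R) (f g : C -> C).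

(** Complex differentiability with real [e], [d] and without a quotient. The increment [h = 0] is
    allowed, so the product and chain rules reduce to polynomial identities and the triangle
    inequality. *)
Definition cderiv f z l := forall e, 0 < e -> exists2 d, 0 < d &
  forall h : C, normc h < d -> normc (f (z + h) - f z - l * h) <= e * normc h.

Lemma cderiv_const (k : C) z : cderiv (fun=> k) z 0.
Proof.
move=> e e0; exists 1 => // h _.
by rewrite subrr mul0r subr0 normc0 mulr_ge0 // ltW.
Qed.

Lemma cderiv_id z : cderiv (fun t : C => t) z 1.
Proof.
move=> e e0; exists 1 => // h _.
by rewrite mul1r [z + h]addrC addrK subrr normc0 mulr_ge0 // ltW.
Qed.

Lemma cderiv_ext f g z l d : 0 < d ->
  (forall h, normc h < d -> f (z + h) = g (z + h)) -> cderiv f z l -> cderiv g z l.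
Proof.
move=> d0 fg fl e /fl[d' d'0 H]; exists (Num.min d d'); first by rewrite lt_min d0.
move=> h; rewrite lt_min => /andP[h1 h2]; rewrite -fg // -[z]addr0 -fg ?normc0 // addr0.
exact: H.
Qed.

Lemma cderiv_eq f z l m : l = m -> cderiv f z l -> cderiv f z m.
Proof. by move=> ->. Qed.

Lemma cderivD f g z l m : cderiv f z l -> cderiv g z m ->
  cderiv (fun t : C => f t + g t) z (l + m).
Proof.
move=> fl gm e e0; have e2 : 0 < e / 2 by lra.
have [d1 d10 H1] := fl _ e2; have [d2 d20 H2] := gm _ e2.
exists (Num.min d1 d2); first by rewrite lt_min d10.
move=> h; rewrite lt_min => /andP[/H1 h1 /H2 h2].
have -> : f (z + h) + g (z + h) - (f z + g z) - (l + m) * h =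
  (f (z + h) - f z - l * h) + (g (z + h) - g z - m * h) by ring.
apply: le_trans (cabsD _ _) _; lra.
Qed.

Lemma cderiv_cont f z l : cderiv f z l -> forall e, 0 < e ->
  exists2 d, 0 < d & forall h, normc h < d -> normc (f (z + h) - f z) <= e.
Proof.
move=> fl e e0; have [d d0 H] := fl _ (ltr01 : 0 < 1 :> R).
have K : 0 < 1 + normc l by rewrite ltr_wpDr.
exists (Num.min d (e / (1 + normc l))); first by rewrite lt_min d0 divr_gt0.
move=> h; rewrite lt_min => /andP[/H h1]; rewrite ltr_pdivlMr // => h2.
have -> : f (z + h) - f z = (f (z + h) - f z - l * h) + l * h by ring.
apply: le_trans (cabsD _ _) _; rewrite normcM; have := cabs_ge0 h; nra.
Qed.

Lemma cderivM f g z l m : cderiv f z l -> cderiv g z m ->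
  cderiv (fun t : C => f t * g t) z (l * g z + f z * m).
Proof.
move=> fl gm e e0.
pose K := 1 + normc (f z) + normc (g z) + normc l.
have K0 : 0 < K by rewrite /K -!addrA ltr_wpDr ?addr_ge0.
pose e' := Num.min 1 (e / (4 * K)).
have e'0 : 0 < e' by rewrite lt_min ltr01 divr_gt0 // mulr_gt0.
have e'1 : e' <= 1 by rewrite ge_min lexx.
have e'2 : e' * (4 * K) <= e by rewrite -ler_pdivlMr ?mulr_gt0 // ge_min lexx orbT.
have [d1 d10 H1] := fl _ e'0; have [d2 d20 H2] := gm _ e'0.
have [d3 d30 H3] := cderiv_cont gm e'0.
exists (Num.min d1 (Num.min d2 d3)); first by rewrite !lt_min d10 d20.
move=> h; rewrite !lt_min => /andP[/H1 h1 /andP[/H2 h2 /H3 h3]].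
have -> : f (z + h) * g (z + h) - f z * g z - (l * g z + f z * m) * h =
  (f (z + h) - f z - l * h) * (g z + (g (z + h) - g z)) + f z * (g (z + h) - g z - m * h)
  + (l * h) * (g (z + h) - g z) by ring.
apply: le_trans (cabsD _ _) _; apply: le_trans (lerD (cabsD _ _) (lexx _)) _.
rewrite !normcM.
have a1 := cabsD (g z) (g (z + h) - g z).
have p1 := cabs_ge0 (f z); have p2 := cabs_ge0 (g z); have p3 := cabs_ge0 l.
have p4 := cabs_ge0 h.
have b1 : normc (f (z + h) - f z - l * h) * normc (g z + (g (z + h) - g z))
   <= (e' * normc h) * K.
  apply: ler_pM => //; rewrite /K; lra.
have b2 : normc (f z) * normc (g (z + h) - g z - m * h) <= K * (e' * normc h).
  apply: ler_pM => //; rewrite /K; lra.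
have b3 : normc l * normc h * normc (g (z + h) - g z) <= (K * normc h) * e'.
  apply: ler_pM => //; rewrite ?mulr_ge0 //; apply: ler_pM => //; rewrite /K; lra.
have : e' * (4 * K) * normc h <= e * normc h by apply: ler_wpM2r.
have : 0 <= K * normc h * e' by rewrite !mulr_ge0 // ltW.
lra.
Qed.

Lemma cderiv_comp f g z l m : cderiv f (g z) l -> cderiv g z m ->
  cderiv (fun t : C => f (g t)) z (l * m).
Proof.
move=> fl gm e e0.
pose K := 2 + normc m + normc l.
have p2 := cabs_ge0 m; have p3 := cabs_ge0 l.
have K0 : 0 < K by rewrite /K; lra.
pose e' := Num.min 1 (e / (2 * K)).
have e'0 : 0 < e' by rewrite lt_min ltr01 divr_gt0 // mulr_gt0.
have e'1 : e' <= 1 by rewrite ge_min lexx.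
have e'2 : e' * (2 * K) <= e by rewrite -ler_pdivlMr ?mulr_gt0 // ge_min lexx orbT.
have [d1 d10 H1] := fl _ e'0; have [d2 d20 H2] := gm _ e'0.
have d12 : 0 < d1 / 2 by lra.
have [d3 d30 H3] := cderiv_cont gm d12.
exists (Num.min d2 d3); first by rewrite lt_min d20.
move=> h; rewrite lt_min => /andP[/H2 h2 /H3 h3].
set k := g (z + h) - g z in h2 h3.
have kd : normc k < d1 by lra.
have := H1 _ kd; rewrite {1}/k [g z + _]addrC subrK => h1.
have -> : f (g (z + h)) - f (g z) - l * m * h =
  (f (g (z + h)) - f (g z) - l * k) + l * (k - m * h) by ring.
apply: le_trans (cabsD _ _) _; rewrite normcM.
have kb : normc k <= K * normc h.
  have -> : k = (k - m * h) + m * h by ring.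
  apply: le_trans (cabsD _ _) _; rewrite normcM.
  have p4 := cabs_ge0 h.
  have : e' * normc h <= 1 * normc h by apply: ler_wpM2r.
  have : 0 <= normc l * normc h by rewrite mulr_ge0.
  rewrite /K; lra.
have p4 := cabs_ge0 h.
have b1 : e' * normc k <= e' * (K * normc h) by rewrite ler_wpM2l // ltW.
have b2 : normc l * normc (k - m * h) <= K * (e' * normc h).
  apply: ler_pM => //; rewrite /K; lra.
have : e' * (2 * K) * normc h <= e * normc h by apply: ler_wpM2r.
lra.
Qed.

Lemma cderivV z : z != 0 -> cderiv (fun t : C => t^-1) z (- z^-1 ^+ 2).
Proof.
move=> z0 e e0; have n0 : 0 < normc z by rewrite cabs_gt0.
exists (Num.min (normc z / 2) (e * normc z ^+ 3 / 2)).
  by rewrite lt_min !divr_gt0 // mulr_gt0 // exprn_gt0.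
move=> h; rewrite lt_min => /andP[h1 h2].
have n1 : normc z / 2 <= normc (z + h) by have := cabs_lb z h; lra.
have n1' : 0 < normc (z + h) by lra.
have zh0 : z + h != 0 by rewrite -cabs_gt0.
have -> : (z + h)^-1 - z^-1 - - z^-1 ^+ 2 * h = h * (h / (z ^+ 2 * (z + h))).
  by field; rewrite z0 zh0.
rewrite normcM mulrC; apply: ler_wpM2r => //.
rewrite normcM normcV normcM cabsX ler_pdivrMr ?mulr_gt0 ?exprn_gt0 //.
have : e * (normc z ^+ 2 * (normc z / 2)) <= e * (normc z ^+ 2 * normc (z + h)).
  by rewrite ler_pM2l // ler_pM2l ?exprn_gt0.
lra.
Qed.

Lemma cderivMl (k : C) f z l : cderiv f z l -> cderiv (fun t : C => k * f t) z (k * l).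
Proof.
move=> fl; have := cderivM (cderiv_const k z) fl; by apply: cderiv_eq; rewrite mul0r add0r.
Qed.

Lemma cderivN f z l : cderiv f z l -> cderiv (fun t : C => - f t) z (- l).
Proof.
move=> fl; have := cderivMl (-1) fl; rewrite mulN1r.
by apply: (@cderiv_ext _ _ _ _ 1) => // h _; rewrite mulN1r.
Qed.

Lemma cderivB f g z l m : cderiv f z l -> cderiv g z m ->
  cderiv (fun t : C => f t - g t) z (l - m).
Proof. by move=> fl gm; apply: cderivD => //; exact: cderivN. Qed.

Definition cE z : C := ((expR (complex.Re z))%:C)%C * cis (complex.Im z).

Lemma cED z w : cE (z + w) = cE z * cE w.
Proof. by rewrite /cE ReD ImD expRD cisD rmorphM /=; ring. Qed.

Lemma cE0 : cE 0 = 1. Proof. by rewrite /cE /= expR0 cis0 mulr1. Qed.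

Lemma cabs_cE z : normc (cE z) = expR (complex.Re z).
Proof. by rewrite normcM cabs_real cabs_cis mulr1 ger0_norm // expR_ge0. Qed.

Lemma cE_neq0 z : cE z != 0.
Proof. by rewrite -cabs_gt0 cabs_cE expR_gt0. Qed.

Lemma cE_natmul z n : cE (n%:R * z) = cE z ^+ n.
Proof.
elim: n => [|n ih]; first by rewrite mul0r cE0 expr0.
by rewrite exprS -ih -cED; congr cE; rewrite -addn1 natrD; ring.
Qed.

Lemma cE_taylor1 (h : C) : normc h <= 1 / 2 -> normc (cE h - 1 - h) <= 12 * normc h ^+ 2.
Proof.
move=> h2; set a := complex.Re h; set b := complex.Im h.
have na : `|a| <= normc h by exact: cabs_Re.
have nb : `|b| <= normc h by exact: cabs_Im.
have p := cabs_ge0 h.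
have ea := expR_taylor1 (le_trans na h2).
have cb := cos_taylor1 b.
have b1 : `|b| <= 1 by lra.
have sb := sin_taylor1 b1.
have a2 : a ^+ 2 <= normc h ^+ 2 by rewrite cabs_sqr lerDl sqr_ge0.
have b2 : b ^+ 2 <= normc h ^+ 2 by rewrite cabs_sqr lerDr sqr_ge0.
have e2 : expR a <= 2.
  have := ler_norm (expR a - 1 - a).
  have := ler_norm a; nra.
apply: le_trans (cabs_ReIm _) _.
rewrite /cE; rewrite !(ReD, ImD, ReN, ImN, ReM, ImM) /= -/a -/b !mul0r subr0 addr0 !oppr0 addr0.
have e0 := expR_gt0 a.
have -> : expR a * cos b - 1 - a = (expR a - 1 - a) + expR a * (cos b - 1) by ring.
have -> : expR a * sin b - b = expR a * (sin b - b) + (expR a - 1 - a) * b + a * b by ring.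
have t1 := ler_normD (expR a - 1 - a) (expR a * (cos b - 1)).
have t2 := ler_normD (expR a * (sin b - b) + (expR a - 1 - a) * b) (a * b).
have t3 := ler_normD (expR a * (sin b - b)) ((expR a - 1 - a) * b).
move: t1 t2 t3; rewrite !normrM (gtr0_norm e0) => t1 t2 t3.
have u1 : expR a * `|cos b - 1| <= 2 * (normc h ^+ 2 / 2).
  by apply: ler_pM => //; lra.
have u2 : expR a * `|sin b - b| <= 2 * normc h ^+ 2.
  by apply: ler_pM => //; lra.
have u3 : `|expR a - 1 - a| * `|b| <= (2 * normc h ^+ 2) * 1.
  by apply: ler_pM => //; lra.
have u4 : `|a| * `|b| <= normc h * normc h by apply: ler_pM.
have -> : 12 * normc h ^+ 2 = 2 * normc h ^+ 2 + 10 * normc h ^+ 2 by ring.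
rewrite -expr2 in u4.
have := sqr_ge0 (normc h); lra.
Qed.

Lemma cderiv_cE z : cderiv cE z (cE z).
Proof.
move=> e e0; have n0 : 0 < normc (cE z) by rewrite cabs_cE expR_gt0.
exists (Num.min (1 / 2) (e / (12 * normc (cE z)))).
  by rewrite lt_min !divr_gt0 // mulr_gt0.
move=> h; rewrite lt_min => /andP[/ltW h1]; rewrite ltr_pdivlMr ?mulr_gt0 // => h2.
have -> : cE (z + h) - cE z - cE z * h = cE z * (cE h - 1 - h) by rewrite cED; ring.
rewrite normcM.
have := cE_taylor1 h1 => h3; have p := cabs_ge0 h.
have : normc (cE z) * normc (cE h - 1 - h) <= normc (cE z) * (12 * normc h ^+ 2).
  by rewrite ler_pM2l.
nra.
Qed.

Lemma cderiv_sum (I : Type) (r : seq I) (F : I -> C -> C) (l : I -> C) z :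
  (forall i, cderiv (F i) z (l i)) ->
  cderiv (fun t : C => \sum_(i <- r) F i t) z (\sum_(i <- r) l i).
Proof.
move=> H; elim: r => [|i r ih].
  rewrite big_nil; apply: cderiv_ext (cderiv_const 0 z); first exact: ltr01.
  by move=> h _; rewrite big_nil.
rewrite big_cons; apply: cderiv_ext (cderivD (H i) ih); first exact: ltr01.
by move=> h _; rewrite big_cons.
Qed.

Lemma cderivX f z l n : cderiv f z l -> exists l', cderiv (fun t : C => f t ^+ n) z l'.
Proof.
move=> fl; elim: n => [|n [l' ih]].
  exists 0; apply: cderiv_ext (cderiv_const 1 z); first exact: ltr01.
  by move=> h _; rewrite expr0.
exists (l * f z ^+ n + f z * l'); apply: cderiv_ext (cderivM fl ih); first exact: ltr01.
by move=> h _; rewrite exprS.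
Qed.

(** The filter formulation yields radii in [R[i]]; being positive they are real, so the estimate can
    be read off with the real modulus [normc]. *)
Lemma derivable_cderiv (zeta : Cplx R -> Cplx R) (z : Cplx R) :
  derivable zeta z 1 -> exists l, cderiv zeta z l.
Proof.
case/cvg_ex => l /cvgrPdist_le H; exists l => e e0.
have e0' : 0 < (e%:C)%C :> R[i]^o by rewrite ltcR.
have := H _ e0'; rewrite near_withinE => /nbhs_ballP[d /= d0 hd].
have dr : d = ((complex.Re d)%:C)%C by rewrite RRe_real // gtr0_real.
exists (complex.Re d); first by rewrite -ltcR -dr.
move=> h hh; have [->|h0] := eqVneq h 0.
  by rewrite addr0 subrr mulr0 subr0 normc0 mulr0.
have hdd : `|h| < d by rewrite dr ltcR; case: (h) hh.
have := hd h; rewrite /ball /= sub0r normrN => /(_ hdd h0).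
have -> : h%:A + z = z + h :> C by rewrite /GRing.scale /= mulr1 addrC.
set D := zeta (z + h) - zeta z => K.
have K' : normc (l - h^-1 * D : C) <= e.
  by rewrite -lecR; move: K; rewrite -/(h^-1 * D); case: (_ - _ : C).
have -> : D - l * h = - (h * (l - h^-1 * D : C)) by field.
by rewrite cabsN normcM mulrC ler_wpM2r.
Qed.

End ComplexDerivative.

(** * Integrals of complex functions over real segments *)

Section PathIntegral.
Variable R : realType.
Local Notation C := R[i].
Implicit Types (a b c d x y e M : R) (q : R -> C) (I J : C).

(* [I] is the integral of [q] over [a, b], expressed by primitives of the real
   and imaginary parts; additivity over subintervals is then immediate. *)
Definition isint q a b I := exists U V : R -> R,
  [/\ forall x, a <= x <= b -> is_derive x 1 U (complex.Re (q x)),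
      forall x, a <= x <= b -> is_derive x 1 V (complex.Im (q x)) &
      I = ((U b - U a) +i* (V b - V a))%C].

Lemma isint_uniq q a b I J : a <= b -> isint q a b I -> isint q a b J -> I = J.
Proof.
move=> ab [U [V [dU dV ->]]] [U' [V' [dU' dV' ->]]].
have aux (F G : R -> R) (h : R -> R) : (forall x, a <= x <= b -> is_derive x 1 F (h x)) ->
    (forall x, a <= x <= b -> is_derive x 1 G (h x)) -> F b - F a = G b - G a.
  move=> dF dG; have [x xab|c _] := @mvt_segment _ (fun t => F t - G t) (fun=> 0) a b ab.
    have := dF x xab; have := dG x xab => ? ?.
    by apply: is_derive_eq; rewrite subrr.
  by rewrite mul0r => /eqP h0; apply/eqP; rewrite -subr_eq0 -[eqbRHS](eqP h0); apply/eqP; ring.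
by congr Complex; apply: aux; eassumption.
Qed.

Lemma isint_split q a c b I : a <= c <= b -> isint q a b I ->
  exists I1 I2, [/\ isint q a c I1, isint q c b I2 & I = I1 + I2].
Proof.
case/andP=> ac cb [U [V [dU dV ->]]].
exists ((U c - U a) +i* (V c - V a))%C, ((U b - U c) +i* (V b - V c))%C; split.
- exists U, V; split => // x /andP[h1 h2]; [apply: dU|apply: dV]; rewrite h1 /=; exact: le_trans cb.
- exists U, V; split => // x /andP[h1 h2]; [apply: dU|apply: dV]; rewrite h2 andbT; exact: le_trans h1.
by apply: complex_ext => /=; ring.
Qed.

Lemma isintD q q' a b I J : isint q a b I -> isint q' a b J ->
  isint (fun x => q x + q' x) a b (I + J).
Proof.
move=> [U [V [dU dV ->]]] [U' [V' [dU' dV' ->]]].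
exists (fun x => U x + U' x), (fun x => V x + V' x); split.
- move=> x xab; have := dU x xab; have := dU' x xab => ? ?.
  by apply: is_derive_eq; rewrite ReD.
- move=> x xab; have := dV x xab; have := dV' x xab => ? ?.
  by apply: is_derive_eq; rewrite ImD.
by apply: complex_ext => /=; ring.
Qed.

Lemma isint_affine (k l : C) a b :
  isint (fun x => k + l * x%:C%C) a b (k * (b - a)%:C%C + l * ((b ^+ 2 - a ^+ 2) / 2)%:C%C).
Proof.
exists (fun x => complex.Re k * x + complex.Re l * (x ^+ 2 / 2)),
       (fun x => complex.Im k * x + complex.Im l * (x ^+ 2 / 2)); split.
- move=> x _; apply: is_derive_eq; rewrite ReD ReM /= /GRing.scale /= /GRing.scale /=; lra.
- move=> x _; apply: is_derive_eq; rewrite ImD ImM /= /GRing.scale /= /GRing.scale /=; lra.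
by apply: complex_ext; rewrite ?(ReD, ImD, ReM, ImM) /=; lra.
Qed.

(** After rotating the integral onto the positive axis, its modulus is the increment of one real
    primitive, and a single mean value point gives the bound with constant 1. *)
Lemma isint_bound q a b I M : a <= b -> isint q a b I ->
  (forall x, a <= x <= b -> normc (q x) <= M) -> normc I <= M * (b - a).
Proof.
move=> ab [U [V [dU dV ->]]] qM.
set J := (_ +i* _)%C; have [w w1 wJ] := unimodular_factor J.
pose W x := complex.Re w * U x - complex.Im w * V x.
have [x xab|c cab] := @mvt_segment _ W
  (fun x => complex.Re w * complex.Re (q x) - complex.Im w * complex.Im (q x)) a b ab.
  have := dU x xab; have := dV x xab => ? ?.
  by apply: is_derive_eq; rewrite /GRing.scale /=; lra.
have -> : W b - W a = normc J.
  have /(congr1 (@complex.Re R)) := wJ; rewrite ReM /= => <-; rewrite /W; ring.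
move=> ->; rewrite -ReM; apply: ler_wpM2r; first by rewrite subr_ge0.
apply: le_trans (ler_norm _) _; apply: le_trans (cabs_Re _) _.
by rewrite normcM w1 mul1r qM.
Qed.

Lemma isint_opp q a b I : isint q a b I -> isint (fun x => - q x) a b (- I).
Proof.
move=> [U [V [dU dV ->]]]; exists (fun x => - U x), (fun x => - V x); split.
- by move=> x xab; have := dU x xab => ?; apply: is_derive_eq; rewrite ReN.
- by move=> x xab; have := dV x xab => ?; apply: is_derive_eq; rewrite ImN.
by apply: complex_ext => /=; ring.
Qed.

Definition cont_on q a b := forall x, a <= x <= b -> forall e, 0 < e ->
  exists2 d, 0 < d & forall y, a <= y <= b -> `|y - x| < d -> normc (q y - q x) <= e.

Lemma continuous_primitive (f : R -> R) a : continuous f ->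
  exists U : R -> R, forall x, a < x -> is_derive x 1 U (f x).
Proof.
move=> cf.
exists (fun x => \int[lebesgue_measure]_(t in [set` `[a, x]]) f t) => x ax.
have ax1 : x < x + 1 by lra.
have ii : lebesgue_measure.-integrable [set` `[a, x + 1]] (EFin \o f).
  apply: continuous_compact_integrable; first exact: segment_compact.
  exact: continuous_subspaceT.
have [h1 h2] := @continuous_FTC1 R f (BLeft a) x (x + 1) ax1 ii ax (cf x).
by apply: DeriveDef; [exact: h1|rewrite -h2 derive1E].
Qed.

(** The fundamental theorem of calculus is applied to a function continuous on the whole line, so
    [q] is first composed with the projection [cl] onto [[a, b]]. The base point [a - 1] makes the
    left end [a] an interior point of the primitive. *)
Lemma isint_exists q a b : a <= b -> cont_on q a b -> exists I, isint q a b I.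
Proof.
move=> ab cq; pose cl x := Num.max a (Num.min b x).
have clab x : a <= cl x <= b.
  by rewrite /cl le_max lexx /= ge_max ab ge_min lexx.
have cle x : a <= x <= b -> cl x = x.
  by case/andP=> h1 h2; rewrite /cl (min_idPr h2) (max_idPr h1).
have clE x : (x <= a /\ cl x = a) \/ (a <= x <= b /\ cl x = x) \/ (b <= x /\ cl x = b).
  case: (lerP x a) => xa.
    by left; split => //; rewrite /cl (min_idPr (le_trans xa ab)) (max_idPl xa).
  case: (lerP x b) => xb; right; [left|right].
    by rewrite cle (ltW xa) ?xb.
  by split; [exact: ltW|rewrite /cl (min_idPl (ltW xb)) (max_idPr ab)].
have cl1 x y : `|cl x - cl y| <= `|x - y|.
  have := ler_norm (x - y); have := ler_norm (y - x); rewrite distrC ler_norml.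
  case: (clE x) => [[h ->]|[[/andP[h h'] ->]|[h ->]]];
  case: (clE y) => [[k ->]|[[/andP[k k'] ->]|[k ->]]] => n1 n2; apply/andP; split; lra.
have cf (p : C -> R) : (forall z, `|p z| <= normc z) -> (forall z w, p (z - w) = p z - p w) ->
    continuous (fun x => p (q (cl x))).
  move=> p1 pB x; apply/cvgrPdist_le => e e0.
  have [d d0 H] := cq (cl x) (clab x) e e0.
  near=> t; rewrite -pB; apply: le_trans (p1 _) _; rewrite cabsBC; apply: H => //.
  apply: le_lt_trans (cl1 _ _) _; rewrite distrC; near: t.
  exact: cvgr_dist_lt.
have [U dU] := @continuous_primitive _ (a - 1) (cf (@complex.Re R) (@cabs_Re R) ltac:(by move=> z w; rewrite ReD ReN)).
have [V dV] := @continuous_primitive _ (a - 1) (cf (@complex.Im R) (@cabs_Im R) ltac:(by move=> z w; rewrite ImD ImN)).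
exists ((U b - U a) +i* (V b - V a))%C; exists U, V; split => //.
- by move=> x xab; rewrite -{2}(cle x xab); apply: dU; lra.
- by move=> x xab; rewrite -{2}(cle x xab); apply: dV; lra.
Unshelve. all: by end_near.
Qed.

(** A total function; 0 is only the default where no primitive exists. *)
Definition cint q a b : C := xget 0 [set I | isint q a b I]%classic.

Lemma cintP q a b : a <= b -> cont_on q a b -> isint q a b (cint q a b).
Proof.
by move=> ab cq; apply: (@xgetPex _ 0 [set I | isint q a b I]%classic); exact: isint_exists.
Qed.

Lemma cint_eq q a b I : a <= b -> isint q a b I -> cint q a b = I.
Proof.
move=> ab h; apply: (isint_uniq ab) (h).
by apply: (@xgetPex _ 0 [set I | isint q a b I]%classic); exists I.
Qed.

Lemma cint_split q a c b : a <= c <= b -> cont_on q a b ->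
  cint q a b = cint q a c + cint q c b.
Proof.
move=> /[dup] acb /andP[ac cb] cq.
have [I1 [I2 [h1 h2 h]]] := isint_split acb (cintP (le_trans ac cb) cq).
by rewrite (cint_eq ac h1) (cint_eq cb h2).
Qed.

Lemma cont_on_sub q a b a' b' : a <= a' -> b' <= b -> cont_on q a b -> cont_on q a' b'.
Proof.
move=> aa bb cq x /andP[h1 h2] e e0.
have [|d d0 H] := cq x _ e e0; first by rewrite (le_trans aa h1) (le_trans h2 bb).
exists d => // y /andP[k1 k2]; apply: H; by rewrite (le_trans aa k1) (le_trans k2 bb).
Qed.

End PathIntegral.

(** Cauchy's theorem for the affine function [k + l w], by direct computation: its four side
    integrals cancel and only the remainders [J1], ..., [J4] survive. *)
Lemma rect_affine_cancel (R : realType) (k l J1 J2 J3 J4 : R[i]) (a b c d : R) :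
  (k + l * (0 +i* c)%C) * (b - a)%:C%C + l * ((b ^+ 2 - a ^+ 2) / 2)%:C%C + J1
  + 'i%C * ((k + l * (b +i* 0)%C) * (d - c)%:C%C + l * 'i%C * ((d ^+ 2 - c ^+ 2) / 2)%:C%C + J4)
  - ((k + l * (0 +i* d)%C) * (b - a)%:C%C + l * ((b ^+ 2 - a ^+ 2) / 2)%:C%C + J2)
  - 'i%C * ((k + l * (a +i* 0)%C) * (d - c)%:C%C + l * 'i%C * ((d ^+ 2 - c ^+ 2) / 2)%:C%C + J3)
  = J1 - J2 + 'i%C * (J4 - J3).
Proof.
case: k l J1 J2 J3 J4 => [? ?] [? ?] [? ?] [? ?] [? ?] [? ?].
by apply: complex_ext => /=; field.
Qed.

(** * Goursat's theorem on rectangles *)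

Section Goursat.
Variable R : realType.
Local Notation C := R[i].
Variables (f : C -> C) (a0 b0 c0 d0 : R).
Hypotheses (ab0 : a0 <= b0) (cd0 : c0 <= d0).
Hypothesis fder : forall z, a0 <= complex.Re z <= b0 -> c0 <= complex.Im z <= d0 ->
  exists l, cderiv f z l.

Let h y := (fun x => f (x +i* y)%C).
Let v x := (fun y => f (x +i* y)%C).

Lemma horiz_cont y : c0 <= y <= d0 -> cont_on (h y) a0 b0.
Proof.
move=> yy x xx e e0; have [l fl] := @fder (x +i* y)%C xx yy.
have [d d0' H] := cderiv_cont fl e0; exists d => // x' _ xd.
have := H ((x' - x)%:C%C); rewrite cabs_real => /(_ xd).
by congr (normc (f _ - _) <= _); apply: complex_ext => /=; ring.
Qed.

Lemma vert_cont x : a0 <= x <= b0 -> cont_on (v x) c0 d0.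
Proof.
move=> xx y yy e e0; have [l fl] := @fder (x +i* y)%C xx yy.
have [d d0' H] := cderiv_cont fl e0; exists d => // y' _ yd.
have := H ((0 +i* (y' - y))%C); rewrite /= expr0n /= add0r sqrtr_sqr => /(_ yd).
by congr (normc (f _ - _) <= _); apply: complex_ext => /=; ring.
Qed.

Definition rect_int a b c d : C :=
  cint (h c) a b + 'i%C * cint (v b) c d - cint (h d) a b - 'i%C * cint (v a) c d.

Definition in_rect (r : R * R * R * R) := let: (a, b, c, d) := r in
  [/\ a0 <= a, a <= b, b <= b0 & [/\ c0 <= c, c <= d & d <= d0]].

Lemma rect_int_split_x a m b c d : a <= m <= b -> in_rect (a, b, c, d) ->
  rect_int a b c d = rect_int a m c d + rect_int m b c d.
Proof.
move=> amb [h1 h2 h3 [h4 h5 h6]]; rewrite /rect_int.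
rewrite (cint_split amb (cont_on_sub h1 h3 (horiz_cont _))); last by rewrite h4 (le_trans h5 h6).
rewrite (cint_split amb (cont_on_sub h1 h3 (horiz_cont _))); last by rewrite h6 (le_trans h4 h5).
ring.
Qed.

Lemma rect_int_split_y a b c m d : c <= m <= d -> in_rect (a, b, c, d) ->
  rect_int a b c d = rect_int a b c m + rect_int a b m d.
Proof.
move=> cmd [h1 h2 h3 [h4 h5 h6]]; rewrite /rect_int.
rewrite (cint_split cmd (cont_on_sub h4 h6 (vert_cont _))); last by rewrite h3 (le_trans h1 h2).
rewrite (cint_split cmd (cont_on_sub h4 h6 (vert_cont _))); last by rewrite h1 (le_trans h2 h3).
ring.
Qed.

Let Phi (r : R * R * R * R) : C := let: (a, b, c, d) := r in rect_int a b c d.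

(** One of the four quarters keeps at least a quarter of the modulus of the boundary integral. The
    last one is the default: if the first three fail, the triangle inequality forces it to
    qualify. *)
Let quarter (r : R * R * R * R) := let: (a, b, c, d) := r in
  let m := (a + b) / 2 in let k := (c + d) / 2 in
  let big s := normc (Phi r) / 4 <= normc (Phi s) in
  if big (a, m, c, k) then (a, m, c, k) else
  if big (m, b, c, k) then (m, b, c, k) else
  if big (a, m, k, d) then (a, m, k, d) else (m, b, k, d).

Lemma quarterP a b c d (a' b' c' d' : R) : in_rect (a, b, c, d) ->
  quarter (a, b, c, d) = (a', b', c', d') ->
  [/\ in_rect (a', b', c', d'), a <= a' /\ b' <= b, c <= c' /\ d' <= d,
      b' - a' = (b - a) / 2 /\ d' - c' = (d - c) / 2 &
      normc (Phi (a, b, c, d)) / 4 <= normc (Phi (a', b', c', d'))].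
Proof.
move=> ir; have [h1 h2 h3 [h4 h5 h6]] := ir.
have amb : a <= (a + b) / 2 <= b by apply/andP; split; lra.
have ckd : c <= (c + d) / 2 <= d by apply/andP; split; lra.
have i1 : in_rect (a, b, c, (c + d) / 2) by repeat split; lra.
have i2 : in_rect (a, b, (c + d) / 2, d) by repeat split; lra.
have e : Phi (a, b, c, d) = Phi (a, (a + b) / 2, c, (c + d) / 2) + Phi ((a + b) / 2, b, c, (c + d) / 2)
   + (Phi (a, (a + b) / 2, (c + d) / 2, d) + Phi ((a + b) / 2, b, (c + d) / 2, d)).
  by rewrite /Phi (rect_int_split_y ckd) // (rect_int_split_x amb i1) (rect_int_split_x amb i2).
rewrite /quarter; case: ifP => [q1|/negbT]; last rewrite -ltNge => q1.
  by case=> <- <- <- <-; split => //; [repeat split; lra|split; lra|split; lra|split; lra].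
case: ifP => [q2|/negbT]; last rewrite -ltNge => q2.
  by case=> <- <- <- <-; split => //; [repeat split; lra|split; lra|split; lra|split; lra].
case: ifP => [q3|/negbT]; last rewrite -ltNge => q3.
  by case=> <- <- <- <-; split => //; [repeat split; lra|split; lra|split; lra|split; lra].
case=> <- <- <- <-; split => //; [repeat split; lra|split; lra|split; lra|split; lra|].
have := cabsD (Phi (a, (a + b) / 2, c, (c + d) / 2) + Phi ((a + b) / 2, b, c, (c + d) / 2))
  (Phi (a, (a + b) / 2, (c + d) / 2, d) + Phi ((a + b) / 2, b, (c + d) / 2, d)).
have := cabsD (Phi (a, (a + b) / 2, c, (c + d) / 2)) (Phi ((a + b) / 2, b, c, (c + d) / 2)).
have := cabsD (Phi (a, (a + b) / 2, (c + d) / 2, d)) (Phi ((a + b) / 2, b, (c + d) / 2, d)).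
rewrite -e; lra.
Qed.

(** Subtracting the affine approximation at [z] does not change the boundary integral; on each side
    the remainder is at most [e] times the half perimeter, and the four sides have twice that
    length. *)
Lemma rect_int_small a b c d z l e : in_rect (a, b, c, d) -> 0 <= e ->
  a <= complex.Re z <= b -> c <= complex.Im z <= d ->
  (forall w, a <= complex.Re w <= b -> c <= complex.Im w <= d ->
    normc (f w - f z - l * (w - z)) <= e * ((b - a) + (d - c))) ->
  normc (rect_int a b c d) <= 2 * e * ((b - a) + (d - c)) ^+ 2.
Proof.
move=> [h1 h2 h3 [h4 h5 h6]] e0 za zc H.
set M := e * _ in H.
pose k := f z - l * z.
have aff w : f w - f z - l * (w - z) = f w - (k + l * w) by rewrite /k; ring.
have hor y : c <= y <= d -> exists J, normc J <= M * (b - a) /\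
   cint (h y) a b = (k + l * (0 +i* y)%C) * (b - a)%:C%C + l * ((b ^+ 2 - a ^+ 2) / 2)%:C%C + J.
  move=> ycd; have cy : isint (h y) a b (cint (h y) a b).
    apply: cintP => //; apply: cont_on_sub h1 h3 (horiz_cont _).
    by move/andP: ycd => [k1 k2]; rewrite (le_trans h4 k1) (le_trans k2 h6).
  exists (cint (h y) a b - ((k + l * (0 +i* y)%C) * (b - a)%:C%C + l * ((b ^+ 2 - a ^+ 2) / 2)%:C%C)); split; last by ring.
  apply: (isint_bound h2 (isintD cy (isint_opp (isint_affine _ _ _ _)))) => x xab.
  have := H (x +i* y)%C xab ycd; rewrite aff; congr (normc _ <= _).
  rewrite /h; suff -> : k + l * (x +i* y)%C = k + l * (0 +i* y)%C + l * x%:C%C by [].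
  have -> : (x +i* y)%C = (0 +i* y)%C + x%:C%C by apply: complex_ext => /=; ring.
  ring.
have ver x : a <= x <= b -> exists J, normc J <= M * (d - c) /\
   cint (v x) c d = (k + l * (x +i* 0)%C) * (d - c)%:C%C + l * 'i%C * ((d ^+ 2 - c ^+ 2) / 2)%:C%C + J.
  move=> xab; have cy : isint (v x) c d (cint (v x) c d).
    apply: cintP => //; apply: cont_on_sub h4 h6 (vert_cont _).
    by move/andP: xab => [k1 k2]; rewrite (le_trans h1 k1) (le_trans k2 h3).
  exists (cint (v x) c d - ((k + l * (x +i* 0)%C) * (d - c)%:C%C + l * 'i%C * ((d ^+ 2 - c ^+ 2) / 2)%:C%C)); split; last by ring.
  apply: (isint_bound h5 (isintD cy (isint_opp (isint_affine _ _ _ _)))) => y ycd.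
  have := H (x +i* y)%C xab ycd; rewrite aff; congr (normc _ <= _).
  rewrite /v; suff -> : k + l * (x +i* y)%C = k + l * (x +i* 0)%C + l * 'i%C * y%:C%C by [].
  have -> : (x +i* y)%C = (x +i* 0)%C + 'i%C * y%:C%C by apply: complex_ext => /=; ring.
  ring.
have [J1 [n1 e1]] := hor c ltac:(by rewrite lexx).
have [J2 [n2 e2]] := hor d ltac:(by rewrite lexx andbT).
have [J3 [n3 e3]] := ver a ltac:(by rewrite lexx).
have [J4 [n4 e4]] := ver b ltac:(by rewrite lexx andbT).
have -> : rect_int a b c d = J1 - J2 + 'i%C * (J4 - J3).
  by rewrite /rect_int e1 e2 e3 e4 rect_affine_cancel.
have ni : normc ('i%C : C) = 1 by rewrite /= expr0n expr1n /= add0r sqrtr1.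
have := cabsD (J1 - J2) ('i%C * (J4 - J3)); rewrite normcM ni mul1r.
have := cabsB J1 J2; have := cabsB J4 J3.
rewrite -/M; have M0 : 0 <= M by rewrite /M mulr_ge0 // addr_ge0 ?subr_ge0.
have -> : 2 * e * ((b - a) + (d - c)) ^+ 2 = 2 * (M * (b - a)) + 2 * (M * (d - c)) by rewrite /M; ring.
lra.
Qed.

(** The nested quarters shrink to a point where [f] is differentiable. There the boundary integral
    is at most half of [eta / 4 ^+ n], while the choice of quarters keeps it at least
    [eta / 4 ^+ n]. *)
Theorem goursat : rect_int a0 b0 c0 d0 = 0.
Proof.
apply/eqP; apply: contraT; rewrite -cabs_gt0 => eta0.
set eta := normc _ in eta0.
pose r n := iter n quarter (a0, b0, c0, d0).
pose a n := (r n).1.1.1; pose b n := (r n).1.1.2; pose c n := (r n).1.2; pose d n := (r n).2.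
have rE n : r n = (a n, b n, c n, d n) by rewrite /a /b /c /d; case: (r n) => [[[]]].
have H n : [/\ in_rect (a n, b n, c n, d n), b n - a n = (b0 - a0) / 2 ^+ n,
   d n - c n = (d0 - c0) / 2 ^+ n & eta / 4 ^+ n <= normc (Phi (r n))].
  elim: n => [|n [ih1 ih2 ih3 ih4]].
    rewrite !expr0 !divr1; split => //; by [].
  have := rE n.+1; rewrite {1}/r iterS -/(r n) (rE n) => /(quarterP ih1) [k1 _ _ [k2 k3] k4].
  split => //; [rewrite k2 ih2|rewrite k3 ih3|]; rewrite ?exprS; first by field.
    by field.
  rewrite rE; apply: le_trans k4; rewrite -rE.
  have -> : eta / (4 * 4 ^+ n) = eta / 4 ^+ n / 4 by field.
  by apply: ler_wpM2r.
have S n : [/\ a n <= a n.+1, b n.+1 <= b n, c n <= c n.+1 & d n.+1 <= d n].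
  have [ih1 _ _ _] := H n.
  by have := rE n.+1; rewrite {1}/r iterS -/(r n) (rE n) => /(quarterP ih1) [_ [? ?] [? ?]].
have nest (u w : nat -> R) : (forall n, u n <= u n.+1 /\ w n.+1 <= w n) ->
    (forall n, u n <= w n) -> exists x, forall n, u n <= x <= w n.
  move=> mono uw.
  have um m n : (m <= n)%N -> u m <= u n.
    by elim: n => [|n ih]; [rewrite leqn0 => /eqP ->|rewrite leq_eqVlt => /orP[/eqP -> //|/ih /le_trans]; apply; case: (mono n)].
  have wm m n : (m <= n)%N -> w n <= w m.
    elim: n => [|n ih]; first by rewrite leqn0 => /eqP ->.
    by rewrite leq_eqVlt => /orP[/eqP -> //|/ih]; apply: le_trans; case: (mono n).
  have uwm m n : u m <= w n.
    case/orP: (leq_total m n) => mn; first exact: le_trans (um _ _ mn) (uw _).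
    exact: le_trans (uw _) (wm _ _ mn).
  exists (sup [set u n | n in setT]%classic) => n; apply/andP; split.
    apply: ub_le_sup; last by exists n.
    by exists (w 0%N) => _ [m _ <-].
  apply: ge_sup; first by exists (u 0%N); exists 0%N.
  by move=> _ [m _ <-].
have [x xP] : exists x, forall n, a n <= x <= b n.
  by apply: nest => n; [case: (S n)|case: (H n) => [[? ? ? [? ? ?]]]].
have [y yP] : exists y, forall n, c n <= y <= d n.
  by apply: nest => n; [case: (S n)|case: (H n) => [[? ? ? [? ? ?]]]].
have [l fl] := @fder (x +i* y)%C (xP 0%N) (yP 0%N).
(* The extra 1 keeps [W] positive for degenerate rectangles; [e] is chosen so that
   [2 * e * (W / 2 ^+ n) ^+ 2] is exactly half of [eta / 4 ^+ n]. *)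
pose W := (b0 - a0) + (d0 - c0) + 1.
have W0 : 0 < W by rewrite /W ltr_wpDl // addr_ge0 ?subr_ge0.
pose e := eta / (4 * W ^+ 2).
have e0 : 0 < e by rewrite divr_gt0 // mulr_gt0 // exprn_gt0.
have [dl dl0 D] := fl e e0.
have [n hn] : exists n : nat, W / 2 ^+ n < dl.
  exists (Num.trunc (W / dl)).+1; rewrite ltr_pdivrMr ?exprn_gt0 // mulrC -ltr_pdivrMr //.
  apply: lt_le_trans (truncnS_gt _) _.
  by rewrite -natrX ler_nat ltnW // ltn_expl.
have [k1 k2 k3 k4] := H n.
have p2 : 0 < 2 ^+ n :> R by rewrite exprn_gt0.
have sz : (b n - a n) + (d n - c n) <= W / 2 ^+ n.
  by rewrite k2 k3 -mulrDl ler_pM2r ?invr_gt0 // /W; lra.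
have sz0 : 0 <= (b n - a n) + (d n - c n).
  by case: k1 => ? ? ? [? ? ?]; lra.
have X w : a n <= complex.Re w <= b n -> c n <= complex.Im w <= d n ->
    normc (f w - f (x +i* y)%C - l * (w - (x +i* y)%C)) <= e * ((b n - a n) + (d n - c n)).
  move=> wa wc.
  have wz : normc (w - (x +i* y)%C) <= (b n - a n) + (d n - c n).
    apply: le_trans (cabs_ReIm _) _; rewrite ReD ImD ReN ImN /=.
    have := xP n; have := yP n; move: wa wc => /andP[? ?] /andP[? ?] /andP[? ?] /andP[? ?].
    by apply: lerD; rewrite ler_norml; apply/andP; split; lra.
  have := D (w - (x +i* y)%C); rewrite [(x +i* y)%C + _]addrC subrK => /(_ _) q.
  apply: le_trans (q _) _; first by apply: le_lt_trans wz _; exact: le_lt_trans sz hn.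
  by rewrite ler_pM2l.
have := @rect_int_small (a n) (b n) (c n) (d n) (x +i* y)%C l e k1 (ltW e0) (xP n) (yP n) X.
rewrite leNgt => /negP; case; apply: lt_le_trans (_ : eta / 4 ^+ n <= _); last first.
  by move: k4; rewrite rE.
have sq : ((b n - a n) + (d n - c n)) ^+ 2 <= (W / 2 ^+ n) ^+ 2.
  by rewrite ler_pXn2r ?nnegrE // divr_ge0 // ltW.
apply: le_lt_trans (_ : 2 * e * (W / 2 ^+ n) ^+ 2 < _).
  by rewrite ler_pM2l // mulr_gt0.
have -> : 2 * e * (W / 2 ^+ n) ^+ 2 = (eta / 4 ^+ n) / 2.
  rewrite /e; have -> : 4 ^+ n = (2 ^+ n) ^+ 2 :> R by rewrite -exprM mulnC exprM; congr (_ ^+ _); ring.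
  have w0 := lt0r_neq0 W0; have q0 := lt0r_neq0 p2.
  by field; rewrite w0 q0.
have : 0 < eta / 4 ^+ n by rewrite divr_gt0 // exprn_gt0.
lra.
Qed.

End Goursat.

(** * Mean values over circles and a maximum principle *)

Section MaximumModulus.
Variable R : realType.
Local Notation C := R[i].
Implicit Types (z w c l : C) (r x y t e d B M : R) (f g h : C -> C).

Definition ccont f z := forall e, 0 < e -> exists2 d, 0 < d &
  forall u : C, normc u < d -> normc (f (z + u) - f z) <= e.

Lemma cis2pi t : cis (t + pi *+ 2) = cis t.
Proof. by rewrite cisD /cis cos2pi sin2pi mulr1. Qed.

(* Goursat's theorem for [w |-> f (c + exp w)] on [u0, ln r] x [0, 2 pi]: the two
   horizontal sides cancel by periodicity, so the circle means do not depend on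
   the radius; letting [u0] tend to minus infinity gives the mean value property. *)
Lemma mean_value_bound f c r B : 0 < r ->
  (forall z, normc (z - c) <= r -> exists l, cderiv f z l) ->
  (forall t, normc (f (c + r%:C%C * cis t)) <= B) -> normc (f c) <= B.
Proof.
move=> r0 fd fB; apply/ler_addgt0Pr => e e0.
have c0 : normc (c - c) <= r by rewrite subrr normc0 ltW.
have [l fl] := fd c c0; have [d d0 D] := cderiv_cont fl e0.
(* On the circle of radius [r'] the function stays within [e] of its value at the centre. *)
pose r' := Num.min r (d / 2).
have r'0 : 0 < r' by rewrite lt_min r0 divr_gt0.
have p0 : 0 <= pi *+ 2 :> R by rewrite mulrn_wge0 // ltW // pi_gt0.
have lr : ln r' <= ln r by rewrite ler_ln ?posrE // ge_min lexx.
pose G w := f (c + cE w).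
have Gd w : ln r' <= complex.Re w <= ln r -> 0 <= complex.Im w <= pi *+ 2 ->
    exists l, cderiv G w l.
  case/andP=> _ wr _.
  have [|l' fl'] := fd (c + cE w).
    by rewrite addrAC subrr add0r cabs_cE -[leRHS](lnK _) ?posrE // ler_expR.
  have gl := cderivD (cderiv_const c w) (cderiv_cE w).
  by exists (l' * (0 + cE w)); exact: (@cderiv_comp R f (fun t : C => c + cE t) w l' (0 + cE w) fl' gl).
have := goursat lr p0 Gd; rewrite /rect_int.
have -> : (fun x => G (x +i* 0)%C) = (fun x => G (x +i* (pi *+ 2))%C).
  by apply/funext => x; rewrite /G /cE /= -[pi *+ 2]add0r cis2pi.
have canc (u v v' : C) : u + 'i%C * v - u - 'i%C * v' = 'i%C * (v - v') by ring.
rewrite canc => /eqP.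
rewrite mulf_eq0 => /orP[|]; first by rewrite eq_complex /= oner_eq0 andbF.
rewrite subr_eq0 => /eqP E.
have cG x : ln r' <= x <= ln r -> isint (fun y => G (x +i* y)%C) 0 (pi *+ 2)
    (cint (fun y => G (x +i* y)%C) 0 (pi *+ 2)).
  by move=> hx; apply: cintP => //; apply: (vert_cont Gd).
have m1 : ln r' <= ln r <= ln r by rewrite lr lexx.
have m2 : ln r' <= ln r' <= ln r by rewrite lr lexx.
have i1 := cG _ m1; have i2 := cG _ m2.
have pp : 0 < pi *+ 2 :> R by rewrite pmulrn_lgt0 // pi_gt0.
have b1 : normc (cint (fun y => G (ln r +i* y)%C) 0 (pi *+ 2)) <= B * (pi *+ 2 - 0).
  by apply: (isint_bound p0 i1) => y _; rewrite /G /cE /= lnK ?posrE.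
have i3 := isintD i2 (isint_opp (isint_affine (f c) 0 0 (pi *+ 2))).
rewrite -E subr0 in b1 i3; rewrite mul0r addr0 in i3.
have b3 : normc (cint (fun y => G (ln r +i* y)%C) 0 (pi *+ 2) - f c * (pi *+ 2)%:C%C) <= e * (pi *+ 2 - 0).
  apply: (isint_bound p0 i3) => y _; rewrite mul0r addr0 /G /cE /= lnK ?posrE //.
  apply: D; rewrite normcM cabs_cis mulr1 cabs_real gtr0_norm //.
  have : r' <= d / 2 by rewrite ge_min lexx orbT.
  lra.
rewrite subr0 in b3.
have b4 := cabsB (cint (fun y => G (ln r +i* y)%C) 0 (pi *+ 2))
  (cint (fun y => G (ln r +i* y)%C) 0 (pi *+ 2) - f c * (pi *+ 2)%:C%C).
rewrite opprB addrC subrK normcM cabs_real (gtr0_norm pp) in b4.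
rewrite -(ler_pM2r pp) mulrDl; apply: le_trans b4 _; exact: lerD.
Qed.

(** The modulus is penalised to [|G| + e * Re(w)^2], which has a maximum on one period rectangle. An
    interior maximum contradicts the mean value bound because the penalty is strictly convex; [e] is
    so small that a maximum on the vertical edges would stay below [normc (G w1)]. *)
Lemma strip_maximum (G : C -> C) (a b B : R) : a < b ->
  (forall w, G (w + (0 +i* (pi *+ 2))%C) = G w) ->
  (forall w, a <= complex.Re w <= b -> exists l, cderiv G w l) ->
  (forall w, complex.Re w = a \/ complex.Re w = b -> normc (G w) <= B) ->
  forall w, a <= complex.Re w <= b -> `|complex.Im w| <= pi -> normc (G w) <= B.
Proof.
move=> ab per Gd GB w1 w1ab w1p; rewrite leNgt; apply/negP => big.
pose K := 1 + a ^+ 2 + b ^+ 2.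
have K0 : 0 < K by rewrite /K -addrA ltr_wpDr // addr_ge0 // sqr_ge0.
pose e := (normc (G w1) - B) / (2 * K).
have e0 : 0 < e by rewrite divr_gt0 ?subr_gt0 // mulr_gt0.
have eK : e * K = (normc (G w1) - B) / 2 by rewrite /e; field; rewrite gt_eqF.
pose v (p : R * R) := normc (G (p.1 +i* p.2)%C) + e * p.1 ^+ 2.
pose A := (`[a, b] `*` `[- pi, pi])%classic : set (R * R).
have inA x y : (A (x, y)) = (a <= x <= b /\ `|y| <= pi).
  suff -> : A = [set p : R * R | a <= p.1 <= b /\ `|p.2| <= pi]%classic by [].
  by rewrite /A; apply/seteqP; split=> -[u t] /=; rewrite !in_itv /= ler_norml.
have cA : compact A by apply: compact_setX; exact: segment_compact.
have A1 : A (complex.Re w1, complex.Im w1) by rewrite inA.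
have cv : {within A, continuous v}%classic.
  apply: continuous_in_subspaceT => -[x y]; rewrite inE inA => -[xab yp].
  apply/cvgrPdist_le => eps eps0.
  have [l Gl] := @Gd (x +i* y)%C xab.
  have eps2 : 0 < eps / 2 by lra.
  have [d d0 D] := cderiv_cont Gl eps2.
  have q0 : 0 < 2 * (e * (2 * `|x| + 1)) by have := normr_ge0 x; nra.
  have e2 : 0 < eps / (2 * (e * (2 * `|x| + 1))).
    by rewrite divr_gt0.
  set d' := Num.min (d / 2) (Num.min 1 (eps / (2 * (e * (2 * `|x| + 1))))).
  have d'0 : 0 < d' by rewrite !lt_min ltr01 e2 divr_gt0.
  exists (ball (x : R) d', ball (y : R) d'); first by split; exact: nbhsx_ballx.
  case=> x' y' [/=]; rewrite /ball /= !lt_min => /andP[x1 /andP[x2 x3]] /andP[y1 _].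
  rewrite /v /=.
  set g1 := normc (G (x +i* y)%C); set g2 := normc (G (x' +i* y')%C).
  have gg : `|g1 - g2| <= eps / 2.
    have := D ((x' - x) +i* (y' - y))%C.
    have -> : (x +i* y)%C + ((x' - x) +i* (y' - y))%C = (x' +i* y')%C.
      by apply: complex_ext => /=; ring.
    have nd : normc ((x' - x) +i* (y' - y))%C < d.
      by apply: le_lt_trans (cabs_ReIm _) _; rewrite /= distrC (distrC y'); lra.
    move=> /(_ nd) hh.
    by apply: le_trans (cabs_abs_sub _ _) _; rewrite cabsBC.
  have xx : `|e * x ^+ 2 - e * x' ^+ 2| <= eps / 2.
    rewrite -mulrBr normrM (gtr0_norm e0) subr_sqr normrM.
    have s : `|x + x'| <= 2 * `|x| + 1.
      have := ler_normD (x + x) (x' - x); have := ler_normD x x.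
      rewrite (_ : x + x + (x' - x) = x + x') ?(distrC x' x); last ring.
      lra.
    rewrite ltr_pdivlMr // in x3.
    have : `|x - x'| * `|x + x'| <= `|x - x'| * (2 * `|x| + 1) by apply: ler_wpM2l.
    nra.
  have -> : g1 + e * x ^+ 2 - (g2 + e * x' ^+ 2) = (g1 - g2) + (e * x ^+ 2 - e * x' ^+ 2) by ring.
  apply: le_trans (ler_normD _ _) _; lra.
have [|[u0 y0]] := compact_EVT_max _ cA cv; first by exists (complex.Re w1, complex.Im w1).
rewrite inE inA => -[u0ab y0p] vmax.
set V := v (u0, y0) in vmax.
have per' x y : G (x +i* y)%C = G (x +i* (y + pi *+ 2))%C.
  by rewrite -[LHS]per; congr G; apply: complex_ext => /=; ring.
(* Periodicity extends the maximality past the horizontal edges, so that a circle of radius at most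
   1 around a maximiser with [|y0| = pi] is still covered. *)
have Bd x y : a <= x <= b -> `|y| <= pi + 1 -> normc (G (x +i* y)%C) <= V - e * x ^+ 2.
  move=> xab; rewrite lerBrDr.
  have p0 := pi_ge2 R; rewrite ler_norml => /andP[y1 y2].
  have [yy|yy] := lerP y pi; last first.
    have := vmax (x, y - pi *+ 2); rewrite inE inA {1}/v /= per' subrK; apply; split => //.
    by rewrite ler_norml; apply/andP; split; lra.
  have [yy'|yy'] := lerP (- pi) y.
    by have := vmax (x, y); rewrite inE inA {1}/v /=; apply; split => //; rewrite ler_norml yy yy'.
  have := vmax (x, y + pi *+ 2); rewrite inE inA {1}/v /= -per'; apply; split => //.
  by rewrite ler_norml; apply/andP; split; lra.
have V1 : normc (G w1) <= V.
  apply: le_trans (vmax (complex.Re w1, complex.Im w1) _); last by rewrite inE.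
  by rewrite /v /=; case: (w1) => ? ? /=; rewrite lerDl mulr_ge0 ?sqr_ge0 // ltW.
have VE : V = normc (G (u0 +i* y0)%C) + e * u0 ^+ 2 by [].
have edge : complex.Re (u0 +i* y0)%C = a \/ complex.Re (u0 +i* y0)%C = b -> False.
  move=> /[dup] hu /GB gb.
  have : u0 ^+ 2 <= K.
    by have := sqr_ge0 a; have := sqr_ge0 b; rewrite /K; case: hu => /= ->; lra.
  rewrite -(ler_pM2l e0) eK => h.
  move: V1; rewrite VE => V1; move: big; lra.
case/andP: (u0ab); rewrite le_eqVlt => /orP[/eqP au|au].
  by case: edge; left; rewrite /= au.
rewrite le_eqVlt => /orP[/eqP ub|ub]; first by case: edge; right; rewrite /= ub.
pose r := Num.min 1 (Num.min (u0 - a) (b - u0)).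
have r0 : 0 < r by rewrite !lt_min ltr01 !subr_gt0 au ub.
have [r1 [r2 r3]] : r <= 1 /\ r <= u0 - a /\ r <= b - u0.
  by rewrite !ge_min !lexx !orbT.
pose w0 : C := (u0 +i* y0)%C.
have inAB z : normc z <= r -> a <= complex.Re (w0 + z) <= b.
  move=> zr; rewrite ReD /=; have := le_trans (cabs_Re z) zr; rewrite ler_norml => /andP[? ?].
  by apply/andP; split; lra.
have ni (k : C) : k = 'i%C \/ k = -1 \/ k = - 'i%C -> normc k = 1.
  by case=> [->|[->|->]]; rewrite ?cabsN /= ?expr0n ?expr1n /= ?add0r ?addr0 sqrtr1.
(* [mean_value_bound] accepts only a bound uniform on the circle. Averaging [G] over the four
   rotations by powers of [i] produces one: the squared real parts of the four points always average
   to [u0 ^+ 2 + r ^+ 2 / 2]. *)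
pose ft w := 4^-1 * (G (w0 + (w - w0)) + G (w0 + 'i%C * (w - w0))
   + (G (w0 + -1 * (w - w0)) + G (w0 + - 'i%C * (w - w0)))).
have lin (k : C) w : cderiv (fun t : C => w0 + k * (t - w0)) w (0 + k * (1 - 0)).
  apply: cderivD (cderiv_const _ _) _; apply: cderivMl; apply: cderivB (cderiv_id _) _.
  exact: cderiv_const.
have fd w : normc (w - w0) <= r -> exists l, cderiv ft w l.
  move=> wr.
  have term (k : C) : normc k = 1 -> exists l, cderiv (fun t : C => G (w0 + k * (t - w0))) w l.
    move=> k1; have [|l Gl] := Gd (w0 + k * (w - w0)).
      by apply: inAB; rewrite normcM k1 mul1r.
    by exists (l * (0 + k * (1 - 0))); exact: (@cderiv_comp R G (fun t : C => w0 + k * (t - w0)) w l (0 + k * (1 - 0)) Gl (lin k w)).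
  have [l1 h1] := term 1 (normc1 _); have [l2 h2] := term 'i%C (ni _ (or_introl erefl)).
  have [l3 h3] := term (-1) (ni _ (or_intror (or_introl erefl))).
  have [l4 h4] := term (- 'i%C) (ni _ (or_intror (or_intror erefl))).
  exists (4^-1 * (l1 + l2 + (l3 + l4))).
  apply: (@cderiv_ext _ (fun t : C => 4^-1 * (G (w0 + 1 * (t - w0)) + G (w0 + 'i%C * (t - w0))
   + (G (w0 + -1 * (t - w0)) + G (w0 + - 'i%C * (t - w0))))) _ _ _ 1) => //.
    by move=> h _; rewrite mul1r.
  by apply: cderivMl; do ! apply: cderivD.
have fb t : normc (ft (w0 + r%:C%C * cis t)) <= V - e * (u0 ^+ 2 + r ^+ 2 / 2).
  rewrite /ft [w0 + _ - w0]addrAC subrr add0r normcM.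
  set x := r * cos t; set y := r * sin t.
  have xy : x ^+ 2 + y ^+ 2 = r ^+ 2 by rewrite !exprMn -mulrDr cos2Dsin2 mulr1.
  have xr : `|x| <= r by rewrite normrM (gtr0_norm r0); apply: ler_piMr; [exact: ltW|exact: cos_max].
  have yr : `|y| <= r by rewrite normrM (gtr0_norm r0); apply: ler_piMr; [exact: ltW|exact: sin_max].
  move: (xr) (yr); rewrite !ler_norml => /andP[x1 x2] /andP[y1 y2].
  have yp (z : R) : - r <= z -> z <= r -> `|y0 + z| <= pi + 1.
    by move=> *; apply: le_trans (ler_normD _ _) _; rewrite lerD // ler_norml; apply/andP; split; lra.
  have xp (z : R) : - r <= z -> z <= r -> a <= u0 + z <= b by move=> *; apply/andP; split; lra.
  have E1 : w0 + r%:C%C * cis t = ((u0 + x) +i* (y0 + y))%C.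
    by apply: complex_ext => /=; rewrite /x /y; ring.
  have E2 : w0 + 'i%C * (r%:C%C * cis t) = ((u0 + - y) +i* (y0 + x))%C.
    by apply: complex_ext => /=; rewrite /x /y; ring.
  have E3 : w0 + -1 * (r%:C%C * cis t) = ((u0 + - x) +i* (y0 + - y))%C.
    by apply: complex_ext => /=; rewrite /x /y; ring.
  have E4 : w0 + - 'i%C * (r%:C%C * cis t) = ((u0 + y) +i* (y0 + - x))%C.
    by apply: complex_ext => /=; rewrite /x /y; ring.
  rewrite E1 E2 E3 E4.
  have x1' : - r <= - x by rewrite lerN2. have x2' : - x <= r by rewrite lerNl.
  have y1' : - r <= - y by rewrite lerN2. have y2' : - y <= r by rewrite lerNl.
  have B1 := Bd _ _ (xp x x1 x2) (yp y y1 y2).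
  have B2 := Bd _ _ (xp (- y) y1' y2') (yp x x1 x2).
  have B3 := Bd _ _ (xp (- x) x1' x2') (yp (- y) y1' y2').
  have B4 := Bd _ _ (xp y y1 y2) (yp (- x) x1' x2').
  have n4 : normc (4^-1 : C) = 4^-1.
    by rewrite normcV -(rmorph_nat (real_complex R)) cabs_real ger0_norm.
  rewrite n4 mulrC ler_pdivrMr //.
  apply: le_trans (cabsD _ _) _; apply: le_trans (lerD (cabsD _ _) (cabsD _ _)) _.
  apply: le_trans (lerD (lerD B1 B2) (lerD B3 B4)) _.
  rewrite -xy; lra.
have := mean_value_bound r0 fd fb.
have -> : ft w0 = G w0 by rewrite /ft subrr !mulr0 !addr0; field.
rewrite leNgt => /negP; apply.
have : 0 < e * r ^+ 2 by rewrite mulr_gt0 // exprn_gt0.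
rewrite VE; lra.
Qed.
End MaximumModulus.

(** * Propagation of limits across annuli, and a Jensen-type count of zeros *)

Section AnnulusAndZeros.
Variable R : realType.
Local Notation C := R[i].
Implicit Types (z w c l : C) (r x y t e d B M : R).

(** A two-circle argument: in the coordinate [w = ln (z - c)] the weight [exp (- k w)] discounts the
    outer bound [M] by [(s / r3) ^+ k], and for fixed [k] the inner circle is made small enough to
    survive the factor [(s / r1) ^+ k]. *)
Lemma annulus_limit (g : nat -> C -> C) c r1 r3 M z : 0 < r1 ->
  r1 < normc (z - c) < r3 ->
  (forall n w, r1 <= normc (w - c) <= r3 -> exists l, cderiv (g n) w l) ->
  (forall n w, normc (w - c) = r3 -> normc (g n w) <= M) ->
  (forall e, 0 < e -> exists n0, forall n, (n0 <= n)%N -> forall w,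
     normc (w - c) = r1 -> normc (g n w) <= e) ->
  forall e, 0 < e -> exists n0, forall n, (n0 <= n)%N -> normc (g n z) <= e.
Proof.
move=> r10 /andP[z1 z3] gd gM g0 e e0.
set s := normc (z - c) in z1 z3.
have s0 : 0 < s by exact: lt_trans z1.
have r30 : 0 < r3 by exact: lt_trans z3.
have M1 : 0 < `|M| + 1 by rewrite ltr_wpDl.
(* The power [k] depends only on [e] and the outer circle; it is fixed before the index [n] is taken
   large. *)
have [|k hk] := @exprn_small _ (s / r3) (e / (`|M| + 1)) _ (divr_gt0 e0 M1).
  by rewrite divr_ge0 ?ltW //= ltr_pdivrMr // mul1r.
have e1 : 0 < e * (r1 / s) ^+ k by rewrite mulr_gt0 // exprn_gt0 // divr_gt0.
have [n0 hn] := g0 _ e1; exists n0 => n /hn gr1.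
pose G w := g n (c + cE w) * (cE w)^-1 ^+ k.
have cEp w : cE (w + (0 +i* (pi *+ 2))%C) = cE w.
  by rewrite /cE ReD ImD /= addr0 cis2pi.
have Gd w : ln r1 <= complex.Re w <= ln r3 -> exists l, cderiv G w l.
  case/andP=> w1 w3.
  have [|l gl] := gd n (c + cE w).
    rewrite addrAC subrr add0r cabs_cE -[leLHS](lnK _) ?posrE // ler_expR w1 /=.
    by rewrite -[leRHS](lnK _) ?posrE // ler_expR.
  have h1 := @cderiv_comp _ (g n) (fun t : C => c + cE t) w l (0 + cE w) gl
     (cderivD (cderiv_const c w) (cderiv_cE w)).
  have h2 := @cderiv_comp _ _ (@cE R) w _ _ (cderivV (cE_neq0 w)) (cderiv_cE w).
  have [l' h3] := cderivX k h2.
  by eexists; exact: cderivM h1 h3.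
have lr : ln r1 < ln r3 by rewrite ltr_ln ?posrE // (lt_trans z1).
have zc0 : z - c != 0 by rewrite -cabs_gt0.
have [t tp zE] := polarE (z - c).
pose w1 : C := (ln s +i* t)%C.
have w1E : cE w1 = z - c by rewrite /cE /= lnK ?posrE // -/s.
have rw : ln r1 <= complex.Re w1 <= ln r3 by rewrite /= !ler_ln ?posrE // !ltW.
have nG w x : 0 < x -> complex.Re w = ln x -> normc (G w) = normc (g n (c + cE w)) * x^-1 ^+ k.
  by move=> x0 wx; rewrite normcM cabsX normcV cabs_cE wx lnK ?posrE.
have bound w : complex.Re w = ln r1 \/ complex.Re w = ln r3 -> normc (G w) <= e * s^-1 ^+ k.
  case=> wr; rewrite (nG _ _ _ wr) //.
    have := gr1 (c + cE w); rewrite addrAC subrr add0r cabs_cE wr lnK ?posrE // => /(_ erefl) h.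
    have -> : e * s^-1 ^+ k = e * (r1 / s) ^+ k * r1^-1 ^+ k.
      by rewrite -mulrA -exprMn; congr (_ * _ ^+ _); field; rewrite !gt_eqF.
    by rewrite ler_pM2r // exprn_gt0 // invr_gt0.
  have := gM n (c + cE w); rewrite addrAC subrr add0r cabs_cE wr lnK ?posrE // => /(_ erefl) h.
  have h' : normc (g n (c + cE w)) <= `|M| + 1 by have := ler_norm M; lra.
  apply: le_trans (_ : (`|M| + 1) * r3^-1 ^+ k <= _).
    by rewrite ler_pM2r // exprn_gt0 // invr_gt0.
  move: hk; rewrite ler_pdivlMr // mulrC => hk.
  have -> : r3^-1 ^+ k = (s / r3) ^+ k * s^-1 ^+ k.
    by rewrite -exprMn; congr (_ ^+ _); field; rewrite !gt_eqF.
  by rewrite mulrA ler_pM2r // exprn_gt0 // invr_gt0.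
have per w : G (w + (0 +i* (pi *+ 2))%C) = G w by rewrite /G cEp.
have := strip_maximum lr per Gd bound rw tp.
by rewrite (nG _ s) // w1E [c + _]addrC subrK ler_pM2r // exprn_gt0 // invr_gt0.
Qed.

Lemma cderiv_ccont (f : C -> C) z l : cderiv f z l -> ccont f z.
Proof. by move=> fl e e0; have [d d0 H] := cderiv_cont fl e0; exists d. Qed.

Lemma ccontM (f g : C -> C) z : ccont f z -> ccont g z -> ccont (fun t : C => f t * g t) z.
Proof.
move=> fc gc e e0.
pose K := normc (f z) + normc (g z) + 1.
have p1 := cabs_ge0 (f z); have p2 := cabs_ge0 (g z).
have K0 : 0 < K by rewrite /K; lra.
pose e' := Num.min 1 (e / (2 * K)).
have e'0 : 0 < e' by rewrite lt_min ltr01 divr_gt0 // mulr_gt0.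
have e'1 : e' <= 1 by rewrite ge_min lexx.
have e'2 : e' * (2 * K) <= e by rewrite -ler_pdivlMr ?mulr_gt0 // ge_min lexx orbT.
have [d1 d10 H1] := fc _ e'0; have [d2 d20 H2] := gc _ e'0.
exists (Num.min d1 d2); first by rewrite lt_min d10.
move=> u; rewrite lt_min => /andP[/H1 h1 /H2 h2].
have -> : f (z + u) * g (z + u) - f z * g z =
  f z * (g (z + u) - g z) + (f (z + u) - f z) * (g z + (g (z + u) - g z)) by ring.
apply: le_trans (cabsD _ _) _; rewrite !normcM.
have a1 := cabsD (g z) (g (z + u) - g z).
have b1 : normc (f z) * normc (g (z + u) - g z) <= K * e'.
  apply: ler_pM => //; rewrite /K; lra.
have b2 : normc (f (z + u) - f z) * normc (g z + (g (z + u) - g z)) <= e' * K.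
  apply: ler_pM => //; rewrite /K; lra.
lra.
Qed.

Lemma ccontX (f : C -> C) z n : ccont f z -> ccont (fun t : C => f t ^+ n) z.
Proof.
move=> fc; elim: n => [|n ih] e e0.
  by exists 1 => // u _; rewrite !expr0 subrr normc0 ltW.
by have [d d0 H] := ccontM fc ih e0; exists d => // u /H; rewrite !exprS.
Qed.

(* Multiplying by [z - rho] upgrades continuity at [rho] to differentiability. *)
Lemma cderiv_root_mul (f : C -> C) c : ccont f c ->
  cderiv (fun t : C => (t - c) * f t) c (f c).
Proof.
move=> fc e e0; have [d d0 H] := fc e e0; exists d => // h /H hh.
have -> : (c + h - c) * f (c + h) - (c - c) * f c - f c * h = (f (c + h) - f c) * h by ring.
by rewrite normcM ler_wpM2r.
Qed.

Definition root_prod (rs : seq C) z : C := \prod_(q <- rs) (z - q).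

Lemma root_prod_cderiv rs z : exists l, cderiv (root_prod rs) z l.
Proof.
elim: rs => [|q rs [l ih]].
  exists 0; apply: cderiv_ext (cderiv_const 1 z); first exact: ltr01.
  by move=> h _; rewrite /root_prod big_nil.
eexists; apply: (@cderiv_ext _ (fun t : C => (t - q) * root_prod rs t)); first exact: ltr01.
  by move=> h _; rewrite /root_prod big_cons.
exact: cderivM (cderivB (cderiv_id z) (cderiv_const q z)) ih.
Qed.

Lemma root_prod_neq0 rs z : z \notin rs -> root_prod rs z != 0.
Proof.
move=> h; rewrite /root_prod prodf_seq_neq0; apply/allP => q qr /=.
by rewrite subr_eq0; apply: contraNneq h => ->.
Qed.

(* [f] is divided by the linear factors of its zeros one at a time; the quotient
   is only known to be continuous at the removed zeros. *)
Lemma divide_roots (f : C -> C) (D : C -> Prop) (rs : seq C) : uniq rs ->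
  (forall z, D z -> exists l, cderiv f z l) ->
  (forall q, q \in rs -> D q /\ f q = 0) ->
  exists h : C -> C, [/\ forall z, f z = h z * root_prod rs z,
    forall z, D z -> ccont h z &
    forall z, D z -> z \notin rs -> exists l, cderiv h z l].
Proof.
move=> urs fd frs; elim: rs urs frs => [|q rs ih] /=.
  move=> _ _; exists f; split.
  - by move=> z; rewrite /root_prod big_nil mulr1.
  - by move=> z /fd[l /cderiv_ccont].
  by move=> z /fd.
case/andP=> qrs urs frs; have [|h [h1 h2 h3]] := ih urs.
  by move=> p prs; apply: frs; rewrite in_cons prs orbT.
have [Dq fq] := frs q (mem_head _ _).
have [l hl] := h3 q Dq qrs.
have hq : h q = 0.
  by apply/eqP; move: (h1 q); rewrite fq => /esym/eqP; rewrite mulf_eq0 (negPf (root_prod_neq0 qrs)) orbF.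
pose h' z := if z == q then l else h z / (z - q).
have E z : h z = h' z * (z - q).
  rewrite /h'; case: eqVneq => [->|zq]; first by rewrite subrr mulr0 hq.
  by rewrite divfK // subr_eq0.
have away z : z != q -> exists2 d, 0 < d & forall u, normc u < d -> h' (z + u) = h (z + u) / (z + u - q).
  move=> zq; exists (normc (z - q)); first by rewrite cabs_gt0 subr_eq0.
  move=> u uz; rewrite /h'; case: eqVneq => // zu.
  by move: uz; rewrite -zu opprD addrA subrr add0r cabsN ltxx.
have dinv z : z != q -> exists l, cderiv (fun t : C => (t - q)^-1) z l.
  move=> zq; eexists.
  apply: (@cderiv_comp _ (fun t : C => t^-1) (fun t : C => t - q)).
    by apply: cderivV; rewrite subr_eq0.
  exact: cderivB (cderiv_id z) (cderiv_const q z).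
exists h'; split.
- by move=> z; rewrite h1 E /root_prod big_cons mulrA.
- move=> z Dz; have [->|zq] := eqVneq z q.
    move=> e e0; have [d d0 H] := hl e e0; exists d => // u ud.
    have [->|u0] := eqVneq u 0; first by rewrite addr0 subrr normc0 ltW.
    rewrite /h' eqxx; case: eqVneq => [qu|_].
      by move: u0; rewrite -[u](addKr q) qu addNr eqxx.
    have := H u ud; rewrite hq subr0 => h4.
    have -> : h (q + u) / (q + u - q) - l = (h (q + u) - l * u) / u by rewrite [q + u - q]addrAC subrr add0r; field; rewrite u0.
    by rewrite normcM normcV ler_pdivrMr // cabs_gt0.
  have [d d0 dE] := away z zq; have [l' dl'] := dinv z zq.
  move=> e e0; have [d' d'0 H] := ccontM (h2 z Dz) (cderiv_ccont dl') e0.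
  exists (Num.min d d'); first by rewrite lt_min d0.
  move=> u; rewrite lt_min => /andP[u1 u2]; rewrite dE // -[z in X in _ - X]addr0 dE ?normc0 //.
  by rewrite addr0; exact: H.
move=> z Dz; rewrite in_cons negb_or => /andP[zq zrs].
have [d d0 dE] := away z zq; have [l' dl'] := dinv z zq; have [l2 hl2] := h3 z Dz zrs.
exists (l2 * (z - q)^-1 + h z * l').
apply: (@cderiv_ext _ (fun t : C => h t * (t - q)^-1) _ _ _ d) => //.
  by move=> u ud; rewrite dE.
exact: cderivM.
Qed.

(** Taking [k]-th powers makes constant factors irrelevant: if [y < x], then [(y / x) ^+ k] drops
    below any positive ratio of [a] and [b]. *)
Lemma power_compare (a b x y : R) : 0 < a -> 0 <= y ->
  (forall k : nat, x ^+ k * a <= y ^+ k * b) -> x <= y.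
Proof.
move=> a0 y0 H; rewrite leNgt; apply/negP => yx.
have x0 : 0 < x by exact: le_lt_trans yx.
have ab : 0 < `|b| + 1 by rewrite ltr_wpDl.
have [||k hk] := @exprn_small _ (y / x) (a / (2 * (`|b| + 1))).
- by rewrite divr_ge0 ?(ltW x0) //= ltr_pdivrMr // mul1r.
- by rewrite divr_gt0 // mulr_gt0.
have := H k; rewrite leNgt => /negP; apply.
have xk : 0 < x ^+ k by rewrite exprn_gt0.
move: hk; rewrite expr_div_n ler_pdivrMr // mulrAC ler_pdivlMr ?mulr_gt0 // => hk.
have h1 : y ^+ k * b <= y ^+ k * (`|b| + 1).
  by apply: ler_wpM2l; [exact: exprn_ge0|have := ler_norm b; lra].
have h2 : 0 < a * x ^+ k by rewrite mulr_gt0.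
have h3 : y ^+ k * (2 * (`|b| + 1)) = 2 * (y ^+ k * (`|b| + 1)) by ring.
lra.
Qed.

(** Jensen's inequality without logarithms: the quotient [h] of [f] by its linear factors is at most
    [M / (r2 - r1) ^+ n] on the outer circle, and the product of the factors is at most [r1 ^+ n] at
    the centre. Since [h] is only continuous at the zeros, the mean value bound is applied to
    [h ^+ k] times the product of factors; the loss [(r2 + r1) ^+ n] does not depend on [k] and
    disappears by [power_compare]. *)
Lemma zeros_in_disc (f : C -> C) c r1 r2 M (rs : seq C) : 0 < r1 -> r1 < r2 ->
  (forall z, normc (z - c) <= r2 -> exists l, cderiv f z l) ->
  (forall z, normc (z - c) = r2 -> normc (f z) <= M) ->
  uniq rs -> (forall q, q \in rs -> normc (q - c) <= r1 /\ f q = 0) ->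
  normc (f c) * ((r2 - r1) / r1) ^+ size rs <= M.
Proof.
move=> r10 r12 fd fM urs frs.
have r20 : 0 < r2 by exact: lt_trans r12.
have M0 : 0 <= M.
  apply: le_trans (cabs_ge0 (f (c + r2%:C%C))) (fM _ _).
  by rewrite addrAC subrr add0r cabs_real gtr0_norm.
have [fc|fc0] := eqVneq (f c) 0; first by rewrite fc normc0 mul0r.
have [|h [h1 h2 h3]] := @divide_roots f (fun z => normc (z - c) <= r2) rs urs fd.
  by move=> q /frs[q1 ->]; split => //; apply: le_trans q1 (ltW r12).
have crs : c \notin rs by apply: contraNN fc0 => /frs[_ ->].
pose n := size rs.
have Pc : 0 < normc (root_prod rs c) by rewrite cabs_gt0 root_prod_neq0.
have bigprod (z : C) : normc (root_prod rs z) = \prod_(q <- rs) normc (z - q).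
  rewrite /root_prod; elim: (rs) => [|q qs ih]; first by rewrite !big_nil normc1.
  by rewrite !big_cons normcM ih.
have P1 : normc (root_prod rs c) <= r1 ^+ n.
  rewrite bigprod // /n; elim: (rs) frs => [|q qs ih] frs; first by rewrite big_nil expr0.
  rewrite big_cons exprS; apply: ler_pM => //; first exact: prodr_ge0.
    by rewrite cabsBC; case: (frs q (mem_head _ _)).
  by apply: ih => p pq; apply: frs; rewrite in_cons pq orbT.
have P2 z : normc (z - c) = r2 -> (r2 - r1) ^+ n <= normc (root_prod rs z).
  move=> zr; rewrite bigprod // /n; elim: (rs) frs => [|q qs ih] frs; first by rewrite big_nil expr0.
  rewrite big_cons exprS; apply: ler_pM; rewrite ?subr_ge0 ?exprn_ge0 ?subr_ge0 ?(ltW r12) //.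
    have [q1 _] := frs q (mem_head _ _).
    by have := cabs_tri z q c; rewrite zr; lra.
  by apply: ih => p pq; apply: frs; rewrite in_cons pq orbT.
have P3 z : normc (z - c) = r2 -> normc (root_prod rs z) <= (r2 + r1) ^+ n.
  move=> zr; rewrite bigprod // /n; elim: (rs) frs => [|q qs ih] frs; first by rewrite big_nil expr0.
  rewrite big_cons exprS; apply: ler_pM => //; first exact: prodr_ge0.
    have [q1 _] := frs q (mem_head _ _).
    by have := cabs_tri z c q; rewrite zr (cabsBC c); lra.
  by apply: ih => p pq; apply: frs; rewrite in_cons pq orbT.
have d0 : 0 < r2 - r1 by rewrite subr_gt0.
have B0 : 0 <= M / (r2 - r1) ^+ n by rewrite divr_ge0 // exprn_ge0 // ltW.
have hB z : normc (z - c) = r2 -> normc (h z) <= M / (r2 - r1) ^+ n.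
  move=> zr; rewrite ler_pdivlMr ?exprn_gt0 //.
  apply: le_trans (fM z zr); rewrite h1 normcM ler_wpM2l //; exact: P2.
have hc : normc (h c) <= M / (r2 - r1) ^+ n.
  apply: (@power_compare (normc (root_prod rs c)) ((r2 + r1) ^+ n)) => // k.
  rewrite -cabsX -normcM.
  have := @mean_value_bound R (fun t : C => h t ^+ k * root_prod rs t) c r2
    ((M / (r2 - r1) ^+ n) ^+ k * (r2 + r1) ^+ n) r20; apply.
    move=> z zr; have [zrs|zrs] := boolP (z \in rs); last first.
      have [l hl] := h3 z zr zrs; have [l1 hk] := cderivX k hl.
      have [l2 hP] := root_prod_cderiv rs z.
      by eexists; exact: cderivM hk hP.
    (* At a zero, one linear factor is kept aside: times a merely continuous function it is
       differentiable there. *)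
    have rsE : perm_eq rs (z :: rem z rs) by exact: perm_to_rem.
    have E (t : C) : root_prod rs t = (t - z) * root_prod (rem z rs) t.
      by rewrite /root_prod (perm_big _ rsE) big_cons.
    have [l2 hP] := root_prod_cderiv (rem z rs) z.
    have hc := ccontM (ccontX k (h2 z zr)) (cderiv_ccont hP).
    eexists; apply: (@cderiv_ext _ (fun t : C => (t - z) * (h t ^+ k * root_prod (rem z rs) t)) _ _ _ 1) => //.
      by move=> u _; rewrite E mulrCA.
    exact: cderiv_root_mul hc.
  move=> t; set z := c + _.
  have zr : normc (z - c) = r2.
    by rewrite /z addrAC subrr add0r normcM cabs_cis mulr1 cabs_real gtr0_norm.
  rewrite normcM cabsX; apply: ler_pM; rewrite ?exprn_ge0 //; last exact: P3.
  by rewrite lerXn2r ?nnegrE // hB.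
rewrite h1 normcM expr_div_n.
have r1n : 0 < r1 ^+ n by rewrite exprn_gt0.
have r2n : 0 < (r2 - r1) ^+ n by rewrite exprn_gt0.
rewrite -/n mulrA ler_pdivrMr //.
have : normc (h c) * normc (root_prod rs c) <= M / (r2 - r1) ^+ n * r1 ^+ n.
  by apply: ler_pM.
rewrite -(ler_pM2r r2n) => /le_trans; apply.
by rewrite mulrAC divfK // gt_eqF.
Qed.

End AnnulusAndZeros.

(** * Exponential sums *)

Section CauchySchwarz.
Variable R : realType.
Local Notation C := R[i].

Lemma cauchy_schwarz (I : Type) (r : seq I) (x y : I -> R) :
  (\sum_(i <- r) x i * y i) ^+ 2 <= (\sum_(i <- r) x i ^+ 2) * (\sum_(i <- r) y i ^+ 2).
Proof.
set A := \sum_(i <- r) _; set X := \sum_(i <- r) _; set Y := \sum_(i <- r) _.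
have Y0 : 0 <= Y by apply: sumr_ge0 => i _; exact: sqr_ge0.
have H c d : 0 <= c ^+ 2 * X - 2 * c * d * A + d ^+ 2 * Y.
  have -> : c ^+ 2 * X - 2 * c * d * A + d ^+ 2 * Y = \sum_(i <- r) (c * x i - d * y i) ^+ 2.
    rewrite /A /X /Y !mulr_sumr -sumrB -big_split /=; apply: eq_bigr => i _; ring.
  by apply: sumr_ge0 => i _; exact: sqr_ge0.
move: Y0; rewrite le_eqVlt => /orP[/eqP Y0|Y0].
  (* When the second sum of squares vanishes, the form at [(A, X + 1)] equals [- A ^+ 2 * (X + 2)],
     which forces [A = 0]. *)
  have := H 1 (A * (X + 1) ^+ 1); have := H (A) (X + 1); rewrite -Y0.
  have X0 : 0 <= X by apply: sumr_ge0 => i _; exact: sqr_ge0.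
  nra.
have := H Y A.
have -> : Y ^+ 2 * X - 2 * Y * A * A + A ^+ 2 * Y = Y * (X * Y - A ^+ 2) by ring.
by rewrite pmulr_rge0 // subr_ge0.
Qed.

Lemma cabs_sum_sqr (a b : nat) (F : nat -> C) :
  normc (\sum_(a <= n < b) F n) ^+ 2 <= (b - a)%:R * \sum_(a <= n < b) normc (F n) ^+ 2.
Proof.
apply: le_trans (_ : (\sum_(a <= n < b) 1 * normc (F n)) ^+ 2 <= _).
  rewrite lerXn2r ?nnegrE // ?sumr_ge0 //; first by move=> i _; rewrite mul1r.
  by apply: le_trans (cabs_sum _ _ _) _; apply: ler_sum => i _; rewrite mul1r.
apply: le_trans (cauchy_schwarz _ _ _) _; apply: ler_wpM2r.
  by apply: sumr_ge0 => i _; exact: sqr_ge0.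
by under eq_bigr do rewrite expr1n; rewrite sumr_const_nat.
Qed.

End CauchySchwarz.

(** * The Kusmin-Landau and van der Corput inequalities *)

Section ExponentialSums.
Variable R : realType.
Local Notation C := R[i].
Implicit Types (t x th : R) (a b h k n : nat) (phi : nat -> R).

(** With [c n = 1 / (cis (d n) - 1)] each term is [c n] times the difference of two consecutive
    terms, and summation by parts leaves the variation of [c]. Increments in [[th, 1]] stay away
    from [2 pi], so [|c n| <= 2 / d n]; monotonicity makes the variation telescope to [4 / d], and
    the last boundary term adds [2 / d]. *)
Lemma kusmin_landau phi a b th : 0 < th ->
  (forall n, (a <= n < b)%N -> th <= phi n.+1 - phi n <= 1) ->
  (forall n, (a <= n)%N -> (n.+1 < b)%N -> phi n.+2 - phi n.+1 <= phi n.+1 - phi n) ->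
  normc (\sum_(a <= n < b) cis (phi n)) <= 6 / th.
Proof.
move=> th0 dth dmono.
have [ba|ab] := leqP b a.
  by rewrite big_geq // normc0 divr_ge0 // ltW.
pose d n := phi n.+1 - phi n.
pose c n : C := (cis (d n) - 1)^-1.
have d0 n : (a <= n < b)%N -> 0 < d n.
  by move=> /dth /andP[h _]; exact: lt_le_trans h.
have c1 n : (a <= n < b)%N -> d n / 2 <= normc (cis (d n) - 1).
  by move=> nb; apply: cis_sub1_ge; rewrite (ltW (d0 _ nb)); case/andP: (dth _ nb).
have cn0 n : (a <= n < b)%N -> cis (d n) - 1 != 0.
  by move=> nb; rewrite -cabs_gt0; apply: lt_le_trans (c1 _ nb); rewrite divr_gt0 // d0.
have cn n : (a <= n < b)%N -> normc (c n) <= 2 / d n.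
  move=> nb; have dn0 := d0 _ nb; rewrite normcV -[2 / _]invf_div lef_pV2 ?posrE ?divr_gt0 ?c1 //.
  by rewrite cabs_gt0 cn0.
have cis_step n : cis (phi n.+1) = cis (d n) * cis (phi n) by rewrite -cisD /d subrK.
have cc n : (a <= n)%N -> (n.+1 < b)%N -> normc (c n - c n.+1) <= 4 * ((d n.+1)^-1 - (d n)^-1).
  move=> an nb; have n1 : (a <= n < b)%N by rewrite an ltnW.
  have n2 : (a <= n.+1 < b)%N by rewrite nb ltnW.
  have z1 := cn0 _ n1; have z2 := cn0 _ n2.
  have -> : c n - c n.+1 = (cis (d n.+1) - cis (d n)) * (c n * c n.+1).
    by rewrite /c; field; rewrite z1 z2.
  rewrite !normcM.
  have := cis_sub_le (d n.+1) (d n); rewrite distrC ger0_norm ?subr_ge0; last exact: dmono.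
  have p1 := d0 _ n1; have p2 := d0 _ n2 => h1.
  have h2 : normc (c n) * normc (c n.+1) <= (2 / d n) * (2 / d n.+1) by apply: ler_pM => //; exact: cn.
  apply: le_trans (ler_pM _ _ h1 h2) _ => //; first by rewrite mulr_ge0.
  by rewrite le_eqVlt; apply/orP; left; apply/eqP; field; rewrite !gt_eqF.
have main m : (a + m < b)%N ->
   normc (\sum_(a <= n < (a + m).+1) cis (phi n) - c (a + m)%N * cis (phi (a + m).+1)) <= 4 / d (a + m)%N.
  elim: m => [|m ih] mb.
    rewrite addn0 in mb *; have ab' : (a <= a < b)%N by rewrite leqnn.
    rewrite big_nat1 cis_step.
    have -> : cis (phi a) - c a * (cis (d a) * cis (phi a)) = - (c a * cis (phi a)).
      by rewrite /c; field; exact: cn0.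
    rewrite cabsN normcM cabs_cis mulr1; apply: le_trans (cn _ ab') _.
    by rewrite ler_pM2r ?invr_gt0 ?d0 // ler_nat.
  rewrite addnS in mb *; have mb' := ltnW mb; have {}ih := ih mb'.
  have am : (a <= a + m)%N by rewrite leq_addr.
  have n1 : (a <= a + m < b)%N by rewrite am mb'.
  have n2 : (a <= (a + m).+1 < b)%N by rewrite mb ltnW.
  rewrite big_nat_recr /=; last by rewrite ltnW.
  set S := \sum_(_ <= _ < _) _ in ih *.
  have -> : S + cis (phi (a + m).+1) - c (a + m).+1 * cis (phi (a + m).+2) =
    (S - c (a + m)%N * cis (phi (a + m).+1)) + (c (a + m)%N - c (a + m).+1) * cis (phi (a + m).+1).
    by rewrite (cis_step (a + m).+1) /c; field; rewrite !cn0.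
  apply: le_trans (cabsD _ _) _; rewrite normcM cabs_cis mulr1.
  apply: le_trans (lerD ih (cc _ am mb)) _; rewrite mulrBr; lra.
have bE : b = (a + (b - a).-1).+1 by rewrite -addnS prednK ?subn_gt0 // subnKC // ltnW.
set m := (b - a).-1 in bE.
have mb : (a + m < b)%N by rewrite [in X in (_ < X)%N]bE.
have := main m mb; rewrite -bE => h1.
have n1 : (a <= a + m < b)%N by rewrite leq_addr mb.
have h2 := cn _ n1.
have -> : \sum_(a <= n < b) cis (phi n) = (\sum_(a <= n < b) cis (phi n) - c (a + m)%N * cis (phi b))
   + c (a + m)%N * cis (phi b) by rewrite subrK.
apply: le_trans (cabsD _ _) _; rewrite normcM cabs_cis mulr1.
apply: le_trans (lerD h1 h2) _; rewrite -mulrDl -natrD ler_pM2l // lef_pV2 ?posrE ?d0 //.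
by case/andP: (dth _ n1).
Qed.

Lemma cabs_sum_cisN phi a b :
  normc (\sum_(a <= n < b) cis (- phi n)) = normc (\sum_(a <= n < b) cis (phi n)).
Proof. by rewrite -[RHS]cabs_conj conjc_sum; under eq_bigr do rewrite cisN. Qed.

Lemma kusmin_landauN phi a b th : 0 < th ->
  (forall n, (a <= n < b)%N -> th <= phi n - phi n.+1 <= 1) ->
  (forall n, (a <= n)%N -> (n.+1 < b)%N -> phi n.+1 - phi n.+2 <= phi n - phi n.+1) ->
  normc (\sum_(a <= n < b) cis (phi n)) <= 6 / th.
Proof.
move=> th0 h1 h2; rewrite -cabs_sum_cisN; apply: kusmin_landau => // n.
  by move/h1; rewrite opprK addrC.
by move=> an nb; rewrite !opprK addrC [leRHS]addrC h2.
Qed.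

(** [H] times the sum is rewritten as a sum, over at most [2 N] positions, of windows of length [H];
    Cauchy-Schwarz over the positions turns the windows into correlations, which depend only on the
    difference of the two shifts. *)
Lemma van_der_corput (E : nat -> C) a b (N H : nat) :
  (forall n, normc (E n) <= 1) -> (b - a <= N)%N -> (0 < H <= N)%N ->
  normc (\sum_(a <= n < b) E n) ^+ 2 <= 2 * N%:R / H%:R *
   (N%:R + 2 * \sum_(1 <= h < H) normc (\sum_(a <= n < b - h) E (n + h)%N * ((E n)^*)%C)).
Proof.
move=> E1 baN /andP[H0 HN].
have [ba|ab] := leqP b a.
  rewrite [X in normc X]big_geq // normc0 expr0n /=; apply: mulr_ge0; first by rewrite divr_ge0.
  by rewrite addr_ge0 // mulr_ge0 // sumr_ge0.
(* The extension by zero is delayed by [H], so that windows [k + h] starting before the first term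
   have natural indices. *)
pose F k : C := if (a + H <= k < b + H)%N then E (k - H)%N else 0.
set S := \sum_(a <= n < b) E n.
pose corr h := \sum_(a <= n < b - h) E (n + h)%N * ((E n)^*)%C.
have Fsum (G : nat -> C) b' l : (l <= H)%N -> (b' <= b)%N ->
   \sum_(a <= k < b + H) (if (a + H <= k + l < b' + H)%N then G (k + l - H)%N else 0) =
   \sum_(a <= n < b') G n.
  move=> lH bb.
  have -> : \sum_(a <= k < b + H) (if (a + H <= k + l < b' + H)%N then G (k + l - H)%N else 0) =
     \sum_(a + l <= k < b + H + l) (if (a + H <= k < b' + H)%N then G (k - H)%N else 0).
    by rewrite big_addn addnK.
  rewrite -big_mkcond /=.
  have -> : \sum_(a + l <= k < b + H + l | (a + H <= k < b' + H)%N) G (k - H)%N =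
     \sum_(a + H <= k < b' + H) G (k - H)%N.
    rewrite [RHS](@big_nat_widen _ _ _ _ _ (b + H + l)%N); last by lia.
    rewrite [RHS](@big_nat_widenl _ _ _ _ (a + l)%N); last by lia.
    by apply: eq_bigl => k; rewrite /= andbC.
  by rewrite big_addn addnK; apply: eq_bigr => n _; rewrite addnK.
have HS : H%:R * S = \sum_(a <= k < b + H) \sum_(0 <= h < H) F (k + h)%N.
  rewrite exchange_big_nat /=.
  rewrite (eq_big_nat _ _ (F2 := fun=> S)); last first.
    by move=> h /andP[_ hH]; rewrite /F (Fsum E) //; lia.
  by rewrite sumr_const_nat subn0 mulr_natl.
have cs := cabs_sum_sqr a (b + H) (fun k => \sum_(0 <= h < H) F (k + h)%N).
have natC (m : nat) : (m%:R : C) = (m%:R)%:C%C by rewrite (rmorph_nat (real_complex R)).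
rewrite -HS normcM natC cabs_real ger0_norm // exprMn in cs.
have cor1 h h' : (h <= H)%N -> (h' <= h)%N ->
    \sum_(a <= k < b + H) F (k + h)%N * ((F (k + h')%N)^*)%C = corr (h - h')%N.
  move=> hH h'h; rewrite /corr -(Fsum (fun n => E (n + (h - h'))%N * ((E n)^*)%C) _ h'); try lia.
  apply: eq_bigr => k _; rewrite /F.
  have -> : (a + H <= k + h' < b - (h - h') + H)%N = (a + H <= k + h < b + H)%N && (a + H <= k + h' < b + H)%N.
    by apply/idP/idP; lia.
  case: ifP => //= h1; last by rewrite mul0r.
  case: ifP => h2; last by rewrite conjc0 mulr0.
  by congr (E _ * _); lia.
have corC (h h' : nat) : normc (\sum_(a <= k < b + H) F (k + h)%N * ((F (k + h')%N)^*)%C) =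
    normc (\sum_(a <= k < b + H) F (k + h')%N * ((F (k + h)%N)^*)%C).
  rewrite -[LHS]cabs_conj conjc_sum; congr normc; apply: eq_bigr => k _.
  by rewrite rmorphM /= conjcK mulrC.
have c0N : normc (corr 0%N) <= N%:R.
  rewrite /corr subn0; apply: le_trans (cabs_sum _ _ _) _.
  apply: le_trans (_ : \sum_(a <= n < b) 1 <= _); last by rewrite sumr_const_nat ler_nat.
  by apply: ler_sum => n _; rewrite addn0 normcM cabs_conj mulr_ile1.
set T := \sum_(1 <= h < H) normc (corr h).
have T0 : 0 <= T by exact: sumr_ge0.
(* For a fixed shift [h] the others lie on its two sides, each side contributing at most [T], and
   [h] itself contributes the diagonal [N]. *)
have inner h : (h < H)%N -> \sum_(0 <= h' < H) normc (\sum_(a <= k < b + H) F (k + h)%N * ((F (k + h')%N)^*)%C) <= N%:R + 2 * T.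
  move=> hH; pose Q h' := normc (\sum_(a <= k < b + H) F (k + h)%N * ((F (k + h')%N)^*)%C).
  have Q1 h' : (h' <= h)%N -> Q h' = normc (corr (h - h')%N).
    by move=> h'h; rewrite /Q cor1 // ltnW.
  have Q2 h' : (h <= h' < H)%N -> Q h' = normc (corr (h' - h)%N).
    by case/andP=> h'h h'H; rewrite /Q corC cor1 // ltnW.
  have -> : \sum_(0 <= h' < H) normc (\sum_(a <= k < b + H) F (k + h)%N * ((F (k + h')%N)^*)%C) =
     \sum_(0 <= h' < h) Q h' + Q h + \sum_(h.+1 <= h' < H) Q h'.
    by rewrite -big_nat_recr //= -big_cat_nat //=.
  have l1 : \sum_(0 <= h' < h) Q h' <= T.
    rewrite big_nat_rev /= add0n.
    rewrite (eq_big_nat _ _ (F2 := fun i => normc (corr i.+1))); last first.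
      move=> i /andP[_ ih]; rewrite Q1; [congr (normc (corr _)); lia|lia].
    rewrite /T [leRHS](@big_cat_nat _ _ _ h.+1) //=.
    by rewrite big_add1 /= lerDl sumr_ge0.
  have l2 : \sum_(h.+1 <= h' < H) Q h' <= T.
    rewrite (eq_big_nat _ _ (F2 := fun i => normc (corr (i - h)%N))); last first.
      by move=> i /andP[hi iH]; rewrite Q2 // iH ltnW.
    have -> : \sum_(h.+1 <= i < H) normc (corr (i - h)%N) = \sum_(1 <= i < H - h) normc (corr i).
      by rewrite -[h.+1]add1n big_addn; apply: eq_bigr => i _; rewrite addnK.
    have e1 : (1 <= H - h)%N by lia.
    have e2 : (H - h <= H)%N by lia.
    rewrite /T [leRHS](@big_cat_nat _ _ _ (H - h)%N 1%N) //=.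
    by rewrite lerDl sumr_ge0.
  rewrite Q1 // subnn; clear -l1 l2 c0N; lra.
have tot : \sum_(a <= k < b + H) normc (\sum_(0 <= h < H) F (k + h)%N) ^+ 2 <= H%:R * (N%:R + 2 * T).
  have -> : \sum_(a <= k < b + H) normc (\sum_(0 <= h < H) F (k + h)%N) ^+ 2 =
     complex.Re (\sum_(0 <= h < H) \sum_(0 <= h' < H) \sum_(a <= k < b + H) F (k + h)%N * ((F (k + h')%N)^*)%C).
    have -> : \sum_(0 <= h < H) \sum_(0 <= h' < H) \sum_(a <= k < b + H) F (k + h)%N * ((F (k + h')%N)^*)%C =
      \sum_(a <= k < b + H) ((normc (\sum_(0 <= h < H) F (k + h)%N) ^+ 2)%:C)%C.
      under eq_bigr do rewrite exchange_big_nat /=.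
      rewrite exchange_big_nat /=; apply: eq_bigr => k _.
      rewrite -mulcJ conjc_sum mulr_suml; apply: eq_bigr => h _.
      by rewrite mulr_sumr.
    by rewrite -(rmorph_sum (real_complex R)).
  apply: le_trans (ler_norm _) _; apply: le_trans (cabs_Re _) _.
  apply: le_trans (cabs_sum _ _ _) _.
  apply: le_trans (_ : \sum_(0 <= h < H) (N%:R + 2 * T) <= _); last first.
    by rewrite sumr_const_nat subn0 [leRHS]mulr_natl.
  rewrite big_nat [leRHS]big_nat; apply: ler_sum => h /andP[_ hH].
  by apply: le_trans (cabs_sum _ _ _) _; exact: inner.
have H0' : 0 < H%:R :> R by rewrite ltr0n.
have W0 : 0 <= N%:R + 2 * T by rewrite addr_ge0 // mulr_ge0.
have fin : H%:R ^+ 2 * normc S ^+ 2 <= (2 * N%:R) * (H%:R * (N%:R + 2 * T)).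
  apply: le_trans cs _; apply: ler_pM => //; first by apply: sumr_ge0 => k _; exact: sqr_ge0.
  by rewrite -natrM ler_nat; lia.
rewrite -(ler_pM2l (exprn_gt0 2 H0')); apply: le_trans fin _.
by rewrite le_eqVlt; apply/orP; left; apply/eqP; field; rewrite gt_eqF.
Qed.

End ExponentialSums.

(** * Iterated differences of the logarithm *)

Section Differences.
Variable R : realType.
Implicit Types (x t : R) (hs : seq nat).

Fixpoint fdiff hs (f : R -> R) : R -> R :=
  if hs is h :: hs' then fun x => fdiff hs' f (x + h%:R) - fdiff hs' f x else f.

(** The [j]-th derivative of [ln], in closed form. *)
Definition ln_deriv (j : nat) : R -> R :=
  if j is j'.+1 then fun x => (-1) ^+ j' * (j'`!)%:R * x^-1 ^+ j'.+1 else @ln R.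

Lemma is_derive_ln_deriv j x : 0 < x -> is_derive x 1 (ln_deriv j) (ln_deriv j.+1 x).
Proof.
move=> x0; case: j => [|j] /=.
  by rewrite expr0 fact0 expr1 !mul1r; exact: is_derive1_ln.
have xn : x != 0 by rewrite gt_eqF.
have dV : is_derive x 1 (fun y : R => y^-1) (- x ^- 2 *: 1).
  exact: (@is_deriveV R (fun y : R => y) x 1 1 xn).
have dX : is_derive x 1 (fun y : R => y^-1 ^+ j.+1) ((j.+1%:R * x^-1 ^+ j) * - x^-1 ^+ 2).
  have := is_deriveX j.+1 dV; rewrite exprfctE /= => dX.
  apply: (is_derive_eq dX).
  by rewrite -[_ *: _]/(_ * (_ * 1)) mulr1 [x^-1 ^+ 2]exprVn.
apply: is_derive_eq.
rewrite /GRing.scale /= factS natrM !exprS; ring.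
Qed.

Lemma is_derive_fdiff hs j x : 0 < x ->
  is_derive x 1 (fdiff hs (ln_deriv j)) (fdiff hs (ln_deriv j.+1) x).
Proof.
elim: hs x => [|h hs ih] x x0 /=; first exact: is_derive_ln_deriv.
have xh : 0 < x + h%:R by rewrite ltr_wpDr.
have d1 : is_derive x 1 (fun y : R => y + h%:R) 1 by apply: is_derive_eq; rewrite addr0.
have d2 := @is_derive1_comp R _ (fun y : R => y + h%:R) x _ _ (ih _ xh) d1.
have d3 := ih x x0.
by apply: is_derive_eq; rewrite mulr1.
Qed.

(** One mean value step per shift. It fixes the size and the sign of a differenced phase, which is
    the information the Kusmin-Landau inequality asks for. *)
Lemma fdiff_mvt hs j x : 0 < x -> exists2 xi, x <= xi <= x + (sumn hs)%:R &
  fdiff hs (ln_deriv j) x = (\prod_(h <- hs) h)%:R * ln_deriv (j + size hs) xi.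
Proof.
elim: hs j x => [|h hs ih] j x x0.
  by exists x; rewrite ?addr0 ?lexx //= big_nil addn0 mul1r.
have xh : x <= x + h%:R by rewrite lerDl.
have [y /andP[y1 y2] e] := @mvt_segment _ (fdiff hs (ln_deriv j)) (fdiff hs (ln_deriv j.+1)) x (x + h%:R) xh
  (fun y hy => is_derive_fdiff hs j (lt_le_trans x0 (proj1 (andP hy)))).
have y0 : 0 < y by exact: lt_le_trans y1.
have [xi /andP[k1 k2] e2] := ih j.+1 y y0.
exists xi; first by rewrite (le_trans y1 k1) /= natrD addrA; apply: le_trans k2 _; rewrite lerD2r.
rewrite /= e e2 big_cons natrM addrAC subrr add0r addnS addSn; ring.
Qed.

Lemma ln_deriv_abs j x : ln_deriv j.+1 x = (-1) ^+ j * ((j`!)%:R / x ^+ j.+1).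
Proof. by rewrite /= -mulrA exprVn. Qed.

End Differences.

Lemma pow_le (R : realType) (x y : R) (n : nat) : 0 <= x -> x <= y -> x ^+ n <= y ^+ n.
Proof. by move=> x0 xy; rewrite lerXn2r // nnegrE // (le_trans x0). Qed.

(** * Derivative tests for the sums of [n ^ (- i t)] *)

Section DerivativeTests.
Variable R : realType.
Local Notation C := R[i].
Implicit Types (t : R) (hs : seq nat) (a b h N : nat).

Definition diff_sum t hs a b : R :=
  normc (\sum_(a <= n < b) cis (- t * fdiff hs (@ln_deriv R 0) n%:R)).

(** First and second differences of the phase are differences with one or two extra shifts 1, so
    [fdiff_mvt] gives their size and sign. The parity of the number of shifts decides whether the
    phase increases or decreases. *)
Lemma diff_sum_derivative_test t hs a b N : 0 < t -> (0 < N <= a)%N -> (b <= N.*2.+1)%N ->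
  (sumn hs + 2 <= N.*2)%N -> (0 < \prod_(h <- hs) h)%N ->
  t * (\prod_(h <- hs) h)%:R * ((size hs)`!)%:R <= N%:R ^+ (size hs).+1 ->
  diff_sum t hs a b <= 6 * (4 * N%:R) ^+ (size hs).+1 /
     (t * (\prod_(h <- hs) h)%:R * ((size hs)`!)%:R).
Proof.
move=> t0 /andP[N0 Na] b2 sm P0 small.
set P : R := (\prod_(h <- hs) h)%:R in small *; set k := size hs in small *.
have P1 : 0 < P by rewrite ltr0n.
have f1 : 0 < (k`!)%:R :> R by rewrite ltr0n fact_gt0.
have N1 : 0 < N%:R :> R by rewrite ltr0n.
pose W := t * P * (k`!)%:R; have W0 : 0 < W by rewrite !mulr_gt0.
pose phi n := - t * fdiff hs (@ln_deriv R 0) n%:R.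
have bwd n (xi : R) : (a <= n)%N -> (n < b)%N -> n%:R <= xi <= n%:R + (sumn hs).+1%:R ->
    N%:R <= xi <= 4 * N%:R.
  move=> an nb /andP[x1 x2]; apply/andP; split.
    by apply: le_trans x1; rewrite ler_nat (leq_trans Na).
  apply: le_trans x2 _; rewrite -natrD -natrM ler_nat; lia.
have d1 n : (a <= n)%N -> (n < b)%N -> exists2 xi, N%:R <= xi <= 4 * N%:R &
    phi n.+1 - phi n = (-1) ^+ k.+1 * (W / xi ^+ k.+1).
  move=> an nb; have n0 : 0 < n%:R :> R by rewrite ltr0n (leq_trans N0) // (leq_trans Na).
  have [xi xb e] := @fdiff_mvt R (1%N :: hs) 0 _ n0.
  exists xi; first by apply: (bwd n) => //; move: xb; rewrite /= add1n.
  have -> : phi n.+1 - phi n = - t * fdiff (1%N :: hs) (@ln_deriv R 0) n%:R.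
    by rewrite /phi /= -mulrBr natr1.
  rewrite e big_cons mul1n add0n [size _]/= ln_deriv_abs -/P -/k /W [(-1) ^+ k.+1]exprS; ring.
have d2 n : (a <= n)%N -> (n.+1 < b)%N -> exists2 xi, 0 < xi &
    (phi n.+2 - phi n.+1) - (phi n.+1 - phi n) = - ((-1) ^+ k.+1 * (t * P * (k.+1`!)%:R / xi ^+ k.+2)).
  move=> an nb; have n0 : 0 < n%:R :> R by rewrite ltr0n (leq_trans N0) // (leq_trans Na).
  have [xi /andP[xb _] e] := @fdiff_mvt R (1%N :: 1%N :: hs) 0 _ n0.
  exists xi; first exact: lt_le_trans xb.
  have -> : (phi n.+2 - phi n.+1) - (phi n.+1 - phi n) = - t * fdiff (1%N :: 1%N :: hs) (@ln_deriv R 0) n%:R.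
    by rewrite /phi /= !natr1 -!mulrBr.
  rewrite e !big_cons !mul1n add0n [size _]/= ln_deriv_abs -/P -/k; ring.
(* The mean value points lie in [[N, 4 N]]; the increments are smallest at the right end, and
   [small] keeps them at most 1 at the left end. *)
pose th := W / (4 * N%:R) ^+ k.+1.
have th0 : 0 < th by rewrite divr_gt0 // exprn_gt0 // mulr_gt0.
have -> : 6 * (4 * N%:R) ^+ k.+1 / (t * P * (k`!)%:R) = 6 / th.
  by rewrite /th -/W invf_div mulrA.
have range xi : N%:R <= xi <= 4 * N%:R -> th <= W / xi ^+ k.+1 <= 1.
  case/andP=> x1 x2; have x0 : 0 < xi by exact: lt_le_trans x1.
  apply/andP; split.
    rewrite /th ler_pM2l // lef_pV2 ?posrE ?exprn_gt0 ?mulr_gt0 //.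
    by apply: pow_le => //; exact: ltW.
  rewrite ler_pdivrMr ?exprn_gt0 // mul1r; apply: le_trans small _.
  by apply: pow_le => //; exact: ltW.
have pos xi : 0 < xi -> 0 <= t * P * (k.+1`!)%:R / xi ^+ k.+2.
  by move=> x0; rewrite divr_ge0 ?exprn_ge0 ?mulr_ge0 ?ltW.
rewrite /diff_sum -/(phi _).
have [od|ev] := boolP (odd k).
  have sg : (-1) ^+ k.+1 = 1 :> R by rewrite exprS -signr_odd od mulrNN mul1r.
  apply: kusmin_landau => // n.
    by case/andP=> an nb; have [xi /range xr ->] := d1 n an nb; rewrite sg mul1r.
  move=> an nb; have [xi /pos x0 e] := d2 n an nb; rewrite -subr_le0 e sg mul1r.
  by rewrite oppr_le0.
have sg : (-1) ^+ k.+1 = -1 :> R by rewrite exprS -signr_odd (negPf ev) mulr1.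
apply: kusmin_landauN => // n.
  case/andP=> an nb; have [xi /range xr e] := d1 n an nb; rewrite -opprB e sg.
  by rewrite mulN1r opprK.
move=> an nb; have [xi /pos x0 e] := d2 n an nb; rewrite -subr_le0.
have -> : phi n.+1 - phi n.+2 - (phi n - phi n.+1) = - (phi n.+2 - phi n.+1 - (phi n.+1 - phi n)) by ring.
by rewrite e sg mulN1r !opprK oppr_le0.
Qed.

Lemma diff_sum_vdc t hs a b N H : (b - a <= N)%N -> (0 < H <= N)%N ->
  diff_sum t hs a b ^+ 2 <= 2 * N%:R / H%:R *
    (N%:R + 2 * \sum_(1 <= h < H) diff_sum t (h :: hs) a (b - h)).
Proof.
move=> baN HN.
have := @van_der_corput R (fun n => cis (- t * fdiff hs (@ln_deriv R 0) n%:R)) a b N H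
  (fun n => ltac:(by rewrite cabs_cis)) baN HN.
congr (_ <= _ * (_ + _ * _)); apply: eq_bigr => h _; congr normc; apply: eq_bigr => n _.
by rewrite -cisN -cisD /= natrD; congr cis; ring.
Qed.

Lemma diff_sum_vdc_max t hs a b N H (B : R) : (b - a <= N)%N -> (0 < H <= N)%N -> 0 <= B ->
  (forall h, (0 < h < H)%N -> diff_sum t (h :: hs) a (b - h) <= B) ->
  diff_sum t hs a b ^+ 2 <= 2 * N%:R ^+ 2 / H%:R + 4 * N%:R * B.
Proof.
move=> baN HN B0 hB; have /andP[H0 _] := HN.
have H1 : 0 < H%:R :> R by rewrite ltr0n.
apply: le_trans (diff_sum_vdc _ _ baN HN) _.
have s1 : \sum_(1 <= h < H) diff_sum t (h :: hs) a (b - h) <= H%:R * B.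
  apply: le_trans (_ : \sum_(1 <= h < H) B <= _).
    by rewrite big_nat [leRHS]big_nat; apply: ler_sum => h /hB.
  by rewrite sumr_const_nat -[leLHS]mulr_natl ler_wpM2r // ler_nat leq_subr.
have N0 : 0 <= 2 * N%:R / H%:R :> R by rewrite divr_ge0.
have : 2 * N%:R / H%:R * (N%:R + 2 * \sum_(1 <= h < H) diff_sum t (h :: hs) a (b - h)) <=
   2 * N%:R / H%:R * (N%:R + 2 * (H%:R * B)) by rewrite ler_wpM2l // lerD2l ler_pM2l.
move/le_trans; apply; rewrite le_eqVlt; apply/orP; left; apply/eqP.
by field; rewrite gt_eqF.
Qed.

Lemma harmonic_le_ln N : (0 < N)%N -> \sum_(1 <= h < N.+1) h%:R^-1 <= 1 + ln N%:R :> R.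
Proof.
elim: N => // -[|N] ih _; first by rewrite big_nat1 invr1 ln1 addr0.
have {ih} := ih isT; rewrite [leLHS in _ -> leLHS <= _]big_nat_recr //=.
have N0 : 0 < N.+1%:R :> R by rewrite ltr0n.
have N1 : 0 < N.+2%:R :> R by rewrite ltr0n.
have h : N.+2%:R^-1 <= ln N.+2%:R - ln N.+1%:R :> R.
  have p : 0 < N.+1%:R / N.+2%:R :> R by rewrite divr_gt0.
  have := @le_ln1Dx R (N.+1%:R / N.+2%:R - 1).
  rewrite [1 + _]addrC subrK ltrBrDr addNr p => /(_ isT).
  rewrite ln_div ?posrE //.
  have -> : N.+1%:R / N.+2%:R - 1 = - N.+2%:R^-1 :> R.
    have q := lt0r_neq0 N1; apply: (mulIf q); rewrite mulrBl mulNr divfK // mulVf //.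
    by rewrite -[N.+2%:R]natr1; ring.
  by move=> k; rewrite -lerN2 opprB.
by move=> ih; have := lerD ih h; rewrite -addrA [ln N.+1%:R + _]addrC subrK.
Qed.

(** The device that removes constants and one logarithm: a slack of [l / 1000] in an exponent pays
    for both once [l] is at least [10 ^ 5]. *)
Lemma expR_absorb (K l x y : R) : 100 * 1000 <= l -> 0 <= K <= 1000 * 1000 -> x + l / 1000 <= y ->
  K * (1 + l) * expR x <= expR y.
Proof.
move=> l1 /andP[K0 K1] xy.
apply: le_trans (_ : expR (l / 1000) * expR x <= _); last first.
  by rewrite -expRD ler_expR; lra.
rewrite ler_pM2r ?expR_gt0 //.
(* The sixteenth power of [expR z >= z >= 25 / 4] is at least [(25/4)^15 z], more than
   [7 * 10^11 z], while the target is at most [1.7 * 10^10 z]. *)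
pose z := l / 1000 / 16; have z1 : 25 / 4 <= z by rewrite /z; lra.
have e1 : z <= expR z by have := expR_ge1Dx z; lra.
have -> : l / 1000 = z * 16%:R by rewrite /z; lra.
rewrite expRM_natr.
have e2 : (25 / 4) ^+ 15 * z <= expR z ^+ 16.
  have zp : (25 / 4) ^+ 15 <= expR z ^+ 15 by apply: pow_le => //; lra.
  by rewrite [leRHS]exprSr; apply: ler_pM => //; lra.
apply: le_trans e2; apply: le_trans (_ : 1000 * 1000 * (1 + l) <= _).
  by apply: ler_wpM2r => //; lra.
have lz : 1 + l <= 17 * 1000 * z by rewrite /z; lra.
have z0 : 0 <= z by lra.
have c1 : 1000 * 1000 * (17 * 1000) <= (25 / 4) ^+ 15 :> R.
  have p2 : 240 <= (25 / 4 : R) ^+ 3 by rewrite !exprS expr0; lra.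
  have -> : (25 / 4 : R) ^+ 15 = (((25 / 4) ^+ 3)) ^+ 5 by rewrite -exprM.
  apply: le_trans (_ : 240 ^+ 5 <= _); last by apply: pow_le => //; lra.
  by rewrite !exprS !expr0; lra.
have := ler_wpM2r z0 c1; move: lz; clear; lra.
Qed.

Lemma natr_ceil_bounds (x : R) : 1 <= x ->
  exists H : nat, [/\ (0 < H)%N, x <= H%:R & H%:R <= 2 * x].
Proof.
move=> x1; have x0 : 0 <= x by lra.
exists (Num.trunc x).+1.
have /andP[h1 h2] := truncn_itv x0; split => //; first exact: ltW.
rewrite -natr1; lra.
Qed.

(* The base of the differencing process: one application of van der Corput's
   inequality followed by the Kusmin-Landau bound. *)
Lemma diff_sum_base t hs a b N (p : R) : (size hs <= 2)%N -> 0 < t -> 1 <= p ->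
  (0 < N <= a)%N -> (b <= N.*2.+1)%N -> (b - a <= N)%N ->
  (sumn hs + N %/ 2 + 2 <= N.*2)%N -> (0 < \prod_(h <- hs) h)%N ->
  let l := ln N%:R in let Q := N%:R ^+ (size hs).+2 / t in
  let X := 1024 * p * (1 + l) * (1 + Q / N%:R) in
  4 * X <= N%:R -> 12 * ((\prod_(h <- hs) h)%:R * X) <= Q ->
  diff_sum t hs a b ^+ 2 <= N%:R ^+ 2 / p.
Proof.
move=> sz t0 p1 /andP[N0 Na] b2 ba sm P0 l Q X X1 X2.
have N1 : 0 < N%:R :> R by rewrite ltr0n.
have l0 : 0 <= l by rewrite ln_ge0 // ler1n.
have Q0 : 0 < Q by rewrite divr_gt0 // exprn_gt0.
have QE : N%:R ^+ (size hs).+2 = t * Q by rewrite /Q mulrC divfK // gt_eqF.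
clearbody Q.
have QN : 0 < Q / N%:R by rewrite divr_gt0.
have X0 : 1 <= X.
  have h1 : 1 <= p * (1 + l) by nra.
  have : 1 <= p * (1 + l) * (1 + Q / N%:R) by nra.
  rewrite /X; nra.
(* [X] is the shift length for which the diagonal and the off-diagonal contributions together give
   [N ^+ 2 / p]: its factor 1024 is [2 * 512], with 512 twice the constant of [c] below. *)
have [H [Hp H1 H2]] := natr_ceil_bounds X0.
have HN2 : (H.*2 <= N)%N.
  by rewrite -(ler_nat R) -muln2 natrM; lra.
have HN : (0 < H <= N)%N by rewrite Hp; move: HN2; clear; lia.
have H0 : 0 < H%:R :> R by rewrite ltr0n.
set P : R := (\prod_(h <- hs) h)%:R in X2.
have P1 : 1 <= P by rewrite ler1n.
(* 256 dominates [6 * 4 ^ (k + 2) / (k + 1)!] for [k = size hs <= 2]; the bound [c / h] then sums to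
   a logarithm. *)
pose c := 256 * Q; have c0 : 0 < c by apply: mulr_gt0.
have term h : (1 <= h < H)%N -> diff_sum t (h :: hs) a (b - h) <= c * h%:R^-1.
  case/andP=> h1 hH; have h0 : 0 < h%:R :> R by rewrite ltr0n.
  pose W := t * (\prod_(h' <- h :: hs) h')%:R * ((size (h :: hs))`!)%:R.
  pose F : R := ((size (h :: hs))`!)%:R.
  have f1 : 1 <= F <= 6.
    by rewrite /F; move: sz => /=; case: (size hs) => [|[|[|]]] //= _; rewrite ler1n ler_nat.
  case/andP: f1; rewrite /F => f1 f6 {F}.
  have WE : W = t * (h%:R * P) * ((size (h :: hs))`!)%:R by rewrite /W big_cons natrM.
  have hHr : h%:R <= H%:R :> R by rewrite ler_nat ltnW.
  have Wsmall : W <= N%:R ^+ (size (h :: hs)).+1.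
    have hx : h%:R * P * 6 <= Q.
      have : h%:R * P <= 2 * X * P by apply: ler_wpM2r; lra.
      lra.
    rewrite [size _]/= QE WE -mulrA ler_pM2l //; apply: le_trans hx.
    by apply: ler_wpM2l => //; rewrite mulr_ge0 // ltW.
  have dt := @diff_sum_derivative_test t (h :: hs) a (b - h) N t0.
  apply: le_trans (dt _ _ _ _ Wsmall) _; rewrite ?N0 //; first by move: b2; clear; lia.
  - by rewrite [sumn _]/=; move: sm hH HN2; clear; lia.
  - by rewrite big_cons muln_gt0 h1.
  rewrite -/W WE [size _]/=.
  have s4 : 6 * (4 * N%:R) ^+ (size hs).+2 <= c * (t * ((size (h :: hs))`!)%:R).
    have -> : c * (t * ((size (h :: hs))`!)%:R) = 256 * ((size (h :: hs))`!)%:R * N%:R ^+ (size hs).+2.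
      by rewrite QE /c; ring.
    rewrite exprMn mulrA ler_pM2r ?exprn_gt0 // -natrX -!natrM ler_nat.
    by move: sz => /=; case: (size hs) => [|[|[|]]].
  have W1 : 0 < t * (h%:R * P) * ((size hs).+1`!)%:R.
    by rewrite !mulr_gt0 // ?(lt_le_trans ltr01).
  rewrite ler_pdivrMr //; apply: le_trans s4 _.
  rewrite [size _]/=; set f := (_`!)%:R.
  have -> : c * h%:R^-1 * (t * (h%:R * P) * f) = c * (t * f) * P by field; rewrite gt_eqF.
  have f0 : 0 < f by rewrite ltr0n fact_gt0.
  have cf : 0 <= c * (t * f) by apply: ltW; apply: mulr_gt0 c0 _; exact: mulr_gt0.
  by rewrite -[leLHS]mulr1; apply: ler_wpM2l cf _ _ P1.
apply: le_trans (diff_sum_vdc _ _ ba HN) _.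
have S1 : \sum_(1 <= h < H) diff_sum t (h :: hs) a (b - h) <= c * (1 + l).
  apply: le_trans (_ : \sum_(1 <= h < H) c * h%:R^-1 <= _).
    by rewrite big_nat [leRHS]big_nat; apply: ler_sum => h /term.
  rewrite -mulr_sumr; apply: ler_wpM2l; first exact: ltW.
  apply: le_trans (_ : \sum_(1 <= h < H.+1) h%:R^-1 <= _).
    by rewrite [leRHS]big_nat_recr //= lerDl invr_ge0.
  apply: le_trans (harmonic_le_ln Hp) _; rewrite lerD2l ler_ln ?posrE ?ltr0n // ler_nat.
  by case/andP: HN.
have K0 : 0 <= 2 * N%:R / H%:R :> R by rewrite divr_ge0.
apply: le_trans (ler_wpM2l K0 (_ : _ <= N%:R + 2 * (c * (1 + l)))) _; first by rewrite lerD2l ler_pM2l.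
have p0 : 0 < p by lra.
rewrite mulrAC ler_pdivrMr // [leRHS]mulrAC ler_pdivlMr //.
have XH : N%:R ^+ 2 * X <= N%:R ^+ 2 * H%:R by rewrite ler_pM2l // exprn_gt0.
apply: le_trans XH.
have -> : N%:R ^+ 2 * X = 2 * N%:R * p * (512 * (1 + l) * (N%:R + Q)).
  by rewrite /X; field; rewrite gt_eqF.
rewrite mulrAC ler_wpM2l ?mulr_ge0 ?ltW // /c.
nra.
Qed.

End DerivativeTests.

(** * The bound with saving [N ^ (-1/15)] on a dyadic block *)

Section BlockBound.
Variable R : realType.
Implicit Types (t : R) (hs : seq nat) (a b h N : nat).

Lemma le_of_sqr_le (x y : R) : 0 <= y -> x ^+ 2 <= y ^+ 2 -> x <= y.
Proof.
move=> y0 h; rewrite leNgt; apply/negP => yx.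
by move: h; rewrite leNgt => /negP; apply; rewrite ltrXn2r // nnegrE ?ltW // (le_lt_trans y0).
Qed.

Lemma absorb_const (K : R) : 0 <= K -> K <= 1000 * 1000 -> 0 <= K <= 1000 * 1000.
Proof. by move=> *; apply/andP. Qed.

Lemma absorb_const1 : 0 <= (100 * 100 : R) <= 1000 * 1000.
Proof. by apply: absorb_const; lra. Qed.

Lemma absorb_const2 : 0 <= (30 * 1000 : R) <= 1000 * 1000.
Proof. by apply: absorb_const; lra. Qed.

Lemma absorb_const3 : 0 <= (8 : R) <= 1000 * 1000.
Proof. by apply: absorb_const; lra. Qed.

(** [diff_sum_base] with every quantity written as a power of [e]. The conditions
    [al + l / 1000 <= l] and the next give [4 X <= N], the two with [pi] give the bound on the
    product of the shifts; each contains the slack for [expR_absorb]. *)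
Lemma diff_sum_base_exp t hs a b N (al pi : R) :
  let l := ln N%:R in let q := (size hs).+2%:R * l - ln t in
  100 * 1000 <= l -> 0 < t -> (size hs <= 2)%N -> 0 <= al ->
  (0 < N <= a)%N -> (b <= N.*2.+1)%N -> (b - a <= N)%N ->
  ((sumn hs).*2 <= N)%N -> (0 < \prod_(h <- hs) h)%N ->
  (\prod_(h <- hs) h)%:R <= expR pi ->
  al + l / 1000 <= l -> al + q - l + l / 1000 <= l ->
  pi + al + l / 1000 <= q -> pi + al + l / 1000 <= l ->
  diff_sum t hs a b <= expR (l - al / 2).
Proof.
move=> l q l1 t0 sz al0 Na b2 ba sm P0 Pp c1 c2 c3 c4.
have N0 : (0 < N)%N by case/andP: Na.
have NE : N%:R = expR l by rewrite lnK // posrE ltr0n.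
have QE : N%:R ^+ (size hs).+2 / t = expR q.
  by rewrite /q expRD expRN lnK ?posrE // expRM_natl -NE.
have N4 : (4 <= N)%N.
  rewrite -(ler_nat R) NE; apply: le_trans (expR_ge1Dx l); move: l1; clear; lra.
apply: le_of_sqr_le; first exact: expR_ge0.
have al1 : 1 <= expR al by rewrite -expR0 ler_expR.
have l0 : 0 <= 1 + l by move: l1; clear; lra.
have := @diff_sum_base R t hs a b N (expR al) sz t0 al1 Na b2 ba.
cbv zeta; rewrite -/l QE => base.
clearbody q l.
have XE : 1024 * expR al * (1 + l) * (1 + expR q / N%:R) =
   1024 * (1 + l) * expR al + 1024 * (1 + l) * expR (al + q - l).
  by rewrite NE -expRN !expRD; ring.
rewrite XE in base.
have h1 := expR_absorb l1 absorb_const1 c1.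
have h2 := expR_absorb l1 absorb_const1 c2.
have h3 := expR_absorb l1 absorb_const2 c3.
have c4' : pi + (al + q - l) + l / 1000 <= q by move: c4; clear; lra.
have h4 := expR_absorb l1 absorb_const2 c4'.
apply: le_trans (base _ P0 _ _) _.
- by move: sm N4; clear; lia.
- rewrite NE; move: (expR_ge0 l) h1 h2; clear; lra.
- have q0 := expR_ge0 q; have n0 : 0 <= 1024 :> R by exact: ler0n.
  set X := _ + _; have X0 : 0 <= X.
    by apply: addr_ge0; apply: mulr_ge0 (expR_ge0 _); apply: mulr_ge0.
  apply: le_trans (_ : 12 * (expR pi * X) <= _).
    by rewrite ler_pM2l ?ltr0n // ler_wpM2r.
  have XE' : expR pi * X = 1024 * ((1 + l) * expR (pi + al)) + 1024 * ((1 + l) * expR (pi + (al + q - l))).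
    by rewrite /X !(expRD pi); move: (1024 : R); clear; move=> ?; ring.
  rewrite XE' -!(mulrA _ (1 + l)) in h3 h4 *; move: q0 h3 h4.
  by move: ((1 + l) * _) ((1 + l) * _); clear; move=> u v; lra.
rewrite NE -!expRM_natl -expRN -expRD ler_expR.
by clear; lra.
Qed.

(** One differencing with shifts up to [expR be]: a saving [be] in the shifted sums balances the
    diagonal term and becomes [be / 2] under the square root. The constants follow the recursion
    [2 + 4 * C <= D ^+ 2]. *)
Lemma diff_sum_step t hs a b N (be C D : R) : let l := ln N%:R in
  100 * 1000 <= l -> (0 < N)%N -> (b - a <= N)%N -> 0 <= be -> be + l / 1000 <= l ->
  0 <= C -> 0 <= D -> 2 + 4 * C <= D ^+ 2 ->
  (forall h, (0 < h)%N -> h%:R <= expR be -> diff_sum t (h :: hs) a (b - h) <= C * expR (l - be)) ->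
  diff_sum t hs a b <= D * expR (l - be / 2).
Proof.
move=> l l1 N0 ba be0 be1 C0 D0 CD H.
have NE : N%:R = expR l by rewrite lnK // posrE ltr0n.
apply: le_of_sqr_le; first by rewrite mulr_ge0 // expR_ge0.
pose K := (Num.trunc (expR be)).+1.
have /andP[k1 k2] := truncn_itv (expR_ge0 be).
have be_1 : 1 <= expR be by rewrite -expR0 ler_expR.
have K2 : expR be <= K%:R by exact: ltW.
have Ks : K%:R <= 2 * expR be by rewrite /K -natr1; move: k1 be_1; clear; lra.
have K0 : 0 < K%:R :> R by rewrite ltr0n.
have KN : (0 < K <= N)%N.
  rewrite /= -(ler_nat R) NE; apply: le_trans Ks _.
  have := expR_absorb l1 absorb_const3 be1; apply: le_trans.
  apply: ler_wpM2r; first exact: expR_ge0.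
  by move: l1; clear; lra.
have B0 : 0 <= C * expR (l - be) by rewrite mulr_ge0 // expR_ge0.
have bd h : (0 < h < K)%N -> diff_sum t (h :: hs) a (b - h) <= C * expR (l - be).
  by case/andP=> h0 hK; apply: H => //; apply: le_trans k1; rewrite ler_nat.
apply: le_trans (diff_sum_vdc_max ba KN B0 bd) _.
rewrite exprMn -expRM_natl NE.
have -> : 2 * (l - be / 2) = (l + l) - be by lra.
have e1 : expR l ^+ 2 / K%:R <= expR (l + l - be).
  rewrite expRD expRN expr2 -expRD ler_pM2l ?expR_gt0 // lef_pV2 ?posrE ?expR_gt0 //.
have e2 : expR l * expR (l - be) = expR (l + l - be) by rewrite -expRD addrA.
have -> : 2 * expR l ^+ 2 / K%:R + 4 * expR l * (C * expR (l - be)) =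
   2 * (expR l ^+ 2 / K%:R) + 4 * C * expR (l + l - be) by rewrite -e2; ring.
apply: le_trans (_ : (2 + 4 * C) * expR (l + l - be) <= _); last first.
  by rewrite ler_wpM2r ?expR_ge0.
by rewrite [leRHS]mulrDl lerD2r ler_pM2l ?ltr0n.
Qed.

(* k = 2, 3, 4: the order of the derivative test applied, chosen by the size of t. *)
Theorem dyadic_block_bound t a b N : let l := ln N%:R in
  100 * 1000 <= l -> (0 < N <= a)%N -> (b <= N.*2.+1)%N -> (b - a <= N)%N ->
  0 < t -> l / 2 <= ln t <= 3 * l ->
  diff_sum t [::] a b <= 4 * expR (l - l / 15).
Proof.
move=> l l1 Na b2 ba t0 /andP[tl tu].
have N0 : (0 < N)%N by case/andP: Na.
have NE : N%:R = expR l by rewrite lnK // posrE ltr0n.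
(* Every application halves the saving, so the final [l / 15] takes exponents [2/15], [4/15], [8/15]
   from the outermost to the innermost. The three orders then reach [ln t] up to about [1.86 l],
   [2.6 l] and [3.06 l]; the last exceeds [3 l] because [6/15 + 8/15 < 1], which limits the
   saving. *)
have [t1|t1] := lerP (ln t) (18 / 10 * l).
  have al0 : 0 <= 2 / 15 * l by move: l1; clear; lra.
  have := @diff_sum_base_exp t [::] a b N (2 / 15 * l) 0 l1 t0 isT al0 Na b2 ba.
  rewrite /= big_nil expR0 -/l.
  have c1 : 2 / 15 * l + l / 1000 <= l by move: l1; clear; lra.
  have c2 : 2 / 15 * l + (2 * l - ln t) - l + l / 1000 <= l by move: l1 tl; clear; lra.
  have c3 : 0 + 2 / 15 * l + l / 1000 <= 2 * l - ln t by move: l1 t1; clear; lra.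
  have c4 : 0 + 2 / 15 * l + l / 1000 <= l by move: l1; clear; lra.
  move=> /(_ isT isT (lexx _) c1 c2 c3 c4) /le_trans; apply.
  have -> : 2 / 15 * l / 2 = l / 15 by field.
  by rewrite -[leLHS]mul1r ler_wpM2r ?expR_ge0 // ler1n.
have hsum h (be : R) : be + l / 1000 <= l -> h%:R <= expR be -> (h <= N %/ 8)%N.
  move=> be1 hb; rewrite leq_divRL // -(ler_nat R) natrM NE.
  have := expR_absorb l1 absorb_const3 be1; apply: le_trans.
  apply: le_trans (_ : 8 * expR be <= _); first by rewrite mulrC ler_pM2l.
  have : 8 * 1 <= 8 * (1 + l) :> R by move: l1; clear; lra.
  by rewrite mulr1; apply: ler_wpM2r; exact: expR_ge0.
have [t2|t2] := lerP (ln t) (258 / 100 * l).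
  have := @diff_sum_step t [::] a b N (2 / 15 * l) 1 4 l1 N0 ba.
  rewrite -/l.
  have c1 : 0 <= 2 / 15 * l by move: l1; clear; lra.
  have c2 : 2 / 15 * l + l / 1000 <= l by move: l1; clear; lra.
  have c3 : 2 + 4 * 1 <= 4 ^+ 2 :> R by rewrite !exprS expr0; lra.
  have -> : 2 / 15 * l / 2 = l / 15 by field.
  move=> /(_ c1 c2 ler01 (ler0n _ _) c3); apply => h h0 hb.
  have h8 := hsum h _ c2 hb.
  have al0 : 0 <= 4 / 15 * l by move: l1; clear; lra.
  have b2' : (b - h <= N.*2.+1)%N by move: b2; clear; lia.
  have ba' : (b - h - a <= N)%N by move: ba; clear; lia.
  have := @diff_sum_base_exp t [:: h] a (b - h) N (4 / 15 * l) (2 / 15 * l) l1 t0 isT al0 Na b2' ba'.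
  rewrite /= big_cons big_nil muln1 addn0 -/l.
  have s1 : (h.*2 <= N)%N by move: h8; clear; lia.
  have d1 : 4 / 15 * l + l / 1000 <= l by move: l1; clear; lra.
  have d2 : 4 / 15 * l + (3 * l - ln t) - l + l / 1000 <= l by move: l1 t1; clear; lra.
  have d3 : 2 / 15 * l + 4 / 15 * l + l / 1000 <= 3 * l - ln t by move: l1 t2; clear; lra.
  have d4 : 2 / 15 * l + 4 / 15 * l + l / 1000 <= l by move: l1; clear; lra.
  move=> /(_ s1 h0 hb d1 d2 d3 d4).
  by rewrite (_ : 4 / 15 * l / 2 = 2 / 15 * l) ?mul1r //; field.
(* The constants 1, 5/2, 4 solve the recursion twice: [2 + 4 <= (5/2)^2] and [2 + 10 <= 4^2]. *)
have := @diff_sum_step t [::] a b N (2 / 15 * l) (5 / 2) 4 l1 N0 ba.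
rewrite -/l.
have c1 : 0 <= 2 / 15 * l by move: l1; clear; lra.
have c2 : 2 / 15 * l + l / 1000 <= l by move: l1; clear; lra.
have c3 : 2 + 4 * (5 / 2) <= 4 ^+ 2 :> R by rewrite !exprS expr0; lra.
have c5 : 0 <= 5 / 2 :> R by lra.
have -> : 2 / 15 * l / 2 = l / 15 by field.
move=> /(_ c1 c2 c5 (ler0n _ _) c3); apply => h h0 hb.
have h8 := hsum h _ c2 hb.
have b2' : (b - h <= N.*2.+1)%N by move: b2; clear; lia.
have ba' : (b - h - a <= N)%N by move: ba; clear; lia.
have := @diff_sum_step t [:: h] a (b - h) N (4 / 15 * l) 1 (5 / 2) l1 N0 ba'.
rewrite -/l.
have e1 : 0 <= 4 / 15 * l by move: l1; clear; lra.
have e2 : 4 / 15 * l + l / 1000 <= l by move: l1; clear; lra.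
have e3 : 2 + 4 * 1 <= (5 / 2) ^+ 2 :> R by rewrite !exprS expr0; clear; lra.
have -> : 4 / 15 * l / 2 = 2 / 15 * l by field.
move=> /(_ e1 e2 ler01 c5 e3); apply => h' h'0 h'b.
have h8' := hsum h' _ e2 h'b.
have al0 : 0 <= 8 / 15 * l by move: l1; clear; lra.
have b3' : (b - h - h' <= N.*2.+1)%N by move: b2; clear; lia.
have ba3 : (b - h - h' - a <= N)%N by move: ba; clear; lia.
have := @diff_sum_base_exp t [:: h'; h] a (b - h - h') N (8 / 15 * l) (6 / 15 * l) l1 t0 isT al0 Na b3' ba3.
rewrite /= !big_cons big_nil muln1 addn0 -/l.
have s1 : ((h' + h).*2 <= N)%N by move: h8 h8'; clear; lia.
have s2 : (0 < h' * h)%N by rewrite muln_gt0 h0 h'0.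
have s3 : (h' * h)%:R <= expR (6 / 15 * l).
  have -> : 6 / 15 * l = 4 / 15 * l + 2 / 15 * l by clear; lra.
  by rewrite natrM expRD; apply: ler_pM.
have d1 : 8 / 15 * l + l / 1000 <= l by move: l1; clear; lra.
have d2 : 8 / 15 * l + (4 * l - ln t) - l + l / 1000 <= l by move: l1 t2; clear; lra.
have d3 : 6 / 15 * l + 8 / 15 * l + l / 1000 <= 4 * l - ln t by move: l1 tu; clear; lra.
have d4 : 6 / 15 * l + 8 / 15 * l + l / 1000 <= l by move: l1; clear; lra.
move=> /(_ s1 s2 s3 d1 d2 d3 d4).
by rewrite (_ : 8 / 15 * l / 2 = 4 / 15 * l) ?mul1r //; field.
Qed.

End BlockBound.

(** * Dirichlet polynomials and zeta *)

Section ComplexPowers.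
Variable R : realType.
Local Notation C := R[i].
Implicit Types (s w : C) (a b u v t : R).

(** [u ^ (- s)], with the sign of Dirichlet series; hence [rpow (- x) u] below is the positive power
    [u ^ x]. *)
Definition cpow s u : C := cE (- (s * (ln u)%:C%C)).
Definition rpow (x u : R) : R := expR (- (x * ln u)).

Lemma cpow_polar s u : cpow s u = (rpow (complex.Re s) u)%:C%C * cis (- (complex.Im s * ln u)).
Proof. by rewrite /cpow /cE ReN ImN ReM ImM /= !mulr0 subr0 add0r. Qed.

Lemma cabs_cpow s u : normc (cpow s u) = rpow (complex.Re s) u.
Proof. by rewrite cpow_polar Normc.normcM cabs_cis mulr1 cabs_real ger0_norm ?expR_ge0. Qed.

Lemma cpowD s w u : cpow (s + w) u = cpow s u * cpow w u.
Proof. by rewrite /cpow mulrDl opprD cED. Qed.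

Lemma cpow0 u : cpow 0 u = 1.
Proof. by rewrite /cpow mul0r oppr0 cE0. Qed.

Lemma cpow_one s : cpow s 1 = 1.
Proof. by rewrite /cpow ln1 mulr0 oppr0 cE0. Qed.

Lemma cpow_real (x u : R) : cpow x%:C%C u = (rpow x u)%:C%C.
Proof. by rewrite cpow_polar /= mul0r oppr0 cis0 mulr1. Qed.

Lemma rpow1 u : 0 < u -> rpow 1 u = u^-1.
Proof. by move=> u0; rewrite /rpow mul1r expRN lnK. Qed.

Lemma cpow1 u : 0 < u -> cpow 1 u = (u^-1)%:C%C.
Proof. by move=> u0; rewrite (cpow_real 1) rpow1. Qed.

Lemma rpow_gt0 x u : 0 < rpow x u. Proof. exact: expR_gt0. Qed.
Lemma rpow_ge0 x u : 0 <= rpow x u. Proof. exact: expR_ge0. Qed.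

Lemma rpowM x u v : 0 < u -> 0 < v -> rpow x (u * v) = rpow x u * rpow x v.
Proof. by move=> u0 v0; rewrite /rpow lnM // mulrDr opprD expRD. Qed.

Lemma rpowD x y u : rpow (x + y) u = rpow x u * rpow y u.
Proof. by rewrite /rpow mulrDl opprD expRD. Qed.

Lemma rpow_anti x u v : 0 <= x -> 0 < u -> u <= v -> rpow x v <= rpow x u.
Proof.
move=> x0 u0 uv; rewrite /rpow ler_expR lerN2 ler_wpM2l // ler_ln // posrE //.
exact: lt_le_trans uv.
Qed.

Lemma cpowM s u v : 0 < u -> 0 < v -> cpow s (u * v) = cpow s u * cpow s v.
Proof. by move=> u0 v0; rewrite /cpow lnM // rmorphD mulrDr opprD cED. Qed.

Lemma cpowS s u : 0 < u -> cpow s u * (u^-1)%:C%C = cpow (s + 1) u.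
Proof. by move=> u0; rewrite cpowD cpow1. Qed.

Lemma isint_scale (k : C) (q : R -> C) a b I : isint q a b I ->
  isint (fun x => k * q x) a b (k * I).
Proof.
case=> U [V [dU dV ->]].
pose kr := complex.Re k; pose ki := complex.Im k.
exists (fun x => kr * U x - ki * V x), (fun x => kr * V x + ki * U x); split.
- move=> x xab; have := dU x xab; have := dV x xab => d1 d2.
  by rewrite ReM; apply: is_deriveB; apply: is_deriveMl.
- move=> x xab; have := dU x xab; have := dV x xab => d1 d2.
  by rewrite ImM; apply: is_deriveD; apply: is_deriveMl.
by apply: complex_ext; rewrite ?ReM ?ImM /= -/kr -/ki; ring.
Qed.

Lemma isint_cpow s a b : 0 < a -> isint (fun u => - s * cpow (s + 1) u) a b (cpow s b - cpow s a).
Proof.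
move=> a0; exists (fun u => complex.Re (cpow s u)), (fun u => complex.Im (cpow s u)).
set x := complex.Re s; set t := complex.Im s.
have d1 u : 0 < u -> is_derive u 1 (fun u => rpow x u) (- (x * u^-1) * rpow x u).
  move=> u0; have dl := is_derive1_ln u0.
  have dm : is_derive u 1 (fun u => - (x * ln u)) (- (x * u^-1)).
    by apply: is_deriveN; apply: is_deriveMl.
  have := @is_derive1_comp R expR (fun u => - (x * ln u)) u _ _ (is_derive_expR _) dm.
  by rewrite mulrC.
have dm u : 0 < u -> is_derive u 1 (fun u => - (t * ln u)) (- (t * u^-1)).
  move=> u0; have dl := is_derive1_ln u0.
  by apply: is_deriveN; apply: is_deriveMl.
have dc u : 0 < u -> is_derive u 1 (fun u => cos (- (t * ln u))) (- sin (- (t * ln u)) * - (t * u^-1)).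
  by move=> u0; have hm := dm u u0; exact: (@is_derive1_comp R cos (fun u => - (t * ln u)) u _ _ (is_derive_cos _) hm).
have ds u : 0 < u -> is_derive u 1 (fun u => sin (- (t * ln u))) (cos (- (t * ln u)) * - (t * u^-1)).
  by move=> u0; have hm := dm u u0; exact: (@is_derive1_comp R sin (fun u => - (t * ln u)) u _ _ (is_derive_sin _) hm).
have E u : cpow s u = (rpow x u * cos (- (t * ln u)) +i* (rpow x u * sin (- (t * ln u))))%C.
  by rewrite cpow_polar /cis; apply: complex_ext; rewrite ?ReM ?ImM /= ?mul0r ?subr0 ?addr0.
split.
- move=> u /andP[au _]; have u0 : 0 < u by exact: lt_le_trans au.
  rewrite -cpowS // (_ : (fun u => complex.Re (cpow s u)) = fun u => rpow x u * cos (- (t * ln u))); last first.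
    by apply/funext => v; rewrite E.
  have hM := is_deriveM (d1 u u0) (dc u u0).
  apply: is_derive_eq hM _.
  rewrite E !ReM !ImM !ReN !ImN /= -/x -/t /GRing.scale /=; ring.
- move=> u /andP[au _]; have u0 : 0 < u by exact: lt_le_trans au.
  rewrite -cpowS // (_ : (fun u => complex.Im (cpow s u)) = fun u => rpow x u * sin (- (t * ln u))); last first.
    by apply/funext => v; rewrite E.
  have hM := is_deriveM (d1 u u0) (ds u u0).
  apply: is_derive_eq hM _.
  rewrite E !ImM !ReM !ReN !ImN /= -/x -/t /GRing.scale /=; ring.
by apply: complex_ext; rewrite ?ReD ?ImD ?ReN ?ImN.
Qed.

Lemma isint_cpow1 s a b : 0 < a -> s != 1 ->
  isint (cpow s) a b ((cpow (s - 1) a - cpow (s - 1) b) / (s - 1)).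
Proof.
move=> a0 s1; have s10 : s - 1 != 0 by rewrite subr_eq0.
have := isint_scale (- (s - 1)^-1) (isint_cpow (s - 1) b a0).
have -> : (fun u => - (s - 1)^-1 * (- (s - 1) * cpow (s - 1 + 1) u)) = cpow s.
  by apply/funext => u; rewrite subrK mulrA mulrNN mulVf // mul1r.
have -> // : - (s - 1)^-1 * (cpow (s - 1) b - cpow (s - 1) a) =
   (cpow (s - 1) a - cpow (s - 1) b) / (s - 1).
by rewrite mulNr -mulrN opprB mulrC.
Qed.

Lemma cpow_diff_le s a b : 0 < a -> a <= b -> 0 <= complex.Re s + 1 ->
  normc (cpow s b - cpow s a) <= normc s * rpow (complex.Re s + 1) a * (b - a).
Proof.
move=> a0 ab s1; apply: isint_bound ab (isint_cpow s b a0) _ => u /andP[au _].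
rewrite Normc.normcM cabsN cabs_cpow ReD ler_wpM2l //.
exact: rpow_anti.
Qed.

Lemma cpow_int_le s a b : 0 < a -> a <= b -> 0 <= complex.Re s -> s != 1 ->
  normc ((cpow (s - 1) a - cpow (s - 1) b) / (s - 1)) <= rpow (complex.Re s) a * (b - a).
Proof.
move=> a0 ab s0 s1; apply: isint_bound ab (isint_cpow1 b a0 s1) _ => u /andP[au _].
by rewrite cabs_cpow rpow_anti.
Qed.

(** On a unit interval [u ^ (- s)] moves away from its left value by at most its derivative bound
    there. *)
Lemma euler_maclaurin_step s a : 0 < a -> 0 <= complex.Re s -> s != 1 ->
  normc (cpow s a - (cpow (s - 1) a - cpow (s - 1) (a + 1)) / (s - 1)) <=
  normc s * rpow (complex.Re s + 1) a.
Proof.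
move=> a0 s0 s1; rewrite cabsBC.
have a1 : a <= a + 1 by rewrite lerDl.
have h1 := isint_cpow1 (a + 1) a0 s1.
have h2 := isint_affine (- cpow s a) 0 a (a + 1).
have h := isintD h1 h2.
have e : a + 1 - a = 1 by ring.
rewrite mul0r addr0 e mulr1 in h.
rewrite -[leRHS]mulr1 -{3}e; apply: isint_bound a1 h _ => u /andP[au ua].
rewrite mul0r addr0; apply: le_trans (cpow_diff_le a0 au _) _; first by rewrite addr_ge0.
rewrite -[leRHS]mulr1 ler_wpM2l ?mulr_ge0 ?rpow_ge0 // -e lerB //.
Qed.

End ComplexPowers.

(** * Dirichlet sums compared with integrals *)

Section DirichletTails.
Variable R : realType.
Local Notation C := R[i].
Implicit Types (s w : C) (x y u v t : R) (a b A B N n m : nat).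

Definition dsum s a b : C := \sum_(a <= m < b) cpow s m%:R.

(* sum minus integral of [u ^ (- s)] over [a, b) *)
Definition em_err s a b : C :=
  dsum s a b - (cpow (s - 1) a%:R - cpow (s - 1) b%:R) / (s - 1).

Lemma em_err_cat s a b c : (a <= b <= c)%N -> em_err s a c = em_err s a b + em_err s b c.
Proof.
by case/andP=> ab bc; rewrite /em_err /dsum (big_cat_nat ab bc) /=; ring.
Qed.

Lemma em_err_self s a : em_err s a a = 0.
Proof. by rewrite /em_err /dsum big_geq // subrr mul0r subr0. Qed.

(** The mean value point is at most [2 m]; the factor 16 is [1 / x <= 2] times
    [2 ^ (x + 1) <= 8]. *)
Lemma rpow_step x (m : R) : 1 <= m -> 1 / 2 <= x -> x <= 2 ->
  rpow (x + 1) m <= 16 * (rpow x m - rpow x (m + 1)).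
Proof.
move=> m1 x1 x2; have m0 : 0 < m by apply: lt_le_trans m1.
have m10 : 0 < m + 1 by rewrite addr_gt0.
have mm : m <= m + 1 by rewrite lerDl.
have x0 : 0 <= x by move: x1; clear; lra.
have hd u : m <= u <= m + 1 -> is_derive u 1 (rpow x) (- x * rpow (x + 1) u).
  move=> /andP[mu _]; have u0 : 0 < u by exact: lt_le_trans mu.
  have dl := is_derive1_ln u0.
  have dm : is_derive u 1 (fun u => - (x * ln u)) (- (x * u^-1)).
    by apply: is_deriveN; apply: is_deriveMl.
  have := @is_derive1_comp R expR (fun u => - (x * ln u)) u _ _ (is_derive_expR _) dm.
  by move=> h; apply: is_derive_eq h _; rewrite rpowD rpow1 // /rpow; ring.
have [xi /andP[h1 h2]] := mvt_segment mm hd.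
rewrite addrAC subrr add0r mulr1 => e.
have -> : rpow x m - rpow x (m + 1) = x * rpow (x + 1) xi.
  by rewrite -[LHS]opprB e mulNr opprK.
have xi0 : 0 < xi by exact: lt_le_trans h1.
have xi2 : xi <= 2 * m by apply: le_trans h2 _; move: m1; clear; lra.
have x10 : 0 <= x + 1 by rewrite addr_ge0.
have := rpow_anti x10 xi0 xi2; rewrite rpowM // => k1.
have k2 : 1 / 8 <= rpow (x + 1) 2.
  have -> : 1 / 8 = rpow 3 2 :> R.
    rewrite /rpow expRN -[3 * _]mulrC expRM_natr lnK ?posrE // mul1r.
    by congr (_^-1); rewrite !exprS expr0; ring.
  rewrite ler_expR lerN2 ler_wpM2r //; first by rewrite ln_ge0 // ler1n.
  by move: x2; clear; lra.
have P0 := rpow_ge0 (x + 1) m.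
have := ler_wpM2r P0 k2 => k3.
have k4 := le_trans k3 k1.
have := ler_wpM2r (rpow_ge0 (x + 1) xi) x1; move: k4; clear; lra.
Qed.

Lemma rpow_sum_le x a b : (0 < a)%N -> (a <= b)%N -> 1 / 2 <= x -> x <= 2 ->
  \sum_(a <= m < b) rpow (x + 1) m%:R <= 16 * (rpow x a%:R - rpow x b%:R).
Proof.
move=> a0 ab x1 x2.
elim: b ab => [|b ih]; first by rewrite leqn0 => /eqP e; rewrite e in a0.
rewrite leq_eqVlt => /predU1P[<-|]; first by rewrite big_geq // subrr mulr0.
rewrite ltnS => ab; rewrite big_nat_recr //=.
have b1 : 1 <= b%:R :> R by rewrite ler1n (leq_trans a0).
have := ih ab; have := rpow_step b1 x1 x2; rewrite -[b.+1%:R]natr1.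
clear; lra.
Qed.

Lemma em_err_le s a b : (0 < a)%N -> (a <= b)%N -> 1 / 2 <= complex.Re s ->
  complex.Re s <= 2 -> s != 1 ->
  normc (em_err s a b) <= 16 * (normc s * rpow (complex.Re s) a%:R).
Proof.
move=> a0 ab x1 x2 s1.
have x0 : 0 <= complex.Re s by move: x1; clear; lra.
apply: (@le_trans _ _ (normc s * \sum_(a <= m < b) rpow (complex.Re s + 1) m%:R)); last first.
  rewrite mulrCA ler_wpM2l //; apply: le_trans (rpow_sum_le a0 ab x1 x2) _.
  by rewrite ler_pM2l ?ltr0n // gerBl rpow_ge0.
elim: b ab => [|b ih]; first by rewrite leqn0 => /eqP e; rewrite e in a0.
rewrite leq_eqVlt => /predU1P[<-|]; first by rewrite em_err_self big_geq // mulr0 /= expr0n /= addr0 sqrtr0.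
rewrite ltnS => ab; rewrite big_nat_recr //= mulrDr.
rewrite (@em_err_cat s a b b.+1) ?ab ?leqnSn //.
apply: le_trans (cabsD _ _) _; apply: lerD; first exact: ih.
have b1 : 0 < b%:R :> R by rewrite ltr0n (leq_trans a0).
have := euler_maclaurin_step b1 x0 s1.
by rewrite /em_err /dsum big_nat1 -[b.+1%:R]natr1.
Qed.

Lemma abel_bound (w : nat -> R) (c : nat -> C) a b (M : R) : (a <= b)%N ->
  (forall n, (a <= n < b)%N -> w n.+1 <= w n) -> (forall n, (a <= n <= b)%N -> 0 <= w n) ->
  (forall k, (a <= k <= b)%N -> normc (\sum_(a <= n < k) c n) <= M) ->
  normc (\sum_(a <= n < b) (w n)%:C%C * c n) <= w a * M.
Proof.
move=> ab anti w0 hM.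
have M0 : 0 <= M by apply: le_trans (hM a _); rewrite ?cabs_ge0 // leqnn ab.
suff key : normc (\sum_(a <= n < b) (w n)%:C%C * c n - (w b)%:C%C * \sum_(a <= n < b) c n) <= (w a - w b) * M.
  have hb : normc ((w b)%:C%C * \sum_(a <= n < b) c n) <= w b * M.
    by rewrite Normc.normcM cabs_real ger0_norm ?w0 ?ab ?leqnn // ler_wpM2l ?hM ?w0 ?ab ?leqnn.
  have := cabsD (\sum_(a <= n < b) (w n)%:C%C * c n - (w b)%:C%C * \sum_(a <= n < b) c n) ((w b)%:C%C * \sum_(a <= n < b) c n).
  rewrite subrK => h; apply: le_trans h _; apply: le_trans (lerD key hb) _.
  by rewrite -mulrDl subrK.
elim: b ab anti w0 hM => [|b ih] ab anti w0 hM.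
  move: ab; rewrite leqn0 => /eqP ->; rewrite !big_geq // mulr0 subrr subrr mul0r.
  by rewrite /= expr0n /= addr0 sqrtr0.
move: ab; rewrite leq_eqVlt => /predU1P[->|].
  by rewrite !big_geq // mulr0 subrr subrr mul0r /= expr0n /= addr0 sqrtr0.
rewrite ltnS => ab; rewrite !big_nat_recr //=.
set S := \sum_(a <= n < b) c n; set W := \sum_(a <= n < b) _.
have -> : W + (w b)%:C%C * c b - (w b.+1)%:C%C * (S + c b) =
   (W - (w b)%:C%C * S) + (w b - w b.+1)%:C%C * (S + c b) by rewrite rmorphB /=; ring.
apply: le_trans (cabsD _ _) _.
have -> : (w a - w b.+1) * M = (w a - w b) * M + (w b - w b.+1) * M by ring.
apply: lerD.
  apply: ih => // n /andP[n1 n2]; [apply: anti|apply: w0|apply: hM]; rewrite n1 /=.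
  - exact: ltnW.
  - exact: leqW.
  - exact: leqW.
have d0 : 0 <= w b - w b.+1 by rewrite subr_ge0 anti // ab /=.
rewrite Normc.normcM cabs_real ger0_norm // ler_wpM2l //.
have := hM b.+1; rewrite big_nat_recr //=; apply.
by rewrite leqnn andbT (leq_trans ab).
Qed.

End DirichletTails.

(** * The difference of sum and integral with the van der Corput saving *)

Section DyadicTails.
Variable R : realType.
Local Notation C := R[i].
Implicit Types (s w : C) (x y u v t : R) (a b A B N n m : nat).

Lemma ln2_bounds : 1 / 2 <= (ln 2 : R) <= 1.
Proof.
have h : expR (1 / 2) <= 2 :> R.
  have := @expR_taylor1 R (1 / 2); rewrite ger0_norm; last by lra.
  by move=> /(_ (lexx _)) /ler_normlP [_]; lra.
apply/andP; split.
  by rewrite -[leLHS]expRK ler_ln ?posrE ?expR_gt0.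
rewrite -[leRHS]expRK ler_ln ?posrE ?expR_gt0 //.
have := expR_ge1Dx (1 : R); lra.
Qed.

Lemma absorb_const32 : 0 <= (64 : R) <= 1000 * 1000.
Proof. by apply: absorb_const; lra. Qed.

(** For [t] below [N ^ (1/2)] the elementary comparison with the integral suffices. Above it the sum
    and the integral are small separately: the sum by [dyadic_block_bound] and partial summation,
    the integral through its denominator [s - 1]. *)
Lemma em_err_block s N b : let l := ln (N%:R : R) in
  100 * 1000 <= l -> (N <= b <= N.*2)%N ->
  985 / 1000 <= complex.Re s -> complex.Re s <= 11 / 10 ->
  0 < complex.Im s -> complex.Im s <= N%:R ^+ 3 ->
  normc (em_err s N b) <= 8 * rpow (complex.Re s - 14 / 15) N%:R.
Proof.
move=> l l1 /andP[Nb b2] x1 x2 t0 t3.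
set x := complex.Re s in x1 x2 *; set t := complex.Im s in t0 t3.
have N0 : (0 < N)%N.
  rewrite lt0n; apply/eqP => N0; move: l1; rewrite /l N0 ln0 //; lra.
have NR : 0 < N%:R :> R by rewrite ltr0n.
have NE : N%:R = expR l by rewrite lnK // posrE.
have s1 : s != 1.
  by apply/eqP => e; move: t0; rewrite /t e /= ltxx.
have tE : t = expR (ln t) by rewrite lnK // posrE.
have lt3 : ln t <= 3 * l.
  rewrite -ler_expR -tE; apply: le_trans t3 _.
  by rewrite NE -expRM_natl.
have [tl|tl] := ltrP (ln t) (l / 2).
  have x12 : 1 / 2 <= x by move: x1; clear; lra.
  have x22 : x <= 2 by move: x2; clear; lra.
  apply: le_trans (em_err_le N0 Nb x12 x22 s1) _.
  rewrite -/x.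
  have sn : normc s <= 4 * expR (l / 2).
    apply: le_trans (cabs_ReIm _) _; rewrite -/x -/t !ger0_norm ?ltW //; last by move: x1; clear; lra.
    have h1 : t <= expR (l / 2) by rewrite tE ler_expR ltW.
    have h2 : 1 <= expR (l / 2) by rewrite -[leLHS]expR0 ler_expR; move: l1; clear; lra.
    move: h1 h2 x2; clear; lra.
  have c : - (x * l) + l / 2 + l / 1000 <= - ((x - 14 / 15) * l) by clearbody l; move: l1; clear; lra.
  have h := expR_absorb l1 absorb_const32 c.
  have h0 := rpow_ge0 (x - 14 / 15) N%:R.
  apply: le_trans (_ : 64 * (1 + l) * expR (- (x * l) + l / 2) <= _); last first.
    by apply: le_trans h _; rewrite -[leLHS]mul1r ler_wpM2r ?expR_ge0 // ler1n.
  apply: le_trans (_ : 16 * (4 * expR (l / 2) * rpow x N%:R) <= _).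
    by rewrite ler_pM2l ?ltr0n // ler_wpM2r ?rpow_ge0.
  rewrite expRD /rpow -/l.
  have e0 := mulr_ge0 (expR_ge0 (- (x * l))) (expR_ge0 (l / 2)).
  have l0 : 0 <= l by move: l1; clear; lra.
  have e1 := mulr_ge0 l0 e0.
  move: e0 e1; move: (expR (- (x * l))) (expR (l / 2)); clear; move=> u v e0 e1; lra.
have tb : l / 2 <= ln t <= 3 * l by rewrite tl lt3.
have sumb k : (N <= k <= b)%N -> normc (\sum_(N <= n < k) cis (- (t * ln n%:R)) : C) <= 4 * expR (l - l / 15).
  case/andP=> Nk kb.
  have := @dyadic_block_bound R t N k N l1; rewrite N0 leqnn => /(_ isT) H.
  have k1 : (k <= N.*2.+1)%N by apply: leq_trans kb _; apply: leqW.
  have k2 : (k - N <= N)%N by move: kb b2; clear; lia.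
  have := H k1 k2 t0 tb; rewrite /diff_sum /=.
  by under eq_bigr => n _ do rewrite mulNr.
have S1 : normc (dsum s N b) <= 4 * rpow (x - 14 / 15) N%:R.
  rewrite /dsum; under eq_bigr => n _ do rewrite cpow_polar.
  apply: le_trans (@abel_bound R (fun n => rpow x n%:R) (fun n => cis (- (t * ln n%:R))) N b _ Nb _ _ sumb) _.
  - move=> n /andP[n1 _]; apply: rpow_anti; [by move: x1; clear; lra| by rewrite ltr0n (leq_trans N0)|].
    by rewrite ler_nat.
  - by move=> n _; exact: rpow_ge0.
  rewrite mulrCA ler_pM2l ?ltr0n // /rpow -/l -expRD ler_expR.
  by clearbody l; clear; lra.
have I1 : normc ((cpow (s - 1) N%:R - cpow (s - 1) b%:R) / (s - 1)) <= 4 * rpow (x - 14 / 15) N%:R.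
  rewrite Normc.normcM Normc.normcV.
  have nt : t <= normc (s - 1).
    by apply: le_trans (cabs_Im _); rewrite ImD ImN /= subr0 ler_norm.
  have bl : ln b%:R <= l + 1.
    have b0 : 0 < b%:R :> R by rewrite ltr0n (leq_trans N0).
    have : ln b%:R <= ln (2 * N%:R) :> R.
      by rewrite ler_ln ?posrE ?mulr_gt0 // -natrM ler_nat mul2n.
    rewrite lnM ?posrE // -/l; have /andP[_] := ln2_bounds; clear; lra.
  have lb : l <= ln b%:R.
    by rewrite ler_ln ?posrE ?ler_nat // ltr0n (leq_trans N0).
  have cb : rpow (x - 1) b%:R <= 2 * rpow (x - 1) N%:R.
    have e2 : expR (1 / 2) <= 2 :> R.
      by have /andP[h _] := ln2_bounds; rewrite -[leRHS]lnK ?posrE // ler_expR.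
    apply: le_trans (_ : expR (1 / 2) * rpow (x - 1) N%:R <= _).
      rewrite -expRD ler_expR -/l; move: bl lb x1 x2; clearbody l; move: (ln b%:R); clear; move=> k; nra.
    by rewrite ler_wpM2r ?rpow_ge0.
  have num : normc (cpow (s - 1) N%:R - cpow (s - 1) b%:R) <= 3 * rpow (x - 1) N%:R.
    apply: le_trans (cabsB _ _) _; rewrite !cabs_cpow ReD ReN /= -/x.
    move: cb; clear; lra.
  have di : (normc (s - 1))^-1 <= expR (- (l / 2)).
    rewrite expRN lef_pV2 ?posrE ?expR_gt0 ?(lt_le_trans t0) //.
    by apply: le_trans nt; rewrite tE ler_expR.
  apply: le_trans (_ : 3 * rpow (x - 1) N%:R * expR (- (l / 2)) <= _).
    by apply: ler_pM (cabs_ge0 _) _ num di; rewrite invr_ge0 cabs_ge0.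
  have : rpow (x - 1) N%:R * expR (- (l / 2)) <= rpow (x - 14 / 15) N%:R.
    rewrite -expRD ler_expR -/l; clearbody l; move: l1; clear; lra.
  have := rpow_ge0 (x - 14 / 15) N%:R; clear; lra.
apply: le_trans (cabsB _ _) _; move: S1 I1; clear; lra.
Qed.

(** Since [Re s - 14/15 > 1/20], each doubling of [N] multiplies the block bound by at most 98/100,
    and [8 + 400 * 98/100 = 400] closes the induction. This is where the abscissa 0.985 meets the
    exponent 14/15. *)
Lemma em_err_dyadic (k : nat) s N b : let l := ln (N%:R : R) in
  100 * 1000 <= l -> (N <= b <= 2 ^ k * N)%N ->
  985 / 1000 <= complex.Re s -> complex.Re s <= 11 / 10 ->
  0 < complex.Im s -> complex.Im s <= N%:R ^+ 3 ->
  normc (em_err s N b) <= 400 * rpow (complex.Re s - 14 / 15) N%:R.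
Proof.
elim: k N => [|k ih] N l l1 /andP[Nb bk] x1 x2 t0 t3.
  have -> : b = N by apply/eqP; rewrite eqn_leq Nb andbT -[leqRHS]mul1n.
  by rewrite em_err_self /= expr0n /= addr0 sqrtr0; apply: mulr_ge0 (ler0n _ _) (rpow_ge0 _ _).
set x := complex.Re s in x1 x2 *.
have [b2|b2] := leqP b N.*2.
  apply: le_trans (em_err_block l1 _ x1 x2 t0 t3) _; first by rewrite Nb.
  by rewrite ler_wpM2r ?rpow_ge0 // ler_nat.
have N0 : (0 < N)%N.
  rewrite lt0n; apply/eqP => N0; move: l1; rewrite /l N0 ln0 //; lra.
have NR : 0 < N%:R :> R by rewrite ltr0n.
have N2 : N.*2%:R = 2 * N%:R :> R by rewrite -mul2n natrM.
have /andP[k1 k2] := ln2_bounds.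
have l2 : 100 * 1000 <= ln N.*2%:R :> R.
  by rewrite N2 lnM ?posrE // -/l; move: k1 l1; clear; lra.
have b2k : (N.*2 <= b <= 2 ^ k * N.*2)%N.
  by rewrite (ltnW b2) /= -mul2n mulnA -expnSr.
have t32 : complex.Im s <= N.*2%:R ^+ 3.
  by apply: le_trans t3 _; apply: pow_le => //; rewrite ler_nat -addnn leq_addr.
have h1 := ih N.*2 l2 b2k x1 x2 t0 t32.
have bN : (N <= N.*2 <= N.*2)%N by rewrite leqnn andbT -addnn leq_addr.
have h2 := em_err_block l1 bN x1 x2 t0 t3.
rewrite (@em_err_cat _ s N N.*2 b) ?(ltnW b2) ?andbT; last by case/andP: bN.
apply: le_trans (cabsD _ _) _.
apply: le_trans (lerD h2 h1) _.
rewrite N2 rpowM // -/x.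
have r2 : rpow (x - 14 / 15) 2 <= 98 / 100.
  have y0 : - (1 / 2) <= - (1 / 40) :> R by clear; lra.
  apply: le_trans (_ : expR (- (1 / 40)) <= _).
    rewrite ler_expR; move: k1 x1; move: (ln 2); clear; move=> k; nra.
  have := @expR_taylor1 R (- (1 / 40)).
  rewrite normrN ger0_norm; last by clear; lra.
  have h : 1 / 40 <= 1 / 2 :> R by clear; lra.
  by move=> /(_ h) /ler_normlP [_]; rewrite sqrrN expr2; clear; lra.
have := ler_wpM2r (rpow_ge0 (x - 14 / 15) N%:R) r2.
move: (rpow _ 2 * _) (rpow_ge0 (x - 14 / 15) N%:R); clear; move=> u; lra.
Qed.

Lemma em_err_large s N b : let l := ln (N%:R : R) in
  100 * 1000 <= l -> (N <= b)%N ->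
  985 / 1000 <= complex.Re s -> complex.Re s <= 11 / 10 ->
  0 < complex.Im s -> complex.Im s <= N%:R ^+ 3 ->
  normc (em_err s N b) <= 400 * rpow (complex.Re s - 14 / 15) N%:R.
Proof.
move=> l l1 Nb x1 x2 t0 t3; apply: (@em_err_dyadic b s N b) => //.
rewrite Nb /=; have N0 : (0 < N)%N.
  rewrite lt0n; apply/eqP => N0; move: l1; rewrite /l N0 ln0 //; lra.
exact: leq_trans (ltnW (ltn_expl b (isT : (1 < 2)%N))) (leq_pmulr _ N0).
Qed.

End DyadicTails.

(** * From the axioms of [zeta] to truncated Dirichlet sums *)

Section ZetaLink.
Variable R : realType.
Local Notation C := R[i].
Implicit Types (s w c z : C) (x y u v t e r : R) (a b n m : nat).

Lemma rpow_small x e : 0 < x -> 0 < e -> exists n0 : nat, forall n, (n0 <= n)%N -> rpow x n%:R <= e.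
Proof.
move=> x0 e0; exists (Num.trunc (expR (- ln e / x))).+1 => n hn.
have /andP[_ h] := truncn_itv (expR_ge0 (- ln e / x)).
have hn' : expR (- ln e / x) <= n%:R.
  by apply: le_trans (ltW h) _; rewrite ler_nat.
have n0 : 0 < n%:R :> R by apply: lt_le_trans hn'; exact: expR_gt0.
rewrite /rpow -[leRHS]lnK ?posrE // ler_expR lerNl mulrC -ler_pdivrMr //.
by rewrite -[leLHS]expRK ler_ln ?posrE ?expR_gt0.
Qed.

Lemma cderiv_cpow z u : exists l, cderiv (fun t : C => cpow t u) z l.
Proof.
have d1 : cderiv (fun t : C => - ((ln u)%:C%C * t)) z (- ((ln u)%:C%C * 1)).
  by apply: cderivN; apply: cderivMl; exact: cderiv_id.
have := @cderiv_comp R (@cE R) (fun t : C => - ((ln u)%:C%C * t)) z _ _ (cderiv_cE _) d1.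
move=> h; eexists; apply: (cderiv_ext ltr01 _ h) => k _.
by rewrite /cpow mulrC.
Qed.

(** The partial sum completed by [n ^ (1 - s) / (s - 1)], the continued integral of [u ^ (- s)]
    beyond [n]. It is holomorphic away from 1, and two truncations differ by [em_err]. *)
Definition zeta_trunc s n : C := dsum s 1 n + cpow (s - 1) n%:R / (s - 1).

Lemma zeta_trunc_sub s a b : (0 < a <= b)%N -> zeta_trunc s b - zeta_trunc s a = em_err s a b.
Proof.
case/andP=> a0 ab; rewrite /zeta_trunc /em_err /dsum (big_cat_nat a0 ab) /=; ring.
Qed.

Lemma cderiv_zeta_trunc z n : z != 1 -> exists l, cderiv (zeta_trunc^~ n) z l.
Proof.
move=> z1; have z10 : z - 1 != 0 by rewrite subr_eq0.
have [l hl] : exists l, cderiv (fun t : C => dsum t 1 n) z l.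
  pose l m := xget 0 [set l | cderiv (fun t : C => cpow t m%:R) z l]%classic.
  exists (\sum_(1 <= m < n) l m); apply: cderiv_sum => m.
  have [k hk] := cderiv_cpow z m%:R.
  exact: (@xgetPex _ 0 [set l | cderiv (fun t : C => cpow t m%:R) z l]%classic (ex_intro _ k hk)).
have d1 : cderiv (fun t : C => t - 1) z (1 - 0).
  by apply: cderivB; [exact: cderiv_id|exact: cderiv_const].
have [k hk] := cderiv_cpow (z - 1) n%:R.
have d2 := @cderiv_comp R (fun t : C => cpow t n%:R) (fun t : C => t - 1) z _ _ hk d1.
have d3 := @cderiv_comp R (fun t : C => t^-1) (fun t : C => t - 1) z _ _ (cderivV z10) d1.
exists (l + (k * (1 - 0) * (z - 1)^-1 + cpow (z - 1) n%:R * (- (z - 1)^-1 ^+ 2 * (1 - 0)))).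
exact: cderivD hl (cderivM d2 d3).
Qed.

Variable zeta : Cplx R -> Cplx R.
Hypothesis hz : is_riemann_zeta zeta.

(** The pointwise property that is carried from [Re s > 1] into the strip. *)
Definition zeta_approx s := forall e, 0 < e -> exists n0 : nat, forall n, (n0 <= n)%N ->
  normc (zeta s - zeta_trunc s n : C) <= e.

Lemma dirichlet_termE s n : dirichlet_term s n = cpow s n%:R.
Proof.
rewrite /dirichlet_term /cexp /cpow /cE; apply: complex_ext; rewrite ?ReM ?ImM /=.
  by rewrite !mul0r subr0.
by rewrite !mul0r addr0.
Qed.

Lemma zeta_approx_gt1 s : 1 < complex.Re s -> zeta_approx s.
Proof.
move=> s1 e e0; have [h _] := hz; have := h s s1 => /cvgrPdist_le H.
have s10 : normc (s - 1) != 0.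
  by rewrite gt_eqF // cabs_gt0 subr_eq0; apply/eqP => k; move: s1; rewrite k /= ltxx.
have sp : 0 < normc (s - 1) by rewrite lt_def s10 cabs_ge0.
have e20 : 0 < e / 2 by rewrite divr_gt0.
have e0' : 0 < ((e / 2)%:C)%C :> R[i]^o by rewrite ltcR.
have [n1 _ hn1] := H _ e0'.
have x0 : 0 < complex.Re s - 1 by rewrite subr_gt0.
have [n2 hn2] := rpow_small x0 (mulr_gt0 sp e20).
exists (maxn n1 n2).+1 => -[//|n]; rewrite ltnS geq_max => /andP[h1 h2].
have k1 : normc (zeta s - dsum s 1 n.+1 : C) <= e / 2.
  have := hn1 n h1; rewrite /= -lecR => K; apply: le_trans K.
  rewrite /series /= /dsum big_add1 /=.
  under eq_bigr => m _ do rewrite -dirichlet_termE.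
  by case: (_ - _ : C).
have k2 : normc (cpow (s - 1) n.+1%:R / (s - 1)) <= e / 2.
  rewrite Normc.normcM Normc.normcV cabs_cpow ReD ReN /= ler_pdivrMr // mulrC.
  by apply: hn2; apply: leqW.
rewrite /zeta_trunc opprD addrA; apply: le_trans (cabsB _ _) _.
by apply: le_trans (lerD k1 k2) _; rewrite -splitr.
Qed.

(** Sending the second cut of [em_err_le] to infinity makes the pointwise convergence quantitative,
    hence uniform on circles, which is what allows another continuation step. *)
Lemma zeta_approx_le s n : zeta_approx s -> 1 / 2 <= complex.Re s -> complex.Re s <= 2 -> s != 1 ->
  (0 < n)%N -> normc (zeta s - zeta_trunc s n : C) <= 16 * (normc s * rpow (complex.Re s) n%:R).
Proof.
move=> hs x1 x2 s1 n0; apply/ler_addgt0Pr => e e0.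
have [m hm] := hs e e0.
have mn : (0 < n <= maxn m n)%N by rewrite n0 leq_maxr.
have h1 := hm (maxn m n) (leq_maxl _ _).
have /andP[_ nm] := mn.
have h2 := em_err_le n0 nm x1 x2 s1; rewrite -(zeta_trunc_sub s mn) in h2.
have -> : zeta s - zeta_trunc s n = (zeta s - zeta_trunc s (maxn m n)) +
  (zeta_trunc s (maxn m n) - zeta_trunc s n) :> C by ring.
by apply: le_trans (cabsD _ _) _; rewrite addrC; exact: lerD.
Qed.

Lemma zeta_cderiv s : s != 1 -> exists l, cderiv (zeta : C -> C) s l.
Proof. by move=> s1; apply: derivable_cderiv; have [_] := hz; apply. Qed.

Lemma circle_bound (f : C -> C) c r :
  (forall w, normc (w - c) = r -> exists l, cderiv f w l) ->
  exists B, forall w, normc (w - c) = r -> normc (f w) <= B.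
Proof.
move=> hf.
have [r0|r0] := ltP r 0.
  by exists 0 => w hw; move: r0; rewrite -hw ltNge cabs_ge0.
pose F (t : R) : R := normc (f (c + r%:C%C * cis t)).
have onc t : normc (c + r%:C%C * cis t - c) = r.
  by rewrite addrAC subrr add0r Normc.normcM cabs_cis mulr1 cabs_real ger0_norm.
have cF : continuous F.
  move=> t; apply/cvgrPdist_le => e e0.
  have [l hl] := hf _ (onc t).
  have [d d0 hd] := cderiv_cont hl e0.
  have d1 : 0 < d / (r + 1) by rewrite divr_gt0 // ltr_wpDl.
  near=> u.
  rewrite /F; apply: le_trans (cabs_abs_sub _ _) _; rewrite cabsBC.
  have -> : c + r%:C%C * cis u = (c + r%:C%C * cis t) + r%:C%C * (cis u - cis t) by ring.
  apply: hd; rewrite Normc.normcM cabs_real ger0_norm //.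
  apply: le_lt_trans (_ : (r + 1) * `|u - t| < _).
    by apply: ler_pM (r0) (cabs_ge0 _) _ (cis_sub_le _ _); rewrite lerDl.
  rewrite -ltr_pdivlMl ?ltr_wpDl // mulrC distrC.
  near: u; exact: cvgr_dist_lt.
have pi0 : - pi <= pi :> R by rewrite ge0_cp // pi_ge0.
have [u _ hu] := EVT_max pi0 (continuous_subspaceT cF).
exists (F u) => w hw.
have [t tpi e] := polarE (w - c).
have -> : w = c + r%:C%C * cis t by rewrite -hw -e addrC subrK.
by apply: hu; rewrite in_itv /= -ler_norml.
Unshelve. all: by end_near.
Qed.

(** [annulus_limit] for the differences of [zeta] and its truncations: on the outer circle they are
    bounded uniformly in [n], by comparison with the truncation at 1, and on the inner circle they
    tend to 0 uniformly. The disc stays away from the pole 1. *)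
Lemma zeta_approx_extend c r1 r3 z : 0 < r1 -> r1 < normc (z - c) < r3 -> r3 < normc (c - 1) ->
  (forall w, normc (w - c) <= r3 -> 1 / 2 <= complex.Re w <= 2) ->
  (forall w, normc (w - c) = r1 -> zeta_approx w) -> zeta_approx z.
Proof.
move=> r10 zr r31 rew har.
have r13 : r1 < r3 by case/andP: zr; exact: lt_trans.
have w1 w : normc (w - c) <= r3 -> w != 1.
  by move=> hw; apply/eqP => e; move: r31; rewrite ltNge cabsBC -e hw.
pose g n w : C := zeta w - zeta_trunc w n.+1.
have hol w : normc (w - c) <= r3 -> exists l, cderiv (zeta : C -> C) w l.
  by move=> hw; apply: zeta_cderiv; exact: w1.
have [B hB] : exists B, forall w, normc (w - c) = r3 -> normc (zeta w : C) <= B.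
  by apply: circle_bound => w hw; apply: hol; rewrite hw.
have wn w : normc (w - c) <= r3 -> normc w <= normc c + r3.
  by move=> hw; have := cabsD (w - c) c; rewrite subrK addrC => k; apply: le_trans k _; rewrite lerD2l.
pose M := B + ((normc (c - 1) - r3)^-1 + 16 * (normc c + r3)).
have key : forall e, 0 < e -> exists n0, forall n, (n0 <= n)%N -> normc (g n z) <= e.
  apply: (@annulus_limit R g c r1 r3 M z r10 zr).
  - move=> n w /andP[_ hw].
    have [l hl] := hol w hw; have [k hk] := cderiv_zeta_trunc n.+1 (w1 w hw).
    by exists (l - k); apply: cderivB.
  - move=> n w hw; have hw' : normc (w - c) <= r3 by rewrite hw.
    have /andP[x1 x2] := rew w hw'.
    apply: le_trans (cabsB _ _) _; apply: lerD; first exact: hB.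
    have n1 : (0 < 1 <= n.+1)%N by [].
    have -> : zeta_trunc w n.+1 = zeta_trunc w 1 + em_err w 1 n.+1 by rewrite -(zeta_trunc_sub w n1); ring.
    apply: le_trans (cabsD _ _) _; apply: lerD.
      rewrite /zeta_trunc /dsum big_geq // add0r cpow_one mul1r Normc.normcV.
      rewrite lef_pV2 ?posrE ?subr_gt0 ?cabs_gt0 ?subr_eq0 ?w1 //.
      rewrite lerBlDr -hw; have := cabs_tri c w 1; rewrite (cabsBC c w); clear; lra.
    apply: le_trans (em_err_le _ _ x1 x2 (w1 w hw')) _ => //.
    by rewrite /rpow ln1 mulr0 oppr0 expR0 mulr1 ler_pM2l ?ltr0n // wn.
  move=> e e0.
  have K0 : 0 < 16 * (normc c + r3 + 1).
    by rewrite mulr_gt0 ?ltr0n // ltr_wpDl // addr_ge0 // (le_trans (ltW r10)) ?ltW.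
  have h2 : 0 < 1 / 2 :> R by lra.
  have [n0 hn0] := rpow_small h2 (divr_gt0 e0 K0).
  exists n0 => n hn w hw; have hw' : normc (w - c) <= r3 by rewrite hw ltW.
  have /andP[x1 x2] := rew w hw'.
  apply: le_trans (zeta_approx_le (har w hw) x1 x2 (w1 w hw') (ltn0Sn n)) _.
  have := hn0 n.+1 (leqW hn); rewrite ler_pdivlMr // mulrC => h; apply: le_trans h.
  rewrite -mulrA ler_pM2l ?ltr0n //; apply: ler_pM; rewrite ?rpow_ge0 ?cabs_ge0 //.
    by apply: le_trans (wn w hw') _; rewrite lerDl.
  rewrite ler_expR lerN2 ler_wpM2r // ln_ge0 // ler1n //.
move=> e e0; have [n0 hn0] := key e e0; exists n0.+1 => -[//|n] hn; exact: hn0.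
Qed.

End ZetaLink.

(** * Bounds for [zeta] near the line of abscissa 1 *)

Section ZetaBounds.
Variable R : realType.
Local Notation C := R[i].
Implicit Types (s w c z : C) (x y u v t e r : R) (a b n m N : nat).
Variable zeta : Cplx R -> Cplx R.
Hypothesis hz : is_riemann_zeta zeta.

(** The circle of radius [a / 2] around [1 + a + i t] lies in the half-plane of convergence and
    serves as inner circle. *)
Lemma zeta_approx_disc (a t r : R) z : let c := ((1 + a) +i* t)%C in 0 < a ->
  r < normc (c - 1) -> 1 / 2 + r <= 1 + a -> 1 + a + r <= 2 -> normc (z - c) < r ->
  zeta_approx zeta z.
Proof.
move=> c a0 rc r1 r2 zr.
have [z1|z1] := ltP 1 (complex.Re z); first exact: zeta_approx_gt1.
have az : a <= normc (z - c).
  apply: le_trans (cabs_Re _); rewrite ReD ReN /= distrC.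
  by apply: le_trans (ler_norm _); move: z1; clear; lra.
have dRe w : normc (w - c) <= r -> `|complex.Re w - (1 + a)| <= r.
  by move=> h; apply: le_trans h; apply: le_trans (cabs_Re _); rewrite ReD ReN.
apply: (@zeta_approx_extend R zeta hz c (a / 2) r z) => //.
- by rewrite divr_gt0.
- by rewrite zr andbT; move: a0 az; move: (normc _); clear; move=> n; lra.
- move=> w /dRe /ler_normlP [h1 h2]; apply/andP; split.
    by move: h1 r1; clear; lra.
  by move: h2 r2; clear; lra.
move=> w hw; apply: zeta_approx_gt1 => //.
have : `|complex.Re w - (1 + a)| <= a / 2.
  by rewrite -hw; apply: le_trans (cabs_Re _); rewrite ReD ReN.
move=> /ler_normlP [h1 h2]; move: h1 a0; clear; lra.
Qed.

Lemma lt_of_sqr_lt (x y : R) : 0 <= y -> x ^+ 2 < y ^+ 2 -> x < y.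
Proof.
move=> y0 h; rewrite ltNge; apply/negP => yx.
by move: h; rewrite ltNge => /negP; apply; apply: pow_le.
Qed.

(** At ordinates above 0.03 one disc centred slightly to the right of the line reaches [s] without
    touching 1. Lower down such a disc would contain the pole, and the continuation goes around
    it. *)
Lemma zeta_approx_strip s : 985 / 1000 <= complex.Re s -> complex.Re s < 1 ->
  0 < complex.Im s -> zeta_approx zeta s.
Proof.
move=> x1 x2 t0; have [t1|t1] := lerP (3 / 100) (complex.Im s).
  apply: (@zeta_approx_disc (1 / 100) (complex.Im s) (3 / 100)).
  - by lra.
  - apply: lt_of_sqr_lt; first exact: cabs_ge0.
    rewrite cabs_sqr ReD ImD ReN ImN /= subr0 !expr2; move: t1; move: (complex.Im s); clear => t; nra.
  - by lra.
  - by lra.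
  - apply: lt_of_sqr_lt; first by lra.
    rewrite cabs_sqr ReD ImD ReN ImN /= subrr !expr2; move: x1 x2; move: (complex.Re s); clear => t; nra.
(* A centre to the upper left of 1 from which every remaining [s] is closer than the pole; its own
   inner circle, near ordinate 0.2, is reached by a disc of the first kind. *)
pose c : C := ((9 / 10) +i* (2 / 10))%C.
have c2 : normc (c - 1) ^+ 2 = 5 / 100.
  by rewrite cabs_sqr ReD ImD ReN ImN /= !expr2; field.
have sc : normc (s - c) < normc (c - 1).
  apply: lt_of_sqr_lt; first exact: cabs_ge0.
  rewrite c2 cabs_sqr ReD ImD ReN ImN /= !expr2; move: x1 x2 t0 t1; move: (complex.Re s) (complex.Im s); clear => u v; nra.
have cb : normc (c - 1) < 3 / 10.
  by apply: lt_of_sqr_lt; rewrite ?c2 ?expr2; lra.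
have sl : 5 / 100 < normc (s - c).
  apply: lt_le_trans (cabs_Re _); rewrite ReD ReN /=; apply: lt_le_trans (ler_norm _).
  by move: x1; clear; lra.
apply: (@zeta_approx_extend R zeta hz c (2 / 100) ((normc (s - c) + normc (c - 1)) / 2) s) => //.
- apply/andP; split; first by move: sl; clear; lra.
  by move: sc; clear; lra.
- by move: sc; clear; lra.
- move=> w hw; have : `|complex.Re w - 9 / 10| <= 3 / 10.
    have -> : complex.Re w - 9 / 10 = complex.Re (w - c) by rewrite ReD ReN.
    apply: le_trans (cabs_Re _) _; apply: le_trans hw _; move: sc cb; clear; lra.
  by move=> /ler_normlP [h1 h2]; apply/andP; split; move: h1 h2; clear; lra.
move=> w hw.
have h1 : `|complex.Re w - 9 / 10| <= 2 / 100.
  have -> : complex.Re w - 9 / 10 = complex.Re (w - c) by rewrite ReD ReN.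
  by rewrite -hw; exact: cabs_Re.
have h2 : `|complex.Im w - 2 / 10| <= 2 / 100.
  have -> : complex.Im w - 2 / 10 = complex.Im (w - c) by rewrite ImD ImN.
  by rewrite -hw; exact: cabs_Im.
case/ler_normlP: h1 => h1 h1'; case/ler_normlP: h2 => h2 h2'.
apply: (@zeta_approx_disc (5 / 100) (complex.Im w) (175 / 1000)).
- by lra.
- apply: lt_of_sqr_lt; first exact: cabs_ge0.
  rewrite cabs_sqr ReD ImD ReN ImN /= subr0 !expr2; move: h2 h2'; move: (complex.Im w); clear => t; nra.
- by lra.
- by lra.
- apply: lt_of_sqr_lt; first by lra.
  rewrite cabs_sqr ReD ImD ReN ImN /= subrr !expr2; move: h1 h1'; move: (complex.Re w); clear => t; nra.
Qed.

(** The truncation at 1 is the polar term [1 / (s - 1)], and it differs from [zeta s] by at most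
    [16 |s|]. At distance 1/17 the polar term wins, since [16 * (18/17) * (1/17) = 288/289]. *)
Lemma zeta_neq0_near1 s : 985 / 1000 <= complex.Re s -> complex.Re s < 1 ->
  0 < complex.Im s -> normc (s - 1) <= 1 / 17 -> zeta s != 0.
Proof.
move=> x1 x2 t0 d; apply/eqP => z0.
have s1 : s != 1 by apply/eqP => k; move: t0; rewrite k /= ltxx.
have y1 : 1 / 2 <= complex.Re s by move: x1; clear; lra.
have y2 : complex.Re s <= 2 by move: x2; clear; lra.
have := zeta_approx_le (zeta_approx_strip x1 x2 t0) y1 y2 s1 (ltn0Sn 0).
rewrite z0 sub0r cabsN /zeta_trunc /dsum big_geq // add0r cpow_one mul1r Normc.normcV.
rewrite /rpow ln1 mulr0 oppr0 expR0 mulr1.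
have d0 : 0 < normc (s - 1) by rewrite cabs_gt0 subr_eq0.
rewrite -[_^-1]mul1r ler_pdivrMr // => h.
have n1 : normc (1 : C) = 1 by rewrite /= expr1n expr0n /= addr0 sqrtr1.
have sn : normc s <= 1 + normc (s - 1).
  by have := cabsD 1 (s - 1); rewrite n1 addrC subrK.
have sn0 := cabs_ge0 s.
have : normc s * normc (s - 1) <= (1 + 1 / 17) * (1 / 17) by apply: ler_pM => //; move: sn d; clear; lra.
move: h; rewrite -mulrA; clear; lra.
Qed.

(** At a zero the truncation is a pure tail error; this is the form in which the vanishing of [zeta]
    enters the detection. *)
Lemma zeta_trunc_zero_le s N : zeta s = 0 -> 985 / 1000 <= complex.Re s -> complex.Re s < 1 ->
  0 < complex.Im s -> complex.Im s <= N%:R ^+ 3 -> 100 * 1000 <= ln (N%:R : R) ->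
  normc (zeta_trunc s N) <= 400 * rpow (complex.Re s - 14 / 15) N%:R.
Proof.
move=> z0 x1 x2 t0 t3 l1; apply/ler_addgt0Pr => e e0.
have N0 : (0 < N)%N.
  rewrite lt0n; apply/eqP => N0; move: l1; rewrite N0 ln0 //; lra.
have [m hm] := zeta_approx_strip x1 x2 t0 e0.
have mn : (0 < N <= maxn m N)%N by rewrite N0 leq_maxr.
have h1 := hm (maxn m N) (leq_maxl _ _).
have y2 : complex.Re s <= 11 / 10 by move: x2; clear; lra.
have h2 := em_err_large l1 (leq_maxr m N) x1 y2 t0 t3.
rewrite -(zeta_trunc_sub s mn) in h2.
rewrite z0 sub0r cabsN in h1.
have -> : zeta_trunc s N = zeta_trunc s (maxn m N) - (zeta_trunc s (maxn m N) - zeta_trunc s N) by ring.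
by apply: le_trans (cabsB _ _) _; rewrite addrC; exact: lerD.
Qed.

Lemma dsum_le s x N : 0 <= x -> 1 - x <= complex.Re s -> (0 < N)%N ->
  normc (dsum s 1 N) <= expR (x * ln N%:R) * (1 + ln N%:R).
Proof.
move=> x0 xs N0; apply: le_trans (cabs_sum _ _ _) _.
apply: (@le_trans _ _ (\sum_(1 <= m < N.+1) expR (x * ln N%:R) * m%:R^-1)); last first.
  by rewrite -big_distrr /= ler_wpM2l ?expR_ge0 // harmonic_le_ln.
rewrite big_nat_recr //; apply: ler_wpDr; first by rewrite mulr_ge0 ?expR_ge0 ?invr_ge0.
apply: ler_sum_nat => m /andP[m0 mN].
have mR : 0 < m%:R :> R by rewrite ltr0n.
have -> : m%:R^-1 = expR (- ln m%:R) :> R by rewrite expRN lnK.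
rewrite cabs_cpow /rpow -expRD ler_expR.
have l0 : 0 <= ln m%:R :> R by rewrite ln_ge0 // ler1n.
have l1 : ln m%:R <= ln N%:R :> R by rewrite ler_ln ?posrE ?ltr0n // ler_nat ltnW.
have := ler_wpM2r l0 xs; have := ler_wpM2l x0 l1; clear; lra.
Qed.

(** Cutting the series at [N >= |s|] makes the error [16 |s| N ^ (- Re s)] no larger than 16 times
    the main factor; with the harmonic sum this gives 17 plus a logarithm, and the polar term gives
    [1 / d]. *)
Lemma zeta_upper s x d N : zeta_approx zeta s -> 0 <= x -> x <= 1 / 2 ->
  1 - x <= complex.Re s -> complex.Re s <= 2 -> 0 < d -> d <= normc (s - 1) ->
  normc s <= N%:R -> (0 < N)%N ->
  normc (zeta s : C) <= expR (x * ln N%:R) * (17 + ln N%:R + d^-1).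
Proof.
move=> hs x0 x12 xs s2 d0 ds sN N0.
have y1 : 1 / 2 <= complex.Re s by move: x12 xs; clear; lra.
have s1 : s != 1.
  by apply/eqP => k; move: ds; rewrite k subrr leNgt (_ : normc 0 = 0) ?d0 //; apply/eqP; rewrite cabs_eq0.
have h1 := zeta_approx_le hs y1 s2 s1 N0.
have h2 := dsum_le x0 xs N0.
have NR : 1 <= N%:R :> R by rewrite ler1n.
have l0 : 0 <= ln N%:R :> R by rewrite ln_ge0.
have rp : rpow (complex.Re s - 1) N%:R <= expR (x * ln N%:R).
  by rewrite ler_expR; have := ler_wpM2r l0 xs; clear; lra.
have h3 : normc (cpow (s - 1) N%:R / (s - 1)) <= expR (x * ln N%:R) / d.
  rewrite Normc.normcM Normc.normcV cabs_cpow ReD ReN /=.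
  apply: ler_pM; rewrite ?rpow_ge0 ?invr_ge0 ?cabs_ge0 //.
  by rewrite lef_pV2 ?posrE // (lt_le_trans d0).
have h4 : normc s * rpow (complex.Re s) N%:R <= expR (x * ln N%:R).
  apply: le_trans rp; apply: (@le_trans _ _ (N%:R * rpow (complex.Re s) N%:R)).
    by rewrite ler_wpM2r ?rpow_ge0.
  have NE : N%:R = expR (ln N%:R) :> R by rewrite lnK // posrE (lt_le_trans ltr01).
  by rewrite {1}NE /rpow -expRD ler_expR; clear; lra.
have -> : zeta s = (zeta s - zeta_trunc s N) + (dsum s 1 N + cpow (s - 1) N%:R / (s - 1)) :> C.
  by rewrite /zeta_trunc; ring.
apply: le_trans (cabsD _ _) _; apply: le_trans (lerD h1 (cabsD _ _)) _.
move: h2 h3 h4; move: (normc (dsum _ _ _)) (normc (_ / _)) (normc s * _) (expR _) => a1 a2 a3 a4.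
move: (_^-1) (ln _); clear => u v; rewrite !mulrDr; lra.
Qed.

End ZetaBounds.

(** * Selberg weights *)

Section SquarefreeArithmetic.
Variable R : realType.
Implicit Types (x : R) (d k m n p q z : nat).

Lemma dvd_sum (V : nmodType) d N (G : nat -> V) : (0 < d)%N ->
  \sum_(1 <= n < N.+1 | (d %| n)%N) G n = \sum_(1 <= k < (N %/ d).+1) G (d * k)%N.
Proof.
move=> d0; elim: N => [|N ih]; first by rewrite div0n !big_geq.
rewrite big_mkcond big_nat_recr //= -big_mkcond ih divnS //.
case: ifP => dN; last by rewrite addr0 add0n.
have e : (d * (N %/ d).+1 = N.+1)%N.
  by rewrite -[RHS](divnK dN) divnS // dN add1n mulnC.
by rewrite add1n [RHS]big_nat_recr //= e.
Qed.

Lemma dvd_sum_cond (V : nmodType) d N (P : pred nat) (G : nat -> V) : (0 < d)%N ->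
  \sum_(1 <= n < N.+1 | P n && (d %| n)%N) G n =
  \sum_(1 <= k < (N %/ d).+1 | P (d * k)%N) G (d * k)%N.
Proof.
move=> d0; rewrite [RHS]big_mkcond.
rewrite -(dvd_sum N (fun n => if P n then G n else 0) d0) -big_mkcondr.
by apply: eq_bigl => n; rewrite andbC.
Qed.

Lemma divisor_sum_range (V : nmodType) n z (P : pred nat) (G : nat -> V) : (0 < n <= z)%N ->
  \sum_(1 <= d < z.+1 | P d && (d %| n)%N) G d = \sum_(1 <= d < n.+1 | P d && (d %| n)%N) G d.
Proof.
case/andP=> n0 nz; rewrite (@big_cat_nat _ _ _ n.+1) //=.
rewrite [X in _ + X]big1_seq ?addr0 // => d /andP[/andP[_ dn]].
by rewrite mem_index_iota => /andP[nd _]; have := dvdn_leq n0 dn; rewrite leqNgt nd.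
Qed.

Definition sqfree n := (0 < n)%N && all (fun p => logn p n <= 1)%N (primes n).

Lemma sqfreeP n : reflect ((0 < n)%N /\ forall p, (logn p n <= 1)%N) (sqfree n).
Proof.
apply: (iffP andP) => -[n0 h]; split=> //.
  move=> p; have [pn|pn] := boolP (p \in primes n); first exact: (allP h).
  by move: pn; rewrite -logn_gt0 lt0n negbK => /eqP ->.
by apply/allP.
Qed.

Lemma sqfree_gt0 n : sqfree n -> (0 < n)%N. Proof. by case/andP. Qed.

Lemma sqfree_dvd m n : (m %| n)%N -> sqfree n -> sqfree m.
Proof.
move=> mn /sqfreeP[n0 h]; apply/sqfreeP; split; first exact: dvdn_gt0 mn.
by move=> p; apply: leq_trans (dvdn_leq_log p n0 mn) (h p).
Qed.

Lemma sqfree_pM p k : prime p -> (0 < k)%N -> sqfree (p * k) = sqfree k && ~~ (p %| k)%N.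
Proof.
move=> pp k0; have p0 := prime_gt0 pp.
have e q : logn q (p * k) = ((q == p) + logn q k)%N by rewrite lognM // logn_prime // eq_sym.
apply/sqfreeP/andP => [[_ h]|[/sqfreeP[_ h] pk]].
  split.
    by apply/sqfreeP; split=> // q; apply: leq_trans (h q); rewrite e leq_addl.
  by apply/negP => pk; have := h p; rewrite e eqxx add1n ltnS leqn0 -leqn0 leqNgt logn_gt0 mem_primes pp k0 pk.
split; first by rewrite muln_gt0 p0.
move=> q; rewrite e; have [->|_] := eqVneq q p; last exact: h.
by rewrite add1n ltnS leqNgt logn_gt0 mem_primes pp k0 (negPf pk).
Qed.

Lemma perm_primes_pM p k : prime p -> (0 < k)%N -> ~~ (p %| k)%N ->
  perm_eq (primes (p * k)) (p :: primes k).
Proof.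
move=> pp k0 pk; apply: uniq_perm; first exact: primes_uniq.
  by rewrite /= primes_uniq mem_primes pp k0 (negPf pk).
by move=> q; rewrite (primesM q (prime_gt0 pp) k0) (primes_prime pp) !inE.
Qed.

Lemma primes_pM_dvd p k : prime p -> (0 < k)%N -> (p %| k)%N -> primes (p * k) = primes k.
Proof.
move=> pp k0 pk; apply: (sorted_eq ltn_trans) => //; last first.
  apply: uniq_perm; rewrite ?primes_uniq // => q.
  rewrite (primesM q (prime_gt0 pp) k0) (primes_prime pp) inE.
  by have [->|] := eqVneq q p; rewrite //= mem_primes pp k0 pk.
all: try exact: sorted_primes.
by move=> a b /andP[h1 h2]; move: (ltn_trans h1 h2); rewrite ltnn.
Qed.

Lemma sqfree_primes_inj m n : sqfree m -> sqfree n -> primes m = primes n -> m = n.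
Proof.
move=> /sqfreeP[m0 hm] /sqfreeP[n0 hn] e; apply: eqn_from_log => // p.
have : (0 < logn p m)%N = (0 < logn p n)%N by rewrite !logn_gt0 e.
move: (hm p) (hn p); by case: (logn p n) => [|[|?]]; case: (logn p m) => [|[|?]].
Qed.

Definition mu n : R := if sqfree n then (-1) ^+ size (primes n) else 0.

Lemma mu1 : mu 1 = 1. Proof. by rewrite /mu /= expr0. Qed.

Lemma mu_abs n : `|mu n| <= 1.
Proof. by rewrite /mu; case: ifP; rewrite ?normr0 // normrX normrN1 expr1n. Qed.

Lemma mu_pM p k : prime p -> (0 < k)%N -> mu (p * k) = if (p %| k)%N then 0 else - mu k.
Proof.
move=> pp k0; rewrite /mu sqfree_pM //.
have [pk|pk] /= := boolP (p %| k)%N; first by rewrite andbF.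
rewrite andbT (perm_size (perm_primes_pM pp k0 pk)) /=.
by case: ifP => _; rewrite ?oppr0 // exprS mulN1r.
Qed.

(** The divisors [d] and [p d] cancel in pairs. *)
Lemma mu_sum_coprime p q N : prime p -> (p %| N)%N -> ~~ (p %| q)%N -> (0 < N)%N ->
  \sum_(1 <= d < N.+1 | (q %| d)%N && (d %| N)%N) mu d = 0.
Proof.
move=> pp pN pq N0; have p0 := prime_gt0 pp.
have Np0 : (0 < N %/ p)%N by rewrite divn_gt0 // dvdn_leq.
have cpq : coprime q p by rewrite coprime_sym prime_coprime.
rewrite (bigID (fun d => p %| d)%N) /=.
rewrite (@dvd_sum_cond _ p N (fun d => (q %| d) && (d %| N))%N mu p0).
have -> : \sum_(1 <= i < N.+1 | (q %| i)%N && (i %| N)%N && ~~ (p %| i)%N) mu i =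
   \sum_(1 <= i < (N %/ p).+1 | (q %| i)%N && ~~ (p %| i)%N && (i %| N %/ p)%N) mu i.
  rewrite -(@divisor_sum_range _ (N %/ p) N (fun i => (q %| i) && ~~ (p %| i))%N); last first.
    by rewrite Np0 leq_div.
  apply: eq_bigl => i; have [pi|pi] := boolP (p %| i)%N; first by rewrite !andbF.
  by rewrite !andbT -{1}(divnK pN) Gauss_dvdl // coprime_sym prime_coprime.
rewrite big_mkcond [X in _ + X]big_mkcond -big_split /= big1_seq // => k /andP[_].
rewrite mem_index_iota => /andP[k0 _].
rewrite Gauss_dvdr // mu_pM //.
have -> : (p * k %| N)%N = (k %| N %/ p)%N by rewrite -{1}(divnK pN) mulnC dvdn_pmul2r.
by case: (q %| k)%N; case: (p %| k)%N; case: (k %| N %/ p)%N; rewrite /= ?addr0 ?addNr.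
Qed.

(** A prime of [N] that does not divide [q] makes the sum cancel in pairs. Otherwise [q] is the only
    multiple of [q] dividing [N] that can be squarefree. *)
Lemma mu_sum q N : (0 < N)%N -> (q %| N)%N ->
  \sum_(1 <= d < N.+1 | (q %| d)%N && (d %| N)%N) mu d =
  if primes N == primes q then mu q else 0.
Proof.
move=> N0 qN; have q0 : (0 < q)%N := dvdn_gt0 N0 qN.
have [/hasP[p pN pq]|/hasPn h] := boolP (has (fun p => ~~ (p %| q))%N (primes N)).
  rewrite ifF; last by apply/eqP => e; move: pN; rewrite e mem_primes (negPf pq) !andbF.
  move: pN; rewrite mem_primes => /and3P[pp _ pN]; exact: (mu_sum_coprime pp).
have e : primes N = primes q.
  apply: (sorted_eq ltn_trans); try exact: sorted_primes.
    by move=> a b /andP[h1 h2]; move: (ltn_trans h1 h2); rewrite ltnn.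
  apply: uniq_perm; rewrite ?primes_uniq // => p.
  apply/idP/idP => hp.
    by rewrite mem_primes q0; move: (h p hp); rewrite negbK => ->; move: hp; rewrite mem_primes => /and3P[->].
  by move: hp; rewrite !mem_primes N0 => /and3P[-> _ pq]; exact: dvdn_trans pq qN.
rewrite e eqxx big_mkcond (bigD1_seq q) /=; last exact: iota_uniq; last first.
  by rewrite mem_index_iota q0 ltnS dvdn_leq.
rewrite dvdnn qN big1_seq ?addr0 // => d /andP[dq _]; case: ifP => // /andP[qd dN].
rewrite /mu; case: ifP => // /sqfreeP[d0 hd]; case/eqP: dq.
apply: eqn_from_log => // p; apply/eqP; rewrite eqn_leq (dvdn_leq_log p d0 qd) andbT.
have [pd|pd] := boolP (p \in primes d); last first.
  by move: pd; rewrite -logn_gt0 lt0n negbK => /eqP ->.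
apply: leq_trans (hd p) _; rewrite logn_gt0 -e.
by move: pd; rewrite !mem_primes N0 => /and3P[-> _ pd]; exact: dvdn_trans pd dN.
Qed.

(** Jordan's totient restricted to squarefree [n]: the product of [p ^ x - 1], Moebius inverse of
    [n ^ x] there. *)
Definition jordan x n : R := if sqfree n then \prod_(p <- primes n) (rpow (- x) p%:R - 1) else 0.

Lemma rpow_nat_ge1 x n : 0 <= x -> (0 < n)%N -> 1 <= rpow (- x) n%:R.
Proof.
move=> x0 n0; rewrite /rpow mulNr opprK -[leLHS]expR0 ler_expR mulr_ge0 // ln_ge0 //.
by rewrite ler1n.
Qed.

Lemma jordan_ge0 x n : 0 <= x -> 0 <= jordan x n.
Proof.
move=> x0; rewrite /jordan; case: ifP => // _; rewrite big_seq; apply: prodr_ge0 => p.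
by rewrite mem_primes => /andP[pp _]; rewrite subr_ge0 rpow_nat_ge1 // prime_gt0.
Qed.

Lemma jordan_pM x p k : prime p -> (0 < k)%N -> ~~ (p %| k)%N ->
  jordan x (p * k) = (rpow (- x) p%:R - 1) * jordan x k.
Proof.
move=> pp k0 pk; rewrite /jordan sqfree_pM // pk andbT.
case: ifP => _; last by rewrite mulr0.
by rewrite (perm_big _ (perm_primes_pM pp k0 pk)) /= big_cons.
Qed.

Lemma sqfree_pdiv n : sqfree n -> (1 < n)%N ->
  exists p m, [/\ prime p, n = (p * m)%N, ~~ (p %| m)%N, sqfree m & (m < n)%N].
Proof.
move=> sn n1; have pp := pdiv_prime n1; have pn := pdiv_dvd n; have n0 := ltnW n1.
exists (pdiv n), (n %/ pdiv n)%N.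
have e : n = (pdiv n * (n %/ pdiv n))%N by rewrite mulnC divnK.
have m0 : (0 < n %/ pdiv n)%N by rewrite divn_gt0 ?prime_gt0 // dvdn_leq.
move: sn; rewrite {1}e sqfree_pM // => /andP[sm pm]; split=> //.
by rewrite ltn_Pdiv // prime_gt1.
Qed.

Lemma jordan_sum x g : sqfree g ->
  \sum_(1 <= q < g.+1 | (q %| g)%N) jordan x q = rpow (- x) g%:R.
Proof.
elim/ltn_ind: g => g ih sg; have g0 := sqfree_gt0 sg.
have [g1|] := leqP g 1.
  have -> : g = 1%N by apply/eqP; rewrite eqn_leq g1 g0.
  by rewrite big_mkcond big_nat1 /= /jordan /= big_nil /rpow ln1 mulr0 oppr0 expR0.
move=> g1; have [p [m [pp e pm sm mg]]] := sqfree_pdiv sg g1.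
have m0 := sqfree_gt0 sm; have p0 := prime_gt0 pp.
have gp : (g %/ p)%N = m by rewrite e mulKn.
rewrite (bigID (fun d => p %| d)%N) /=.
rewrite (@dvd_sum_cond _ p g (fun d => (d %| g))%N (jordan x) p0) gp.
have -> : \sum_(1 <= i < g.+1 | (i %| g)%N && ~~ (p %| i)%N) jordan x i =
   \sum_(1 <= i < m.+1 | (i %| m)%N) jordan x i.
  have := @divisor_sum_range R m g predT (jordan x); rewrite m0 (ltnW mg) => <- //.
  apply: eq_bigl => i /=; have [pi|pi] := boolP (p %| i)%N; rewrite ?andbF ?andbT.
    by apply/esym/negbTE; apply: contra pm; exact: dvdn_trans.
  by rewrite e Gauss_dvdr // coprime_sym prime_coprime.
have -> : \sum_(1 <= k < m.+1 | (p * k %| g)%N) jordan x (p * k) =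
   (rpow (- x) p%:R - 1) * \sum_(1 <= i < m.+1 | (i %| m)%N) jordan x i.
  rewrite big_distrr /= big_nat_cond [RHS]big_nat_cond.
  apply: eq_big => k; first by rewrite e dvdn_pmul2l.
  case/andP=> /andP[k0 _]; rewrite e dvdn_pmul2l // => km; rewrite jordan_pM //.
  by apply: contra pm => /dvdn_trans; apply.
rewrite (ih m mg sm) e natrM rpowM ?ltr0n // mulrBl mul1r; ring.
Qed.

Lemma jordan_le x q : 0 <= x -> (0 < q)%N -> jordan x q <= rpow (- x) q%:R.
Proof.
move=> x0 q0; have [sq|sq] := boolP (sqfree q); last by rewrite /jordan (negPf sq) rpow_ge0.
rewrite -jordan_sum // big_mkcond big_nat_recr //= dvdnn lerDr.
by apply: sumr_ge0 => i _; case: ifP => // _; exact: jordan_ge0.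
Qed.

(** For squarefree [q], a truncation of the Euler product of [p ^ (- x) + p ^ (- 2 x) + ...] over
    the primes of [q], whose limit is the inverse of [jordan x q]. *)
Definition radsum x q N : R :=
  \sum_(1 <= n < N.+1 | (primes n == primes q) && (q %| n)%N) rpow x n%:R.

Lemma radsum_ge0 x q N : 0 <= radsum x q N.
Proof. by apply: sumr_ge0 => n _; exact: rpow_ge0. Qed.

Lemma radsum_le x q N M : (N <= M)%N -> radsum x q N <= radsum x q M.
Proof.
move=> NM; rewrite /radsum [leRHS](@big_cat_nat _ _ _ N.+1) //= lerDl.
by apply: sumr_ge0 => n _; exact: rpow_ge0.
Qed.

(** Removing one factor [p] from [n] leaves a number that either still contains [p] or has exactly
    the primes of [q]. *)
Lemma radsum_pM x p q N : prime p -> (0 < q)%N -> ~~ (p %| q)%N ->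
  radsum x (p * q) N <= rpow x p%:R * (radsum x (p * q) N + radsum x q N).
Proof.
move=> pp q0 pq; have p0 := prime_gt0 pp.
apply: le_trans (_ : rpow x p%:R * (radsum x (p * q) (N %/ p) + radsum x q (N %/ p)) <= _); last first.
  by rewrite ler_wpM2l ?rpow_ge0 // lerD // radsum_le // leq_div.
rewrite {1}/radsum.
have -> : \sum_(1 <= n < N.+1 | (primes n == primes (p * q)) && (p * q %| n)%N) rpow x n%:R =
  \sum_(1 <= n < N.+1 | ((primes n == primes (p * q)) && (p * q %| n)%N) && (p %| n)%N) rpow x n%:R.
  apply: eq_bigl => n; apply/idP/andP => [/andP[-> h]|[]//]; split=> //.
  by apply: dvdn_trans h; exact: dvdn_mulr.
rewrite (@dvd_sum_cond _ p N (fun n => (primes n == primes (p * q)) && (p * q %| n)%N) (fun n => rpow x n%:R) p0).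
rewrite /radsum -[(\sum_(_ <= n < _ | _) _ + _)]/(_ + _) !(big_mkcond (fun i => (_ == _) && _)) -big_split big_distrr /=.
apply: ler_sum_nat => k /andP[k0 _]; rewrite dvdn_pmul2l //.
have k00 : 0 <= rpow x k%:R :> R by exact: rpow_ge0.
have pR : 0 < p%:R :> R by rewrite ltr0n.
have kR : 0 < k%:R :> R by rewrite ltr0n.
have P0 := rpow_ge0 x p%:R.
case: ifP => [/andP[/eqP pk qk]|_]; last first.
  by rewrite mulr_ge0 // addr_ge0 //; case: ifP.
rewrite natrM rpowM // ler_wpM2l //.
have [dk|dk] := boolP (p %| k)%N.
  rewrite ifT ?lerDl; first by case: ifP.
  rewrite -(primes_pM_dvd pp k0 dk) pk eqxx /= Gauss_dvd ?dk ?qk //.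
  by rewrite prime_coprime.
rewrite [X in _ <= _ + X]ifT ?lerDr; first by case: ifP.
rewrite qk andbT; apply/eqP; apply: (sorted_eq ltn_trans); try exact: sorted_primes.
  by move=> a b /andP[h1 h2]; move: (ltn_trans h1 h2); rewrite ltnn.
rewrite -(perm_cons p); apply: (@perm_trans _ (primes (p * k))).
  by rewrite perm_sym perm_primes_pM.
by rewrite pk perm_primes_pM.
Qed.

(** [radsum_pM] multiplied by [p ^ x] says that [p ^ x - 1] times the sum for [p q] is at most the
    sum for [q]; primes are removed one at a time. *)
Lemma jordan_radsum_le1 x q N : 0 < x -> sqfree q -> jordan x q * radsum x q N <= 1.
Proof.
move=> x0; elim/ltn_ind: q => q ih sq; have q0 := sqfree_gt0 sq.
have [q1|] := leqP q 1.
  have -> : q = 1%N by apply/eqP; rewrite eqn_leq q1 q0.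
  rewrite /jordan /= big_nil mul1r /radsum.
  case: N {ih} => [|N]; first by rewrite big_geq.
  rewrite big_ltn_cond // /= big1_seq ?addr0; first by rewrite /rpow ln1 mulr0 oppr0 expR0.
  move=> n /andP[/andP[/eqP e _]]; rewrite mem_index_iota => /andP[n1 _].
  have : pdiv n \in primes n by rewrite mem_primes pdiv_prime // pdiv_dvd (ltnW n1).
  by rewrite e.
move=> q1; have [p [m [pp e pm sm mq]]] := sqfree_pdiv sq q1.
have m0 := sqfree_gt0 sm.
apply: le_trans (ih m mq sm).
rewrite e jordan_pM // -mulrA [leLHS]mulrCA ler_wpM2l ?(jordan_ge0 _ (ltW x0)) //.
have := radsum_pM x N pp m0 pm.
have P0 : 0 < rpow (- x) p%:R :> R by exact: rpow_gt0.
move=> /(ler_wpM2l (ltW P0)); rewrite mulrA -rpowD addNr.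
have -> : rpow 0 p%:R = 1 :> R by rewrite /rpow mul0r oppr0 expR0.
rewrite mul1r; move: (radsum _ _ _) (radsum _ _ _) (rpow _ _); clear=> u v w.
by rewrite mulrBl mul1r lerBlDl.
Qed.

Definition zsum x N : R := \sum_(1 <= n < N.+1) rpow x n%:R.

Lemma zsum_ge0 x N : 0 <= zsum x N.
Proof. by apply: sumr_ge0 => n _; exact: rpow_ge0. Qed.

(** Each [n] is counted at most once, for [q] the product of its primes. *)
Lemma radsum_sum_le x z N : \sum_(1 <= q < z.+1 | sqfree q) radsum x q N <= zsum x N.
Proof.
rewrite /radsum.
under eq_bigr => q _ do rewrite big_mkcond.
rewrite exchange_big /= /zsum; apply: ler_sum => n _.
have [/hasP[q0 h0 /andP[s0 /andP[/eqP e0 d0]]]|/hasPn h] :=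
  boolP (has (fun q => sqfree q && ((primes n == primes q) && (q %| n)%N)) (index_iota 1 z.+1)).
  rewrite big_mkcond (bigD1_seq q0) //=; last exact: iota_uniq.
  rewrite s0 e0 eqxx d0 big1 ?addr0 // => q qq; case: ifP => // sq.
  case: ifP => // /andP[/eqP e _].
  by move: qq; rewrite (sqfree_primes_inj sq s0 (esym e)) eqxx.
rewrite big1_seq ?rpow_ge0 // => q /andP[sq /h].
by rewrite sq /= => /negPf ->.
Qed.

End SquarefreeArithmetic.

(** * Partial sums of the zeta series at real arguments *)

Section RealZetaSums.
Variable R : realType.
Implicit Types (x u v e : R) (d k m n p q z M N : nat).

Lemma rpow_integral_step x m : 0 < x -> (0 < m)%N ->
  rpow (x + 1) m.+1%:R <= (rpow x m%:R - rpow x m.+1%:R) / x <= rpow (x + 1) (m%:R : R).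
Proof.
move=> x0 m0; have mR : 0 < m%:R :> R by rewrite ltr0n.
have mm : m%:R <= m.+1%:R :> R by rewrite ler_nat.
have hd u : m%:R <= u <= m.+1%:R -> is_derive u 1 (rpow x) (- x * rpow (x + 1) u).
  move=> /andP[mu _]; have u0 : 0 < u by exact: lt_le_trans mu.
  have dl := is_derive1_ln u0.
  have dm : is_derive u 1 (fun u => - (x * ln u)) (- (x * u^-1)).
    by apply: is_deriveN; apply: is_deriveMl.
  have := @is_derive1_comp R expR (fun u => - (x * ln u)) u _ _ (is_derive_expR _) dm.
  by move=> h; apply: is_derive_eq h _; rewrite rpowD rpow1 // /rpow; ring.
have [xi /andP[h1 h2]] := mvt_segment mm hd.
have -> : m.+1%:R - m%:R = 1 :> R by rewrite -natr1 addrAC subrr add0r.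
rewrite mulr1 => e.
have -> : (rpow x m%:R - rpow x m.+1%:R) / x = rpow (x + 1) xi.
  by rewrite -opprB e; field; rewrite gt_eqF.
have x10 : 0 <= x + 1 by rewrite addr_ge0 // ltW.
by rewrite !rpow_anti // (lt_le_trans mR).
Qed.

Lemma zsum_diff x M N : 0 < x -> (0 < M <= N)%N ->
  (rpow x M.+1%:R - rpow x N.+1%:R) / x <= zsum (x + 1) N - zsum (x + 1) M
    <= (rpow x M%:R - rpow x N%:R) / x.
Proof.
move=> x0 /andP[M0 MN]; elim: N MN => [|N ih].
  by rewrite leqn0 => /eqP e; rewrite e in M0.
rewrite leq_eqVlt => /predU1P[<-|]; first by rewrite !subrr mul0r lexx.
rewrite ltnS => MN; have /andP[h1 h2] := ih MN.
have N0 : (0 < N)%N by exact: leq_trans MN.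
have /andP[_ k2] := rpow_integral_step x0 (ltn0Sn N).
have /andP[k1 _] := rpow_integral_step x0 N0.
have -> : zsum (x + 1) N.+1 = zsum (x + 1) N + rpow (x + 1) N.+1%:R by rewrite /zsum big_nat_recr.
move: h1 h2 k1 k2; rewrite !mulrBl; clear; lra.
Qed.

Lemma rpow_one x : rpow x 1 = 1 :> R.
Proof. by rewrite /rpow ln1 mulr0 oppr0 expR0. Qed.

Lemma rpow_le1 x u : 0 <= x -> 1 <= u -> rpow x u <= 1.
Proof.
move=> x0 u1; rewrite -(rpow_one x); exact: rpow_anti.
Qed.

Lemma zsum1 x : zsum x 1 = 1 :> R.
Proof. by rewrite /zsum big_nat1 rpow_one. Qed.

Lemma zsum_upper x N : 0 < x -> (0 < N)%N -> zsum (x + 1) N <= 1 + (1 - rpow x N%:R) / x.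
Proof.
move=> x0 N0; have := @zsum_diff x 1 N x0; rewrite N0 => /(_ isT) /andP[_].
by rewrite zsum1 rpow_one lerBlDl.
Qed.

Lemma zsum_lower x N : 0 < x -> (0 < N)%N -> (1 - rpow x N%:R) / x <= zsum (x + 1) N.
Proof.
move=> x0 N0; have := @zsum_diff x 1 N x0; rewrite N0 => /(_ isT) /andP[h _].
have /andP[_] := @rpow_integral_step x 1 x0 isT; rewrite !rpow_one => h2.
have h3 : rpow x N.+1%:R <= rpow x N%:R :> R.
  by apply: rpow_anti; rewrite ?ltr0n ?ler_nat // ltW.
have : (rpow x N%:R - rpow x N.+1%:R) / x >= 0 by rewrite divr_ge0 ?subr_ge0 // ltW.
rewrite zsum1 in h; move: h h2; rewrite !mulrBl; clear; lra.
Qed.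

Lemma zsum_le_inv x N : 0 < x -> zsum (x + 1) N <= 1 + x^-1.
Proof.
move=> x0; case: N => [|N]; first by rewrite /zsum big_geq // addr_ge0 // invr_ge0 ltW.
apply: le_trans (zsum_upper x0 (ltn0Sn N)) _.
by rewrite lerD2l -[leRHS]mul1r ler_wpM2r ?invr_ge0 ?(ltW x0) // gerBl rpow_ge0.
Qed.

Lemma zsum_mono x M N : (M <= N)%N -> zsum x M <= zsum x N :> R.
Proof.
move=> MN; rewrite /zsum [leRHS](@big_cat_nat _ _ _ M.+1) //= lerDl.
by apply: sumr_ge0 => n _; exact: rpow_ge0.
Qed.

(** The supremum plays the role of the value of the zeta function at [1 + x], obtained here for any
    realType from the partial sums alone. *)
Lemma zsum_sup x : 0 < x -> exists Z : R, [/\ forall N, zsum (x + 1) N <= Z,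
  Z <= 1 + x^-1 & forall e, 0 < e -> exists N0, forall N, (N0 <= N)%N -> Z - e <= zsum (x + 1) N].
Proof.
move=> x0; pose A := [set zsum (x + 1) N | N in [set: nat]]%classic : set R.
have Aub : ubound A (1 + x^-1) by move=> y [N _ <-]; exact: zsum_le_inv.
have hs : has_sup A by split; [exists (zsum (x + 1) 0), 0%N|exists (1 + x^-1)].
exists (sup A); split.
- by move=> N; apply: ub_le_sup; [exists (1 + x^-1)|exists N].
- by apply: ge_sup => //; case: hs.
move=> e e0; have [y [N _ <-] h] := sup_adherent e0 hs.
by exists N => M NM; apply: le_trans (ltW h) (zsum_mono _ NM).
Qed.

Lemma inv_step m : (0 < m)%N ->
  (m.+1%:R^-1 : R) <= ln (m.+1%:R : R) - ln (m%:R : R) <= (m%:R^-1 : R).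
Proof.
move=> m0; have mR : 0 < m%:R :> R by rewrite ltr0n.
have m1 : 0 < m.+1%:R :> R by rewrite ltr0n.
have e : m.+1%:R = m%:R + 1 :> R by rewrite natr1.
have up (u v : R) : 0 < u -> 0 < v -> ln v - ln u <= (v - u) / u.
  move=> u0 v0; have -> : ln v - ln u = ln (v / u) by rewrite ln_div.
  have := @expR_ge1Dx R (ln (v / u)).
  rewrite lnK ?posrE ?divr_gt0 // => h.
  by rewrite mulrBl divff ?gt_eqF // lerBrDl.
apply/andP; split; last first.
  by apply: le_trans (up _ _ mR m1) _; rewrite e addrAC subrr add0r mul1r.
have := up _ _ m1 mR; rewrite -lerN2 -mulNr !opprB => h; apply: le_trans h.
by rewrite e addrAC subrr add0r mul1r.
Qed.

Lemma zsum1_diff M N : (0 < M <= N)%N ->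
  ln (N.+1%:R : R) - ln (M.+1%:R : R) <= zsum (1 : R) N - zsum (1 : R) M
    <= ln (N%:R : R) - ln (M%:R : R).
Proof.
case/andP=> M0; elim: N => [|N ih].
  by rewrite leqn0 => /eqP e; rewrite e in M0.
rewrite leq_eqVlt => /predU1P[<-|]; first by rewrite !subrr lexx.
rewrite ltnS => MN; have /andP[h1 h2] := ih MN.
have N0 : (0 < N)%N by exact: leq_trans MN.
have /andP[_ k2] := inv_step (ltn0Sn N).
have /andP[k1 _] := inv_step N0.
have -> : zsum 1 N.+1 = zsum 1 N + N.+1%:R^-1 :> R by rewrite /zsum big_nat_recr //= rpow1 ?ltr0n.
move: h1 h2 k1 k2; move: (_^-1) (ln _) (ln _) (ln _) (ln _) (zsum _ _) (zsum _ _); clear => *.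
by apply/andP; split; lra.
Qed.

Lemma zsum1_lower N : (0 < N)%N -> ln N%:R <= zsum 1 N :> R.
Proof.
move=> N0; have := @zsum1_diff 1 N; rewrite N0 => /(_ isT) /andP[h _].
have /andP[_] := @inv_step 1 isT; rewrite ln1 subr0 invr1 => h2.
have h3 : ln N%:R <= ln N.+1%:R :> R by rewrite ler_ln ?posrE ?ltr0n // ler_nat.
move: h; rewrite zsum1; move: h2 h3; clear; lra.
Qed.

(* Main term of [zsum (x + 1)] at a real argument [u], up to an additive constant. *)
Lemma zsum_floor x u v M N : 0 < x -> (0 < M <= N)%N -> 
  M%:R <= u -> u <= M.+1%:R -> N%:R <= v -> v <= N.+1%:R ->
  `|(zsum (x + 1) N + rpow x v / x) - (zsum (x + 1) M + rpow x u / x)| <= 3 / M%:R.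
Proof.
move=> x0 MN Mu uM Nv vN; have /andP[M0 MN'] := MN.
have MR : 0 < M%:R :> R by rewrite ltr0n.
have N0 : (0 < N)%N := leq_trans M0 MN'.
have NR : 0 < N%:R :> R by rewrite ltr0n.
have x0' := ltW x0; have iv0 : 0 <= x^-1 by rewrite invr_ge0.
have anti (a b : R) : 0 < a -> a <= b -> rpow x b / x <= rpow x a / x.
  by move=> a0 ab; rewrite ler_wpM2r // rpow_anti.
have a1 := anti _ _ MR Mu; have a2 := anti _ _ (lt_le_trans MR Mu) uM.
have a3 := anti _ _ NR Nv; have a4 := anti _ _ (lt_le_trans NR Nv) vN.
have /andP[h1 h2] := zsum_diff x0 MN.
have inv k : (0 < k)%N -> rpow (x + 1) k%:R <= (k%:R^-1 : R).
  move=> k0; rewrite rpowD rpow1 ?ltr0n // -[leRHS]mul1r ler_wpM2r ?invr_ge0 // rpow_le1 // ler1n //.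
have /andP[_ s1] := rpow_integral_step x0 M0; have s2 := inv M M0.
have /andP[_ s3] := rpow_integral_step x0 N0; have s4 := inv N N0.
have s5 : N%:R^-1 <= M%:R^-1 :> R by rewrite lef_pV2 ?posrE // ler_nat.
rewrite !mulrBl in h1 h2 s1 s3.
rewrite ler_norml; apply/andP; split; move: a1 a2 a3 a4 h1 h2 s1 s2 s3 s4 s5; clear; lra.
Qed.

End RealZetaSums.

(** * Selberg's quadratic form and its diagonalisation *)

Section SelbergForm.
Variable R : realType.
Implicit Types (x u : R) (d e k m n p q v z A B X : nat).

Lemma divisor_sum_mul (V : comPzRingType) A B X (f g h : nat -> V) :
  \sum_(1 <= n < X.+1) (\sum_(1 <= d < A.+1 | (d %| n)%N) f d) *
     (\sum_(1 <= e < B.+1 | (e %| n)%N) g e) * h n =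
  \sum_(1 <= d < A.+1) \sum_(1 <= e < B.+1) f d * g e *
     \sum_(1 <= k < (X %/ lcmn d e).+1) h (lcmn d e * k)%N.
Proof.
transitivity (\sum_(1 <= n < X.+1) \sum_(1 <= d < A.+1) \sum_(1 <= e < B.+1)
    (if (lcmn d e %| n)%N then f d * g e * h n else 0)).
  apply: eq_bigr => n _; rewrite (big_mkcond (fun d => d %| n)%N) (big_mkcond (fun e => e %| n)%N).
  rewrite !big_distrl /=; apply: eq_bigr => d _; rewrite big_distrr big_distrl /=.
  apply: eq_bigr => e _; rewrite dvdn_lcm.
  by case: (d %| n)%N; case: (e %| n)%N; rewrite /= ?mul0r ?mulr0 ?mul0r.
rewrite exchange_big /= big_nat [RHS]big_nat; apply: eq_bigr => d /andP[d0 _].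
rewrite exchange_big /= big_nat [RHS]big_nat; apply: eq_bigr => e /andP[e0 _].
by rewrite -big_mkcond dvd_sum ?lcmn_gt0 ?d0 // big_distrr.
Qed.

Lemma rpow_lcm x d e : (0 < d)%N -> (0 < e)%N ->
  rpow x (lcmn d e)%:R = rpow x d%:R * rpow x e%:R * rpow (- x) (gcdn d e)%:R :> R.
Proof.
move=> d0 e0; have g0 : (0 < gcdn d e)%N by rewrite gcdn_gt0 d0.
have l0 : (0 < lcmn d e)%N by rewrite lcmn_gt0 d0.
rewrite -rpowM ?ltr0n // -natrM -muln_lcm_gcd natrM rpowM ?ltr0n //.
by rewrite -mulrA -rpowD subrr /rpow mul0r oppr0 expR0 mulr1.
Qed.

(** The power of the least common multiple separates up to [gcd ^ x], which [jordan_sum] expands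
    over common divisors [q]. The expansion holds for squarefree gcd, and the support of [f]
    provides that. *)
Lemma lcm_form_diag x A B (f g : nat -> R) : (B <= A)%N ->
  (forall d, ~~ sqfree d -> f d = 0) ->
  \sum_(1 <= d < A.+1) \sum_(1 <= e < B.+1) f d * g e * rpow x (lcmn d e)%:R =
  \sum_(1 <= q < A.+1) jordan x q *
    ((\sum_(1 <= d < A.+1 | (q %| d)%N) f d * rpow x d%:R) *
     (\sum_(1 <= e < B.+1 | (q %| e)%N) g e * rpow x e%:R)).
Proof.
move=> BA f0.
transitivity (\sum_(1 <= d < A.+1) \sum_(1 <= e < B.+1) \sum_(1 <= q < A.+1)
    (if (q %| d)%N && (q %| e)%N then jordan x q * (f d * rpow x d%:R) * (g e * rpow x e%:R) else 0)).
  apply: eq_big_nat => d /andP[d0 dA]; apply: eq_big_nat => e /andP[e0 eB].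
  have [sd|/f0 ->] := boolP (sqfree d); last first.
    by rewrite big1 => [|q _]; [rewrite !mul0r|case: ifP => // _; ring].
  rewrite rpow_lcm // -(jordan_sum x (sqfree_dvd (dvdn_gcdl d e) sd)).
  rewrite -(@divisor_sum_range R (gcdn d e) A predT (jordan x)) /=; last first.
    by rewrite gcdn_gt0 d0 /=; apply: leq_trans (dvdn_leq d0 (dvdn_gcdl d e)) _.
  rewrite (big_mkcond (fun q => q %| gcdn d e)%N) !big_distrr /=; apply: eq_bigr => q _; rewrite dvdn_gcd.
  by case: ifP => _; rewrite ?mulr0 //; ring.
rewrite (eq_bigr (fun d => \sum_(1 <= q < A.+1) \sum_(1 <= e < B.+1)
   (if (q %| d)%N && (q %| e)%N then jordan x q * (f d * rpow x d%:R) * (g e * rpow x e%:R) else 0))); last first.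
  by move=> d _; rewrite exchange_big.
rewrite exchange_big /=; apply: eq_bigr => q _.
rewrite (big_mkcond (fun d => q %| d)%N) (big_mkcond (fun e => q %| e)%N).
rewrite big_distrl big_distrr /=; apply: eq_bigr => d _.
rewrite !big_distrr /=; apply: eq_bigr => e _.
by case: (q %| d)%N; case: (q %| e)%N; rewrite /= ?mul0r ?mulr0 //; ring.
Qed.

(** Unnormalised Selberg weights. The factor [zsum x (z %/ d)] is chosen so that the sums over
    multiples of [q] in the diagonal form collapse to [mu R q * radsum x q z]. *)
Definition sieve_wt x z d : R := mu R d * zsum x (z %/ d).

Lemma sieve_wt_sqfree x z d : ~~ sqfree d -> sieve_wt x z d = 0.
Proof. by rewrite /sieve_wt /mu => /negPf ->; rewrite mul0r. Qed.

(** Writing [n = d k] and summing over [d] first, [mu_sum] keeps exactly the [n] with the primes of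
    [q]. *)
Lemma sieve_wt_multiples x z q : (0 < q)%N ->
  \sum_(1 <= d < z.+1 | (q %| d)%N) sieve_wt x z d * rpow x d%:R = mu R q * radsum x q z.
Proof.
move=> q0.
transitivity (\sum_(1 <= d < z.+1) \sum_(1 <= n < z.+1)
   (if (q %| d)%N && (d %| n)%N then mu R d * rpow x n%:R else 0)).
  rewrite big_mkcond; apply: eq_big_nat => d /andP[d0 dz]; case: (q %| d)%N => /=; last by rewrite big1.
  rewrite -big_mkcond dvd_sum // /sieve_wt -mulrA -big_distrr /=; congr (_ * _).
  rewrite /zsum big_distrl /=; apply: eq_big_nat => k /andP[k0 _].
  by rewrite natrM rpowM ?ltr0n // mulrC.
rewrite exchange_big /= /radsum big_distrr /= big_mkcond [RHS]big_mkcond.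
rewrite [RHS]big_mkcond /=.
apply: eq_big_nat => n /andP[n0 nz]; rewrite -big_mkcond.
have -> : \sum_(1 <= i < z.+1 | (q %| i)%N && (i %| n)%N) mu R i * rpow x n%:R =
   (\sum_(1 <= i < n.+1 | (q %| i)%N && (i %| n)%N) mu R i) * rpow x n%:R.
  by rewrite -big_distrl /= -(@divisor_sum_range _ n z (fun d => q %| d)%N) // n0.
have [qn|qn] := boolP (q %| n)%N; last first.
  rewrite andbF big1 ?mul0r // => d /andP[qd dn]; case/negP: qn; exact: dvdn_trans dn.
by rewrite mu_sum // andbT; case: ifP => _; rewrite ?mul0r.
Qed.

(** Each diagonal term is at most [jordan * radsum ^+ 2 <= radsum], and the [radsum] add up to at
    most [zsum]. *)
Lemma sieve_form_le x z : 0 < x ->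
  \sum_(1 <= d < z.+1) \sum_(1 <= e < z.+1)
    sieve_wt x z d * sieve_wt x z e * rpow x (lcmn d e)%:R <= zsum x z.
Proof.
move=> x0; rewrite lcm_form_diag //; last exact: sieve_wt_sqfree.
apply: le_trans (radsum_sum_le x z z); rewrite [leRHS]big_mkcond /=.
apply: ler_sum_nat => q /andP[q0 _]; rewrite sieve_wt_multiples //.
case: ifP => sq; last by rewrite /jordan sq mul0r.
have m2 : mu R q * mu R q <= 1.
  by rewrite -expr2 -real_normK ?num_real // expr_le1 // mu_abs.
have r0 := radsum_ge0 x q z; have j0 := jordan_ge0 q (ltW x0).
have jr := jordan_radsum_le1 z x0 sq.
have -> : jordan x q * (mu R q * radsum x q z * (mu R q * radsum x q z)) =
   (mu R q * mu R q) * ((jordan x q * radsum x q z) * radsum x q z) by ring.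
apply: (@le_trans _ _ (1 * (1 * radsum x q z))); last by rewrite !mul1r.
apply: ler_pM => //.
- by rewrite -expr2 sqr_ge0.
- by rewrite !mulr_ge0.
- by rewrite ler_wpM2r.
Qed.

Definition sieve_sum x z n : R := \sum_(1 <= d < z.+1 | (d %| n)%N) sieve_wt x z d.

(** The terms are nonnegative, so the cutoff may be raised until each inner sum over multiples of a
    least common multiple is close to the full zeta value; the remaining form is the one of
    [sieve_form_le]. Both sides of the approximation matter because the weights change sign. *)
Lemma sieve_sum_sqr x z X : 0 < x ->
  \sum_(1 <= n < X.+1) sieve_sum (x + 1) z n ^+ 2 * rpow (x + 1) n%:R <= (1 + x^-1) * zsum (x + 1) z.
Proof.
move=> x0; set s := x + 1; have s0 : 0 < s by rewrite addr_gt0.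
have [Z [hZ Z1 hZ0]] := zsum_sup x0.
apply/ler_addgt0Pr => e e0.
pose K : R := \sum_(1 <= d < z.+1) \sum_(1 <= e < z.+1)
   `|sieve_wt s z d * sieve_wt s z e * rpow s (lcmn d e)%:R|.
have K0 : 0 <= K by apply: sumr_ge0 => d _; apply: sumr_ge0.
have K1 : 0 < K + 1 by rewrite ltr_wpDl.
have [N0 hN0] := hZ0 (e / (K + 1)) (divr_gt0 e0 K1).
(* Least common multiples are at most [z * z], so every inner sum has at least [N0] terms. *)
pose X' := maxn X (N0 * (z * z)).
apply: (@le_trans _ _ (\sum_(1 <= n < X'.+1) sieve_sum s z n ^+ 2 * rpow s n%:R)).
  rewrite [leRHS](@big_cat_nat _ _ _ X.+1) //= ?ltnS ?leq_maxl // lerDl.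
  by apply: sumr_ge0 => n _; rewrite mulr_ge0 ?sqr_ge0 ?rpow_ge0.
under eq_bigr => n _ do rewrite expr2.
rewrite (@divisor_sum_mul R z z X' (sieve_wt s z) (sieve_wt s z) (fun n => rpow s n%:R)).
pose a d k := sieve_wt s z d * sieve_wt s z k * rpow s (lcmn d k)%:R.
apply: (@le_trans _ _ (\sum_(1 <= d < z.+1) \sum_(1 <= k < z.+1) (a d k * Z + `|a d k| * (e / (K + 1))))).
  apply: ler_sum_nat => d /andP[d0 dz]; apply: ler_sum_nat => k /andP[k0 kz].
  have l0 : (0 < lcmn d k)%N by rewrite lcmn_gt0 d0.
  have -> : \sum_(1 <= i < (X' %/ lcmn d k).+1) rpow s (lcmn d k * i)%:R =
     rpow s (lcmn d k)%:R * zsum s (X' %/ lcmn d k) :> R.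
    rewrite /zsum big_distrr /=; apply: eq_big_nat => i /andP[i0 _].
    by rewrite natrM rpowM ?ltr0n.
  rewrite mulrA -/(a d k).
  have lz : (lcmn d k <= z * z)%N.
    rewrite !ltnS in dz kz.
    by apply: leq_trans (dvdn_leq _ _) (leq_mul dz kz); rewrite ?muln_gt0 ?d0 // dvdn_lcm dvdn_mulr // dvdn_mull.
  have NX : (N0 <= X' %/ lcmn d k)%N.
    rewrite leq_divRL //; apply: leq_trans (leq_maxr X _); by rewrite leq_mul2l lz orbT.
  have h1 := hN0 _ NX; have h2 := hZ (X' %/ lcmn d k)%N.
  set H := zsum _ _ in h1 h2 *; rewrite -lerBlDl -mulrBr.
  apply: le_trans (ler_norm _) _; rewrite normrM ler_wpM2l // distrC ger0_norm ?subr_ge0 //.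
  by rewrite lerBlDl -lerBlDr.
under eq_bigr => d _ do rewrite big_split /=.
rewrite big_split /=; apply: lerD; last first.
  have -> : \sum_(1 <= d < z.+1) \sum_(1 <= k < z.+1) `|a d k| * (e / (K + 1)) = K * (e / (K + 1)).
    by rewrite /K big_distrl /=; apply: eq_bigr => d _; rewrite big_distrl.
  rewrite mulrCA -[leRHS]mulr1 ler_pM2l // ler_pdivrMr // mul1r lerDl //.
have -> : \sum_(1 <= d < z.+1) \sum_(1 <= k < z.+1) a d k * Z =
   Z * \sum_(1 <= d < z.+1) \sum_(1 <= k < z.+1) a d k.
  by rewrite big_distrr /=; apply: eq_bigr => d _; rewrite big_distrr; apply: eq_bigr => k _; rewrite mulrC.
apply: ler_pM.
- by apply: le_trans (hZ 0); rewrite /zsum big_geq.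
- rewrite /a lcm_form_diag //; last exact: sieve_wt_sqfree.
  by apply: sumr_ge0 => q _; rewrite mulr_ge0 ?jordan_ge0 ?(ltW s0) // -expr2 sqr_ge0.
- exact: Z1.
exact: sieve_form_le.
Qed.

Lemma sieve_sum_one x z : (0 < z)%N -> sieve_sum x z 1 = zsum x z.
Proof.
move=> z0; rewrite /sieve_sum; have := @divisor_sum_range R 1 z predT (sieve_wt x z).
by rewrite z0 => -> //=; rewrite big_mkcond big_nat1 /= /sieve_wt mu1 mul1r divn1.
Qed.

(** Multiplied by [v], the sum is compared with the one where [v / d] is replaced by its integer
    part. That one counts [n <= v] through [mu_sum], and both it and the fractional parts cost at
    most the number [v / q] of multiples of [q]. *)
Lemma mu_inv_sum_multiples q v : (0 < q)%N -> 
  `|\sum_(1 <= d < v.+1 | (q %| d)%N) mu R d / d%:R| <= 2 / q%:R.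
Proof.
move=> q0; have qR : 0 < q%:R :> R by rewrite ltr0n.
have [v0|v0] := posnP v.
  by rewrite v0 big_geq // normr0 divr_ge0 // ltW.
have vR : 0 < v%:R :> R by rewrite ltr0n.
rewrite -(ler_pM2l vR) -{1}(ger0_norm (ltW vR)) -normrM.
pose Y := \sum_(1 <= d < v.+1 | (q %| d)%N) mu R d * (v %/ d)%:R.
have cnt : \sum_(1 <= n < v.+1 | (q %| n)%N) (1 : R) <= v%:R / q%:R.
  rewrite dvd_sum // sumr_const_nat subn1 /= ler_pdivlMr // -natrM ler_nat.
  exact: leq_trunc_div.
have YE : Y = \sum_(1 <= n < v.+1 | (q %| n)%N) (if primes n == primes q then mu R q else 0).
  transitivity (\sum_(1 <= d < v.+1) \sum_(1 <= n < v.+1) (if (q %| d)%N && (d %| n)%N then mu R d else 0)).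
    rewrite /Y big_mkcond; apply: eq_big_nat => d /andP[d0 _]; case: (q %| d)%N => /=; last by rewrite big1.
    by rewrite -big_mkcond dvd_sum // sumr_const_nat subn1 /= mulr_natr.
  rewrite exchange_big /= [RHS]big_mkcond; apply: eq_big_nat => n /andP[n0 nv].
  rewrite -big_mkcond (@divisor_sum_range _ n v (fun d => q %| d)%N) ?n0 //.
  have [qn|qn] := boolP (q %| n)%N; first by rewrite mu_sum.
  by rewrite big1 // => d /andP[qd dn]; case/negP: qn; exact: dvdn_trans dn.
have Y1 : `|Y| <= v%:R / q%:R.
  rewrite YE; apply: le_trans (ler_norm_sum _ _ _) _; apply: le_trans cnt.
  by apply: ler_sum => n _; case: ifP => _; rewrite ?normr0 // mu_abs.
have D1 : `|v%:R * \sum_(1 <= d < v.+1 | (q %| d)%N) mu R d / d%:R - Y| <= v%:R / q%:R.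
  rewrite big_distrr /= -sumrB; apply: le_trans (ler_norm_sum _ _ _) _; apply: le_trans cnt.
  rewrite big_nat_cond [leRHS]big_nat_cond; apply: ler_sum => d /andP[/andP[d0 _] _].
  have dR : 0 < d%:R :> R by rewrite ltr0n.
  have -> : v%:R * (mu R d / d%:R) - mu R d * (v %/ d)%:R = mu R d * (v%:R / d%:R - (v %/ d)%:R) by ring.
  rewrite normrM -[leRHS]mulr1; apply: ler_pM => //; first exact: mu_abs.
  have e : v%:R = (v %/ d)%:R * d%:R + (v %% d)%:R :> R by rewrite -natrM -natrD -divn_eq.
  have -> : v%:R / d%:R - (v %/ d)%:R = (v %% d)%:R / d%:R :> R.
    by rewrite {1}e mulrDl mulfK ?gt_eqF // addrAC subrr add0r.
  rewrite ger0_norm ?divr_ge0 // ler_pdivrMr // mul1r ler_nat ltnW // ltn_mod //.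
set T := v%:R * _ in D1 *.
have -> : T = (T - Y) + Y by rewrite subrK.
apply: le_trans (ler_normD _ _) _; apply: le_trans (lerD D1 Y1) _.
by rewrite le_eqVlt; apply/orP; left; apply/eqP; ring.
Qed.

(** For the mixed form of detector and mollifier, weights built at exponent [x] are tested at
    exponent 1, where the collapse of [sieve_wt_multiples] is lost; exchanging the sums reduces to
    [mu_inv_sum_multiples]. *)
Lemma sieve_wt_inv_multiples x z q : (0 < q)%N ->
  `|\sum_(1 <= d < z.+1 | (q %| d)%N) sieve_wt x z d * rpow 1 d%:R| <= 2 * zsum x z / q%:R.
Proof.
move=> q0.
have -> : \sum_(1 <= d < z.+1 | (q %| d)%N) sieve_wt x z d * rpow 1 d%:R =
   \sum_(1 <= k < z.+1) rpow x k%:R * \sum_(1 <= d < (z %/ k).+1 | (q %| d)%N) mu R d / d%:R.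
  transitivity (\sum_(1 <= d < z.+1) \sum_(1 <= k < z.+1)
     (if (q %| d)%N && (d * k <= z)%N then rpow x k%:R * (mu R d / d%:R) else 0)).
    rewrite big_mkcond; apply: eq_big_nat => d /andP[d0 dz]; case: (q %| d)%N => /=; last by rewrite big1.
    rewrite /sieve_wt rpow1 ?ltr0n // mulrAC mulrC /zsum big_distrl /=.
    rewrite [RHS](@big_cat_nat _ _ _ (z %/ d).+1) //=; last by rewrite ltnS leq_div.
    rewrite [X in _ = _ + X]big1_seq ?addr0; last first.
      move=> k /andP[_]; rewrite mem_index_iota => /andP[k1 _].
      by rewrite ifF // mulnC leqNgt -ltn_divLR // k1.
    apply: eq_big_nat => k /andP[k0 k1]; rewrite ifT //.
    by rewrite mulnC -leq_divRL.
  rewrite exchange_big /=; apply: eq_big_nat => k /andP[k0 kz].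
  rewrite big_distrr /= [RHS]big_mkcond [LHS](@big_cat_nat _ _ _ (z %/ k).+1) //=; last by rewrite ltnS leq_div.
  rewrite [X in _ + X]big1_seq ?addr0; last first.
    move=> d /andP[_]; rewrite mem_index_iota => /andP[k1 _].
    by rewrite ifF // [X in _ && X]leqNgt -ltn_divLR // k1 andbF.
  apply: eq_big_nat => d /andP[d0 d1].
  by rewrite -(leq_divRL _ _ k0) -ltnS d1 andbT.
apply: le_trans (ler_norm_sum _ _ _) _.
rewrite mulrAC mulrC /zsum big_distrl /=; apply: ler_sum => k _.
rewrite normrM ger0_norm ?rpow_ge0 // ler_wpM2l ?rpow_ge0 //.
exact: mu_inv_sum_multiples.
Qed.

End SelbergForm.

(** * The detector and the mollifier *)

Section DetectorWeights.
Variable R : realType.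
Implicit Types (x u : R) (d e k m n p q v A B X : nat).
Variables (ep : R) (z1 z2 E : nat).
Hypotheses (ep0 : 0 < ep) (z10 : (0 < z1)%N) (z12 : (z1 <= z2)%N) (E0 : (0 < E)%N).
Local Notation s := (ep + 1).

Let z1R : 0 < z1%:R :> R. Proof. by rewrite ltr0n. Qed.
Let z20 : (0 < z2)%N. Proof. exact: leq_trans z12. Qed.
Let z2R : 0 < z2%:R :> R. Proof. by rewrite ltr0n. Qed.
Let s0 : 0 < s. Proof. by rewrite addr_gt0. Qed.

(** Equal to [(z1 / z2) ^ ep]. In the difference [det_wt] of two sieve weights, this coefficient
    cancels the terms [(z / d) ^ (- ep) / ep] by which the truncated zeta sums depend on [z];
    [det_norm] then normalises the value at 1. *)
Definition det_ratio : R := rpow ep z2%:R / rpow ep z1%:R.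
Definition det_norm : R := zsum s z2 - det_ratio * zsum s z1.
Definition det_wt d : R := (sieve_wt s z2 d - det_ratio * sieve_wt s z1 d) / det_norm.
Definition mol_wt e : R := sieve_wt 1 E e / zsum 1 E.
Definition det_sum n : R := \sum_(1 <= d < z2.+1 | (d %| n)%N) det_wt d.
Definition mol_sum n : R := \sum_(1 <= e < E.+1 | (e %| n)%N) mol_wt e.

Lemma det_ratio_ge0 : 0 <= det_ratio.
Proof. by rewrite divr_ge0 ?rpow_ge0. Qed.

Lemma det_ratio_le1 : det_ratio <= 1.
Proof. by rewrite ler_pdivrMr ?rpow_gt0 // mul1r rpow_anti ?ler_nat // ltW. Qed.

Lemma det_norm_ge : (1 - det_ratio) / ep - 1 <= det_norm.
Proof.
have h2 := zsum_lower ep0 z20; have h1 := zsum_upper ep0 z10.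
have k0 := det_ratio_ge0; have k1 := det_ratio_le1.
have h3 := ler_wpM2l k0 h1.
have e : det_ratio * ((1 - rpow ep z1%:R) / ep) = (det_ratio - rpow ep z2%:R) / ep.
  by rewrite mulrA mulrBr mulr1 /det_ratio divfK ?gt_eqF ?rpow_gt0.
rewrite mulrDr mulr1 e in h3; rewrite /det_norm.
move: h2 h3 k1; rewrite !mulrBl; move: (_ / _) (_ / _) (1 / _) => *; lra.
Qed.

Hypothesis dn0 : 0 < det_norm.

Let znn N : 0 <= zsum s N. Proof. exact: zsum_ge0. Qed.

Lemma sieve_sum_range x z n : (z <= z2)%N ->
  \sum_(1 <= d < z2.+1 | (d %| n)%N) sieve_wt x z d = sieve_sum x z n.
Proof.
move=> zz; rewrite (@big_cat_nat _ _ _ z.+1) //= [X in _ + X]big1_seq ?addr0 // => d.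
rewrite mem_index_iota => /andP[_ /andP[zd _]].
by rewrite /sieve_wt divn_small // /zsum big_geq // mulr0.
Qed.

Lemma det_sumE n : det_sum n = (sieve_sum s z2 n - det_ratio * sieve_sum s z1 n) / det_norm.
Proof.
rewrite -(sieve_sum_range s n (leqnn z2)) -(sieve_sum_range s n z12).
by rewrite big_distrr /= -sumrB big_distrl.
Qed.

Lemma det_sum1 : det_sum 1 = 1.
Proof. by rewrite det_sumE !sieve_sum_one // divff // gt_eqF. Qed.

Lemma zsum1_gt0 : 0 < zsum 1 E :> R.
Proof.
have := zsum_mono (1 : R) E0; rewrite zsum1; exact: lt_le_trans.
Qed.

Lemma mol_sum1 : mol_sum 1 = 1.
Proof.
rewrite /mol_sum /mol_wt -big_distrl /= -/(sieve_sum 1 E 1) sieve_sum_one // divff // gt_eqF //.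
exact: zsum1_gt0.
Qed.

(** The square of the difference is at most twice the sum of the squares. With [ep = 1 / L],
    numerator and denominator are both of order [L ^+ 2], so the logarithms cancel. *)
Lemma det_sum_sqr X : \sum_(1 <= n < X.+1) det_sum n ^+ 2 * rpow s n%:R <=
  4 * (1 + ep^-1) * zsum s z2 / det_norm ^+ 2.
Proof.
have h2 := sieve_sum_sqr z2 X ep0; have h1 := sieve_sum_sqr z1 X ep0.
have h3 : (1 + ep^-1) * zsum s z1 <= (1 + ep^-1) * zsum s z2.
  by rewrite ler_wpM2l ?zsum_mono // addr_ge0 // invr_ge0 ltW.
have k0 := det_ratio_ge0; have k1 := det_ratio_le1.
rewrite ler_pdivlMr ?exprn_gt0 // big_distrl /=.
apply: (@le_trans _ _ (2 * \sum_(1 <= n < X.+1) sieve_sum s z2 n ^+ 2 * rpow s n%:R +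
   2 * \sum_(1 <= n < X.+1) sieve_sum s z1 n ^+ 2 * rpow s n%:R)); last first.
  by move: h1 h2 h3; lra.
rewrite !big_distrr -big_split /=; apply: ler_sum => n _.
have r0 := rpow_ge0 s n%:R.
rewrite det_sumE expr_div_n mulrAC divfK ?expf_neq0 ?gt_eqF //.
rewrite !mulrA -mulrDl ler_wpM2r //.
have [a0 b0] := (sqr_ge0 (sieve_sum s z2 n + det_ratio * sieve_sum s z1 n), sqr_ge0 (sieve_sum s z1 n)).
have kk : det_ratio ^+ 2 <= 1 by rewrite expr_le1.
have := ler_wpM2r b0 kk; rewrite mul1r -exprMn.
move: a0; move: (det_ratio * _) => t; rewrite sqrrB sqrrD; lra.
Qed.

Lemma det_wt_le d : `|det_wt d| <= 2 * zsum s z2 / det_norm.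
Proof.
have k0 := det_ratio_ge0; have k1 := det_ratio_le1.
have w z : (z <= z2)%N -> `|sieve_wt s z d| <= zsum s z2.
  move=> zz; rewrite /sieve_wt normrM [X in _ * X]ger0_norm //.
  apply: (@le_trans _ _ (1 * zsum s (z %/ d))); first by rewrite ler_wpM2r // mu_abs.
  by rewrite mul1r zsum_mono // (leq_trans (leq_div _ _)).
rewrite normrM [X in _ * X]ger0_norm ?invr_ge0 ?(ltW dn0) //.
rewrite ler_wpM2r ?invr_ge0 ?(ltW dn0) //.
apply: le_trans (ler_normB _ _) _; rewrite (normrM det_ratio) (ger0_norm k0).
have := w z2 (leqnn _); have := w z1 z12 => w1 w2.
have : det_ratio * `|sieve_wt s z1 d| <= 1 * zsum s z2 by apply: ler_pM.
move: w2; lra.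
Qed.

Lemma mol_wt_le e : `|mol_wt e| <= 1.
Proof.
have h := zsum1_gt0; rewrite /mol_wt /sieve_wt normrM [X in _ * X]ger0_norm ?invr_ge0 ?(ltW h) //.
rewrite ler_pdivrMr // normrM; apply: ler_pM => //; first exact: mu_abs.
by rewrite ger0_norm ?zsum_ge0 // zsum_mono // leq_div.
Qed.

(** All divisors of [n] are at most [z1], so both weights are [mu d] times a common constant, minus
    [(z / d) ^ (- ep) / ep], plus an error of order [d / z1]. The constant is killed by the Moebius
    sum over divisors of [n > 1], the power by [det_ratio], and the errors of the two weights add to
    [12 d / z1]. *)
Lemma det_sum_small n : (1 < n <= z1)%N ->
  `|det_sum n| <= 12 / det_norm * \sum_(1 <= d < n.+1 | (d %| n)%N) d%:R / z1%:R.
Proof.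
case/andP=> n1 nz; have n0 := ltnW n1.
(* [c] stands for the zeta value at [1 + ep]; replacing [z %/ d] by [z / d] in [zsum_floor] costs
   [3 / (z %/ d) <= 6 d / z1]. *)
pose I u := rpow ep u / ep; pose c := zsum s z2 + I z2%:R.
pose err z d := zsum s (z %/ d) + I (z%:R / d%:R) - c.
have errb z d : (z1 <= z <= z2)%N -> (0 < d <= z1)%N -> `|err z d| <= 6 * (d%:R / z1%:R).
  case/andP=> zz1 zz2 /andP[d0 dz].
  have dR : 0 < d%:R :> R by rewrite ltr0n.
  have M0 : (0 < z %/ d)%N by rewrite divn_gt0 // (leq_trans dz).
  have M2 : (0 < z %/ d <= z2)%N by rewrite M0 (leq_trans (leq_div _ _)).
  have l1 : (z %/ d)%:R <= z%:R / d%:R :> R by rewrite ler_pdivlMr // -natrM ler_nat leq_trunc_div.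
  have l2 : z%:R / d%:R <= (z %/ d).+1%:R :> R.
    by rewrite ler_pdivrMr // -natrM ler_nat ltnW // ltn_ceil.
  have := zsum_floor ep0 M2 l1 l2 (lexx _) (_ : z2%:R <= z2.+1%:R :> R).
  rewrite ler_nat leqnSn => /(_ isT); rewrite distrC => h.
  apply: le_trans h _.
  have MR : 0 < (z %/ d)%:R :> R by rewrite ltr0n.
  have k : z1%:R / d%:R <= 2 * (z %/ d)%:R :> R.
    apply: (@le_trans _ _ (z%:R / d%:R)); first by rewrite ler_wpM2r ?invr_ge0 ?ler_nat // ltW.
    apply: le_trans l2 _; rewrite -natrM ler_nat mul2n -addnn -addn1 leq_add2l //.
  have q0 : 0 <= 3 * (d%:R / z1%:R) :> R by rewrite mulr_ge0 // divr_ge0 // ltW.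
  have := ler_wpM2l q0 k; rewrite ler_pdivrMr //.
  have -> : 3 * (d%:R / z1%:R) * (z1%:R / d%:R) = 3 :> R by field; rewrite !gt_eqF.
  by move=> h3; apply: le_trans h3 _; rewrite le_eqVlt; apply/orP; left; apply/eqP; ring.
rewrite det_sumE normrM [X in _ * X]ger0_norm ?invr_ge0 ?(ltW dn0) // [leRHS]mulrAC.
rewrite ler_wpM2r ?invr_ge0 ?(ltW dn0) //.
have SE z : (z1 <= z <= z2)%N -> sieve_sum s z n = \sum_(1 <= d < n.+1 | (d %| n)%N) sieve_wt s z d.
  case/andP=> zz1 zz2; have := @divisor_sum_range R n z predT (sieve_wt s z).
  by rewrite n0 (leq_trans nz) // => /(_ isT).
rewrite !SE ?leqnn ?z12 //.
have mz : \sum_(1 <= d < n.+1 | (d %| n)%N) mu R d = 0.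
  have := @mu_sum R 1 n n0 (dvd1n _).
  have -> : primes n == primes 1 = false.
    apply/eqP => e; have : pdiv n \in primes n by rewrite mem_primes pdiv_prime // pdiv_dvd n0.
    by rewrite e.
  by move=> {2}<-; apply: eq_bigl => d; rewrite dvd1n.
have wE z d : sieve_wt s z d = mu R d * c - mu R d * I (z%:R / d%:R) + mu R d * err z d.
  by rewrite /err /sieve_wt; ring.
have IE z d : (0 < z)%N -> (0 < d)%N -> I (z%:R / d%:R) = rpow ep z%:R * (rpow ep d%:R)^-1 / ep.
  move=> zz0 d0; rewrite /I rpowM ?ltr0n ?invr_gt0 ?ltr0n //.
  by congr (_ * _ / _); rewrite /rpow lnV ?posrE ?ltr0n // mulrN expRN -mulNr.
rewrite big_distrr -sumrB /=.
have -> : \sum_(1 <= d < n.+1 | (d %| n)%N) (sieve_wt s z2 d - det_ratio * sieve_wt s z1 d) =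
  \sum_(1 <= d < n.+1 | (d %| n)%N) (mu R d * (c * (1 - det_ratio)) +
     mu R d * (err z2 d - det_ratio * err z1 d)).
  rewrite big_nat_cond [RHS]big_nat_cond; apply: eq_bigr => d /andP[/andP[d0 _] _].
  rewrite !wE !IE // /det_ratio.
  have := lt0r_neq0 (rpow_gt0 ep (z1%:R : R)); have := lt0r_neq0 (rpow_gt0 ep (d%:R : R)).
  move: (rpow _ _) (rpow _ _) (rpow _ _) (err _ _) (err _ _) => r1 r2 r3 e1 e2 h1 h2; field.
  by rewrite h1 h2 gt_eqF.
rewrite big_split /= -big_distrl /= mz mul0r add0r.
apply: le_trans (ler_norm_sum _ _ _) _; rewrite big_distrr /=.
rewrite big_nat_cond [leRHS]big_nat_cond; apply: ler_sum => d /andP[/andP[d0 dn] _].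
rewrite ltnS in dn.
have d1 : (0 < d <= z1)%N by rewrite d0 (leq_trans dn).
have e1 := errb z1 d ltac:(by rewrite leqnn) d1.
have e2 := errb z2 d ltac:(by rewrite leqnn z12) d1.
have k0 := det_ratio_ge0; have k1 := det_ratio_le1.
rewrite normrM; apply: (@le_trans _ _ (1 * (12 * (d%:R / z1%:R)))); last by rewrite mul1r.
apply: ler_pM => //; first exact: mu_abs.
apply: le_trans (ler_normB _ _) _; rewrite (normrM det_ratio) (ger0_norm k0).
have := ler_pM k0 (normr_ge0 _) k1 e1; move: e2; lra.
Qed.

(** In diagonal form the detector factor is [O(1 / q)], which compensates [jordan 1 q <= q], and the
    mollifier factors sum to at most 1 by [radsum_sum_le]. *)
Lemma det_mol_form : (E <= z2)%N ->
  `|\sum_(1 <= d < z2.+1) \sum_(1 <= e < E.+1) det_wt d * mol_wt e * rpow 1 (lcmn d e)%:R| <=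
  4 * zsum s z2 / det_norm.
Proof.
move=> Ez; have k0 := det_ratio_ge0; have k1 := det_ratio_le1; have zE := zsum1_gt0.
have d0 : forall d, ~~ sqfree d -> det_wt d = 0.
  by move=> d sd; rewrite /det_wt !sieve_wt_sqfree // mulr0 subrr mul0r.
rewrite lcm_form_diag //.
pose c := 4 * zsum s z2 / det_norm.
have c0 : 0 <= c by rewrite divr_ge0 ?(ltW dn0) // mulr_ge0.
apply: le_trans (ler_norm_sum _ _ _) _.
apply: (@le_trans _ _ (\sum_(1 <= q < z2.+1) (if sqfree q then c / zsum 1 E * radsum 1 q E else 0))); last first.
  rewrite -big_mkcond -big_distrr /= -[leRHS]mulr1 -mulrA ler_wpM2l //.
  rewrite mulrC ler_pdivrMr // mul1r; exact: radsum_sum_le.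
apply: ler_sum_nat => q /andP[q0 qz].
have [sq|sq] := boolP (sqfree q); last by rewrite /jordan (negPf sq) mul0r normr0.
have qR : 0 < q%:R :> R by rewrite ltr0n.
have r0 := radsum_ge0 (1 : R) q E.
have U : `|\sum_(1 <= d < z2.+1 | (q %| d)%N) det_wt d * rpow 1 d%:R| <= c / q%:R.
  have -> : \sum_(1 <= d < z2.+1 | (q %| d)%N) det_wt d * rpow 1 d%:R =
    (\sum_(1 <= d < z2.+1 | (q %| d)%N) sieve_wt s z2 d * rpow 1 d%:R -
     det_ratio * \sum_(1 <= d < z1.+1 | (q %| d)%N) sieve_wt s z1 d * rpow 1 d%:R) / det_norm.
    have -> : \sum_(1 <= d < z1.+1 | (q %| d)%N) sieve_wt s z1 d * rpow 1 d%:R =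
        \sum_(1 <= d < z2.+1 | (q %| d)%N) sieve_wt s z1 d * rpow 1 d%:R.
      rewrite [RHS](@big_cat_nat _ _ _ z1.+1) //= [X in _ = _ + X]big1_seq ?addr0 // => d.
      rewrite mem_index_iota => /andP[_ /andP[zd _]].
      by rewrite /sieve_wt divn_small // /zsum big_geq // mulr0 mul0r.
    rewrite big_distrr -sumrB big_distrl /=; apply: eq_bigr => d _; rewrite /det_wt; ring.
  rewrite normrM [X in _ * X]ger0_norm ?invr_ge0 ?(ltW dn0) //.
  rewrite /c [leRHS]mulrAC ler_wpM2r ?invr_ge0 ?(ltW dn0) //.
  apply: le_trans (ler_normB _ _) _; rewrite (normrM det_ratio) (ger0_norm k0).
  have u2 := sieve_wt_inv_multiples s z2 q0; have u1 := sieve_wt_inv_multiples s z1 q0.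
  have := ler_pM k0 (normr_ge0 _) k1 u1.
  have zz : 2 * zsum s z1 / q%:R <= 2 * zsum s z2 / q%:R.
    by rewrite ler_wpM2r ?invr_ge0 ?(ltW qR) // ler_pM2l // zsum_mono.
  move: u2 zz; rewrite mul1r (_ : 4 * zsum s z2 / q%:R = 2 * zsum s z2 / q%:R + 2 * zsum s z2 / q%:R); last by ring.
  move: (_ / _) (_ / _) => v w; lra.
have V : `|\sum_(1 <= e < E.+1 | (q %| e)%N) mol_wt e * rpow 1 e%:R| <= radsum 1 q E / zsum 1 E.
  have -> : \sum_(1 <= e < E.+1 | (q %| e)%N) mol_wt e * rpow 1 e%:R = mu R q * radsum 1 q E / zsum 1 E.
    rewrite -sieve_wt_multiples // big_distrl /=; apply: eq_bigr => e _; rewrite /mol_wt; ring.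
  rewrite normrM [X in _ * X]ger0_norm ?invr_ge0 ?(ltW zE) // ler_wpM2r ?invr_ge0 ?(ltW zE) //.
  by rewrite normrM (ger0_norm r0) -[leRHS]mul1r ler_wpM2r // mu_abs.
have J0 := jordan_ge0 q (ler01 : 0 <= 1 :> R).
have J1 := jordan_le (ler01 : 0 <= 1 :> R) q0.
have qE : rpow (- 1) q%:R = q%:R :> R by rewrite /rpow mulN1r opprK lnK.
rewrite qE in J1.
rewrite !normrM (ger0_norm J0).
have -> : c / zsum 1 E * radsum 1 q E = q%:R * ((c / q%:R) * (radsum 1 q E / zsum 1 E)).
  by field; rewrite !gt_eqF.
by apply: ler_pM (J0) _ J1 _; [rewrite mulr_ge0|apply: ler_pM].
Qed.

(** The normalisation divides the bound [zsum 1 E] of the sieve form by its square; this is the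
    logarithm saved by the mollifier. *)
Lemma mol_form :
  \sum_(1 <= d < E.+1) \sum_(1 <= e < E.+1) mol_wt d * mol_wt e * rpow 1 (lcmn d e)%:R <=
  (zsum 1 E)^-1.
Proof.
have h := zsum1_gt0; have hf := sieve_form_le E (ltr01 : 0 < 1 :> R).
rewrite -(ler_pM2r (mulr_gt0 h h)) [leRHS]mulrA mulVf ?gt_eqF // mul1r; apply: le_trans hf.
rewrite big_distrl /= le_eqVlt; apply/orP; left; apply/eqP.
apply: eq_bigr => d _; rewrite big_distrl /=; apply: eq_bigr => e _; rewrite /mol_wt.
by field; rewrite gt_eqF.
Qed.

End DetectorWeights.

(** The gcd is at most the sum of all common divisors [q]; for each [q] the two variables give
    harmonic sums, and [q] itself gives a third. *)
Lemma inv_lcm_sum_le (R : realType) A B : (0 < A)%N -> (B <= A)%N ->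
  \sum_(1 <= d < A.+1) \sum_(1 <= e < B.+1) (rpow 1 (lcmn d e)%:R : R) <= (1 + ln A%:R) ^+ 3.
Proof.
move=> A0 BA; have AR : 0 < A%:R :> R by rewrite ltr0n.
have l0 : 0 <= 1 + ln A%:R :> R by rewrite addr_ge0 // ln_ge0 // ler1n.
have hle M : (M <= A)%N -> \sum_(1 <= k < M.+1) k%:R^-1 <= 1 + ln A%:R :> R.
  move=> MA; apply: le_trans (harmonic_le_ln _ A0).
  rewrite [leRHS](@big_cat_nat _ _ _ M.+1) //= lerDl; apply: sumr_ge0 => k _.
  by rewrite invr_ge0.
have mult M q : (M <= A)%N -> (0 < q)%N ->
  \sum_(1 <= d < M.+1 | (q %| d)%N) (d%:R^-1 : R) <= q%:R^-1 * (1 + ln A%:R).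
  move=> MA q0; rewrite dvd_sum //.
  rewrite (eq_bigr (fun k => q%:R^-1 * k%:R^-1)); last by move=> k _; rewrite natrM invfM.
  by rewrite -big_distrr ler_wpM2l ?invr_ge0 // hle // (leq_trans (leq_div _ _)).
apply: (@le_trans _ _ (\sum_(1 <= d < A.+1) \sum_(1 <= e < B.+1) \sum_(1 <= q < A.+1)
    (if (q %| d)%N && (q %| e)%N then q%:R * (d%:R^-1 * e%:R^-1) else 0))).
  apply: ler_sum_nat => d /andP[d0 dA]; apply: ler_sum_nat => e /andP[e0 eB].
  rewrite rpow_lcm // !rpow1 ?ltr0n //.
  have g0 : (0 < gcdn d e)%N by rewrite gcdn_gt0 d0.
  rewrite /rpow mulN1r opprK lnK ?posrE ?ltr0n //.
  rewrite (bigD1_seq (gcdn d e)) /=; [|rewrite mem_index_iota g0 /=|exact: iota_uniq].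
    rewrite dvdn_gcdl dvdn_gcdr mulrC lerDl; apply: sumr_ge0 => q _.
    by case: ifP => // _; rewrite !mulr_ge0 ?invr_ge0.
  by rewrite ltnS; apply: leq_trans (dvdn_leq d0 (dvdn_gcdl d e)) _.
rewrite (eq_bigr (fun d => \sum_(1 <= q < A.+1) \sum_(1 <= e < B.+1)
   (if (q %| d)%N && (q %| e)%N then q%:R * (d%:R^-1 * e%:R^-1) else 0))); last first.
  by move=> d _; rewrite exchange_big.
rewrite exchange_big /=.
apply: (@le_trans _ _ (\sum_(1 <= q < A.+1) q%:R^-1 * (1 + ln A%:R) ^+ 2)); last first.
  by rewrite -big_distrl /= exprS ler_wpM2r ?sqr_ge0 // hle.
apply: ler_sum_nat => q /andP[q0 qA]; have qR : 0 < q%:R :> R by rewrite ltr0n.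
have -> : \sum_(1 <= d < A.+1) \sum_(1 <= e < B.+1)
   (if (q %| d)%N && (q %| e)%N then q%:R * (d%:R^-1 * e%:R^-1) else 0) =
   q%:R * ((\sum_(1 <= d < A.+1 | (q %| d)%N) d%:R^-1) * (\sum_(1 <= e < B.+1 | (q %| e)%N) e%:R^-1)) :> R.
  rewrite (big_mkcond (fun d => q %| d)%N) (big_mkcond (fun d => q %| d)%N) /=.
  rewrite big_distrl big_distrr /=; apply: eq_bigr => d _.
  rewrite !big_distrr /=; apply: eq_bigr => e _.
  by case: (q %| d)%N; case: (q %| e)%N; rewrite /= ?mul0r ?mulr0.
have -> : q%:R^-1 * (1 + ln A%:R) ^+ 2 = q%:R * ((q%:R^-1 * (1 + ln A%:R)) * (q%:R^-1 * (1 + ln A%:R))) :> R.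
  by field; rewrite gt_eqF.
rewrite ler_pM2l //; apply: ler_pM; try exact: mult.
all: by apply: sumr_ge0 => k _; rewrite invr_ge0.
Qed.

(** * Zeros in short intervals *)

Lemma pow_double (R : realType) (y b c : R) (n : nat) : 0 <= b -> c <= b * b -> b <= y ^+ n ->
  c <= y ^+ (n + n).
Proof. by move=> b0 hc h; apply: le_trans hc _; rewrite exprD; apply: ler_pM. Qed.

Lemma pow512_ge (R : realType) (y : R) : 17 / 16 <= y -> 13 * (1000 * 1000) * (1000 * 1000) <= y ^+ 512.
Proof.
rewrite -[y in _ <= y -> _]expr1 => h0.
have {}h0 : (1128 / 1000) <= y ^+ 2 by apply: (@pow_double R y (17 / 16) _ 1) h0; clear; lra.
have {}h0 : (1272 / 1000) <= y ^+ 4 by apply: (@pow_double R y (1128 / 1000) _ 2) h0; clear; lra.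
have {}h0 : (1617 / 1000) <= y ^+ 8 by apply: (@pow_double R y (1272 / 1000) _ 4) h0; clear; lra.
have {}h0 : (26 / 10) <= y ^+ 16 by apply: (@pow_double R y (1617 / 1000) _ 8) h0; clear; lra.
have {}h0 : (67 / 10) <= y ^+ 32 by apply: (@pow_double R y (26 / 10) _ 16) h0; clear; lra.
have {}h0 : 44 <= y ^+ 64 by apply: (@pow_double R y (67 / 10) _ 32) h0; clear; lra.
have {}h0 : 1900 <= y ^+ 128 by apply: (@pow_double R y 44 _ 64) h0; clear; lra.
have {}h0 : (3610 * 1000) <= y ^+ 256 by apply: (@pow_double R y 1900 _ 128) h0; clear; lra.
have {}h0 : (13 * (1000 * 1000) * (1000 * 1000)) <= y ^+ 512 by apply: (@pow_double R y (3610 * 1000) _ 256) h0; clear; lra.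
exact: h0.
Qed.

(** The upper limit for [ln T] plus 20 fits under [exp 32], here bounded below by [(17/16)^512]. *)
Lemma expR32_ge (R : realType) : 67 / 10 * 10 ^+ 12 + 20 <= expR 32 :> R.
Proof.
have e0 : 17 / 16 <= expR (1 / 16) :> R by have := expR_ge1Dx (1 / 16 : R); lra.
have -> : 32 = 512%:R * (1 / 16) :> R by field.
rewrite expRM_natl; apply: le_trans (pow512_ge e0).
have -> : 10 ^+ 12 = (1000 * 1000) * (1000 * 1000) :> R.
  have -> : 1000 = 10 ^+ 3 :> R by rewrite -natrX.
  by rewrite -!exprD.
rewrite -(mulrA 13); have m : 4 <= 1000 * 1000 * (1000 * 1000) :> R.
  by rewrite -!natrM ler_nat.
by move: (1000 * 1000 * (1000 * 1000)) m; clear => z m; lra.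
Qed.

Lemma expR1_le4 (R : realType) : expR 1 <= 4 :> R.
Proof.
have /andP[h _] := ln2_bounds R.
have k : expR (1 / 2) <= 2 :> R by rewrite -[leRHS]lnK ?posrE // ler_expR.
have -> : expR 1 = expR (1 / 2) * expR (1 / 2) :> R by rewrite -expRD -splitr.
by apply: (@le_trans _ _ (2 * 2)); [apply: ler_pM; rewrite ?expR_ge0|rewrite -natrM].
Qed.

Lemma expR_unpack (R : realType) (n L X P : R) : 0 < L -> L <= expR P ->
  (2 * L)^-1 * expR n <= expR X * expR P -> n <= 1 + P + X + P.
Proof.
move=> L0 LP; rewrite ler_pdivrMl ?mulr_gt0 // => h; rewrite -ler_expR; apply: le_trans h _.
rewrite mulrA 3!expRD; apply: ler_wpM2r; first exact: expR_ge0.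
apply: ler_wpM2r; first exact: expR_ge0.
have e2 : 2 <= expR 1 :> R by exact: expR_ge1Dx.
by apply: ler_pM (ler0n _ _) (ltW L0) e2 LP.
Qed.

Section ZeroCounts.
Variable R : realType.
Local Notation C := R[i].
Implicit Types (s w c z rho : C) (x y u v t r a : R) (d k n m N X : nat) (rs : seq C).
Variable zeta : Cplx R -> Cplx R.
Hypothesis hz : is_riemann_zeta zeta.

(** The identity of the zeta series with its inverse, exact at finite level because the double sum
    is cut by the product [d k <= X]. *)
Lemma dsum_mu s X : (0 < X)%N ->
  \sum_(1 <= d < X.+1) (mu R d)%:C%C * cpow s d%:R * dsum s 1 (X %/ d).+1 = 1.
Proof.
move=> X0.
transitivity (\sum_(1 <= d < X.+1) \sum_(1 <= n < X.+1) (if (d %| n)%N then (mu R d)%:C%C * cpow s n%:R else 0)).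
  apply: eq_big_nat => d /andP[d0 dX]; rewrite -big_mkcond dvd_sum // /dsum big_distrr /=.
  by apply: eq_big_nat => k /andP[k0 _]; rewrite natrM cpowM ?ltr0n // mulrA.
rewrite exchange_big /= big_ltn // [X in _ + X]big1_seq ?addr0; last first.
  move=> n /andP[_]; rewrite mem_index_iota => /andP[n1 nX]; rewrite -big_mkcond -big_distrl /=.
  have n0 := ltnW n1.
  have := @mu_sum R 1 n n0 (dvd1n _).
  have -> : primes n == primes 1 = false.
    apply/eqP => e; have : pdiv n \in primes n by rewrite mem_primes pdiv_prime // pdiv_dvd n0.
    by rewrite e.
  rewrite -(@divisor_sum_range _ n X (fun d => 1 %| d)%N) ?n0 // => e0.
  rewrite -(rmorph_sum (real_complex R)) /=.
  have -> : \sum_(1 <= i < X.+1 | (i %| n)%N) mu R i = 0.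
    by rewrite -{2}e0; apply: eq_bigl => d; rewrite dvd1n.
  by rewrite mul0r.
rewrite big_ltn // dvdnn mu1 mul1r cpow_one big1_seq ?addr0 // => d /andP[_].
rewrite mem_index_iota => /andP[d1 _]; rewrite dvdn1 ifF //.
by apply/eqP => e; rewrite e in d1.
Qed.

Lemma dsum_tail s u N M : 0 < u -> 1 + u <= complex.Re s -> (0 < N <= M)%N ->
  normc (dsum s 1 M.+1 - dsum s 1 N.+1) <= rpow u N%:R / u.
Proof.
move=> u0 su /andP[N0 NM].
have -> : dsum s 1 M.+1 - dsum s 1 N.+1 = \sum_(N.+1 <= n < M.+1) cpow s n%:R.
  by rewrite /dsum (@big_cat_nat _ _ _ N.+1 1 M.+1) //= addrAC subrr add0r.
apply: le_trans (cabs_sum _ _ _) _.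
apply: (@le_trans _ _ (zsum (u + 1) M - zsum (u + 1) N)).
  have -> : zsum (u + 1) M - zsum (u + 1) N = \sum_(N.+1 <= n < M.+1) rpow (u + 1) n%:R.
    by rewrite /zsum (@big_cat_nat _ _ _ N.+1 1 M.+1) //= addrAC subrr add0r.
  apply: ler_sum_nat => n /andP[n0 _]; rewrite cabs_cpow /rpow ler_expR lerN2 ler_wpM2r //.
    by rewrite ln_ge0 // ler1n; apply: leq_trans n0.
  by rewrite addrC.
have := @zsum_diff R u N M u0; rewrite N0 => /(_ NM) /andP[_ h]; apply: le_trans h _.
by rewrite ler_wpM2r ?invr_ge0 ?(ltW u0) // gerBl rpow_ge0.
Qed.

Lemma zeta_dsum s u N : 0 < u -> 1 + u <= complex.Re s -> (0 < N)%N ->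
  normc (zeta s - dsum s 1 N.+1 : C) <= rpow u N%:R / u.
Proof.
move=> u0 su N0; apply/ler_addgt0Pr => e e0.
have s1 : 1 < complex.Re s by apply: lt_le_trans su; rewrite ltrDl.
have sp : 0 < normc (s - 1).
  by rewrite cabs_gt0 subr_eq0; apply/eqP => k; move: s1; rewrite k /= ltxx.
have e2 : 0 < e / 2 by rewrite divr_gt0.
have [n1 h1] := zeta_approx_gt1 hz s1 e2.
have x0 : 0 < complex.Re s - 1 by rewrite subr_gt0.
have [n2 h2] := rpow_small x0 (mulr_gt0 sp e2).
pose M := maxn N (maxn n1 n2).
have M1 : (n1 <= M.+1)%N by rewrite /M; apply: leqW; rewrite !leq_max leqnn orbT.
have M2 : (n2 <= M.+1)%N by rewrite /M; apply: leqW; rewrite !leq_max leqnn !orbT.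
have NM : (0 < N <= M)%N by rewrite N0 leq_maxl.
have k1 := h1 _ M1; have k2 := h2 _ M2; have k3 := dsum_tail u0 su NM.
have k4 : normc (cpow (s - 1) M.+1%:R / (s - 1)) <= e / 2.
  by rewrite Normc.normcM Normc.normcV cabs_cpow ReD ReN /= ler_pdivrMr // mulrC.
have -> : zeta s - dsum s 1 N.+1 = (zeta s - zeta_trunc s M.+1) + cpow (s - 1) M.+1%:R / (s - 1) +
   (dsum s 1 M.+1 - dsum s 1 N.+1) :> C by rewrite /zeta_trunc; ring.
apply: le_trans (cabsD _ _) _; rewrite addrC; apply: lerD k3 _.
apply: le_trans (cabsD _ _) _; apply: le_trans (lerD k1 k4) _; by rewrite -splitr.
Qed.

(** The partial sums [A] of the inverse series have modulus at most [1 + 1 / u], and [Z * A] tends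
    to 1. In the error, half of the exponent [u] is given up to keep the sum over [d] convergent,
    and the other half tends to 0 with [N]. *)
Lemma zeta_lower u t : 0 < u -> u / (1 + u) <= normc (zeta ((1 + u) +i* t)%C : C).
Proof.
move=> u0; set s : C := (_ +i* _)%C; set Z : C := zeta s.
have su : 1 + u <= complex.Re s by [].
rewrite ler_pdivrMr ?addr_gt0 //.
suff h : 1 <= normc Z * (1 + u^-1).
  have := ler_wpM2l (ltW u0) h; rewrite mulr1 mulrCA => h'; apply: le_trans h' _.
  by rewrite mulrDr mulr1 divff ?gt_eqF // addrC.
apply/ler_addgt0Pr => e e0.
have u2 : 0 < u / 2 by rewrite divr_gt0.
have K0 : 0 < u^-1 * (1 + (u / 2)^-1) by rewrite mulr_gt0 ?addr_gt0 ?invr_gt0.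
have [n0 hn0] := rpow_small u2 (divr_gt0 e0 K0).
(* Twice [N], so that the integer part of [X / d] is at least [N / d] for every [d <= X]. *)
pose N := n0.+1; pose X := N.*2.
have X0 : (0 < X)%N by [].
have NR : 0 < N%:R :> R by rewrite ltr0n.
pose A : C := \sum_(1 <= d < X.+1) (mu R d)%:C%C * cpow s d%:R.
have absA : normc A <= 1 + u^-1.
  apply: le_trans (cabs_sum _ _ _) _; apply: le_trans (zsum_le_inv X u0).
  apply: ler_sum => d _; rewrite Normc.normcM cabs_real cabs_cpow.
  by rewrite -[leRHS]mul1r [complex.Re s]addrC ler_wpM2r ?rpow_ge0 ?mu_abs.
have E : Z * A - 1 = \sum_(1 <= d < X.+1) (mu R d)%:C%C * cpow s d%:R * (Z - dsum s 1 (X %/ d).+1).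
  rewrite -(dsum_mu s X0) /A big_distrr -sumrB /=; apply: eq_bigr => d _; ring.
have B : normc (Z * A - 1) <= e.
  rewrite E; apply: le_trans (cabs_sum _ _ _) _.
  apply: (@le_trans _ _ (\sum_(1 <= d < X.+1) rpow (u / 2 + 1) d%:R * (u^-1 * rpow (u / 2) N%:R))); last first.
    rewrite -big_distrl /= -/(zsum (u / 2 + 1) X).
    have h1 := zsum_le_inv X u2; have h2 := hn0 N (leqnSn _).
    rewrite ler_pdivlMr // in h2; apply: le_trans h2; rewrite mulrC.
    have -> : rpow (u / 2) N%:R * (u^-1 * (1 + (u / 2)^-1)) =
      (u^-1 * rpow (u / 2) N%:R) * (1 + (u / 2)^-1) by ring.
    by rewrite ler_wpM2l // mulr_ge0 ?rpow_ge0 // invr_ge0 ltW.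
  apply: ler_sum_nat => d /andP[d0 dX]; rewrite ltnS in dX.
  have dR : 0 < d%:R :> R by rewrite ltr0n.
  have q0 : (0 < X %/ d)%N by rewrite divn_gt0.
  rewrite 2!Normc.normcM cabs_real cabs_cpow.
  apply: (@le_trans _ _ (1 * rpow (1 + u) d%:R * (rpow u (X %/ d)%:R / u))).
    apply: ler_pM; rewrite ?mulr_ge0 ?cabs_ge0 ?rpow_ge0 //.
      by rewrite ler_wpM2r ?rpow_ge0 ?mu_abs.
    exact: zeta_dsum.
  have qN : N%:R / d%:R <= (X %/ d)%:R :> R.
    rewrite ler_pdivrMr // -natrM ler_nat.
    have := ltn_ceil X d0; move: q0; rewrite /X -addnn.
    have := ltn_pmod (N + N) d0; have := divn_eq (N + N) d.
    move: ((N + N) %/ d)%N => q e1 e2 q0 e3.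
    have : (d <= q * d)%N by rewrite leq_pmull.
    move: e1 e2 e3; clear; lia.
  have Nd : 0 < N%:R / d%:R :> R by rewrite divr_gt0.
  have h1 : rpow u (X %/ d)%:R <= rpow (u / 2) (N%:R / d%:R) :> R.
    apply: (@le_trans _ _ (rpow (u / 2) (X %/ d)%:R)).
      by rewrite /rpow ler_expR lerN2 ler_wpM2r ?ln_ge0 ?ler1n //; move: u0; clear; lra.
    by apply: rpow_anti => //; exact: ltW.
  have h2 : rpow (u / 2) (N%:R / d%:R) = rpow (u / 2) N%:R * rpow (- (u / 2)) d%:R :> R.
    by rewrite rpowM ?invr_gt0 //; congr (_ * _); rewrite /rpow lnV ?posrE // mulrN mulNr.
  rewrite mul1r; apply: (@le_trans _ _ (rpow (1 + u) d%:R * (rpow (u / 2) N%:R * rpow (- (u / 2)) d%:R / u))).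
    by rewrite ler_wpM2l ?rpow_ge0 // ler_wpM2r ?invr_ge0 ?(ltW u0) // -h2.
  have -> : u / 2 + 1 = (1 + u) + - (u / 2) by field.
  rewrite [in leRHS]rpowD le_eqVlt; apply/orP; left; apply/eqP; ring.
have n1 : normc (1 : C) = 1 by rewrite /= expr1n expr0n /= addr0 sqrtr1.
have := cabsB (Z * A) (Z * A - 1); rewrite subKr n1 Normc.normcM => h.
apply: le_trans h _; apply: lerD => //.
by rewrite ler_wpM2l ?cabs_ge0.
Qed.

(** [zeros_in_disc] around a point right of the line, with [zeta_lower] at the centre and
    [zeta_upper] on the circle; [r] is a slightly larger radius for the continuation of [zeta]. *)
Lemma zeros_disc_count (a t r1 r2 r x dd : R) N rs : let c : C := ((1 + a) +i* t)%C in
  0 < a -> 0 < r1 -> r1 < r2 -> r2 < r -> r < normc (c - 1) -> 1 / 2 + r <= 1 + a -> 1 + a + r <= 2 ->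
  r2 <= x + a -> 0 <= x -> x <= 1 / 2 -> 0 < dd -> dd <= normc (c - 1) - r2 -> (0 < N)%N ->
  1 + a + t + r2 <= N%:R -> 0 <= t ->
  uniq rs -> (forall q, q \in rs -> normc (q - c) <= r1 /\ zeta q = 0) ->
  a / (1 + a) * ((r2 - r1) / r1) ^+ size rs <= expR (x * ln N%:R) * (17 + ln N%:R + dd^-1).
Proof.
move=> c a0 r10 r12 r2r rc rl rh xa x0 x12 d0 dc N0 cN t0 ur hr.
have w1 w : normc (w - c) <= r2 -> dd <= normc (w - 1).
  move=> hw; have := cabs_tri c w 1; rewrite (cabsBC c w); move: dc hw; clear; lra.
have wn1 w : normc (w - c) <= r2 -> w != 1.
  by move=> /w1 h; apply/eqP => e; move: h; rewrite e subrr leNgt (_ : normc 0 = 0) ?d0 //; apply/eqP; rewrite cabs_eq0.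
apply: (@le_trans _ _ (normc (zeta c : C) * ((r2 - r1) / r1) ^+ size rs)).
  rewrite ler_wpM2r ?zeta_lower // exprn_ge0 // divr_ge0 ?(ltW r10) // subr_ge0 ltW //.
apply: (@zeros_in_disc R (zeta : C -> C) c r1 r2) => //.
  by move=> z hz'; apply: zeta_cderiv => //; exact: wn1.
move=> w hw; have hw' : normc (w - c) <= r2 by rewrite hw.
have dRe : `|complex.Re w - (1 + a)| <= r2.
  by apply: le_trans hw'; apply: le_trans (cabs_Re _); rewrite ReD ReN.
case/ler_normlP: dRe => e1 e2.
apply: zeta_upper (w1 _ hw') _ N0 => //.
- by apply: (@zeta_approx_disc R zeta hz a t r) => //; apply: le_lt_trans hw' _.
- by move: e1 xa; clear; lra.
- by move: e2 r2r rh; clear; lra.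
have cn : normc c <= 1 + a + t.
  by apply: le_trans (cabs_ReIm _) _; rewrite /= !ger0_norm // addr_ge0 // ltW.
by have := cabsD (w - c) c; rewrite subrK => h; apply: le_trans h _; apply: le_trans cN; move: cn hw'; clear; lra.
Qed.

Lemma size_fibers (T : eqType) (f : T -> nat) (J : nat) (B : R) (rs : seq T) : 0 <= B ->
  (forall q, q \in rs -> (f q < J)%N) ->
  (forall j, (j < J)%N -> (count (fun q => f q == j) rs)%:R <= B) -> (size rs)%:R <= J%:R * B.
Proof.
move=> B0 hf hc.
have -> : size rs = (\sum_(0 <= j < J) count (fun q => f q == j) rs)%N.
  have : all (fun q => f q < J)%N rs by apply/allP.
  elim: (rs) => [|q qs ih] /=; first by rewrite big1.
  case/andP=> q1 /ih ->; rewrite big_split /= -add1n; congr (_ + _)%N.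
  rewrite (bigD1_seq (f q)) /=; [|by rewrite mem_index_iota|exact: iota_uniq].
  by rewrite eqxx big1 // => j; rewrite eq_sym => /negPf ->.
rewrite natr_sum; apply: (@le_trans _ _ (\sum_(0 <= j < J) B)); last first.
  by rewrite sumr_const_nat subn0 mulr_natl.
by apply: ler_sum_nat => j /andP[_ jJ]; exact: hc.
Qed.

Definition strip_zero rho := [/\ zeta rho = 0, 985 / 1000 <= complex.Re rho,
  complex.Re rho < 1 & 0 < complex.Im rho].

(** The disc of radius 0.021 around [1.005 + i t] covers the box, and radius 0.05 still avoids the
    pole. The ratio of radii exceeds [1.16 ^ 2], and Bernoulli turns the exponential growth in the
    number of zeros into a quadratic one, enough for small ordinates. *)
Lemma low_zero_box (t : R) N rs : 55 / 1000 <= t -> t + 2 <= N%:R -> uniq rs ->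
  (forall q, q \in rs -> strip_zero q /\ `|complex.Im q - t| <= 5 / 1000) ->
  (1 + 16 / 100 * (size rs)%:R) ^+ 2 <= 202 * (expR (45 / 1000 * ln N%:R) * (217 + ln (N%:R : R))).
Proof.
move=> t0 tN ur hr.
pose c : C := ((1 + 5 / 1000) +i* t)%C.
have t00 : 0 <= t by move: t0; clear; lra.
have N0 : (0 < N)%N by rewrite -(ltr_nat R); apply: lt_le_trans tN; move: t0; clear; lra.
have cc : 55 / 1000 <= normc (c - 1).
  apply: le_trans (cabs_Im _); rewrite ImD ImN /= subr0; apply: le_trans t0 (ler_norm _).
have := @zeros_disc_count (5 / 1000) t (21 / 1000) (5 / 100) (51 / 1000) (45 / 1000) (1 / 200) N rs.
rewrite -/c.
have a1 : (0 : R) < 5 / 1000 by move: t00; clear; lra.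
have a2 : (0 : R) < 21 / 1000 by move: t00; clear; lra.
have a3 : (21 / 1000 : R) < 5 / 100 by move: t00; clear; lra.
have a4 : (5 / 100 : R) < 51 / 1000 by move: t00; clear; lra.
have a5 : 51 / 1000 < normc (c - 1) by move: cc; clear; lra.
have a6 : 1 / 2 + 51 / 1000 <= 1 + 5 / 1000 :> R by move: t00; clear; lra.
have a7 : 1 + 5 / 1000 + 51 / 1000 <= 2 :> R by move: t00; clear; lra.
have a8 : 5 / 100 <= 45 / 1000 + 5 / 1000 :> R by move: t00; clear; lra.
have a9 : 0 <= 45 / 1000 :> R by move: t00; clear; lra.
have b1 : 45 / 1000 <= 1 / 2 :> R by move: t00; clear; lra.
have b2 : (0 : R) < 1 / 200 by move: t00; clear; lra.
have b3 : 1 / 200 <= normc (c - 1) - 5 / 100 by move: cc; clear; lra.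
have b4 : 1 + 5 / 1000 + t + 5 / 100 <= N%:R by apply: le_trans tN; move: t00; clear; lra.
move=> /(_ a1 a2 a3 a4 a5 a6 a7 a8 a9 b1 b2 b3 N0 b4 t00 ur) h.
have hq q : q \in rs -> normc (q - c) <= 21 / 1000 /\ zeta q = 0.
  move=> /hr [[z0 x1 x2 _] /ler_normlP [y1 y2]]; split=> //.
  apply: le_of_sqr_le; first by move: t00; clear; lra.
  rewrite cabs_sqr ReD ImD ReN ImN /= !expr2; move: x1 x2 y1 y2.
  move: (complex.Re q) (complex.Im q); clear => u v; nra.
have {}h := h hq.
have e1 : (1 / 200 : R)^-1 = 200 by rewrite invf_div divr1.
clear a1 a2 a3 a4 a5 a6 a7 a8 a9 b1 b2 b3 b4 cc.
rewrite e1 in h.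
have k : (116 / 100 : R) ^+ 2 <= (5 / 100 - 21 / 1000) / (21 / 1000) by rewrite expr2; move: t00; clear; lra.
have k2 : (1 + 16 / 100 * (size rs)%:R) ^+ 2 <= (((5 / 100 - 21 / 1000) / (21 / 1000)) ^+ size rs : R).
  apply: (@le_trans _ _ (((116 / 100) ^+ 2) ^+ size rs)); last by apply: pow_le k; exact: sqr_ge0.
  rewrite -exprM mulnC exprM; apply: pow_le; first by apply: addr_ge0 => //; apply: mulr_ge0 (ler0n _ _); move: t00; clear; lra.
  have e2 : 1 + 16 / 100 = 116 / 100 :> R by move: t00; clear; lra.
  have hb : (0 : R) <= 16 / 100 by move: t00; clear; lra.
  by have := @bernoulli_ineq R (16 / 100) (size rs) hb; rewrite e2 [_%:R * _]mulrC.
apply: le_trans k2 _; move: h; rewrite (_ : 17 + ln N%:R + 200 = 217 + ln N%:R :> R); last by ring.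
set S := _ ^+ size rs; set P := _ * (217 + _).
have S0 : 0 <= S by apply: exprn_ge0; move: t00; clear; lra.
have q1 : 1 / 202 <= 5 / 1000 / (1 + 5 / 1000) :> R.
  by rewrite ler_pdivlMr; move: t00; clear; lra.
clearbody S P => q3; move: (le_trans (ler_wpM2r S0 q1) q3); clear; lra.
Qed.

(** The ordinates are cut into intervals of length 1/100, at most [101 * T0] of them. *)
Lemma low_zero_count (T0 : R) N rs : 1 <= T0 -> T0 + 3 <= N%:R -> uniq rs ->
  (forall q, q \in rs -> strip_zero q /\ complex.Im q < T0) ->
  (size rs)%:R <= 101 * T0 * (850 + 202 * (expR (45 / 1000 * ln N%:R) * (217 + ln N%:R)) / 86).
Proof.
move=> T1 TN ur hr; have T00 : 0 <= T0 by move: T1; clear; lra.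
set Q := 202 * _; have Q0 : 0 <= Q.
  apply: mulr_ge0 (ler0n _ _) _; apply: mulr_ge0 (expR_ge0 _) _.
  apply: addr_ge0 (ler0n _ _) _; rewrite ln_ge0 //; move: T1 TN; clear; lra.
pose f (q : C) := Num.trunc (100 * complex.Im q).
pose J := (Num.trunc (100 * T0)).+1.
have h100 : 0 <= 100 * T0 by move: T00; clear; lra.
have /andP[J1 J2] := truncn_itv h100.
have fq q : q \in rs -> (f q)%:R <= 100 * complex.Im q < (f q).+1%:R.
  move=> /hr [[_ _ _ g0] _]; apply: truncn_itv; move: g0; clear; lra.
have fJ q : q \in rs -> (f q < J)%N.
  move=> qr; have /andP[h1 _] := fq q qr; have [_ h2] := hr q qr.
  rewrite -(ltr_nat R); apply: le_lt_trans J2; apply: le_trans h1 _; move: h2; clear; lra.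
have B0 : 0 <= 850 + Q / 86 by move: Q0; clear; lra.
apply: le_trans (size_fibers B0 fJ _) _; last first.
  rewrite ler_wpM2r // /J -[_.+1%:R]natr1; move: J1 T1; clear; lra.
move=> j jJ; rewrite -size_filter; set qs : seq C := [seq q <- rs | f q == j].
pose t : R := j%:R / 100 + 5 / 1000.
have tE : 100 * t = j%:R + 1 / 2 by rewrite /t; field.
have hq q : q \in qs -> strip_zero q /\ `|complex.Im q - t| <= 5 / 1000.
  rewrite mem_filter => /andP[/eqP fj qr]; have [z _] := hr q qr; split=> //.
  have := fq q qr; rewrite fj -[j.+1%:R]natr1 => /andP[h1 h2].
  by apply/ler_normlP; split; move: tE h1 h2; clear; lra.
have uq : uniq qs by exact: filter_uniq.
have [->|qs0] := eqVneq (size qs) 0%N; first exact: B0.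
have t55 : 55 / 1000 <= t.
  have [q qq] : exists q, q \in qs.
    by case: qs qs0 {hq uq} => [|q qs'] // _; exists q; rewrite mem_head.
  have [[z0 x1 x2 g0] /ler_normlP [y1 y2]] := hq q qq.
  (* Zeros of ordinate below 0.05 would lie within 1/17 of the pole, where there are none; hence the
     centre is at height at least 0.055. *)
  have j5 : (5 <= j)%N.
    rewrite leqNgt; apply/negP => j4.
    have jr : j%:R <= 4 :> R by rewrite ler_nat -ltnS.
    have gs : complex.Im q < 5 / 100.
      have := fq q; move: qq; rewrite mem_filter => /andP[/eqP fj qr] /(_ qr) /andP[_].
      rewrite fj -[j.+1%:R]natr1; move: jr; clear; lra.
    have : normc (q - 1) <= 1 / 17.
      apply: le_of_sqr_le; first by clear -jr; lra.
      rewrite cabs_sqr ReD ImD ReN ImN /= !expr2; move: x1 x2 g0 gs.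
      move: (complex.Re q) (complex.Im q); clear => u v; nra.
    by move/(zeta_neq0_near1 hz x1 x2 g0); rewrite z0 eqxx.
  have j5R : 5 <= j%:R :> R by rewrite (ler_nat R 5).
  move: tE j5R; clear; lra.
have tN : t + 2 <= N%:R.
  have jr : j%:R <= 100 * T0.
    by apply: le_trans J1; rewrite ler_nat -ltnS.
  move: jr tE TN T1; clear; lra.
have := low_zero_box t55 tN uq hq; rewrite -/Q => h.
have n0 : 0 <= (size qs)%:R :> R by exact: ler0n.
(* The tangent at 269 turns the quadratic bound into a linear one: [2 * 0.16 * 269 > 86] and
   [269 ^ 2 / 86 < 850]. *)
have := sqr_ge0 (16 / 100 * (size qs)%:R - 269 : R); move: h; rewrite sqrrD sqrrB expr1n mul1r.
clearbody Q; move: n0; move: (size qs)%:R; clear => n n0; rewrite !expr2; lra.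
Qed.

(** The box lies within [r1 = 21 / L + delta] of [1 + 1 / L + i t]. Enlarging the radius five times
    gives growth by [4 >= e] per zero, so the count is the logarithm of the bounds:
    [5 r1 (L + 1) <= 106 + 5 delta L] for the power of [N], and 32 for each of the two factors of
    order [L]. *)
Lemma main_zero_box (t L delta : R) N rs : 100 * 1000 <= L -> L <= 67 / 10 * 10 ^+ 12 ->
  0 <= delta -> delta <= 15 / 1000 -> 1 <= t -> t + 2 <= N%:R -> ln (N%:R : R) <= L + 1 -> uniq rs ->
  (forall q, q \in rs -> [/\ zeta q = 0, 1 - delta <= complex.Re q, complex.Re q < 1 &
     `|complex.Im q - t| <= 20 / L]) ->
  (size rs)%:R <= 175 + 5 * (delta * L).
Proof.
move=> L1 L2 d0 d1 t1 tN NL ur hr.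
have L0 : 0 < L by move: L1; clear; lra.
have Ln0 : L != 0 by rewrite gt_eqF.
pose u := L^-1; have u0 : 0 < u by rewrite invr_gt0.
have uL : u * L = 1 by rewrite mulVf.
have us1 : 1000 * u <= 1 / 100.
  by have := ler_wpM2l (ltW u0) L1; rewrite uL; clear; lra.
pose r1 := 21 * u + delta.
pose c : C := ((1 + u) +i* t)%C.
have cc : 1 <= normc (c - 1).
  apply: le_trans (cabs_Im _); rewrite ImD ImN /= subr0; apply: le_trans t1 (ler_norm _).
have N0 : (0 < N)%N by rewrite -(ltr_nat R); apply: lt_le_trans tN; move: t1; clear; lra.
have a2 : 0 < r1 by move: u0 d0; rewrite /r1; clear; lra.
have a3 : r1 < 5 * r1 by move: a2; clear; lra.
have r1s : 5 * r1 <= 1 / 10 by move: us1 d1 u0; rewrite /r1; clear; lra.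
have a4 : 5 * r1 < 2 / 10 by move: r1s; clear; lra.
have a5 : 2 / 10 < normc (c - 1) by move: cc; clear; lra.
have a6 : 1 / 2 + 2 / 10 <= 1 + u by move: u0; clear; lra.
have a7 : 1 + u + 2 / 10 <= 2 by move: us1 u0; clear; lra.
have a8 : 5 * r1 <= 5 * r1 + u by move: u0; clear; lra.
have a9 : 0 <= 5 * r1 by move: a2; clear; lra.
have b1 : 5 * r1 <= 1 / 2 by move: r1s; clear; lra.
have b2 : (0 : R) < 1 / 2 by move: u0; clear; lra.
have b3 : 1 / 2 <= normc (c - 1) - 5 * r1 by move: cc r1s; clear; lra.
have b4 : 1 + u + t + 5 * r1 <= N%:R by apply: le_trans tN; move: us1 u0 r1s; clear; lra.
have t0 : 0 <= t by move: t1; clear; lra.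
have hq q : q \in rs -> normc (q - c) <= r1 /\ zeta q = 0.
  move=> /hr [z0 x1 x2 y]; split=> //; apply: le_trans (cabs_ReIm _) _.
  rewrite ReD ReN ImD ImN /=.
  have : `|complex.Re q - (1 + u)| <= u + delta.
    by apply/ler_normlP; split; move: x1 x2 u0 d0; clear; lra.
  move: y; rewrite -/u /r1; clear; lra.
have := zeros_disc_count u0 a2 a3 a4 a5 a6 a7 a8 a9 b1 b2 b3 N0 b4 t0 ur hq.
have -> : (5 * r1 - r1) / r1 = 4 by field; rewrite gt_eqF.
have -> : (1 / 2 : R)^-1 = 2 by rewrite invf_div divr1.
move=> h; set n := (size rs) in h *.
have e4 : expR n%:R <= 4 ^+ n :> R.
  rewrite -[n%:R]mulr1 expRM_natl; apply: pow_le; first exact: expR_ge0.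
  exact: expR1_le4.
have lo : (2 * L)^-1 <= u / (1 + u).
  rewrite invfM -/u mulrC ler_wpM2l ?(ltW u0) // lef_pV2 ?posrE ?ltr0n ?addr_gt0 //.
  move: us1 u0; clear; lra.
have big : L + 20 <= expR 32 by apply: le_trans (expR32_ge R); rewrite lerD2r.
have l0 : 0 <= ln N%:R :> R by rewrite ln_ge0 // ler1n.
have h1 : (2 * L)^-1 * expR n%:R <= expR (106 + 5 * (delta * L)) * expR 32.
  apply: (@le_trans _ _ (u / (1 + u) * 4 ^+ n)).
    apply: ler_pM (expR_ge0 _) lo e4; rewrite invr_ge0; apply: mulr_ge0 (ler0n _ _) (ltW L0).
  apply: le_trans h _; apply: ler_pM; rewrite ?expR_ge0 //.
  - by move: l0; clear; lra.
  - rewrite ler_expR; apply: (@le_trans _ _ (5 * r1 * (L + 1))); first by rewrite ler_wpM2l.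
    have -> : 5 * r1 * (L + 1) = 105 * (u * L) + 5 * (delta * L) + 105 * u + 5 * delta by rewrite /r1; ring.
    by rewrite uL; move: us1 d1 u0; clear; lra.
  by apply: le_trans big; move: NL; clear; lra.
have LP : L <= expR 32 by apply: le_trans big; rewrite lerDl ler0n.
have := expR_unpack L0 LP h1; clear -L0; lra.
Qed.

End ZeroCounts.

(** * The mollified kernel *)

Section Kernel.
Variable R : realType.
Local Notation C := R[i].
Implicit Types (s c : C) (u v w x y h : R) (d e k n m A B X j J : nat).

Lemma cabs_subR x y : normc (x%:C%C - y%:C%C) = `|x - y|.
Proof. rewrite (_ : x%:C%C - y%:C%C = (x - y)%:C%C) ?cabs_real //; exact: (esym (rmorphB (real_complex R) x y)). Qed.

Lemma trunc_bounds u : 1 <= u -> [/\ (0 < Num.trunc u)%N, (Num.trunc u)%:R <= u,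
  u < (Num.trunc u).+1%:R & u <= 2 * (Num.trunc u)%:R].
Proof.
move=> u1; have u0 : 0 <= u by apply: le_trans u1.
have /andP[h1 h2] := truncn_itv u0.
have M0 : (0 < Num.trunc u)%N by rewrite -ltnS -(ltr_nat R); exact: le_lt_trans u1 h2.
split=> //; apply: le_trans (ltW h2) _; rewrite -natrM ler_nat; move: M0; clear; lia.
Qed.

(** Rounding the two real endpoints to integers costs 1 each on top of the 400 of [em_err_large]. *)
Lemma dsum_window_main s u v : expR (100 * 1000) <= u -> u <= v -> 985 / 1000 <= complex.Re s ->
  complex.Re s <= 11 / 10 -> 0 < complex.Im s -> complex.Im s <= u ^+ 3 ->
  normc (dsum s (Num.trunc u).+1 (Num.trunc v).+1 - (cpow (s - 1) u - cpow (s - 1) v) / (s - 1)) <=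
  402 * rpow (complex.Re s - 14 / 15) u.
Proof.
move=> u1 uv x1 x2 t0 t3.
have e1 : 1 <= expR (100 * 1000) :> R by rewrite -[leLHS]expR0 ler_expR; apply: mulr_ge0; exact: ler0n.
have u11 := le_trans e1 u1; have v11 := le_trans u11 uv.
have u0 : 0 < u by apply: lt_le_trans u11.
have v0 : 0 < v by apply: lt_le_trans uv.
have s1 : s != 1 by apply/eqP => e; move: t0; rewrite e /= ltxx.
have [U0 U1 U2 _] := trunc_bounds u11; have [V0 V1 V2 _] := trunc_bounds v11.
set M := Num.trunc u in U0 U1 U2 *; set N := Num.trunc v in V0 V1 V2 *.
have MN : (M <= N)%N by rewrite -ltnS -(ltr_nat R); apply: le_lt_trans (le_trans U1 uv) V2.
have th : 0 <= complex.Re s - 14 / 15 by move: x1; clear; lra.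
have s0 : 0 <= complex.Re s by move: x1; clear; lra.
have lM : 100 * 1000 <= ln (M.+1%:R : R).
  rewrite -[leLHS]expRK ler_ln ?posrE ?expR_gt0 ?ltr0n //; apply: le_trans u1 (ltW U2).
have t3' : complex.Im s <= M.+1%:R ^+ 3.
  by apply: le_trans t3 _; apply: pow_le; rewrite ltW.
have h1 := em_err_large lM (MN : (M.+1 <= N.+1)%N) x1 x2 t0 t3'.
have h1' : normc (em_err s M.+1 N.+1) <= 400 * rpow (complex.Re s - 14 / 15) u.
  apply: le_trans h1 _; apply: ler_wpM2l; first exact: ler0n.
  by apply: rpow_anti => //; exact: ltW.
have r15 : rpow (complex.Re s) u <= rpow (complex.Re s - 14 / 15) u.
  by rewrite /rpow ler_expR lerN2 ler_wpM2r ?ln_ge0 // gerBl; apply: divr_ge0; exact: ler0n.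
have h2 : normc ((cpow (s - 1) u - cpow (s - 1) M.+1%:R) / (s - 1)) <= rpow (complex.Re s - 14 / 15) u.
  apply: le_trans (cpow_int_le u0 (ltW U2) s0 s1) _; apply: le_trans r15.
  have d1 : M.+1%:R - u <= 1 by rewrite -[M.+1%:R]natr1; move: U1; clear; lra.
  by have := ler_wpM2l (rpow_ge0 (complex.Re s) u) d1; rewrite mulr1.
have h3 : normc ((cpow (s - 1) v - cpow (s - 1) N.+1%:R) / (s - 1)) <= rpow (complex.Re s - 14 / 15) u.
  apply: le_trans (cpow_int_le v0 (ltW V2) s0 s1) _; apply: le_trans r15.
  apply: (@le_trans _ _ (rpow (complex.Re s) v * 1)).
    have d1 : N.+1%:R - v <= 1 by rewrite -[N.+1%:R]natr1; move: V1; clear; lra.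
    by rewrite ler_wpM2l ?rpow_ge0.
  by rewrite mulr1 rpow_anti.
have -> : dsum s M.+1 N.+1 - (cpow (s - 1) u - cpow (s - 1) v) / (s - 1) =
  em_err s M.+1 N.+1 - (cpow (s - 1) u - cpow (s - 1) M.+1%:R) / (s - 1) +
  (cpow (s - 1) v - cpow (s - 1) N.+1%:R) / (s - 1) by rewrite /em_err; ring.
apply: le_trans (cabsD _ _) _; apply: le_trans (lerD (cabsB _ _) (lexx _)) _.
move: h1' h2 h3; move: (normc _) (normc _) (normc _) (rpow _ _); clear => a b e f; lra.
Qed.

Lemma window_sumE (V : nmodType) (z Y : R) D X (F : nat -> V) : (0 < D)%N -> 0 <= z -> z <= Y -> Y <= X%:R ->
  \sum_(1 <= k < (X %/ D).+1) (if (z < (D * k)%:R) && ((D * k)%:R <= Y) then F k else 0) =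
  \sum_((Num.trunc (z / D%:R)).+1 <= k < (Num.trunc (Y / D%:R)).+1) F k.
Proof.
move=> D0 z0 zY YX; have DR : 0 < D%:R :> R by rewrite ltr0n.
have zD : 0 <= z / D%:R by rewrite divr_ge0 // ltW.
have YD : 0 <= Y / D%:R by rewrite divr_ge0 ?(ltW DR) // (le_trans z0).
set M := Num.trunc (z / D%:R); set N := Num.trunc (Y / D%:R).
have /andP[M1 M2] := truncn_itv zD; have /andP[N1 N2] := truncn_itv YD.
rewrite -/M -/N in M1 M2 N1 N2.
have MN : (M <= N)%N.
  rewrite -ltnS -(ltr_nat R); apply: le_lt_trans (le_trans M1 _) N2.
  by rewrite ler_wpM2r ?invr_ge0 ?(ltW DR).
have NX : (N <= X %/ D)%N.
  rewrite leq_divRL // -(ler_nat R) natrM; apply: le_trans YX.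
  by rewrite -ler_pdivlMr.
have cond k : (z < (D * k)%:R) && ((D * k)%:R <= Y) = (M < k <= N)%N.
  rewrite natrM mulrC -ltr_pdivrMr // -ler_pdivlMr //.
  congr (_ && _).
    apply/idP/idP => hk.
      by rewrite -(ltr_nat R); apply: le_lt_trans M1 hk.
    by apply: lt_le_trans M2 _; rewrite ler_nat.
  apply/idP/idP => hk.
    by rewrite -ltnS -(ltr_nat R); apply: le_lt_trans hk N2.
  by apply: le_trans N1; rewrite ler_nat.
rewrite (@big_cat_nat _ _ _ N.+1) //= [X in _ + X]big1_seq ?addr0; last first.
  move=> k /andP[_]; rewrite mem_index_iota => /andP[k1 _]; rewrite cond.
  by rewrite [(k <= N)%N]leqNgt k1 andbF.
rewrite (@big_cat_nat _ _ _ M.+1) //= big1_seq ?add0r; last first.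
  move=> k /andP[_]; rewrite mem_index_iota ltnS => /andP[_ k1]; rewrite cond.
  by rewrite ltnNge k1.
by apply: eq_big_nat => k /andP[k1 k2]; rewrite cond k1 -ltnS k2.
Qed.

(* A double divisor sum whose inner sums have main terms [I D ^ (s - 1)]. *)
Lemma lcm_main_term (f g : nat -> R) A B (S : nat -> C) (I s : C) (F c u : R) :
  (0 < A)%N -> (B <= A)%N -> (0 < B)%N -> 0 < u -> 0 <= c -> 0 <= F ->
  (forall d, `|f d| <= F) -> (forall e, `|g e| <= 1) ->
  (forall D, (0 < D <= A * B)%N ->
    normc (S D - I * cpow (1 - s) D%:R) <= c * rpow (complex.Re s - 14 / 15) (u / D%:R)) ->
  normc (\sum_(1 <= d < A.+1) \sum_(1 <= e < B.+1) (f d)%:C%C * (g e)%:C%C *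
      (cpow s (lcmn d e)%:R * S (lcmn d e)) -
    I * (\sum_(1 <= d < A.+1) \sum_(1 <= e < B.+1) f d * g e * rpow 1 (lcmn d e)%:R)%:C%C) <=
  c * F * rpow (complex.Re s - 14 / 15) u * rpow (- (1 / 15)) (A * B)%:R * (1 + ln A%:R) ^+ 3.
Proof.
move=> A0 BA B0 u0 c0 F0 fF g1 hS.
set th := complex.Re s - 14 / 15.
have lcmb d e : (0 < d <= A)%N -> (0 < e <= B)%N -> (0 < lcmn d e <= A * B)%N.
  case/andP=> d0 dA /andP[e0 eB]; rewrite lcmn_gt0 d0 e0 /=.
  apply: leq_trans (leq_mul dA eB); apply: dvdn_leq; first by rewrite muln_gt0 d0.
  by rewrite dvdn_lcm dvdn_mulr // dvdn_mull.
have -> : I * (\sum_(1 <= d < A.+1) \sum_(1 <= e < B.+1) f d * g e * rpow 1 (lcmn d e)%:R)%:C%C =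
  \sum_(1 <= d < A.+1) \sum_(1 <= e < B.+1) (f d)%:C%C * (g e)%:C%C * (cpow s (lcmn d e)%:R * (I * cpow (1 - s) (lcmn d e)%:R)).
  rewrite (rmorph_sum (real_complex R)) big_distrr /=; apply: eq_bigr => d _.
  rewrite (rmorph_sum (real_complex R)) big_distrr /=; apply: eq_bigr => e _.
  have : cpow s (lcmn d e)%:R * cpow (1 - s) (lcmn d e)%:R = (rpow 1 (lcmn d e)%:R)%:C%C.
    by rewrite -cpowD addrC subrK (cpow_real 1).
  move=> h; rewrite 2!(rmorphM (real_complex R)) /= -h; move: (cpow _ _) (cpow _ _) => a b; ring.
rewrite -sumrB; apply: le_trans (cabs_sum _ _ _) _.
have AB0 : 0 < (A * B)%:R :> R by rewrite ltr0n muln_gt0 A0.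
pose G := c * F * rpow th u * rpow (- (1 / 15)) (A * B)%:R.
have G0 : 0 <= G by rewrite !mulr_ge0 ?rpow_ge0.
apply: (@le_trans _ _ (G * \sum_(1 <= d < A.+1) \sum_(1 <= e < B.+1) (rpow 1 (lcmn d e)%:R : R))); last first.
  by rewrite ler_wpM2l // inv_lcm_sum_le.
rewrite big_distrr /=; apply: ler_sum_nat => d /andP[d0 dA].
rewrite -sumrB big_distrr /=; apply: le_trans (cabs_sum _ _ _) _.
apply: ler_sum_nat => e /andP[e0 eB].
have /andP[l0 lAB] := lcmb d e ltac:(by rewrite d0 -ltnS) ltac:(by rewrite e0 -ltnS).
set D := lcmn d e in l0 lAB *.
have DR : 0 < D%:R :> R by rewrite ltr0n.
rewrite -!mulrBr 3!Normc.normcM !cabs_real cabs_cpow.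
have h := hS D ltac:(by rewrite l0).
apply: (@le_trans _ _ (F * 1 * (rpow (complex.Re s) D%:R * (c * rpow th (u / D%:R))))).
  apply: ler_pM; rewrite ?mulr_ge0 ?rpow_ge0 ?cabs_ge0 //; first exact: ler_pM.
  by rewrite ler_wpM2l ?rpow_ge0.
have e1 : rpow th (u / D%:R) = rpow th u * rpow (- th) D%:R.
  by rewrite rpowM ?invr_gt0 //; congr (_ * _); rewrite /rpow lnV ?posrE // mulrN mulNr.
(* The modulus [D] contributes [D ^ (-14/15)]: one factor [1 / D] is kept for the sum over least
   common multiples, and [D ^ (1/15)] is bounded by its largest value. *)
have e2 : rpow (complex.Re s) D%:R * rpow (- th) D%:R = rpow 1 D%:R * rpow (- (1 / 15)) D%:R.
  have ex : complex.Re s + - th = 1 + - (1 / 15) by rewrite /th; move: (complex.Re s); clear => a; lra.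
  by rewrite -!rpowD ex.
have e3 : rpow (- (1 / 15)) D%:R <= rpow (- (1 / 15)) (A * B)%:R :> R.
  have p15 : 0 <= 1 / 15 :> R by apply: divr_ge0; rewrite ?ler01 ?ler0n.
  by rewrite /rpow ler_expR !mulNr !opprK ler_wpM2l // ler_ln ?posrE // ler_nat.
have -> : F * 1 * (rpow (complex.Re s) D%:R * (c * rpow th (u / D%:R))) =
  c * F * rpow th u * ((rpow 1 D%:R * rpow (- (1 / 15)) D%:R)).
  rewrite e1 -e2; ring.
rewrite /G -!mulrA ler_wpM2l // ler_wpM2l // ler_wpM2l ?rpow_ge0 //.
by rewrite mulrC ler_wpM2r ?rpow_ge0.
Qed.

Definition mol_quad E : R := \sum_(1 <= d < E.+1) \sum_(1 <= e < E.+1)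
  mol_wt R E d * mol_wt R E e * rpow 1 (lcmn d e)%:R.

(** The saving [z ^ (-1/15)] after summation over moduli up to [E ^ 2]; the cube of the logarithm
    comes from [inv_lcm_sum_le]. *)
Definition mol_err E (z : R) : R :=
  rpow (1 / 15) z * rpow (- (1 / 15)) (E * E)%:R * (1 + ln (E%:R : R)) ^+ 3.

Lemma mol_form_ge0 E : 0 <= mol_quad E.
Proof.
rewrite /mol_quad lcm_form_diag //; last by move=> d sd; rewrite /mol_wt sieve_wt_sqfree // mul0r.
by apply: sumr_ge0 => q _; rewrite mulr_ge0 ?jordan_ge0 // -expr2 sqr_ge0.
Qed.

Lemma mol_form_le E : (0 < E)%N -> mol_quad E <= (zsum (1 : R) E)^-1.
Proof. by move=> E0; exact: (mol_form R E0). Qed.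

Lemma mol_window_expand E X (z Y : R) (s : C) : 0 <= z -> z <= Y -> Y <= X%:R ->
  \sum_(1 <= n < X.+1) (mol_sum R E n)%:C%C * (mol_sum R E n)%:C%C * (if (z < n%:R) && (n%:R <= Y) then cpow s n%:R else 0) =
  \sum_(1 <= d < E.+1) \sum_(1 <= e < E.+1) (mol_wt R E d)%:C%C * (mol_wt R E e)%:C%C *
    (cpow s (lcmn d e)%:R * dsum s (Num.trunc (z / (lcmn d e)%:R)).+1 (Num.trunc (Y / (lcmn d e)%:R)).+1).
Proof.
move=> z0 zY YX.
have bE n : (mol_sum R E n)%:C%C = \sum_(1 <= d < E.+1 | (d %| n)%N) (mol_wt R E d)%:C%C by rewrite /mol_sum (rmorph_sum (real_complex R)).
under eq_bigr => n _ do rewrite bE.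
rewrite (@divisor_sum_mul _ E E X (fun d => (mol_wt R E d)%:C%C) (fun d => (mol_wt R E d)%:C%C)
  (fun n => if (z < n%:R) && (n%:R <= Y) then cpow s n%:R else 0)).
apply: eq_big_nat => d /andP[d0 _]; apply: eq_big_nat => e /andP[e0 _].
have l0 : (0 < lcmn d e)%N by rewrite lcmn_gt0 d0.
congr (_ * _); rewrite (window_sumE (fun k => cpow s (lcmn d e * k)%:R) l0 z0 zY YX).
rewrite /dsum big_distrr /=; apply: eq_big_nat => k /andP[k0 _].
have k00 : (0 < k)%N by exact: leq_trans k0.
by rewrite natrM cpowM ?ltr0n.
Qed.

(** The conditions on [z / E ^ 2] guarantee that the window divided by any modulus [D <= E ^ 2]
    still lies in the range of [dsum_window_main]. *)
Lemma mol_window_main E X (z Y : R) (s : C) : (0 < E)%N -> (E * E)%:R * expR (100 * 1000) <= z -> z <= Y -> Y <= X%:R ->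
  1 <= complex.Re s -> complex.Re s <= 11 / 10 -> 0 < complex.Im s ->
  complex.Im s <= (z / (E * E)%:R) ^+ 3 ->
  normc (\sum_(1 <= n < X.+1) (mol_sum R E n)%:C%C * (mol_sum R E n)%:C%C * (if (z < n%:R) && (n%:R <= Y) then cpow s n%:R else 0)
    - (cpow (s - 1) z - cpow (s - 1) Y) / (s - 1) * (mol_quad E)%:C%C) <= 402 * mol_err E z.
Proof.
move=> E0 zE zY YX x1 x2 t0 t3.
have EE : 0 < (E * E)%:R :> R by rewrite ltr0n muln_gt0 E0.
have z0 : 0 < z by apply: lt_le_trans zE; rewrite mulr_gt0 ?expR_gt0.
have z1 : 1 <= z.
  apply: le_trans zE; apply: mulr_ege1; first by rewrite ler1n muln_gt0 E0.
  by rewrite -[leLHS]expR0 ler_expR; apply: mulr_ge0; exact: ler0n.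
have Y0 : 0 < Y by exact: lt_le_trans zY.
rewrite (mol_window_expand E s (ltW z0) zY YX).
have c0 : 0 <= 402 :> R by exact: ler0n.
apply: (@le_trans _ _ (402 * 1 * rpow (complex.Re s - 14 / 15) z * rpow (- (1 / 15)) (E * E)%:R * (1 + ln E%:R) ^+ 3)).
  apply: (@lcm_main_term (mol_wt R E) (mol_wt R E) E E
    (fun D => dsum s (Num.trunc (z / D%:R)).+1 (Num.trunc (Y / D%:R)).+1)) => //.
  - exact: (mol_wt_le R E0).
  - exact: (mol_wt_le R E0).
  move=> D /andP[D0 DE]; have DR : 0 < D%:R :> R by rewrite ltr0n.
  have DEr : D%:R <= (E * E)%:R :> R by rewrite ler_nat.
  have -> : (cpow (s - 1) z - cpow (s - 1) Y) / (s - 1) * cpow (1 - s) D%:R =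
    (cpow (s - 1) (z / D%:R) - cpow (s - 1) (Y / D%:R)) / (s - 1).
    have eD : cpow (1 - s) D%:R = cpow (s - 1) (D%:R^-1).
      by rewrite /cpow lnV ?posrE // -(opprB s) rmorphN !mulNr mulrN opprK.
    rewrite !cpowM ?invr_gt0 // eD; move: (cpow _ _) (cpow _ _) (cpow _ _) (_^-1) => *; ring.
  have zz : z / (E * E)%:R <= z / D%:R by rewrite ler_wpM2l ?(ltW z0) // lef_pV2 ?posrE.
  apply: dsum_window_main => //.
  - by apply: le_trans zz; rewrite ler_pdivlMr // mulrC.
  - by rewrite ler_wpM2r ?invr_ge0 ?(ltW DR).
  - by move: x1; clear; lra.
  - apply: le_trans t3 _; apply: pow_le => //; by rewrite divr_ge0 ?(ltW z0) ?(ltW EE).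
have th : rpow (complex.Re s - 14 / 15) z <= rpow (1 / 15) z.
  rewrite /rpow ler_expR lerN2 ler_wpM2r ?ln_ge0 //; move: x1; clear; lra.
have l0 : 0 <= (1 + ln E%:R) ^+ 3 :> R.
  by apply: exprn_ge0; rewrite addr_ge0 // ln_ge0 // ler1n.
rewrite /mol_err mulr1 -!mulrA; apply: ler_wpM2l => //.
by apply: ler_wpM2r th; rewrite mulr_ge0 ?rpow_ge0.
Qed.

(** The case [s = 1], where the integral is [ln Y - ln z] and harmonic sums replace exponential
    sums. The rounding error [2 / u] is weakened to a power of exponent 1/15 so that [lcm_main_term]
    applies. *)
Lemma near_kernel E X (z Y : R) : (0 < E)%N -> (E * E)%:R <= z -> z <= Y -> Y <= X%:R ->
  \sum_(1 <= n < X.+1) mol_sum R E n * mol_sum R E n * (if (z < n%:R) && (n%:R <= Y) then n%:R^-1 else 0) <=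
  (ln Y - ln z) / zsum (1 : R) E + 2 * mol_err E z.
Proof.
move=> E0 zE zY YX.
have EE : 0 < (E * E)%:R :> R by rewrite ltr0n muln_gt0 E0.
have z0 : 0 < z by apply: lt_le_trans zE.
have Y0 : 0 < Y by exact: lt_le_trans zY.
have c0 : 0 <= 2 :> R by exact: ler0n.
set Sm := \sum_(1 <= n < X.+1) _.
have SmE : Sm%:C%C = \sum_(1 <= n < X.+1) (mol_sum R E n)%:C%C * (mol_sum R E n)%:C%C * (if (z < n%:R) && (n%:R <= Y) then cpow 1 n%:R else 0).
  rewrite /Sm (rmorph_sum (real_complex R)) /=; apply: eq_big_nat => n /andP[n0 _].
  by rewrite 2!(rmorphM (real_complex R)) /=; case: ifP => _; rewrite ?cpow1 ?ltr0n.
have key : normc (Sm%:C%C - (ln Y - ln z)%:C%C * (mol_quad E)%:C%C) <=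
   2 * 1 * rpow (complex.Re (1 : C) - 14 / 15) z * rpow (- (1 / 15)) (E * E)%:R * (1 + ln E%:R) ^+ 3.
  rewrite SmE (mol_window_expand E 1 (ltW z0) zY YX).
  apply: (@lcm_main_term (mol_wt R E) (mol_wt R E) E E
    (fun D => dsum 1 (Num.trunc (z / D%:R)).+1 (Num.trunc (Y / D%:R)).+1)) => //.
  - exact: (mol_wt_le R E0).
  - exact: (mol_wt_le R E0).
  move=> D /andP[D0 DE]; have DR : 0 < D%:R :> R by rewrite ltr0n.
  have DEr : D%:R <= (E * E)%:R :> R by rewrite ler_nat.
  rewrite subrr cpow0 mulr1.
  have u1 : 1 <= z / D%:R by rewrite ler_pdivlMr // mul1r (le_trans DEr).
  have uv : z / D%:R <= Y / D%:R by rewrite ler_wpM2r ?invr_ge0 ?(ltW DR).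
  have lE : ln Y - ln z = ln (Y / D%:R) - ln (z / D%:R) by rewrite !ln_div ?posrE //; ring.
  rewrite lE; set u := z / D%:R in u1 uv *; set v := Y / D%:R in uv *.
  have u0 : 0 < u by apply: lt_le_trans u1.
  have v0 : 0 < v by apply: lt_le_trans uv.
  have [U0 U1 U2 U3] := trunc_bounds u1; have [V0 V1 V2 _] := trunc_bounds (le_trans u1 uv).
  set M := Num.trunc u in U0 U1 U2 U3 *; set N := Num.trunc v in V0 V1 V2 *.
  have MN : (M <= N)%N by rewrite -ltnS -(ltr_nat R); apply: le_lt_trans (le_trans U1 uv) V2.
  have -> : dsum (1 : C) M.+1 N.+1 = (zsum (1 : R) N - zsum (1 : R) M)%:C%C.
    have -> : zsum 1 N - zsum 1 M = \sum_(M.+1 <= n < N.+1) rpow 1 n%:R :> R.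
      by rewrite /zsum (@big_cat_nat _ _ _ M.+1 1 N.+1) //= addrAC subrr add0r.
    rewrite (rmorph_sum (real_complex R)) /=; apply: eq_bigr => n _; exact: (cpow_real 1).
  rewrite cabs_subR.
  have MR : 0 < M%:R :> R by rewrite ltr0n.
  have hM : M%:R^-1 <= 2 * u^-1.
    by rewrite -[leLHS]mul1r ler_pdivrMr // mulrAC ler_pdivlMr // mul1r.
  have r1 : u^-1 <= rpow (complex.Re (1 : C) - 14 / 15) u.
    rewrite -rpow1 // /rpow ler_expR lerN2 ler_wpM2r ?ln_ge0 //= gerBl.
  apply: (@le_trans _ _ (M%:R^-1)); last first.
    by apply: le_trans hM _; rewrite ler_pM2l ?ltr0n.
  have := @zsum1_diff R M N; rewrite U0 => /(_ MN) /andP[g1 g2].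
  have /andP[_ g3] := inv_step R U0.
  have lns (p q : R) : 0 < p -> p <= q -> ln p <= ln q by move=> p0 pq; rewrite ler_ln ?posrE // (lt_le_trans p0).
  have q1 := lns _ _ MR U1; have q2 := lns _ _ u0 (ltW U2).
  have NR : 0 < N%:R :> R by rewrite ltr0n.
  have q3 := lns _ _ NR V1; have q4 := lns _ _ v0 (ltW V2).
  move: g1 g2 g3 q1 q2 q3 q4; move: (_^-1) (ln _) (ln _) (ln _) (ln _) (ln _) (ln _) (zsum _ _) (zsum _ _).
  by clear => *; apply/ler_normlP; split; lra.
have PE : (ln Y - ln z)%:C%C * (mol_quad E)%:C%C = ((ln Y - ln z) * mol_quad E)%:C%C by rewrite -(rmorphM (real_complex R)).
rewrite PE cabs_subR in key.
have := le_trans (ler_norm _) key; rewrite lerBlDl mulr1 => h; apply: le_trans h _.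
have -> : 1 - 14 / 15 = 1 / 15 :> R by clear; lra.
rewrite /mol_err -!mulrA lerD2r; apply: ler_wpM2l (mol_form_le E0).
by rewrite subr_ge0 ler_ln ?posrE.
Qed.


End Kernel.

(** * The averaged window, and the detector evaluated at a zero *)

Section FarKernel.
Variable R : realType.
Local Notation C := R[i].
Implicit Types (s c q : C) (u v w x y h : R) (d e k n m A B E X j J : nat).

Lemma cabs1 : normc (1 : C) = 1.
Proof. by rewrite /= expr1n expr0n /= addr0 sqrtr1. Qed.

(** The distance to 1 is at least [1 - r] and at least [t / 2 - (1 - r)]; the average of the two is
    [t / 4]. *)
Lemma one_sub_scaled_cis (r t : R) : 0 <= r -> r <= 1 -> 0 <= t <= 1 ->
  t / 4 <= normc (r%:C%C * cis (- t) - 1).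
Proof.
move=> r0 r1 t01; set q : C := r%:C%C * cis (- t).
have qn : normc q = r by rewrite /q Normc.normcM cabs_real cabs_cis mulr1 ger0_norm.
have h1 : t / 2 <= normc (cis (- t) - 1 : C).
  apply: le_trans (cis_sub1_ge t01) _.
  have -> : cis (- t) - 1 = - (cis (- t) * (cis t - 1)) :> C by rewrite mulrBr -cisD addNr cis0 mulr1 opprB.
  by rewrite cabsN Normc.normcM cabs_cis mul1r.
have h2 : normc (cis (- t) - q) = 1 - r.
  have -> : cis (- t) - q = (1 - r)%:C%C * cis (- t) by rewrite /q (rmorphB (real_complex R)) mulrBl mul1r.
  by rewrite Normc.normcM cabs_real cabs_cis mulr1 ger0_norm // subr_ge0.
have h3 : 1 - r <= normc (q - 1).
  have := cabsB q (q - 1); rewrite subKr cabs1 qn; clear; lra.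
have h4 := cabs_tri (cis (- t)) q 1.
move: h1 h2 h3 h4; move: (normc _) (normc _) (normc _); clear => a b e; lra.
Qed.

(** A geometric progression of ratio [exp (- s h)], whose distance from 1 is at least a quarter of
    [Im s * h]. *)
Lemma cpow_geometric_le s a h J : 1 <= a -> 0 < h -> 0 <= complex.Re s -> 0 < complex.Im s ->
  complex.Im s * h <= 1 ->
  normc (\sum_(j < J) cpow s (a * expR (j%:R * h))) <= 8 / (complex.Im s * h).
Proof.
move=> a1 h0 s0 t0 th; have a0 : 0 < a by apply: lt_le_trans a1.
set t := complex.Im s in t0 th *; set sg := complex.Re s in s0 *.
pose q : C := (expR (- (sg * h)))%:C%C * cis (- (t * h)).
have qE : q = cE (- (s * h%:C%C)).
  by rewrite /q /cE ReN ImN ReM ImM /= !mulr0 subr0 add0r.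
have th0 : 0 < t * h by rewrite mulr_gt0.
have sh : expR (- (sg * h)) <= 1 by rewrite -[leRHS]expR0 ler_expR oppr_le0 mulr_ge0 // ltW.
have ql : t * h / 4 <= normc (q - 1).
  by apply: one_sub_scaled_cis; rewrite ?expR_ge0 // (ltW th0).
have qn : normc q <= 1.
  by rewrite /q Normc.normcM cabs_real cabs_cis mulr1 ger0_norm ?expR_ge0.
have -> : \sum_(j < J) cpow s (a * expR (j%:R * h)) = cpow s a * \sum_(j < J) q ^+ j.
  rewrite big_distrr /=; apply: eq_bigr => j _; rewrite cpowM ?expR_gt0 //; congr (_ * _).
  rewrite /cpow expRK qE -cE_natmul; congr (cE _).
  rewrite rmorphM /= mulrN mulrCA; congr (- (_ * _)); exact: (rmorph_nat (real_complex R)).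
have a_le : normc (cpow s a) <= 1 by rewrite cabs_cpow rpow_le1.
have X : normc (\sum_(j < J) q ^+ j) * (t * h / 4) <= 2.
  apply: (@le_trans _ _ (normc (q ^+ J - 1))).
    by rewrite subrX1 Normc.normcM mulrC ler_wpM2r ?cabs_ge0.
  apply: le_trans (cabsB _ _) _; rewrite cabs1 cabsX.
  have : normc q ^+ J <= 1 by rewrite exprn_ile1 ?cabs_ge0.
  by clear; lra.
rewrite ler_pdivlMr // Normc.normcM.
have := ler_wpM2r (mulr_ge0 (cabs_ge0 (\sum_(j < J) q ^+ j)) (ltW th0)) a_le.
move: X; rewrite mul1r; move: (normc (cpow _ _)) (normc _) => p n; clear.
rewrite mulrA [n * _]mulrC => X1 X2; move: (p * _) X1 X2 => Z; rewrite ?mulrA; lra.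
Qed.

(** Smoothing by a finite average: the sharp window [(v, y]] is averaged over [J] geometric
    dilations, which gives linear ramps in [ln n] up to steps. On the main terms the average is a
    geometric sum and supplies the second power of decay. *)
Definition win_lo v h j := v * expR (j%:R * h).
Definition win_wt v y h J n : R :=
  (\sum_(j < J) (if (win_lo v h j < n%:R) && (n%:R <= win_lo y h j) then 1 else 0)) / J%:R.
Definition kernel E X v y h J s : C :=
  \sum_(1 <= n < X.+1) (win_wt v y h J n * (mol_sum R E n * mol_sum R E n))%:C%C * cpow s n%:R.

Lemma win_lo_ge v h j : 0 <= v -> 0 <= h -> v <= win_lo v h j.
Proof.
by move=> v0 h0; rewrite -[leLHS]mulr1 ler_wpM2l // -[leLHS]expR0 ler_expR mulr_ge0.
Qed.

Lemma win_lo_le v h j J : 0 <= v -> 0 <= h -> (j <= J)%N -> win_lo v h j <= win_lo v h J.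
Proof. by move=> v0 h0 jJ; rewrite ler_wpM2l // ler_expR ler_wpM2r // ler_nat. Qed.

(** One factor [1 / t] comes from the integral of [u ^ (- s)], the other from averaging its
    endpoints, with 8 for each end of the window. *)
Lemma far_kernel E X v y h J s : (0 < E)%N -> (0 < J)%N -> (E * E)%:R * expR (100 * 1000) <= v ->
  v <= y -> win_lo y h J <= X%:R -> 0 < h -> 1 <= complex.Re s -> complex.Re s <= 11 / 10 ->
  0 < complex.Im s -> complex.Im s <= (v / (E * E)%:R) ^+ 3 -> complex.Im s * h <= 1 ->
  normc (kernel E X v y h J s) <=
    16 / (J%:R * h * complex.Im s ^+ 2) / zsum (1 : R) E + 402 * mol_err E v.
Proof.
move=> E0 J0 vE vy yX h0 x1 x2 t0 t3 th.
have EE : 1 <= (E * E)%:R :> R by rewrite ler1n muln_gt0 E0.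
have e1 : 1 <= expR (100 * 1000) :> R by rewrite -[leLHS]expR0 ler_expR; apply: mulr_ge0; exact: ler0n.
have v1 : 1 <= v by apply: le_trans vE; exact: mulr_ege1.
have v0 : 0 <= v by apply: le_trans v1.
have y0 : 0 <= y by exact: le_trans vy.
have JR : 0 < J%:R :> R by rewrite ltr0n.
have h0' := ltW h0.
pose W j := \sum_(1 <= n < X.+1) (mol_sum R E n)%:C%C * (mol_sum R E n)%:C%C *
  (if (win_lo v h j < n%:R) && (n%:R <= win_lo y h j) then cpow s n%:R else 0).
pose I j := (cpow (s - 1) (win_lo v h j) - cpow (s - 1) (win_lo y h j)) / (s - 1).
have kE : kernel E X v y h J s = (J%:R^-1)%:C%C * \sum_(j < J) W j.
  rewrite /kernel /W exchange_big /= big_distrr /=; apply: eq_bigr => n _.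
  rewrite /win_wt mulrC -big_distrr /=.
  have -> : \sum_(j < J) (if (win_lo v h j < n%:R) && (n%:R <= win_lo y h j) then cpow s n%:R else 0) =
    (\sum_(j < J) (if (win_lo v h j < n%:R) && (n%:R <= win_lo y h j) then 1 else 0))%:C%C * cpow s n%:R.
    rewrite (rmorph_sum (real_complex R)) big_distrl /=; apply: eq_bigr => j _.
    by case: ifP => _; rewrite ?mul1r ?mul0r.
  rewrite !(rmorphM (real_complex R)) /=; ring.
have Wb j : (j < J)%N -> normc (W j - I j * (mol_quad R E)%:C%C) <= 402 * mol_err E v.
  move=> jJ; have vj := win_lo_ge j v0 h0'; have l1 := win_lo_le y0 h0' (ltnW jJ).
  have vyj : win_lo v h j <= win_lo y h j by rewrite ler_wpM2r ?expR_ge0.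
  apply: le_trans (@mol_window_main R E X (win_lo v h j) (win_lo y h j) s E0 _ vyj (le_trans l1 yX) x1 x2 t0 _) _.
  - exact: le_trans vj.
  - apply: le_trans t3 _; apply: pow_le; first by rewrite divr_ge0.
    by rewrite ler_wpM2r // invr_ge0.
  apply: ler_wpM2l; first exact: ler0n.
  rewrite /mol_err; apply: ler_wpM2r.
    by apply: exprn_ge0; rewrite addr_ge0 // ln_ge0 // ler1n.
  apply: ler_wpM2r; first exact: rpow_ge0.
  apply: rpow_anti => //.
  exact: lt_le_trans v1.
have Ib : normc (\sum_(j < J) I j) <= 16 / (h * complex.Im s ^+ 2).
  have st : complex.Im (s - 1) = complex.Im s by rewrite ImD ImN /= subr0.
  have sr : 0 <= complex.Re (s - 1) by rewrite ReD ReN /= subr_ge0.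
  have g1 := @cpow_geometric_le (s - 1) v h J v1 h0 sr; have g2 := @cpow_geometric_le (s - 1) y h J (le_trans v1 vy) h0 sr.
  rewrite st in g1 g2; have {}g1 := g1 t0 th; have {}g2 := g2 t0 th.
  rewrite /I -big_distrl /= sumrB Normc.normcM Normc.normcV.
  have nt : complex.Im s <= normc (s - 1) by rewrite -st; apply: le_trans (cabs_Im _); exact: ler_norm.
  have -> : 16 / (h * complex.Im s ^+ 2) = (8 / (complex.Im s * h) + 8 / (complex.Im s * h)) * (complex.Im s)^-1.
    by field; rewrite !gt_eqF.
  apply: ler_pM; rewrite ?cabs_ge0 ?invr_ge0 //.
    by apply: le_trans (cabsB _ _) _; apply: lerD.
  by rewrite lef_pV2 ?posrE // (lt_le_trans t0).
have -> : kernel E X v y h J s = (J%:R^-1)%:C%C * ((\sum_(j < J) I j) * (mol_quad R E)%:C%C) +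
   (J%:R^-1)%:C%C * \sum_(j < J) (W j - I j * (mol_quad R E)%:C%C).
  by rewrite kE sumrB big_distrl /= -mulrDr addrC subrK.
have Jv : normc ((J%:R^-1)%:C%C : C) = J%:R^-1 by rewrite cabs_real ger0_norm // invr_ge0 ltW.
have q0 := mol_form_ge0 R E; have q1 := mol_form_le R E0.
apply: le_trans (cabsD _ _) _; apply: lerD.
  rewrite 2!Normc.normcM Jv cabs_real (ger0_norm q0).
  have -> : 16 / (J%:R * h * complex.Im s ^+ 2) / zsum (1 : R) E =
    J%:R^-1 * (16 / (h * complex.Im s ^+ 2) * (zsum (1 : R) E)^-1).
    by rewrite -mulrA !invfM; ring.
  by rewrite ler_wpM2l ?invr_ge0 ?(ltW JR) // ler_pM ?cabs_ge0.
rewrite Normc.normcM Jv mulrC ler_pdivrMr //.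
apply: le_trans (cabs_sum _ _ _) _.
apply: (@le_trans _ _ (\sum_(j < J) (402 * mol_err E v))); last by rewrite sumr_const card_ord mulr_natr.
by apply: ler_sum => j _; apply: Wb.
Qed.

Lemma win_wt_ge0 v y h J n : 0 <= win_wt v y h J n.
Proof.
by apply: divr_ge0 => //; apply: sumr_ge0 => j _; case: ifP.
Qed.

Lemma win_wt_le v y h J n : (0 < J)%N -> 0 <= v -> 0 <= y -> 0 <= h ->
  win_wt v y h J n <= if (v < n%:R) && (n%:R <= win_lo y h J) then 1 else 0.
Proof.
move=> J0 v0 y0 h0; rewrite ler_pdivrMr ?ltr0n //.
case: ifP => c.
  apply: (@le_trans _ _ (\sum_(j < J) 1)); first by apply: ler_sum => j _; case: ifP.
  by rewrite sumr_const card_ord mul1r.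
rewrite mul0r; apply: sumr_le0 => j _; case: ifP => // /andP[c1 c2].
by rewrite (le_lt_trans (win_lo_ge j v0 h0) c1) (le_trans c2 (win_lo_le y0 h0 (ltnW (ltn_ord j)))) in c.
Qed.

Lemma win_wt1 v y h J n : (0 < J)%N -> 0 <= v -> 0 <= y -> 0 <= h ->
  win_lo v h J < n%:R -> n%:R <= y -> win_wt v y h J n = 1.
Proof.
move=> J0 v0 y0 h0 c1 c2; rewrite /win_wt (eq_bigr (fun=> 1)); last first.
  move=> j _; rewrite ifT // (le_lt_trans (win_lo_le v0 h0 (ltnW (ltn_ord j))) c1).
  exact: le_trans c2 (win_lo_ge j y0 h0).
by rewrite sumr_const card_ord divff // pnatr_eq0 -lt0n.
Qed.

(** The weights are nonnegative, so taking absolute values reduces to the real point [s = 1]. *)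
Lemma kernel_near E X v y h J s : (0 < E)%N -> (0 < J)%N -> (E * E)%:R <= v -> v <= y -> 0 <= h ->
  win_lo y h J <= X%:R -> 1 <= complex.Re s ->
  normc (kernel E X v y h J s) <= (ln (win_lo y h J) - ln v) / zsum (1 : R) E + 2 * mol_err E v.
Proof.
move=> E0 J0 vE vy h0 yX x1.
have v0 : 0 <= v by apply: le_trans vE.
have y0 : 0 <= y by apply: le_trans vy.
have vY : v <= win_lo y h J by apply: le_trans vy (win_lo_ge J y0 h0).
apply: le_trans (@near_kernel R E X v (win_lo y h J) E0 vE vY yX).
apply: le_trans (cabs_sum _ _ _) _; apply: ler_sum_nat => n /andP[n0 _].
have b0 : 0 <= mol_sum R E n * mol_sum R E n by rewrite -expr2 sqr_ge0.
rewrite Normc.normcM cabs_real cabs_cpow normrM (ger0_norm (win_wt_ge0 _ _ _ _ _)) (ger0_norm b0).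
rewrite mulrAC mulrC; apply: ler_wpM2l => //.
have w := @win_wt_le v y h J n J0 v0 y0 h0.
apply: le_trans (ler_wpM2r (rpow_ge0 _ _) w) _.
case: ifP => _; rewrite ?mul0r // mul1r -rpow1 ?ltr0n //.
by rewrite /rpow ler_expR lerN2 ler_wpM2r // ln_ge0 // ler1n.
Qed.

(** Opening both weights leaves zeta sums up to [X / D], which at a zero equal minus the polar term
    [(X / D) ^ (1 - rho) / (rho - 1)] up to a tail. The polar terms recombine into the mixed form of
    [det_mol_form], so the total is about [X ^ delta / Im rho]: this is why small ordinates are
    treated separately. *)
Lemma detector_total (zeta : Cplx R -> Cplx R) (ep : R) z1 z2 E X (rho : C) : is_riemann_zeta zeta ->
  0 < ep -> (0 < z1)%N -> (z1 <= z2)%N -> (0 < E)%N -> (E <= z2)%N -> 0 < det_norm ep z1 z2 ->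
  (z2 * E)%:R * expR (100 * 1000) <= X%:R :> R ->
  strip_zero zeta rho -> complex.Im rho <= (X%:R / (z2 * E)%:R) ^+ 3 ->
  normc (\sum_(1 <= n < X.+1) (det_sum ep z1 z2 n * mol_sum R E n)%:C%C * cpow rho n%:R) <=
    rpow (complex.Re rho - 1) X%:R / complex.Im rho * (4 * zsum (ep + 1) z2 / det_norm ep z1 z2) +
    401 * (2 * zsum (ep + 1) z2 / det_norm ep z1 z2) * rpow (complex.Re rho - 14 / 15) X%:R *
      rpow (- (1 / 15)) (z2 * E)%:R * (1 + ln (z2%:R : R)) ^+ 3.
Proof.
move=> hz ep0 z10 z12 E0 Ez dn0 zX [z0 x1 x2 g0] g3.
have z20 : (0 < z2)%N by exact: leq_trans z12.
have ZE : 0 < (z2 * E)%:R :> R by rewrite ltr0n muln_gt0 z20.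
have e1 : 1 <= expR (100 * 1000) :> R by rewrite -[leLHS]expR0 ler_expR; apply: mulr_ge0; exact: ler0n.
have XR : 0 < X%:R :> R by apply: lt_le_trans zX; rewrite mulr_gt0 ?expR_gt0.
have s1 : rho != 1 by apply/eqP => e; move: g0; rewrite e /= ltxx.
have s10 : rho - 1 != 0 by rewrite subr_eq0.
set P := 4 * _ / _; set F := 2 * _ / _.
have F0 : 0 <= F by apply: divr_ge0 (ltW dn0); apply: mulr_ge0 (zsum_ge0 _ _); exact: ler0n.
pose I := - (cpow (rho - 1) X%:R / (rho - 1)).
have th0 : 0 <= complex.Re rho - 14 / 15 by move: x1; clear; lra.
have r0 : 0 <= complex.Re rho by move: x1; clear; lra.
have key := @lcm_main_term R (det_wt ep z1 z2) (mol_wt R E) z2 E (fun D => dsum rho 1 (X %/ D).+1) I rho F 401 X%:R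
  z20 Ez E0 XR (ler0n _ _) F0 (det_wt_le ep0 z10 z12 dn0) (mol_wt_le R E0).
have inner D : (0 < D <= z2 * E)%N -> normc (dsum rho 1 (X %/ D).+1 - I * cpow (1 - rho) D%:R) <=
    401 * rpow (complex.Re rho - 14 / 15) (X%:R / D%:R).
  case/andP=> D0 DE; have DR : 0 < D%:R :> R by rewrite ltr0n.
  have DEr : D%:R <= (z2 * E)%:R :> R by rewrite ler_nat.
  have uE : expR (100 * 1000) <= X%:R / D%:R :> R.
    rewrite ler_pdivlMr //; apply: le_trans zX; rewrite mulrC ler_wpM2r ?expR_ge0 //.
  have u1 := le_trans e1 uE.
  have u0 : 0 < X%:R / D%:R :> R by apply: lt_le_trans u1.
  have M1 : (X %/ D)%:R <= X%:R / D%:R :> R by rewrite ler_pdivlMr // -natrM ler_nat leq_trunc_div.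
  have M2 : X%:R / D%:R <= (X %/ D).+1%:R :> R.
    by rewrite ler_pdivrMr // -natrM ler_nat ltnW // ltn_ceil.
  have cD : I * cpow (1 - rho) D%:R = - (cpow (rho - 1) (X%:R / D%:R) / (rho - 1)).
    have eD : cpow (1 - rho) D%:R = cpow (rho - 1) (D%:R^-1).
      by rewrite /cpow lnV ?posrE // -(opprB rho) rmorphN !mulNr mulrN opprK.
    rewrite cpowM ?invr_gt0 // eD /I; move: (cpow _ _) (cpow _ _) (_^-1) => *; ring.
  rewrite cD opprK; set u := X%:R / D%:R in uE u1 u0 M1 M2 *; set M := (X %/ D)%N in M1 M2 *.
  have -> : dsum rho 1 M.+1 + cpow (rho - 1) u / (rho - 1) =
    zeta_trunc rho M.+1 + (cpow (rho - 1) u - cpow (rho - 1) M.+1%:R) / (rho - 1).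
    by rewrite /zeta_trunc; move: (cpow _ _) (cpow _ _) (_^-1) (dsum _ _ _) => *; ring.
  have lM : 100 * 1000 <= ln (M.+1%:R : R).
    rewrite -[leLHS]expRK ler_ln ?posrE ?expR_gt0 ?ltr0n //; exact: le_trans uE M2.
  have g3' : complex.Im rho <= M.+1%:R ^+ 3.
    apply: le_trans g3 _; apply: pow_le; first by rewrite divr_ge0 ?(ltW ZE).
    apply: le_trans M2; rewrite ler_wpM2l // lef_pV2 ?posrE //.
  have h1 := zeta_trunc_zero_le hz z0 x1 x2 g0 g3' lM.
  have h2 := cpow_int_le u0 M2 r0 s1.
  have h3 : rpow (complex.Re rho - 14 / 15) M.+1%:R <= rpow (complex.Re rho - 14 / 15) u by exact: rpow_anti.
  have h4 : rpow (complex.Re rho) u * (M.+1%:R - u) <= rpow (complex.Re rho - 14 / 15) u.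
    have d1 : M.+1%:R - u <= 1 by rewrite -[M.+1%:R]natr1; move: M1; clear; lra.
    have := ler_wpM2l (rpow_ge0 (complex.Re rho) u) d1; rewrite mulr1 => k; apply: le_trans k _.
    by rewrite /rpow ler_expR lerN2 ler_wpM2r ?ln_ge0 // gerBl.
  apply: le_trans (cabsD _ _) _; apply: le_trans (lerD h1 (le_trans h2 h4)) _.
  move: h3; move: (rpow _ _) (rpow _ _); clear => a b; lra.
have {}key := key inner.
have -> : \sum_(1 <= n < X.+1) (det_sum ep z1 z2 n * mol_sum R E n)%:C%C * cpow rho n%:R =
  \sum_(1 <= d < z2.+1) \sum_(1 <= e < E.+1) (det_wt ep z1 z2 d)%:C%C * (mol_wt R E e)%:C%C *
      (cpow rho (lcmn d e)%:R * dsum rho 1 (X %/ lcmn d e).+1).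
  transitivity (\sum_(1 <= n < X.+1) (\sum_(1 <= d < z2.+1 | (d %| n)%N) (det_wt ep z1 z2 d)%:C%C) *
     (\sum_(1 <= e < E.+1 | (e %| n)%N) (mol_wt R E e)%:C%C) * cpow rho n%:R).
    apply: eq_bigr => n _; rewrite (rmorphM (real_complex R)) /=; congr (_ * _ * _).
      by rewrite /det_sum (rmorph_sum (real_complex R)).
    by rewrite /mol_sum (rmorph_sum (real_complex R)).
  rewrite divisor_sum_mul; apply: eq_big_nat => d /andP[d0 _]; apply: eq_big_nat => e /andP[e0 _].
  have l0 : (0 < lcmn d e)%N by rewrite lcmn_gt0 d0.
  congr (_ * _); rewrite /dsum big_distrr /=; apply: eq_big_nat => k /andP[k0 _].
  by rewrite natrM cpowM ?ltr0n.
set T := \sum_(1 <= d < z2.+1) _ in key *; set Q := \sum_(1 <= d < z2.+1) _ in key.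
have Qb : `|Q| <= P by exact: det_mol_form.
have Ib : normc (I * Q%:C%C) <= rpow (complex.Re rho - 1) X%:R / complex.Im rho * P.
  rewrite (Normc.normcM I) cabs_real /I cabsN (Normc.normcM (cpow _ _)) Normc.normcV cabs_cpow.
  have -> : complex.Re (rho - 1) = complex.Re rho - 1 by rewrite ReD ReN.
  apply: ler_pM => //; first by rewrite mulr_ge0 ?rpow_ge0 ?invr_ge0 ?cabs_ge0.
  apply: ler_wpM2l; first exact: rpow_ge0.
  have nt : complex.Im rho <= normc (rho - 1).
    by apply: le_trans (cabs_Im _); rewrite ImD ImN /= subr0 ler_norm.
  by rewrite lef_pV2 ?posrE // (lt_le_trans g0).
have -> : T = I * Q%:C%C + (T - I * Q%:C%C) by rewrite addrC subrK.
by apply: le_trans (cabsD _ _) _; apply: lerD.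
Qed.

(** [det_sum_small] gives the divisor sum of [n] over [z1], and the mollifier is bounded trivially
    by [E]. Pulling out [z0 ^ (2 - Re rho)] leaves the sum of divisor sums over [n ^ 2], of
    logarithmic size; the gap between [z0] and [z1] makes the result small. *)
Lemma small_terms (ep : R) z0 z1 z2 E (rho : C) : 0 < ep -> (0 < z1)%N -> (z1 <= z2)%N -> (0 < E)%N ->
  0 < det_norm ep z1 z2 -> (0 < z0)%N -> (z0 <= z1)%N -> 0 <= complex.Re rho -> complex.Re rho <= 1 ->
  normc (\sum_(2 <= n < z0.+1) (det_sum ep z1 z2 n * mol_sum R E n)%:C%C * cpow rho n%:R) <=
   12 / det_norm ep z1 z2 / z1%:R * E%:R * rpow (complex.Re rho - (1 + 1)) z0%:R * (2 * (1 + ln z0%:R)).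
Proof.
move=> ep0 z10 z12 E0 dn0 z00 z01 r0 r1.
have z0R : 0 < z0%:R :> R by rewrite ltr0n.
have z1R : 0 < z1%:R :> R by rewrite ltr0n.
set c := 12 / _; set w := rpow (_ - _) _.
have c0 : 0 <= c by apply: divr_ge0 (ltW dn0); exact: ler0n.
pose G := c / z1%:R * E%:R * w.
have w0 : 0 <= w by exact: rpow_ge0.
have G0 : 0 <= G.
  by apply: mulr_ge0 w0; apply: mulr_ge0 (ler0n _ _); exact: divr_ge0 c0 (ltW z1R).
have sm : \sum_(1 <= n < z0.+1) (\sum_(1 <= d < z0.+1 | (d %| n)%N) d%:R) * rpow (1 + 1) n%:R <=
   2 * (1 + ln z0%:R) :> R.
  have -> : \sum_(1 <= n < z0.+1) (\sum_(1 <= d < z0.+1 | (d %| n)%N) d%:R) * rpow (1 + 1) n%:R =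
    \sum_(1 <= d < z0.+1) d%:R^-1 * zsum (1 + 1) (z0 %/ d) :> R.
    transitivity (\sum_(1 <= n < z0.+1) \sum_(1 <= d < z0.+1) (if (d %| n)%N then d%:R * rpow (1 + 1) n%:R else 0 : R)).
      apply: eq_bigr => n _; rewrite big_mkcond big_distrl /=; apply: eq_bigr => d _.
      by case: ifP; rewrite ?mul0r.
    rewrite exchange_big /=; apply: eq_big_nat => d /andP[d0 _]; rewrite -big_mkcond dvd_sum //.
    rewrite /zsum big_distrr /=; apply: eq_big_nat => k /andP[k0 _].
    rewrite natrM rpowM ?ltr0n // mulrA; congr (_ * _).
    by rewrite rpowD rpow1 ?ltr0n // mulrA divff ?mul1r // pnatr_eq0 -lt0n.
  apply: (@le_trans _ _ (\sum_(1 <= d < z0.+1) d%:R^-1 * 2)).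
    apply: ler_sum => d _; rewrite ler_wpM2l ?invr_ge0 //.
    by have := @zsum_le_inv R 1 (z0 %/ d) ltr01; rewrite invr1.
  by rewrite -big_distrl /= mulrC ler_pM2l ?ltr0n // harmonic_le_ln.
apply: le_trans (cabs_sum _ _ _) _.
apply: (@le_trans _ _ (\sum_(1 <= n < z0.+1) G * ((\sum_(1 <= d < z0.+1 | (d %| n)%N) d%:R) * rpow (1 + 1) n%:R))); last first.
  by rewrite -big_distrr /= -/G ler_wpM2l.
rewrite [leRHS]big_ltn ?ltnS //; apply: ler_wpDl.
  rewrite mulr_ge0 // mulr_ge0 ?rpow_ge0 //; apply: sumr_ge0 => d _; exact: ler0n.
apply: ler_sum_nat => n /andP[n2 nz]; rewrite ltnS in nz.
have n0 : (0 < n)%N by exact: ltnW.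
have nR : 0 < n%:R :> R by rewrite ltr0n.
rewrite Normc.normcM cabs_real cabs_cpow normrM.
have ha := @det_sum_small R ep z1 z2 ep0 z10 z12 dn0 n.
rewrite n2 (leq_trans nz z01) in ha; have {}ha := ha isT.
have hb : `|mol_sum R E n| <= E%:R.
  apply: le_trans (ler_norm_sum _ _ _) _; rewrite big_mkcond.
  apply: (@le_trans _ _ (\sum_(1 <= e < E.+1) 1)); last by rewrite sumr_const_nat subn1.
  by apply: ler_sum => e _; case: ifP => // _; exact: mol_wt_le.
have hr : rpow (complex.Re rho) n%:R <= w * rpow (1 + 1) n%:R.
  have -> : complex.Re rho = (complex.Re rho - (1 + 1)) + (1 + 1) by rewrite subrK.
  rewrite rpowD ler_wpM2r ?rpow_ge0 // /w /rpow ler_expR lerN2.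
  have l : ln n%:R <= ln z0%:R :> R by rewrite ler_ln ?posrE // ler_nat.
  have : complex.Re rho - (1 + 1) <= 0 by move: r1; clear; lra.
  by move=> t0; rewrite ler_wnM2l.
have E1 : \sum_(1 <= d < n.+1 | (d %| n)%N) d%:R / z1%:R = z1%:R^-1 * \sum_(1 <= d < z0.+1 | (d %| n)%N) d%:R :> R.
  have := @divisor_sum_range R n z0 predT (fun d => d%:R); rewrite n0 nz => /(_ isT) /= ->.
  by rewrite big_distrr /=; apply: eq_bigr => d _; rewrite mulrC.
rewrite E1 in ha; set S := \sum_(1 <= d < z0.+1 | (d %| n)%N) d%:R in ha *.
have S0 : 0 <= S by apply: sumr_ge0 => d _; exact: ler0n.
apply: (@le_trans _ _ (c * (z1%:R^-1 * S) * E%:R * (w * rpow (1 + 1) n%:R))).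
  apply: ler_pM (mulr_ge0 (normr_ge0 _) (normr_ge0 _)) (rpow_ge0 _ _) _ hr.
  exact: ler_pM (normr_ge0 _) (normr_ge0 _) ha hb.
by rewrite /G le_eqVlt; apply/orP; left; apply/eqP; ring.
Qed.

End FarKernel.

(** * Large values by duality, and zeros sorted by distance *)

Section LargeValues.
Variable R : realType.
Local Notation C := R[i].
Implicit Types (s c r : C) (u v w x y h : R) (n m k : nat).

Lemma conj_cpow s u : ((cpow s u)^*)%C = cpow (s^*)%C u.
Proof.
have -> : cpow (s^*)%C u = (rpow (complex.Re s) u)%:C%C * cis (complex.Im s * ln u).
  by case: s => p q; rewrite cpow_polar /= mulNr opprK.
rewrite cpow_polar cisN; move: (rpow _ _) (cis _) => r [p q].
by apply: complex_ext => /=; ring.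
Qed.

Lemma conj_mul (z w : C) : ((z * w)^*)%C = (z^*)%C * (w^*)%C.
Proof. by case: z w => p q [r t]; apply: complex_ext => /=; ring. Qed.

(** Each value is rotated onto the positive axis, the sum over zeros is moved inside, and
    Cauchy-Schwarz in [n] separates [a] from [b]. Expanding the second square gives the kernel at
    [r + q^* + 1 - 2 sg], of real part at least 1 for zeros to the right of [sg]; [W] may exceed
    [b ^+ 2], which leaves room for smoothing. *)
Lemma halasz (rs : seq C) (sg G : R) z X X' (a b W : nat -> R) :
  (X <= X')%N -> (forall n, 0 <= W n) -> (forall n, (z < n <= X)%N -> b n ^+ 2 <= W n) ->
  \sum_(z.+1 <= n < X.+1) a n ^+ 2 * rpow (2 * sg - 1) n%:R <= G ->
  (forall r, r \in rs -> 9 / 10 <= normc (\sum_(z.+1 <= n < X.+1) (a n * b n)%:C%C * cpow r n%:R)) ->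
  (9 / 10 * (size rs)%:R) ^+ 2 <=
    G * \sum_(r <- rs) \sum_(q <- rs)
      normc (\sum_(1 <= n < X'.+1) (W n)%:C%C * cpow (r + (q^*)%C + (1 - 2 * sg)%:C%C) n%:R).
Proof.
move=> XX W0 bW aG hr.
pose S r : C := \sum_(z.+1 <= n < X.+1) (a n * b n)%:C%C * cpow r n%:R.
have uf r : exists c, normc c = 1 /\ c * S r = (normc (S r))%:C%C.
  by have [c c1 c2] := unimodular_factor (S r); exists c.
have [cf hcf] := choice uf.
pose Z n : C := \sum_(r <- rs) cf r * cpow r n%:R.
have e1 : (\sum_(r <- rs) normc (S r))%:C%C = \sum_(z.+1 <= n < X.+1) (a n * b n)%:C%C * Z n.
  rewrite (rmorph_sum (real_complex R)) /=.
  transitivity (\sum_(r <- rs) \sum_(z.+1 <= n < X.+1) (a n * b n)%:C%C * (cf r * cpow r n%:R)).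
    apply: eq_bigr => r _; have [_ <-] := hcf r; rewrite /S big_distrr /=; apply: eq_bigr => n _.
    by rewrite mulrCA.
  by rewrite exchange_big /=; apply: eq_bigr => n _; rewrite /Z big_distrr.
have lo : 9 / 10 * (size rs)%:R <= \sum_(r <- rs) normc (S r).
  have -> : 9 / 10 * (size rs)%:R = \sum_(r <- rs) (9 / 10 : R).
    by rewrite big_const_seq count_predT iter_addr_0 mulr_natr.
  by rewrite big_seq [leRHS]big_seq; apply: ler_sum => r rr; exact: hr.
(* The weight whose square is the one in the mean square of [a]; its inverse goes to the sum over
   zeros. *)
pose al := (2 * sg - 1) / 2.
have hi : \sum_(r <- rs) normc (S r) <=
   \sum_(z.+1 <= n < X.+1) (`|a n| * rpow al n%:R) * (`|b n| * normc (Z n) * rpow (- al) n%:R).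
  have -> : \sum_(r <- rs) normc (S r) = normc ((\sum_(r <- rs) normc (S r))%:C%C : C).
    by rewrite cabs_real ger0_norm //; apply: sumr_ge0 => r _; exact: cabs_ge0.
  rewrite e1; apply: le_trans (cabs_sum _ _ _) _; apply: ler_sum => n _.
  rewrite Normc.normcM cabs_real normrM.
  have er : rpow al n%:R * rpow (- al) n%:R = 1 :> R by rewrite -rpowD subrr /rpow mul0r oppr0 expR0.
  have -> : `|a n| * rpow al n%:R * (`|b n| * normc (Z n) * rpow (- al) n%:R) =
    `|a n| * `|b n| * normc (Z n) * (rpow al n%:R * rpow (- al) n%:R) by ring.
  by rewrite er mulr1.
have l0 : 0 <= 9 / 10 * (size rs)%:R :> R.
  by apply: mulr_ge0 (ler0n _ _); apply: divr_ge0; exact: ler0n.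
apply: (@le_trans _ _ ((\sum_(z.+1 <= n < X.+1) (`|a n| * rpow al n%:R) * (`|b n| * normc (Z n) * rpow (- al) n%:R)) ^+ 2)).
  by apply: pow_le => //; exact: le_trans lo hi.
apply: le_trans (cauchy_schwarz _ _ _) _.
have G1 : \sum_(i <- index_iota z.+1 X.+1) (`|a i| * rpow al i%:R) ^+ 2 <= G.
  apply: le_trans aG; apply: ler_sum => n _.
  rewrite exprMn real_normK ?num_real // -expRM_natl.
  by rewrite le_eqVlt; apply/orP; left; apply/eqP; congr (_ * expR _); rewrite /al; field.
have G0 : 0 <= G by apply: le_trans G1; apply: sumr_ge0 => n _; exact: sqr_ge0.
apply: ler_pM => //; try by apply: sumr_ge0 => n _; exact: sqr_ge0.
pose V n : R := W n * (rpow (1 - 2 * sg) n%:R * normc (Z n) ^+ 2).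
have V0 n : 0 <= V n.
  by apply: mulr_ge0 (W0 n) _; apply: mulr_ge0 (rpow_ge0 _ _) (sqr_ge0 _).
apply: (@le_trans _ _ (\sum_(1 <= n < X'.+1) V n)).
  apply: (@le_trans _ _ (\sum_(z.+1 <= n < X.+1) V n)).
    apply: ler_sum_nat => n /andP[n1 n2].
    have -> : (`|b n| * normc (Z n) * rpow (- al) n%:R) ^+ 2 = b n ^+ 2 * (rpow (1 - 2 * sg) n%:R * normc (Z n) ^+ 2).
      rewrite !exprMn real_normK ?num_real // -expRM_natl mulrAC mulrA.
      by congr (_ * expR _ * _); rewrite /al; field.
    have nn : 0 <= rpow (1 - 2 * sg) n%:R * normc (Z n) ^+ 2 by apply: mulr_ge0 (rpow_ge0 _ _) (sqr_ge0 _).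
    by rewrite ler_wpM2r // bW // n1 -ltnS.
  have [zX|zX] := leqP z X; last first.
    by rewrite big_geq ?ltnS 1?ltnW //; apply: sumr_ge0.
  rewrite [leRHS](@big_cat_nat _ _ _ z.+1) //= ?ltnS ?(leq_trans zX) //.
  rewrite [X in _ <= _ + X](@big_cat_nat _ _ _ X.+1) //=.
  by rewrite addrCA lerDl addr_ge0 // sumr_ge0.
have VE : (\sum_(1 <= n < X'.+1) V n)%:C%C = \sum_(r <- rs) \sum_(q <- rs) cf r * ((cf q)^*)%C *
   \sum_(1 <= n < X'.+1) (W n)%:C%C * cpow (r + (q^*)%C + (1 - 2 * sg)%:C%C) n%:R.
  rewrite (rmorph_sum (real_complex R)) /=.
  transitivity (\sum_(1 <= n < X'.+1) \sum_(r <- rs) \sum_(q <- rs) cf r * ((cf q)^*)%C *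
     ((W n)%:C%C * cpow (r + (q^*)%C + (1 - 2 * sg)%:C%C) n%:R)).
    apply: eq_bigr => n _.
    rewrite /V (rmorphM (real_complex R)) (rmorphM (real_complex R)) /= -mulcJ.
    rewrite {2}/Z conjc_sum {1}/Z big_distrl /= !big_distrr /=; apply: eq_bigr => r _.
    rewrite !big_distrr /=; apply: eq_bigr => q _.
    rewrite conj_mul conj_cpow !cpowD cpow_real.
    move: (cpow _ _) (cpow _ _) (rpow _ _)%:C%C (W n)%:C%C ((cf q)^*)%C (cf r) => a1 a2 a3 a4 a5 a6; ring.
  rewrite exchange_big /=; apply: eq_bigr => r _; rewrite exchange_big /=; apply: eq_bigr => q _.
  by rewrite big_distrr.
have -> : \sum_(1 <= n < X'.+1) V n = normc ((\sum_(1 <= n < X'.+1) V n)%:C%C : C).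
  by rewrite cabs_real ger0_norm // sumr_ge0.
rewrite VE; apply: le_trans (cabs_sum _ _ _) _; apply: ler_sum => r _.
apply: le_trans (cabs_sum _ _ _) _; apply: ler_sum => q _.
rewrite 2!Normc.normcM cabs_conj; have [-> _] := hcf r; have [-> _] := hcf q.
by rewrite !mul1r.
Qed.

Lemma sum_by_fibers (T : eqType) (f : T -> nat) (g : nat -> R) (K : nat) (B : R) (rs : seq T) :
  (forall q : T, q \in rs -> (f q < K)%N) -> (forall k, 0 <= g k) ->
  (forall k, (k < K)%N -> (count (fun q : T => f q == k) rs)%:R <= B) ->
  \sum_(q <- rs) g (f q) <= B * \sum_(0 <= k < K) g k.
Proof.
move=> hf g0 hc.
have -> : \sum_(q <- rs) g (f q) = \sum_(0 <= k < K) (count (fun q : T => f q == k) rs)%:R * g k.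
  have : all (fun q : T => f q < K)%N rs by apply/allP.
  elim: (rs) => [|q qs ih] /=.
    by rewrite big_nil big1 // => k _; rewrite mul0r.
  case/andP=> q1 /ih e; rewrite big_cons e.
  under [RHS]eq_bigr => k _ do rewrite natrD mulrDl.
  rewrite big_split /=; congr (_ + _).
  rewrite (bigD1_seq (f q)) /=; [|by rewrite mem_index_iota|exact: iota_uniq].
  rewrite eqxx mul1r big1 ?addr0 // => k; rewrite eq_sym => /negPf ->; by rewrite mul0r.
rewrite big_distrr /=; apply: ler_sum_nat => k /andP[_ kK].
by rewrite ler_wpM2r // hc.
Qed.

(** Ordinates at distance between [40 k / L] and [40 (k + 1) / L] from [g] fill two intervals of
    half length [20 / L], one on each side, as counted by [main_zero_box]. *)
Lemma bin_count (zeta : Cplx R -> Cplx R) (L delta T g : R) N (rs : seq C) k : is_riemann_zeta zeta ->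
  100 * 1000 <= L -> L <= 67 / 10 * 10 ^+ 12 -> 0 <= delta -> delta <= 15 / 1000 ->
  T + 3 <= N%:R -> ln (N%:R : R) <= L + 1 -> uniq rs ->
  (forall q, q \in rs -> [/\ zeta q = 0, 1 - delta <= complex.Re q, complex.Re q < 1 &
     2 <= complex.Im q <= T]) ->
  (count (fun q => Num.trunc (`|complex.Im q - g| * L / 40) == k) rs)%:R <= 2 * (175 + 5 * (delta * L)).
Proof.
move=> hz L1 L2 d0 d1 TN NL ur hr.
have L0 : 0 < L by move: L1; clear; lra.
have M0 : 0 <= 175 + 5 * (delta * L).
  by apply: addr_ge0; [exact: ler0n|apply: mulr_ge0; [exact: ler0n|apply: mulr_ge0 => //; exact: ltW]].
have u0 : 0 < 20 / L by rewrite divr_gt0 ?ltr0n.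
have us : 20 / L <= 1 / 10.
  by rewrite ler_pdivrMr // div1r ler_pdivlMl ?ltr0n //; move: L1; clear; lra.
have main t (P : pred C) : (forall q, P q -> `|complex.Im q - t| <= 20 / L) -> (count P rs)%:R <= 175 + 5 * (delta * L).
  move=> hP; rewrite -size_filter; set qs : seq C := [seq q <- rs | P q].
  have [->|qs0] := eqVneq (size qs) 0%N; first exact: M0.
  have hq q : q \in qs -> [/\ zeta q = 0, 1 - delta <= complex.Re q, complex.Re q < 1 & `|complex.Im q - t| <= 20 / L].
    by rewrite mem_filter => /andP[Pq /hr [a1 a2 a3 a4]]; split=> //; exact: hP.
  have [q qq] : exists q, q \in qs.
    by case: qs qs0 {hq} => [|q qs'] // _; exists q; rewrite mem_head.
  have /ler_normlP[h1 h2] : `|complex.Im q - t| <= 20 / L by case: (hq q qq).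
  have /andP[h3 h4] : 2 <= complex.Im q <= T.
    by move: qq; rewrite mem_filter => /andP[_ /hr [_ _ _]].
  have uq : uniq qs by exact: filter_uniq.
  apply: (@main_zero_box R zeta hz t L delta N qs) => //.
    by move: h2 us h3; move: (20 / L); clear => a; lra.
  by apply: le_trans TN; move: h1 us h4; move: (20 / L); clear => a; lra.
pose e := 40 / L.
have eE : e = 2 * (20 / L) by rewrite /e; field; rewrite gt_eqF.
pose t1 := g + (k%:R + 1 / 2) * e; pose t2 := g - (k%:R + 1 / 2) * e.
apply: (@le_trans _ _ ((count (fun q => `|complex.Im q - t1| <= 20 / L) rs)%:R +
   (count (fun q => `|complex.Im q - t2| <= 20 / L) rs)%:R)); last first.
  have m1 := main t1 (fun q => `|complex.Im q - t1| <= 20 / L) (fun _ hp => hp).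
  have m2 := main t2 (fun q => `|complex.Im q - t2| <= 20 / L) (fun _ hp => hp).
  by apply: le_trans (lerD m1 m2) _; rewrite [leRHS]mulr_natl mulr2n.
rewrite -natrD ler_nat -count_predUI; apply: leq_trans (leq_addr _ _); apply: sub_count => q /= /eqP hk.
have p0 : 0 <= `|complex.Im q - g| * L / 40.
  by apply: divr_ge0; [rewrite mulr_ge0 // ltW|exact: ler0n].
have := truncn_itv p0; rewrite hk -[k.+1%:R]natr1.
have xE : `|complex.Im q - g| = `|complex.Im q - g| * L / 40 * e by rewrite /e; field; rewrite gt_eqF.
have e0 : 0 < e by rewrite divr_gt0 ?ltr0n.
move: xE; set p := _ * L / 40 => xE /andP[k1 k2].
have b1 : k%:R * e <= `|complex.Im q - g| by rewrite xE ler_wpM2r // ltW.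
have b2 : `|complex.Im q - g| <= (k%:R + 1) * e by rewrite xE ler_wpM2r // ltW.
have e20 : 20 / L = e / 2 by rewrite eE; move: (20 / L); clear => a; lra.
rewrite e20 /t1 /t2; apply/orP.
have ke : (k%:R + 1) * e = k%:R * e + e by rewrite mulrDl mul1r.
have ke2 : (k%:R + 1 / 2) * e = k%:R * e + e / 2 by rewrite mulrDl mul1r [e / 2]mulrC.
rewrite ke in b2; rewrite ke2.
have [s0|s0] := lerP 0 (complex.Im q - g).
  left; rewrite ger0_norm // in b1 b2; apply/ler_normlP.
  by move: b1 b2; move: (k%:R * e) (complex.Im q); clear => a b; split; lra.
right; rewrite ltr0_norm // in b1 b2; apply/ler_normlP.
by move: b1 b2; move: (k%:R * e) (complex.Im q); clear => a b; split; lra.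
Qed.

End LargeValues.

(** * Numerical choices *)

Section Numerics.
Variable R : realType.
Local Notation C := R[i].
Implicit Types (u v w x y h L : R) (n m k : nat).

Lemma floor_exp y : 0 <= y -> let n := Num.trunc (expR y) in
  [/\ (0 < n)%N, n%:R <= expR y, expR y < n.+1%:R, y - 1 <= ln (n%:R : R) & ln (n%:R : R) <= y].
Proof.
move=> y0 n; have e1 : 1 <= expR y by rewrite -[leLHS]expR0 ler_expR.
have [n0 n1 n2 n3] := trunc_bounds e1; rewrite -/n in n0 n1 n2 n3.
have nR : 0 < n%:R :> R by rewrite ltr0n.
split=> //.
  have : ln (expR y) <= ln (2 * n%:R) by rewrite ler_ln ?posrE ?expR_gt0 ?mulr_gt0.
  rewrite expRK lnM ?posrE //; have /andP[_] := ln2_bounds R.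
  by move: (ln 2) (ln n%:R) => a b; clear -a b; lra.
by rewrite -[leRHS]expRK ler_ln ?posrE ?expR_gt0.
Qed.

(** The cube of [expR_absorb] at [L / 4], which is still above [10 ^ 5]; it uses three quarters of
    the slack [L / 1000]. *)
Lemma absorb3 L K x y : 481 * 1000 <= L -> 0 <= K -> K <= 1000 * 1000 * (1000 * 1000) ->
  x + L / 1000 <= y -> K * (1 + L) ^+ 3 * expR x <= expR y.
Proof.
move=> L1 K0 K1 xy; pose l := L / 4.
have l1 : 100 * 1000 <= l by rewrite /l; move: L1; clear; lra.
have lL : 1 + L <= 4 * (1 + l) by rewrite /l; clear; lra.
have L0 : 0 <= 1 + L by move: L1; clear; lra.
have c1 : 0 + l / 1000 <= l / 1000 by rewrite add0r.
have [M [M64 MK Ml]] : exists M : R, [/\ 64 <= M, K <= M * M & M * (1 + l) <= expR (l / 1000)].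
  have [M ME] : exists M : R, M = 1000 * 1000 by exists (1000 * 1000).
  have M64 : 64 <= M by rewrite ME; clear; lra.
  exists M; split=> //; first by rewrite ME.
  have c0 : 0 <= M <= 1000 * 1000 by rewrite -ME lexx andbT (le_trans _ M64) // ler0n.
  by have := expR_absorb l1 c0 c1; rewrite expR0 mulr1.
have M0 : 0 <= M by apply: le_trans M64; exact: ler0n.
have l0 : 0 <= 1 + l by move: l1; clear; lra.
have h3 : (M * (1 + l)) ^+ 3 <= expR (l / 1000) ^+ 3 by apply: pow_le Ml; exact: mulr_ge0.
have h4 : (1 + L) ^+ 3 <= (4 * (1 + l)) ^+ 3 by exact: pow_le lL.
have h5 : K * (1 + L) ^+ 3 <= (M * (1 + l)) ^+ 3.
  apply: (@le_trans _ _ (M * M * (4 * (1 + l)) ^+ 3)).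
    by apply: ler_pM MK h4 => //; exact: exprn_ge0.
  rewrite !exprMn mulrA; apply: ler_wpM2r; first exact: exprn_ge0.
  rewrite [leRHS]exprSr -expr2; apply: ler_wpM2l; first exact: sqr_ge0.
  by apply: le_trans M64; rewrite -natrX ler_nat.
apply: (@le_trans _ _ (expR (l / 1000) ^+ 3 * expR x)).
  by rewrite ler_wpM2r ?expR_ge0 //; exact: le_trans h5 h3.
rewrite -expRM_natl -expRD ler_expR; apply: le_trans xy; rewrite /l; move: L1; clear; lra.
Qed.

Lemma expR1_le : expR 1 <= 3 :> R.
Proof.
have h : expR (1 / 16) <= 10704 / 10000 :> R.
  have := @expR_taylor1 R (1 / 16); rewrite ger0_norm; last by lra.
  have e : 1 / 16 <= 1 / 2 :> R by lra.
  by move=> /(_ e) /ler_normlP [_]; rewrite expr2; clear; lra.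
have -> : 1 = 4%:R * (4%:R * (1 / 16)) :> R by field.
rewrite expRM_natl expRM_natl.
have h2 : expR (1 / 16) ^+ 4 <= 1313 / 1000 :> R.
  by apply: le_trans (pow_le 4 (expR_ge0 _) h) _; rewrite !exprS expr0; clear; lra.
by apply: le_trans (pow_le 4 (exprn_ge0 _ (expR_ge0 _)) h2) _; rewrite !exprS expr0; clear; lra.
Qed.

Lemma expR10_ge : 5000 <= expR 10 :> R.
Proof.
have h : 125 / 100 <= expR (1 / 4) :> R by have := expR_ge1Dx (1 / 4 : R); lra.
have -> : 10 = 40%:R * (1 / 4) :> R by field.
rewrite expRM_natl.
have p2 : 156 / 100 <= expR (1 / 4) ^+ 2 :> R.
  rewrite expr2; apply: le_trans (ler_pM _ _ h h); lra.
have p5 : 92 / 10 <= expR (1 / 4) ^+ 10 :> R.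
  have -> : expR (1 / 4) ^+ 10 = (expR (1 / 4) ^+ 2) ^+ 5 :> R by rewrite -exprM.
  apply: le_trans (pow_le 5 _ p2); rewrite ?exprS ?expr0; lra.
have -> : expR (1 / 4) ^+ 40 = (expR (1 / 4) ^+ 10) ^+ 4 :> R by rewrite -exprM.
by apply: le_trans (pow_le 4 _ p5); rewrite ?exprS ?expr0; lra.
Qed.

Lemma nat_expR n : (0 < n)%N -> n%:R = expR (ln n%:R) :> R.
Proof. by move=> n0; rewrite lnK // posrE ltr0n. Qed.

Definition fl c L := Num.trunc (expR (c * L)).

Lemma fl_bounds c L : 0 <= c -> 0 <= L ->
  [/\ (0 < fl c L)%N, (fl c L)%:R <= expR (c * L), expR (c * L) < (fl c L).+1%:R,
    c * L - 1 <= ln ((fl c L)%:R : R) & ln ((fl c L)%:R : R) <= c * L].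
Proof. by move=> c0 L0; apply: floor_exp; exact: mulr_ge0. Qed.

Lemma fl_le c d L : 0 <= c -> 0 <= L -> c <= d -> (fl c L <= fl d L)%N.
Proof.
move=> c0 L0 cd; have [_ h1 _ _ _] := fl_bounds c0 L0.
have [_ _ h2 _ _] := fl_bounds (le_trans c0 cd) L0.
rewrite -ltnS -(ltr_nat R); apply: le_lt_trans h1 (le_lt_trans _ h2).
by rewrite ler_expR ler_wpM2r.
Qed.

(** The exponents satisfy several strict inequalities with room for [L / 1000]:
    [3 (0.34 - 0.006) > 1] for the windows of the kernel, [0.345 * 1.015 + 0.003 < 0.3545] for the
    small terms, and [3 (0.7015 - 0.3645 - 0.003) > 1] for detection up to height [T]. The gap 0.01
    between [par_z1] and [par_z2] gives the detector a norm proportional to [L]. *)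
Definition par_E L := fl (3 / 1000) L.

Lemma par_E_bounds L : 0 <= L ->
  [/\ (0 < par_E L)%N, (par_E L)%:R <= expR (3 / 1000 * L), expR (3 / 1000 * L) < (par_E L).+1%:R,
    3 / 1000 * L - 1 <= ln ((par_E L)%:R : R) & ln ((par_E L)%:R : R) <= 3 / 1000 * L].
Proof. by apply: fl_bounds; clear; lra. Qed.

Definition par_z0 L := fl (345 / 1000) L.

Lemma par_z0_bounds L : 0 <= L ->
  [/\ (0 < par_z0 L)%N, (par_z0 L)%:R <= expR (345 / 1000 * L), expR (345 / 1000 * L) < (par_z0 L).+1%:R,
    345 / 1000 * L - 1 <= ln ((par_z0 L)%:R : R) & ln ((par_z0 L)%:R : R) <= 345 / 1000 * L].
Proof. by apply: fl_bounds; clear; lra. Qed.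

Definition par_z1 L := fl (3545 / 10000) L.

Lemma par_z1_bounds L : 0 <= L ->
  [/\ (0 < par_z1 L)%N, (par_z1 L)%:R <= expR (3545 / 10000 * L), expR (3545 / 10000 * L) < (par_z1 L).+1%:R,
    3545 / 10000 * L - 1 <= ln ((par_z1 L)%:R : R) & ln ((par_z1 L)%:R : R) <= 3545 / 10000 * L].
Proof. by apply: fl_bounds; clear; lra. Qed.

Definition par_z2 L := fl (3645 / 10000) L.

Lemma par_z2_bounds L : 0 <= L ->
  [/\ (0 < par_z2 L)%N, (par_z2 L)%:R <= expR (3645 / 10000 * L), expR (3645 / 10000 * L) < (par_z2 L).+1%:R,
    3645 / 10000 * L - 1 <= ln ((par_z2 L)%:R : R) & ln ((par_z2 L)%:R : R) <= 3645 / 10000 * L].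
Proof. by apply: fl_bounds; clear; lra. Qed.

Definition par_X L := fl (7015 / 10000) L.

Lemma par_X_bounds L : 0 <= L ->
  [/\ (0 < par_X L)%N, (par_X L)%:R <= expR (7015 / 10000 * L), expR (7015 / 10000 * L) < (par_X L).+1%:R,
    7015 / 10000 * L - 1 <= ln ((par_X L)%:R : R) & ln ((par_X L)%:R : R) <= 7015 / 10000 * L].
Proof. by apply: fl_bounds; clear; lra. Qed.

Definition par_top L := fl (7065 / 10000) L.

Lemma par_top_bounds L : 0 <= L ->
  [/\ (0 < par_top L)%N, (par_top L)%:R <= expR (7065 / 10000 * L), expR (7065 / 10000 * L) < (par_top L).+1%:R,
    7065 / 10000 * L - 1 <= ln ((par_top L)%:R : R) & ln ((par_top L)%:R : R) <= 7065 / 10000 * L].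
Proof. by apply: fl_bounds; clear; lra. Qed.

Lemma par_E_le_z2 L : 0 <= L -> (par_E L <= par_z2 L)%N.
Proof. by move=> L0; apply: (fl_le _ L0); clear; lra. Qed.

Lemma par_z0_le_z1 L : 0 <= L -> (par_z0 L <= par_z1 L)%N.
Proof. by move=> L0; apply: (fl_le _ L0); clear; lra. Qed.

Lemma par_z1_le_z2 L : 0 <= L -> (par_z1 L <= par_z2 L)%N.
Proof. by move=> L0; apply: (fl_le _ L0); clear; lra. Qed.

Lemma par_X_le_top L : 0 <= L -> (par_X L <= par_top L)%N.
Proof. by move=> L0; apply: (fl_le _ L0); clear; lra. Qed.

Lemma par_z0_le_X L : 0 <= L -> (par_z0 L <= par_X L)%N.
Proof. by move=> L0; apply: (fl_le _ L0); clear; lra. Qed.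

Lemma zsum_num L z2 : 481 * 1000 <= L -> (0 < z2)%N -> ln (z2%:R : R) <= 3645 / 10000 * L ->
  zsum (L^-1 + 1) z2 <= 366 / 1000 * L.
Proof.
move=> L1 z20 lz; have L0 : 0 < L by move: L1; clear; lra.
have ep0 : 0 < L^-1 by rewrite invr_gt0.
apply: le_trans (zsum_upper ep0 z20) _; rewrite invrK.
have h : 1 - 3645 / 10000 <= rpow L^-1 z2%:R.
  apply: le_trans (_ : 1 + - (L^-1 * ln z2%:R) <= _); last exact: expR_ge1Dx.
  rewrite lerD2l lerN2 mulrC ler_pdivrMr //.
have : (1 - rpow L^-1 z2%:R) * L <= 3645 / 10000 * L.
  by rewrite ler_wpM2r ?(ltW L0) //; move: h; clear; lra.
move: L1; clear; lra.
Qed.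

(** The ratio [(z1 / z2) ^ (1 / L)] is essentially [exp (-0.01)]; rounding the cutoffs to integers
    turns 0.01 into 0.00999, the quadratic term into 0.00979, and the subtracted 1 of [det_norm_ge]
    into 0.0097. *)
Lemma det_norm_num L z1 z2 : 481 * 1000 <= L -> (0 < z1)%N -> (z1 <= z2)%N ->
  ln (z1%:R : R) <= 3545 / 10000 * L -> 3645 / 10000 * L - 1 <= ln (z2%:R : R) ->
  97 / 10000 * L <= det_norm L^-1 z1 z2.
Proof.
move=> L1 z10 z12 l1 l2; have L0 : 0 < L by move: L1; clear; lra.
have ep0 : 0 < L^-1 by rewrite invr_gt0.
apply: le_trans (det_norm_ge ep0 z10 z12); rewrite invrK.
have k : det_ratio L^-1 z1 z2 <= expR (- (999 / (100 * 1000))).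
  rewrite /det_ratio /rpow -expRN -expRD ler_expR opprK addrC -mulrBr mulrC ler_pdivrMr //.
  move: l1 l2 L1; move: (ln z1%:R) (ln z2%:R) => a b; clear -a b L; lra.
have := @expR_taylor1 R (- (999 / (100 * 1000))).
rewrite normrN ger0_norm; last by clear; lra.
have e : 999 / (100 * 1000) <= 1 / 2 :> R by clear; lra.
move=> /(_ e) /ler_normlP [_]; rewrite sqrrN expr2 => t.
have k2 : det_ratio L^-1 z1 z2 <= 1 - 979 / (100 * 1000) by move: k t; move: (expR _) (det_ratio _ _ _) => a b; clear -a b; lra.
have : 979 / (100 * 1000) * L <= (1 - det_ratio L^-1 z1 z2) * L.
  by rewrite ler_wpM2r ?(ltW L0) //; move: k2; clear; lra.
move: L1; clear; lra.
Qed.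

End Numerics.

(** * Detection of zeros and the mean square of the detector *)

Section Detection.
Variable R : realType.
Local Notation C := R[i].
Implicit Types (u v w x y h L delta : R) (n m k : nat).

(** The term [n = 1] equals 1, while the whole sum and the terms [2 <= n <= z0] are small; what
    remains has modulus at least 9/10. Only logarithmic bounds on the cutoffs enter. *)
Lemma detect_of_params (zeta : Cplx R -> Cplx R) L delta (rho : C) E z0 z1 z2 X : is_riemann_zeta zeta ->
  481 * 1000 <= L -> strip_zero zeta rho -> 0 <= delta -> 1 - delta <= complex.Re rho ->
  expR (10 + 71 / 100 * (delta * L)) <= complex.Im rho -> complex.Im rho <= expR L ->
  (E <= z2)%N -> (z0 <= z1)%N -> (z1 <= z2)%N -> (z0 <= X)%N ->
  (0 < E)%N -> ln (E%:R : R) <= 3 / 1000 * L ->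
  (0 < z0)%N -> ln (z0%:R : R) <= 345 / 1000 * L ->
  (0 < z1)%N -> 3545 / 10000 * L - 1 <= ln (z1%:R : R) ->
  (0 < z2)%N -> ln (z2%:R : R) <= 3645 / 10000 * L ->
  (0 < X)%N -> 7015 / 10000 * L - 1 <= ln (X%:R : R) -> ln (X%:R : R) <= 7015 / 10000 * L ->
  zsum (L^-1 + 1) z2 <= 366 / 1000 * L -> 97 / 10000 * L <= det_norm L^-1 z1 z2 ->
  9 / 10 <= normc (\sum_(z0.+1 <= n < X.+1)
    (det_sum L^-1 z1 z2 n * mol_sum R E n)%:C%C * cpow rho n%:R).
Proof.
move=> hz L1 hrho d0 hd g1 g2 Ez2 z01 z12 z0X E0 Eu z00 z0u z10 z1l z20 z2u X0 Xl Xu hzs hdn.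
have L0 : 0 < L by move: L1; clear; lra.
have Lw := ltW L0.
have ep0 : 0 < L^-1 by rewrite invr_gt0.
have cst : 0 < 97 / 10000 :> R by clear; lra.
have dn0 : 0 < det_norm L^-1 z1 z2 by apply: lt_le_trans hdn; exact: mulr_gt0.
have zE0 : (0 < z2 * E)%N by rewrite muln_gt0 z20 E0.
have zER : 0 < (z2 * E)%:R :> R by rewrite ltr0n.
have lzE : ln ((z2 * E)%:R : R) = ln z2%:R + ln E%:R by rewrite natrM lnM // posrE ltr0n.
have lE0 : 0 <= ln (E%:R : R) by rewrite ln_ge0 // ler1n.
have lX0 : 0 <= ln (X%:R : R) by rewrite ln_ge0 // ler1n.
have lz00 : 0 <= ln (z0%:R : R) by rewrite ln_ge0 // ler1n.
have lz20 : 0 <= ln (z2%:R : R) by rewrite ln_ge0 // ler1n.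
case: (hrho) => _ b1 b2 g0.
have side1 : (z2 * E)%:R * expR (100 * 1000) <= X%:R :> R.
  rewrite (nat_expR R zE0) (nat_expR R X0) -expRD ler_expR lzE.
  move: Eu z2u Xl L1; move: (ln E%:R) (ln z2%:R) (ln X%:R) => a b c; clear -a b c L; lra.
have side2 : complex.Im rho <= (X%:R / (z2 * E)%:R) ^+ 3.
  apply: le_trans g2 _; rewrite {1}(nat_expR R zE0) {1}(nat_expR R X0) -expRN -expRD -expRM_natl ler_expR lzE.
  move: Eu z2u Xl L1; move: (ln E%:R) (ln z2%:R) (ln X%:R) => a b c; clear -a b c L; lra.
have tot := detector_total hz ep0 z10 z12 E0 Ez2 dn0 side1 hrho side2.
have r0 : 0 <= complex.Re rho by apply: le_trans b1; clear; lra.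
have sm := small_terms ep0 z10 z12 E0 dn0 z00 z01 r0 (ltW b2).
(* The quotient 0.366 / 0.0097 is below 38. *)
have zd : zsum (L^-1 + 1) z2 / det_norm L^-1 z1 z2 <= 38.
  rewrite ler_pdivrMr //; move: hzs hdn L0; move: (zsum _ _) (det_norm _ _ _) => a b; clear -a b L; lra.
have zd0 : 0 <= zsum (L^-1 + 1) z2 / det_norm L^-1 z1 z2.
  by apply: divr_ge0 (ltW dn0); apply: sumr_ge0 => i _; exact: rpow_ge0.
have small : expR (- 10) <= 1 / 5000 :> R.
  rewrite expRN; apply: le_trans (_ : 5000^-1 <= _); last by rewrite div1r.
  by rewrite lef_pV2 ?posrE ?expR_gt0 ?ltr0n // expR10_ge.
(* [X ^ delta] is at most [exp (0.71 delta L)], so the lower bound on the ordinate leaves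
   [exp (-10) <= 1/5000], and [4 * 38 / 5000 < 4 / 100]. *)
have q1 : rpow (complex.Re rho - 1) X%:R / complex.Im rho * (4 * zsum (L^-1 + 1) z2 / det_norm L^-1 z1 z2) <= 4 / 100.
  rewrite -[4 * _ / _]mulrA.
  have k : rpow (complex.Re rho - 1) X%:R / complex.Im rho <= 1 / 5000.
    rewrite ler_pdivrMr //; apply: le_trans (_ : expR (- 10) * complex.Im rho <= _); last first.
      by rewrite ler_wpM2r // ltW.
    apply: le_trans (_ : expR (- 10) * expR (10 + 71 / 100 * (delta * L)) <= _); last by rewrite ler_wpM2l ?expR_ge0.
    rewrite /rpow -expRD ler_expR -mulNr opprB.
    apply: le_trans (_ : delta * ln X%:R <= _); first by apply: ler_wpM2r => //; move: hd; clear; lra.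
    apply: le_trans (ler_wpM2l d0 Xu) _; have := mulr_ge0 d0 Lw.
    by rewrite mulrCA; move: (delta * L) => a; clear -a; lra.
  apply: le_trans (_ : 1 / 5000 * (4 * 38) <= _); last by clear; lra.
  apply: ler_pM k _; [by apply: divr_ge0; rewrite ?rpow_ge0 // ltW|by rewrite mulr_ge0|].
  by rewrite ler_wpM2l.
have l2 : 1 + ln (z2%:R : R) <= 1 + L by move: z2u L0; move: (ln _) => a; clear -a L; lra.
have l0 : 1 + ln (z0%:R : R) <= 1 + L by move: z0u L0; move: (ln _) => a; clear -a L; lra.
have l20 : 0 <= 1 + ln (z2%:R : R) by rewrite addr_ge0.
have l00 : 0 <= 1 + ln (z0%:R : R) by rewrite addr_ge0.
have LL : 1 <= 1 + L by rewrite lerDl.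
have LL0 : 0 <= 1 + L by apply: le_trans LL.
have q2 : 401 * (2 * zsum (L^-1 + 1) z2 / det_norm L^-1 z1 z2) * rpow (complex.Re rho - 14 / 15) X%:R *
      rpow (- (1 / 15)) (z2 * E)%:R * (1 + ln (z2%:R : R)) ^+ 3 <= 1 / 5000.
  apply: le_trans small; rewrite -[2 * _ / _]mulrA.
  have K1 : 401 * (2 * 38) <= 1000 * 1000 * (1000 * 1000) :> R by clear; lra.
  have K0 : 0 <= 401 * (2 * 38) :> R by clear; lra.
  (* 0.0516 is below [0.985 - 14/15], and 0.3675 is the exponent of [z2 * E]. *)
  have xy : - (516 / 10000) * (7015 / 10000 * L - 1) + 1 / 15 * (3675 / 10000 * L) + 1 + L / 1000 <= - (10 : R).
    by move: L1; clear; lra.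
  apply: le_trans (absorb3 L1 K0 K1 xy).
  have hA : 401 * (2 * (zsum (L^-1 + 1) z2 / det_norm L^-1 z1 z2)) <= 401 * (2 * 38).
    by move: zd; move: (_ / _) => a; clear -a; lra.
  have hA0 : 0 <= 401 * (2 * (zsum (L^-1 + 1) z2 / det_norm L^-1 z1 z2)).
    by move: zd0; move: (_ / _) => a; clear -a; lra.
  have hS0 : 0 <= (1 + ln (z2%:R : R)) ^+ 3 by exact: exprn_ge0.
  have hS := pow_le 3 l20 l2.
  have hP0 : 0 <= rpow (complex.Re rho - 14 / 15) X%:R * rpow (- (1 / 15)) (z2 * E)%:R.
    by apply: mulr_ge0; exact: rpow_ge0.
  have hP : rpow (complex.Re rho - 14 / 15) X%:R * rpow (- (1 / 15)) (z2 * E)%:R <=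
     expR (- (516 / 10000) * (7015 / 10000 * L - 1) + 1 / 15 * (3675 / 10000 * L) + 1).
    rewrite /rpow -expRD ler_expR lzE -mulNr.
    have : - (complex.Re rho - 14 / 15) * ln X%:R <= - (516 / 10000) * ln X%:R.
      by rewrite ler_wpM2r //; move: b1; clear; lra.
    move: Eu z2u Xl L1; move: (_ * ln X%:R) => d; move: (ln E%:R) (ln z2%:R) (ln X%:R) => a b c; clear -a b c d L; lra.
  have := ler_pM (mulr_ge0 hA0 hS0) hP0 (ler_pM hA0 hS0 hA hS) hP.
  move: (401 * (2 * (_ / _))) (rpow _ _) (rpow _ _) ((1 + ln _) ^+ 3) => a b c d.
  by rewrite (_ : a * d * (c * b) = a * c * b * d); last ring.
have dni : 0 <= (det_norm L^-1 z1 z2)^-1 by rewrite invr_ge0 ltW.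
have q3 : 12 / det_norm L^-1 z1 z2 / z1%:R * E%:R * rpow (complex.Re rho - (1 + 1)) z0%:R * (2 * (1 + ln (z0%:R : R))) <= 1 / 5000.
  apply: le_trans small.
  have K1 : 2 <= 1000 * 1000 * (1000 * 1000) :> R by clear; lra.
  have K0 : 0 <= 2 :> R by clear; lra.
  (* 1.015 bounds [2 - Re rho]; the exponent is negative because [z0] lies sufficiently below
     [z1]. *)
  have xy : - (3545 / 10000 * L - 1) + 3 / 1000 * L + 1015 / 1000 * (345 / 1000 * L) + L / 1000 <= - (10 : R).
    by move: L1; clear; lra.
  apply: le_trans (absorb3 L1 K0 K1 xy).
  rewrite [leRHS]mulrC; apply: ler_pM; rewrite ?mulr_ge0 ?rpow_ge0 ?divr_ge0 ?(ltW dn0) //.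
    rewrite 2!expRD; apply: ler_pM; rewrite ?mulr_ge0 ?rpow_ge0 ?divr_ge0 ?(ltW dn0) //.
      apply: ler_pM; rewrite ?mulr_ge0 ?rpow_ge0 ?divr_ge0 ?(ltW dn0) //.
        rewrite -[leRHS]mul1r; apply: ler_pM; rewrite ?invr_ge0 ?divr_ge0 ?(ltW dn0) //.
          by rewrite ler_pdivrMr // mul1r; apply: le_trans hdn; move: L1; clear; lra.
        by rewrite (nat_expR R z10) -expRN ler_expR lerN2.
      by rewrite (nat_expR R E0) ler_expR.
    rewrite /rpow ler_expR -mulNr; apply: ler_pM => //; move: b1 b2; clear; lra.
  rewrite ler_wpM2l //; apply: le_trans l0 _.
  by rewrite -[leLHS]expr1; apply: ler_weXn2l.
move: tot sm; rewrite big_ltn // det_sum1 // mol_sum1 // mulr1 cpow_one mulr1.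
rewrite (big_cat_nat (n := z0.+1)) /=; [|by rewrite ltnS|by rewrite ltnS].
set S1 := \sum_(2 <= n < z0.+1) _; set S2 := \sum_(z0.+1 <= n < X.+1) _ => tot sm.
have := cabs_tri (R := R) 1 0 0; rewrite !subr0 cabs1 => _.
have e : normc (1 : C) <= normc (1%:C%C + (S1 + S2)) + normc S1 + normc S2.
  have -> : (1 : C) = (1%:C%C + (S1 + S2)) - S1 - S2 by rewrite (rmorph1 (real_complex R)); ring.
  by apply: le_trans (cabsB _ _) _; rewrite lerD2r; exact: cabsB.
rewrite cabs1 in e; move: e (le_trans sm q3) tot q1 q2; move: (normc S1) (normc S2) (normc _) => a b c.
move: (rpow _ _ / _ * _) (401 * _ * _ * _ * _) => d f; clear -a b c d f; lra.
Qed.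

Lemma detect_ge (zeta : Cplx R -> Cplx R) L delta (rho : C) : is_riemann_zeta zeta ->
  481 * 1000 <= L -> strip_zero zeta rho -> 0 <= delta -> 1 - delta <= complex.Re rho ->
  expR (10 + 71 / 100 * (delta * L)) <= complex.Im rho -> complex.Im rho <= expR L ->
  9 / 10 <= normc (\sum_((par_z0 L).+1 <= n < (par_X L).+1)
    (det_sum L^-1 (par_z1 L) (par_z2 L) n * mol_sum R (par_E L) n)%:C%C * cpow rho n%:R).
Proof.
move=> hz L1 hrho d0 hd g1 g2; have L0 : 0 <= L by move: L1; clear; lra.
have [E0 _ _ _ Eu] := par_E_bounds L0.
have [z00 _ _ _ z0u] := par_z0_bounds L0.
have [z10 _ _ z1l z1u] := par_z1_bounds L0.
have [z20 _ _ z2l z2u] := par_z2_bounds L0.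
have [X0 _ _ Xl Xu] := par_X_bounds L0.
exact: (detect_of_params hz L1 hrho d0 hd g1 g2 (par_E_le_z2 L0) (par_z0_le_z1 L0) (par_z1_le_z2 L0)
  (par_z0_le_X L0) E0 Eu z00 z0u z10 z1l z20 z2u X0 Xl Xu (zsum_num L1 z20 z2u)
  (det_norm_num L1 z10 (par_z1_le_z2 L0) z1u z2l)).
Qed.

(** The weight differs from the one of [det_sum_sqr] by [n ^ (2 delta + 1 / L)], at most
    [3 exp (1.403 delta L)] for [n <= X]; the mean square itself is at most
    [4 * 0.366 / 0.0097 ^ 2], about 15600. *)
Lemma det_mean_square_of_params L delta z0 z1 z2 X : 481 * 1000 <= L -> 0 <= delta ->
  (z1 <= z2)%N -> (z0 <= X)%N -> (0 < z1)%N -> (0 < z2)%N -> (0 < X)%N -> ln (X%:R : R) <= 7015 / 10000 * L ->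
  zsum (L^-1 + 1) z2 <= 366 / 1000 * L -> 97 / 10000 * L <= det_norm L^-1 z1 z2 ->
  \sum_(z0.+1 <= n < X.+1) det_sum L^-1 z1 z2 n ^+ 2 * rpow (2 * (1 - delta) - 1) n%:R
   <= 50 * 1000 * expR (1403 / 1000 * (delta * L)).
Proof.
move=> L1 d0 z12 z0X z10 z20 X0 Xu hzs hdn.
have L0 : 0 < L by move: L1; clear; lra.
have Lw := ltW L0.
have ep0 : 0 < L^-1 by rewrite invr_gt0.
have cst : 0 < 97 / 10000 :> R by clear; lra.
have dn0 : 0 < det_norm L^-1 z1 z2 by apply: lt_le_trans hdn; exact: mulr_gt0.
pose A := expR (1403 / 1000 * (delta * L)).
have A0 : 0 <= A by exact: expR_ge0.
have a0 : 0 <= 3 * A by rewrite mulr_ge0.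
apply: (@le_trans _ _ (\sum_(1 <= n < X.+1) 3 * A * (det_sum L^-1 z1 z2 n ^+ 2 * rpow (L^-1 + 1) n%:R))).
  rewrite [leRHS](big_cat_nat (n := z0.+1)) /=; [|by []|by rewrite ltnS]; apply: ler_wpDl.
    by apply: sumr_ge0 => i _; exact: mulr_ge0 a0 (mulr_ge0 (sqr_ge0 _) (rpow_ge0 _ _)).
  apply: ler_sum_nat => n /andP[n1 n2].
  rewrite [leRHS]mulrCA; apply: ler_wpM2l; first exact: sqr_ge0.
  have n0 : (0 < n)%N by apply: leq_ltn_trans n1.
  have ln0 : 0 <= ln (n%:R : R) by rewrite ln_ge0 // ler1n.
  have nX : ln (n%:R : R) <= 7015 / 10000 * L.
    by apply: le_trans Xu; rewrite ler_ln ?posrE ?ltr0n // ler_nat -ltnS.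
  have -> : rpow (2 * (1 - delta) - 1) n%:R = expR ((2 * delta + L^-1) * ln n%:R) * rpow (L^-1 + 1) n%:R.
    by rewrite /rpow -expRD; congr expR; ring.
  apply: (ler_wpM2r (rpow_ge0 _ _)).
  apply: le_trans (_ : expR (1 + 1403 / 1000 * (delta * L)) <= _); last first.
    by rewrite expRD; apply: (ler_wpM2r A0); exact: expR1_le.
  rewrite ler_expR; apply: (@le_trans _ _ ((2 * delta + L^-1) * (7015 / 10000 * L))).
    by apply: ler_wpM2l nX; rewrite addr_ge0 ?mulr_ge0 // ltW.
  have -> : (2 * delta + L^-1) * (7015 / 10000 * L) = 1403 / 1000 * (delta * L) + 7015 / 10000.
    by field; rewrite gt_eqF.
  by move: (_ * (_ * _)) => a; clear -a; lra.
rewrite -big_distrr /=; apply: le_trans (ler_wpM2l a0 (det_sum_sqr ep0 z10 z12 dn0 X)) _.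
have h : 4 * (1 + L^-1^-1) * zsum (L^-1 + 1) z2 / det_norm L^-1 z1 z2 ^+ 2 <= 16 * 1000.
  have b0 : 0 <= 97 / 10000 * L by apply: mulr_ge0 Lw; exact: ltW.
  rewrite invrK ler_pdivrMr ?exprn_gt0 //.
  apply: le_trans (_ : 16 * 1000 * (97 / 10000 * L) ^+ 2 <= _); last first.
    by apply: ler_wpM2l (pow_le 2 b0 hdn); clear; lra.
  apply: le_trans (ler_wpM2l _ hzs) _; first by rewrite mulr_ge0 // addr_ge0.
  have -> : 4 * (1 + L) * (366 / 1000 * L) = (1464 / 1000 * (1 + L)) * L by field.
  rewrite exprMn expr2 [leRHS]mulrA; rewrite expr2 mulrA; apply: (ler_wpM2r Lw).
  by move: L1; clear; lra.
apply: le_trans (ler_wpM2l a0 h) _.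
by rewrite -/A; clear -A0; lra.
Qed.

Lemma det_mean_square L delta : 481 * 1000 <= L -> 0 <= delta ->
  \sum_((par_z0 L).+1 <= n < (par_X L).+1)
     det_sum L^-1 (par_z1 L) (par_z2 L) n ^+ 2 * rpow (2 * (1 - delta) - 1) n%:R
   <= 50 * 1000 * expR (1403 / 1000 * (delta * L)).
Proof.
move=> L1 d0; have L0 : 0 <= L by move: L1; clear; lra.
have [z10 _ _ _ z1u] := par_z1_bounds L0.
have [z20 _ _ z2l z2u] := par_z2_bounds L0.
have [X0 _ _ _ Xu] := par_X_bounds L0.
exact: (det_mean_square_of_params L1 d0 (par_z1_le_z2 L0) (par_z0_le_X L0) z10 z20 X0 Xu (zsum_num L1 z20 z2u)
  (det_norm_num L1 z10 (par_z1_le_z2 L0) z1u z2l)).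
Qed.

End Detection.

(** * The kernel with its numerical parameters *)

Section Rows.
Variable R : realType.
Local Notation C := R[i].
Implicit Types (s r q : C) (u v w x y h L delta : R) (n m k : nat).

(** The averaged window rises from [T ^ 0.34] to its full height at [T ^ 0.345], where the detected
    sum starts, stays full up to [T ^ 0.7015], and vanishes after [T ^ 0.7065]. *)
Definition win_start L : R := expR (340 / 1000 * L).
Definition win_end L : R := expR (7015 / 10000 * L).
(** More than [L exp L] dilations make the step so fine that [t] times the step is at most 1 for all
    [t <= exp L], as the geometric sum estimate asks. *)
Definition win_num L : nat := (Num.trunc (L * expR L)).+1.
Definition win_step L : R := 5 / 1000 * L / (win_num L)%:R.
Definition win_top L : nat := (par_top L).+1.
(** Both constants use [L / zsum 1 E <= 334]: near the diagonal the logarithmic length [0.3665 L]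
    gives 123, and away from it [16 * 200 * 334 / 40 ^ 2 = 668] over [k ^ 2]. *)
Definition bin_bound k : R := if k is 0 then 123 else 668 * rpow (1 + 1) k%:R.

Lemma win_loE c L : 0 < L -> win_lo (expR (c * L)) (win_step L) (win_num L) = expR (c * L + 5 / 1000 * L).
Proof.
move=> L0; rewrite /win_lo /win_step -expRD; congr expR; congr (_ + _).
by rewrite mulrC divfK // pnatr_eq0.
Qed.

Lemma kernel_conj E X v y h J s : kernel E X v y h J (s^*)%C = ((kernel E X v y h J s)^*)%C.
Proof.
rewrite conjc_sum; apply: eq_bigr => n _; rewrite conj_mul conj_cpow; congr (_ * _).
by move: (_ * _) => a; apply: complex_ext => //=; rewrite oppr0.
Qed.

(** Bin 0 uses the bound by absolute values, the other bins the quadratic decay; negative ordinates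
    are reduced to positive ones by conjugation. *)
Lemma kernel_bin L s : 481 * 1000 <= L -> 1 <= complex.Re s -> complex.Re s <= 11 / 10 ->
  `|complex.Im s| <= expR L ->
  normc (kernel (par_E L) (win_top L) (win_start L) (win_end L) (win_step L) (win_num L) s) <=
   bin_bound (Num.trunc (`|complex.Im s| * L / 40)) + 402 * mol_err (par_E L) (win_start L).
Proof.
move=> L1 s1 s2.
have L0 : 0 < L by move: L1; clear; lra.
have Lw := ltW L0.
have [E0 _ _ El Eu] := par_E_bounds Lw.
have [_ _ tT _ _] := par_top_bounds Lw.
have J0 : (0 < win_num L)%N by [].
have JR : 0 < (win_num L)%:R :> R by rewrite ltr0n.
have h0 : 0 < win_step L by apply: divr_gt0 JR; apply: mulr_gt0 L0; clear; lra.
have topE : win_lo (win_end L) (win_step L) (win_num L) = expR (7065 / 10000 * L).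
  by rewrite /win_end win_loE //; congr expR; clear; lra.
have top : win_lo (win_end L) (win_step L) (win_num L) <= (win_top L)%:R by rewrite topE ltW.
have vy : win_start L <= win_end L by rewrite ler_expR (ler_pM2r L0); clear; lra.
have EE0 : (0 < par_E L * par_E L)%N by rewrite muln_gt0 E0.
have lEE : ln ((par_E L * par_E L)%:R : R) = ln (par_E L)%:R + ln (par_E L)%:R by rewrite natrM lnM // posrE ltr0n.
have vE : (par_E L * par_E L)%:R * expR (100 * 1000) <= win_start L.
  rewrite (nat_expR R EE0) -expRD ler_expR lEE.
  by move: Eu L1; move: (ln _) => a; clear -a L; lra.
have EEv : (par_E L * par_E L)%:R <= win_start L.
  by rewrite (nat_expR R EE0) ler_expR lEE; move: Eu L1; move: (ln _) => a; clear -a L; lra.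
have ZE : 3 / 1000 * L - 1 <= zsum 1 (par_E L) by apply: le_trans (zsum1_lower R E0).
have Z0 : 0 < zsum 1 (par_E L) :> R by exact: zsum1_gt0.
have LZ : L / zsum 1 (par_E L) <= 334.
  by rewrite ler_pdivrMr //; move: ZE L1; move: (zsum _ _) => a; clear -a L; lra.
have LZ0 : 0 <= L / zsum 1 (par_E L) by apply: divr_ge0 => //; exact: ltW.
have cube : expR L <= (win_start L / (par_E L * par_E L)%:R) ^+ 3.
  rewrite (nat_expR R EE0) -expRN -expRD -expRM_natl ler_expR lEE.
  by move: Eu L1; move: (ln _) => a; clear -a L; lra.
have err0 : 0 <= mol_err (par_E L) (win_start L).
  by apply: mulr_ge0; [apply: mulr_ge0; exact: rpow_ge0|apply: exprn_ge0; rewrite addr_ge0 // ln_ge0 // ler1n].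
have hJ : expR L * win_step L <= 1.
  rewrite /win_step mulrA ler_pdivrMr // mul1r.
  have LE0 : 0 <= L * expR L by rewrite mulr_ge0 ?expR_ge0.
  have /andP[_ h2] := truncn_itv LE0; apply: le_trans (ltW h2).
  rewrite [leLHS]mulrCA; apply: le_trans (_ : 5 / 1000 * (L * expR L) <= _).
    by rewrite [expR L * L]mulrC.
  by apply: ler_piMl LE0 _; clear; lra.
have far q : 1 <= complex.Re q -> complex.Re q <= 11 / 10 -> 0 < complex.Im q -> complex.Im q <= expR L ->
  (0 < Num.trunc (complex.Im q * L / 40))%N ->
  normc (kernel (par_E L) (win_top L) (win_start L) (win_end L) (win_step L) (win_num L) q) <=
   bin_bound (Num.trunc (complex.Im q * L / 40)) + 402 * mol_err (par_E L) (win_start L).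
  move=> q1 q2 q3 q4 k0.
  have qh : complex.Im q * win_step L <= 1 by apply: le_trans hJ; rewrite ler_wpM2r // ltW.
  apply: le_trans (far_kernel E0 J0 vE vy top h0 q1 q2 q3 (le_trans q4 cube) qh) _.
  rewrite lerD2r.
  have p0 : 0 <= complex.Im q * L / 40 by apply: divr_ge0 (ler0n _ _); rewrite mulr_ge0 // ltW.
  have /andP[kk _] := truncn_itv p0.
  move: (Num.trunc _) k0 kk => k k0 kk.
  have kR : 0 < k%:R :> R by rewrite ltr0n.
  have -> : bin_bound k = 668 / (k%:R * k%:R) by case: k k0 kk kR => // k _ _ kR; rewrite /bin_bound rpowD rpow1 // -invfM.
  have -> : (win_num L)%:R * win_step L = 5 / 1000 * L by rewrite /win_step mulrC divfK // gt_eqF.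
  have kt : 40 * k%:R <= complex.Im q * L by move: kk; rewrite ler_pdivlMr ?ltr0n // mulrC.
  have -> : 16 / (5 / 1000 * L * complex.Im q ^+ 2) / zsum 1 (par_E L) =
     3200 * (L / zsum 1 (par_E L)) / (complex.Im q * L) ^+ 2.
    by field; rewrite !gt_eqF.
  rewrite ler_pdivrMr ?exprn_gt0 ?mulr_gt0 //.
  have kt2 : (40 * k%:R) ^+ 2 <= (complex.Im q * L) ^+ 2 by apply: pow_le kt; rewrite mulr_ge0.
  apply: le_trans (_ : 3200 * 334 <= _); first by apply: ler_wpM2l LZ; exact: ler0n.
  apply: le_trans (_ : 668 / (k%:R * k%:R) * (40 * k%:R) ^+ 2 <= _); last first.
    by apply: ler_wpM2l kt2; apply: divr_ge0 (ler0n _ _) _; apply: mulr_ge0; exact: ltW.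
  have -> : 668 / (k%:R * k%:R) * (40 * k%:R) ^+ 2 = 668 * 1600 :> R by field; rewrite gt_eqF.
  by clear; lra.
move=> ts; have [k0|k0] := posnP (Num.trunc (`|complex.Im s| * L / 40)).
  rewrite k0 /bin_bound; apply: le_trans (kernel_near E0 J0 EEv vy (ltW h0) top s1) _.
  apply: lerD; last by apply: (ler_wpM2r err0); rewrite ler_nat.
  rewrite topE /win_start !expRK -mulrBl -mulrA.
  by move: LZ LZ0; move: (L / _) => a; clear -a; lra.
have [i0|i0] := lerP 0 (complex.Im s).
  move: k0 ts; rewrite ger0_norm // => k0 ts; apply: far => //.
  by rewrite lt_neqAle i0 andbT; apply: contraTneq k0 => <-; rewrite !mul0r -leqNgt leqn0 truncn0.
rewrite -cabs_conj -kernel_conj.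
have iE : `|complex.Im s| = complex.Im (s^*)%C by rewrite ltr0_norm //; case: (s).
move: k0 ts; rewrite iE => k0 ts.
have rE : complex.Re (s^*)%C = complex.Re s by case: (s).
by apply: far => //; rewrite ?rE // -iE normr_gt0 lt_eqF.
Qed.

Lemma sum_bin_bound K : \sum_(0 <= k < K) bin_bound k <= 1459.
Proof.
case: K => [|K]; first by rewrite /index_iota /= big_nil; exact: ler0n.
rewrite big_ltn //.
have -> : \sum_(1 <= k < K.+1) bin_bound k = 668 * zsum (1 + 1) K.
  by rewrite /zsum big_distrr /= !big_nat; apply: eq_bigr => -[].
have : zsum (1 + 1) K <= 1 + 1^-1 :> R by exact: zsum_le_inv.
by rewrite invr1 /bin_bound; move: (zsum _ _) => a; clear -a; lra.
Qed.

Lemma bin_bound_ge0 k : 0 <= bin_bound k.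
Proof. case: k => [|k]; [exact: ler0n|by apply: mulr_ge0 (ler0n _ _) (rpow_ge0 _ _)]. Qed.

(** The mean square may be as large as [T ^ (1.403 * 0.015)], barely less than the saving
    [T ^ ((0.34 - 0.006) / 15)]; the difference of the exponents, after a slack of 1/1000, is still
    about 0.0002. *)
Lemma mol_err_num L delta : 481 * 1000 <= L -> delta <= 15 / 1000 ->
  50 * 1000 * expR (1403 / 1000 * (delta * L)) * (402 * mol_err (par_E L) (win_start L)) <= 1 / 100.
Proof.
move=> L1 d1.
have L0 : 0 < L by move: L1; clear; lra.
have Lw := ltW L0.
have dL : delta * L <= 15 / 1000 * L by rewrite ler_pM2r.
have [E0 _ _ El Eu] := par_E_bounds Lw.
have EE0 : (0 < par_E L * par_E L)%N by rewrite muln_gt0 E0.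
have lE0 : 0 <= ln ((par_E L)%:R : R) by rewrite ln_ge0 // ler1n.
have small : expR (- 10) <= 1 / 100 :> R.
  rewrite expRN div1r lef_pV2 ?posrE ?expR_gt0 ?ltr0n //; apply: le_trans (expR10_ge R); clear; lra.
apply: le_trans small.
have K1 : 50 * 1000 * 402 <= 1000 * 1000 * (1000 * 1000) :> R by clear; lra.
have K0 : 0 <= 50 * 1000 * 402 :> R by clear; lra.
have xy : 1403 / 1000 * (delta * L) + (- (1 / 15 * (340 / 1000 * L)) + 1 / 15 * (6 / 1000 * L)) + L / 1000 <= - (10 : R).
  by move: dL L1; move: (delta * L) => a; clear -a L; lra.
apply: le_trans (absorb3 L1 K0 K1 xy).
rewrite /mol_err 2!expRD.
have h1 : rpow (1 / 15) (win_start L) = expR (- (1 / 15 * (340 / 1000 * L))) by rewrite /rpow /win_start expRK.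
have h2 : rpow (- (1 / 15)) (par_E L * par_E L)%:R <= expR (1 / 15 * (6 / 1000 * L)).
  rewrite /rpow ler_expR natrM lnM ?posrE ?ltr0n // mulNr opprK; apply: ler_wpM2l; first by clear; lra.
  by move: Eu; move: (ln _) => a; clear -a L; lra.
have h3 : (1 + ln ((par_E L)%:R : R)) ^+ 3 <= (1 + L) ^+ 3.
  by apply: pow_le; [rewrite addr_ge0|move: Eu Lw; move: (ln _) => a; clear -a L; lra].
rewrite h1.
have p2 := rpow_ge0 (- (1 / 15)) ((par_E L * par_E L)%:R : R).
have p3 : 0 <= (1 + ln ((par_E L)%:R : R)) ^+ 3 by apply: exprn_ge0; rewrite addr_ge0.
have gen (k l a b c d e f : R) : 0 <= k * l * a * b -> c * d <= e * f ->
    k * a * (l * (b * c * d)) <= k * l * f * (a * (b * e)).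
  move=> hp hq; have -> : k * a * (l * (b * c * d)) = k * l * a * b * (c * d) by ring.
  have -> : k * l * f * (a * (b * e)) = k * l * a * b * (e * f) by ring.
  exact: ler_wpM2l.
apply: gen (ler_pM p2 p3 h2 h3).
by apply: mulr_ge0 (expR_ge0 _); apply: mulr_ge0 K0 (expR_ge0 _).
Qed.

End Rows.

(** * Zeros of large ordinate *)

Section HighZeros.
Variable R : realType.
Local Notation C := R[i].
Implicit Types (s r q : C) (u v w x y h L delta : R) (n m k : nat).

(** The error common to all pairs contributes a hundredth of the square of the number [S] of zeros
    and is absorbed on the left; then [50000 * 511000 / 0.8 < 32 * 10 ^ 9]. *)
Lemma quadratic_ineq_solve (a b B e S : R) : 0 < S ->
  (9 / 10 * S) ^+ 2 <= 50 * 1000 * a * (S * (B + S * e)) -> 50 * 1000 * a * e <= 1 / 100 ->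
  50 * 1000 * a * B = 50 * 1000 * (511 * 1000) * b -> S <= 32 * 1000 * (1000 * 1000) * b.
Proof.
move=> S0 tot errG GB.
have : (9 / 10 * S) ^+ 2 <= S * (50 * 1000 * (511 * 1000) * b + S * (1 / 100)).
  apply: (le_trans tot); rewrite mulrCA; apply: (ler_wpM2l (ltW S0)).
  by rewrite mulrDr GB lerD2l mulrCA; apply: (ler_wpM2l (ltW S0)).
have -> : (9 / 10 * S) ^+ 2 = S * (81 / 100 * S) by field.
by rewrite ler_pM2l //; move: S0; clear -S b; lra.
Qed.

(** For each zero the others are sorted into bins of width [40 / L]: every bin holds
    [O(1 + delta L)] zeros, and the kernel bounds of the bins have a convergent sum, so a row costs
    no logarithm of [T]. *)
Lemma high_zero_count (zeta : Cplx R -> Cplx R) L delta (rs : seq C) : is_riemann_zeta zeta ->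
  481 * 1000 <= L -> L <= 67 / 10 * 10 ^+ 12 -> 0 <= delta -> delta <= 15 / 1000 -> uniq rs ->
  (forall q, q \in rs -> [/\ zeta q = 0, 1 - delta <= complex.Re q, complex.Re q < 1 &
     expR (10 + 71 / 100 * (delta * L)) <= complex.Im q <= expR L]) ->
  (size rs)%:R <= 32 * 1000 * (1000 * 1000) * expR (14316 / 10000 * (delta * L)).
Proof.
move=> hz L1 L2 d0 d1 ur hr.
have L0 : 0 < L by move: L1; clear; lra.
have Lw := ltW L0.
have x0 : 0 <= delta * L by exact: mulr_ge0.
have [_ _ z0u _ _] := par_z0_bounds Lw.
have [_ Xu _ _ _] := par_X_bounds Lw.
have XX' : (par_X L <= win_top L)%N by apply: leqW; exact: par_X_le_top.
have h0 : 0 <= win_step L by apply: divr_ge0 (ler0n _ _); apply: mulr_ge0 Lw; clear; lra.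
pose W n : R := win_wt (win_start L) (win_end L) (win_step L) (win_num L) n * (mol_sum R (par_E L) n * mol_sum R (par_E L) n).
have W0 n : 0 <= W n by rewrite /W -expr2 mulr_ge0 ?win_wt_ge0 ?sqr_ge0.
have bW n : (par_z0 L < n <= par_X L)%N -> mol_sum R (par_E L) n ^+ 2 <= W n.
  move=> /andP[n1 n2]; rewrite /W win_wt1 ?expR_ge0 // ?mul1r ?expr2 //.
    rewrite /win_start win_loE // (_ : 340 / 1000 * L + 5 / 1000 * L = 345 / 1000 * L); last by clear; lra.
    by apply: lt_le_trans z0u _; rewrite ler_nat.
  by apply: le_trans Xu; rewrite ler_nat.
have e10 : 5000 <= expR (10 + 71 / 100 * (delta * L)).
  apply: le_trans (expR10_ge R) _; rewrite ler_expR lerDl; apply: mulr_ge0 x0; clear; lra.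
have det r : r \in rs -> 9 / 10 <= normc (\sum_((par_z0 L).+1 <= n < (par_X L).+1)
    (det_sum L^-1 (par_z1 L) (par_z2 L) n * mol_sum R (par_E L) n)%:C%C * cpow r n%:R).
  move=> /hr [r1 r2 r3 /andP[r4 r5]]; apply: (detect_ge hz L1 _ d0 r2 r4 r5); split=> //.
    by move: r2 d1; clear; lra.
  by apply: lt_le_trans r4; exact: expR_gt0.
have := halasz XX' W0 bW (det_mean_square L1 d0) det.
pose N := ((Num.trunc (expR L)).+4).
have eL0 : 0 <= expR L by exact: expR_ge0.
have /andP[t1 t2] := truncn_itv eL0.
have eL4 : 4 <= expR L by apply: le_trans (expR_ge1Dx _); move: L1; clear; lra.
have TN : expR L + 3 <= N%:R by rewrite /N -[_.+4]addn3 natrD lerD2r ltW.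
have NL : ln (N%:R : R) <= L + 1.
  have N2 : N%:R <= 2 * expR L :> R by rewrite /N -addn4 natrD; move: t1 eL4; move: (expR _) => a; clear; lra.
  apply: le_trans (_ : ln (2 * expR L) <= _); first by rewrite ler_ln ?posrE ?mulr_gt0 ?expR_gt0 ?ltr0n.
  rewrite lnM ?posrE ?expR_gt0 // expRK; have /andP[_] := ln2_bounds R.
  by move: (ln 2) => a; clear -a L; lra.
have err0 : 0 <= 402 * mol_err (par_E L) (win_start L).
  apply: mulr_ge0 (ler0n _ _) _; apply: mulr_ge0; [apply: mulr_ge0; exact: rpow_ge0|apply: exprn_ge0].
    by have [E0 _ _ _ _] := par_E_bounds Lw; rewrite addr_ge0 // ln_ge0 // ler1n.
have errG := mol_err_num L1 d1.
move: (402 * mol_err _ _) err0 errG (@kernel_bin R L) => err err0 errG kb.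
(* A row costs [2 (175 + 5 delta L) * 1459]. Here [2 * 175 * 1459 < 511000] and
   [2 * 5 * 1459 < 511000 * 0.0286], so [1 + y <= exp y] absorbs the linear factor; [1.403 + 0.0286]
   is the exponent 1.4316. *)
pose B1 := 511 * 1000 * expR (286 / 10000 * (delta * L)).
have row r : r \in rs -> \sum_(q <- rs) normc (\sum_(1 <= n < (win_top L).+1)
    (W n)%:C%C * cpow (r + (q^*)%C + (1 - 2 * (1 - delta))%:C%C) n%:R) <= B1 + (size rs)%:R * err.
  move=> /hr [r1 r2 r3 /andP[r4 r5]].
  apply: (@le_trans _ _ (\sum_(q <- rs) (bin_bound R (Num.trunc (`|complex.Im q - complex.Im r| * L / 40)) + err))).
    rewrite !big_seq; apply: ler_sum => q /hr [q1 q2 q3 /andP[q4 q5]].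
    set s := r + _ + _.
    have sR : complex.Re s = complex.Re r + complex.Re q + (1 - 2 * (1 - delta)) by rewrite /s; case: (r) (q) => a b [c d].
    have sI : complex.Im s = complex.Im r - complex.Im q.
      by rewrite /s; case: (r) (q) => a b [c d] /=; rewrite addr0.
    have := kb s L1; rewrite sR sI distrC; apply.
    - by move: r2 q2; clear; lra.
    - by move: r3 q3 d1; clear; lra.
    - by apply/ler_normlP; move: r4 r5 q4 q5 e10; move: (expR _) (expR _) => a b; clear; split; lra.
  rewrite big_split /= big_const_seq iter_addr_0 count_predT mulr_natl lerD2r.
  pose K := (Num.trunc (expR L * L / 40)).+1.
  have kp q : 0 <= `|complex.Im q - complex.Im r| * L / 40 by apply: divr_ge0 (ler0n _ _); rewrite mulr_ge0.
  apply: le_trans (@sum_by_fibers R _ (fun q : C => Num.trunc (`|complex.Im q - complex.Im r| * L / 40)) (bin_bound R) K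
    (2 * (175 + 5 * (delta * L))) rs _ (bin_bound_ge0 R) _) _.
  - move=> q /hr [q1 q2 q3 /andP[q4 q5]]; rewrite /K ltnS; apply: le_truncn.
    rewrite ler_pM2r ?invr_gt0 ?ltr0n // ler_pM2r //; apply/ler_normlP.
    by move: r4 r5 q4 q5 e10; move: (expR _) (expR _) => a b; clear; split; lra.
  - move=> k _; apply: (@bin_count R zeta L delta (expR L) (complex.Im r) N rs k hz _ L2 d0 d1 TN NL ur); first by move: L1; clear; lra.
    move=> q /hr [q1 q2 q3 /andP[q4 q5]]; split=> //; rewrite q5 andbT; move: q4 e10; move: (expR _) => a; clear; lra.
  apply: (@le_trans _ _ (2 * (175 + 5 * (delta * L)) * 1459)).
    apply: ler_wpM2l; [apply: mulr_ge0 (ler0n _ _) _; apply: addr_ge0 (ler0n _ _) _; exact: mulr_ge0 (ler0n _ _) x0|exact: sum_bin_bound].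
  have := expR_ge1Dx (286 / 10000 * (delta * L)); rewrite /B1; move: x0; move: (delta * L) (expR _) => a b; clear -a b; lra.
move=> main; have [s0|s0] := posnP (size rs).
  rewrite s0; apply: mulr_ge0 (expR_ge0 _); clear; lra.
have S0 : 0 < (size rs)%:R :> R by rewrite ltr0n.
have G0 : 0 <= 50 * 1000 * expR (1403 / 1000 * (delta * L)) by apply: mulr_ge0 (expR_ge0 _); clear; lra.
have tot : (9 / 10 * (size rs)%:R) ^+ 2 <= 50 * 1000 * expR (1403 / 1000 * (delta * L)) * ((size rs)%:R * (B1 + (size rs)%:R * err)).
  apply: (le_trans main); apply: (ler_wpM2l G0).
  apply: (@le_trans _ _ (\sum_(r <- rs) (B1 + (size rs)%:R * err))).
    by rewrite !big_seq; apply: ler_sum => r hr'; exact: row.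
  by rewrite big_const_seq iter_addr_0 count_predT [leRHS]mulr_natl.
have GB : 50 * 1000 * expR (1403 / 1000 * (delta * L)) * B1 = 50 * 1000 * (511 * 1000) * expR (14316 / 10000 * (delta * L)).
  rewrite (_ : 14316 / 10000 * (delta * L) = 1403 / 1000 * (delta * L) + 286 / 10000 * (delta * L)); last by move: (delta * L); clear => a; lra.
  by rewrite expRD /B1; move: (expR _) (expR _) => a b; ring.
exact: quadratic_ineq_solve S0 tot errG GB.
Qed.

End HighZeros.

(** * Zeros of small ordinate and the conclusion *)

Section ZeroCount.
Variable R : realType.
Local Notation C := R[i].
Implicit Types (s r q : C) (u v w x y h L delta : R) (n m k : nat).

(** There are [O(T0)] intervals with [T0 = exp (10 + 0.71 delta L)], and each costs a power 0.045 of
    [T0] and a logarithm. Together the exponent stays below [0.75 delta L], and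
    [101 * 60000 * 2457 < 15 * 10 ^ 9]. *)
Lemma low_zero_count_num (zeta : Cplx R -> Cplx R) x (rs : seq C) : is_riemann_zeta zeta -> 0 <= x -> uniq rs ->
  (forall q, q \in rs -> strip_zero zeta q /\ complex.Im q < expR (10 + 71 / 100 * x)) ->
  (size rs)%:R <= 15 * 1000 * (1000 * 1000) * expR (75 / 100 * x).
Proof.
move=> hz x0 ur hr; pose T0 := expR (10 + 71 / 100 * x).
have y0 : 0 <= 10 + 71 / 100 * x by move: x0; clear; lra.
have T4 : 4 <= T0 by apply: le_trans (expR_ge1Dx _); move: x0; clear; lra.
have T1 : 1 <= T0 by move: T4; clear; lra.
have T00 : 0 <= T0 by exact: expR_ge0.
pose N := (Num.trunc T0).+4.
have /andP[t1 t2] := truncn_itv T00.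
have TN : T0 + 3 <= N%:R by rewrite /N -[_.+4]addn3 natrD lerD2r ltW.
have NL : ln (N%:R : R) <= 11 + 71 / 100 * x.
  have N2 : N%:R <= 2 * T0 :> R by rewrite /N -addn4 natrD; move: t1 T4; rewrite -/T0; clear; lra.
  apply: le_trans (_ : ln (2 * T0) <= _); first by rewrite ler_ln ?posrE ?mulr_gt0 ?expR_gt0 ?ltr0n.
  rewrite lnM ?posrE ?expR_gt0 // expRK; have /andP[_] := ln2_bounds R.
  by move: (ln 2) => a; clear -a x; lra.
apply: le_trans (low_zero_count hz T1 TN ur hr) _.
have lN : 0 <= ln (N%:R : R) by rewrite ln_ge0 // ler1n.
move: (ln (N%:R : R)) NL lN => l NL lN {TN t1 t2 N}.
pose E := expR (352 / 10000 * x).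
have E1 : 1 <= E by apply: le_trans (expR_ge1Dx _); move: x0; clear; lra.
have h1 : expR (45 / 1000 * l) <= 3 * expR (32 / 1000 * x).
  apply: le_trans (_ : expR (1 + 32 / 1000 * x) <= _).
    by rewrite ler_expR; move: NL x0; clear; lra.
  by rewrite expRD; apply: (ler_wpM2r (expR_ge0 _)); exact: expR1_le.
have h2 : 217 + l <= 228 * expR (32 / 10000 * x).
  have := expR_ge1Dx (32 / 10000 * x); move: NL x0; move: (expR _) => a; clear -a x; lra.
have l0 : 0 <= 217 + l by exact: addr_ge0 (ler0n _ _) lN.
have h3 : expR (45 / 1000 * l) * (217 + l) <= 684 * E.
  apply: le_trans (ler_pM (expR_ge0 _) l0 h1 h2) _.
  rewrite /E (_ : 352 / 10000 * x = 32 / 1000 * x + 32 / 10000 * x); last by clear; lra.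
  by rewrite expRD; move: (expR _) (expR _) => a b; rewrite le_eqVlt; apply/orP; left; apply/eqP; ring.
have h4 : 850 + 202 * (expR (45 / 1000 * l) * (217 + l)) / 86 <= 2457 * E.
  by move: h3 E1; move: (_ * _) E => a b; clear -a b; lra.
have h5 : T0 <= 60 * 1000 * expR (71 / 100 * x).
  rewrite /T0 expRD; apply: (ler_wpM2r (expR_ge0 _)).
  rewrite (_ : 10 = 10%:R * 1); last by rewrite mulr1.
  rewrite expRM_natl; apply: le_trans (pow_le 10 (expR_ge0 _) (expR1_le R)) _.
  by rewrite !exprS expr0; clear; lra.
have h6 : E * expR (71 / 100 * x) <= expR (75 / 100 * x) by rewrite -expRD ler_expR; move: x0; clear; lra.
have p4 : 0 <= 850 + 202 * (expR (45 / 1000 * l) * (217 + l)) / 86.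
  by have := mulr_ge0 (expR_ge0 (45 / 1000 * l)) l0; move: (_ * _) => a; clear -a; lra.
move: (850 + _) p4 h4 => Q p4 h4; have := ler_pM T00 p4 h5 h4.
rewrite (_ : 60 * 1000 * expR (71 / 100 * x) * (2457 * E) = 60 * 1000 * 2457 * (E * expR (71 / 100 * x))); last first.
  by move: (expR _) => a; ring.
rewrite -[101 * T0 * Q]mulrA; have := expR_ge0 (75 / 100 * x); move: h6.
by move: (T0 * Q) (E * _) (expR (75 / 100 * x)) => a b c; clear -a b c; lra.
Qed.

Lemma zero_count (zeta : Cplx R -> Cplx R) L delta (rs : seq C) : is_riemann_zeta zeta ->
  481 * 1000 <= L -> L <= 67 / 10 * 10 ^+ 12 -> 0 <= delta -> delta <= 15 / 1000 -> uniq rs ->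
  (forall q, q \in rs -> [/\ zeta q = 0, 0 < complex.Im q <= expR L & 1 - delta < complex.Re q < 1]) ->
  (size rs)%:R <= 162 / 100 * 10 ^+ 11 * expR (1448 / 1000 * (delta * L)).
Proof.
move=> hz L1 L2 d0 d1 ur hr.
have x0 : 0 <= delta * L by apply: mulr_ge0 => //; move: L1; clear; lra.
pose P (q : C) := complex.Im q < expR (10 + 71 / 100 * (delta * L)).
have lo : (size (seq.filter P rs))%:R <= 15 * 1000 * (1000 * 1000) * expR (75 / 100 * (delta * L)).
  apply: (low_zero_count_num hz x0); first exact: filter_uniq.
  move=> q; rewrite mem_filter => /andP[q0 /hr [q1 /andP[q2 q3] /andP[q4 q5]]]; split=> //; split=> //.
  by move: q4 d1; clear; lra.
have hi : (size (seq.filter (predC P) rs))%:R <= 32 * 1000 * (1000 * 1000) * expR (14316 / 10000 * (delta * L)).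
  apply: (high_zero_count hz L1 L2 d0 d1); first exact: filter_uniq.
  move=> q; rewrite mem_filter /= -leNgt => /andP[q0 /hr [q1 /andP[q2 q3] /andP[q4 q5]]]; split=> //; first exact: ltW.
  by rewrite q0 q3.
have -> : size rs = (size (seq.filter P rs) + size (seq.filter (predC P) rs))%N by rewrite !size_filter count_predC.
rewrite natrD; move: lo hi; move: (size _)%:R (size _)%:R => a b lo hi.
have e1 : expR (75 / 100 * (delta * L)) <= expR (1448 / 1000 * (delta * L)).
  by rewrite ler_expR; move: (delta * L) x0 => c; clear; lra.
have e2 : expR (14316 / 10000 * (delta * L)) <= expR (1448 / 1000 * (delta * L)).
  by rewrite ler_expR; move: (delta * L) x0 => c; clear; lra.
have e0 := expR_ge0 (1448 / 1000 * (delta * L)).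
(* The sum of the constants 15 and 32, in thousands of millions, of the two ranges of ordinates. *)
have c : 47 * 1000 * (1000 * 1000) <= 162 / 100 * 10 ^+ 11 :> R by clear; lra.
apply: le_trans (ler_wpM2r e0 c); move: lo hi e0 e1 e2.
by move: (expR _) (expR _) (expR _) => u v w; clear; lra.
Qed.

(** An infinite set has finite subsets of every size, against the bound [B]; so [counting] is the
    size of a finite enumeration. *)
Lemma counting_le (T : choiceType) (A : classical_sets.set T) (B : R) :
  (forall rs : seq T, uniq rs -> (forall z : T, z \in rs -> A z) -> (size rs)%:R <= B) ->
  (counting A <= B%:E)%E.
Proof.
move=> hB; rewrite /counting.
have fA : finite_set A.
  apply: contrapT => iA; have [F FA Fn] := infinite_set_fset (Num.trunc B).+1 iA.
  have B0 : 0 <= B by have := hB [::] isT (fun z (hz : z \in [::]) => False_ind _ (notF hz)).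
  have := hB (finmap.enum_fset F) (finmap.fset_uniq F) FA.
  have /andP[_ h] := truncn_itv B0; apply/negP; rewrite -ltNge; apply: lt_le_trans h _.
  by rewrite ler_nat.
rewrite asboolT // lee_fin; apply: hB; first exact: finmap.fset_uniq.
by move=> q qF; rewrite -(fset_setK fA).
Qed.

End ZeroCount.

Theorem mainTheorem3 (R : realType) (zeta : Cplx R -> Cplx R)
    (hzeta : is_riemann_zeta zeta) (T sigma : R)
    (hT : expR (481 * 10 ^+ 3 + 958) < T <= expR (67 / 10 * 10 ^+ 12))
    (hsigma : 985 / 1000 <= sigma <= 1) :
  (N zeta sigma T <=
     ((162 / 100 * 10 ^+ 11) * T `^ (1448 / 1000 * (1 - sigma)))%:E)%E.
Proof.
move: hT hsigma => /andP[T1 T2] /andP[s1 s2].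
have T0 : 0 < T by apply: lt_trans T1; exact: expR_gt0.
have lnT : expR (ln T) = T by rewrite lnK.
have L1 : 481 * 1000 <= ln T.
  have : expR (481 * 10 ^+ 3 + 958) <= expR (ln T) by rewrite lnT ltW.
  by rewrite ler_expR; move: (ln T) => L; clear; lra.
have L2 : ln T <= 67 / 10 * 10 ^+ 12 by rewrite -ler_expR lnT.
have d0 : 0 <= 1 - sigma by rewrite subr_ge0.
have d1 : 1 - sigma <= 15 / 1000 by move: s1; clear; lra.
rewrite /powR gt_eqF // -[X in expR X]mulrA; apply: counting_le => rs ur hr.
apply: (zero_count hzeta L1 L2 d0 d1 ur) => q /hr [q1 /andP[q2 q3] /andP[q4 q5]].
by rewrite lnT subKr q1 q2 q4 q5 ltW.
Qed.
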